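(* Let $d=2$ and fix $T>0$. Assume that $W$ satisfies (H1)–(H3), listed in the context, and that for some $C>0$ $$|D^2W(F)|\le C\big(1+|F|^{p-2}\big)\quad\text{for all }F\in\mathbb{R}^{2\times2}.$$ Let $F_0^\delta,\overline F_0\in H^1(\mathbb{T}^2)\cap L^p(\mathbb{T}^2)$ be curl-free and $u_0^\delta,\overline u_0\in L^2(\mathbb{T}^2)$, with $u_0^\delta=\overline u_0$ and $F_0^\delta=\overline F_0$. Let $(u^\delta,F^\delta)$, $\delta>0$, be a weak solution with data $(u_0^\delta,F_0^\delta)$ of $$\partial_tu-\operatorname{div}S(F)=\Delta u-\delta\operatorname{div}(\Delta F),\qquad\partial_tF=\nabla u,\qquad\operatorname{curl}F=0,$$ and let $(\overline u,\overline F)$ be a weak solution with data $(\overline u_0,\overline F_0)$ of $$\partial_t\overline u=\operatorname{div}S(\overline F)+\Delta\overline u,\qquad\partial_t\overline F=\nabla\overline u,\qquad\operatorname{curl}\overline F=0$$ (both in the sense of the context). Then: (1) Let $2\le p<4$ and select $1<r<\min\{2,\frac2{p-2}\}$ (with $\frac{2}{p-2}=\infty$ if $p=2$). There exist positive constants $C_1>0$, depending on the initial data, and $C_2=C_2(r,p)>0$, depending on $r$ and $p$, such that for $t\in[0,T]$ and $\delta$ satisfying $$\delta\le\frac{\exp\big\{\frac4r\big(1-\exp(C_2t)\big)\big\}}{C_1^{2/r}}$$ we have $$\|F^\delta(\cdot,t)-\overline F(\cdot,t)\|_{L^r(\mathbb{T}^2)}^r\le\Big(C_1\delta^{\frac r2}\Big)^{\exp(-C_2t)}\exp\big\{2-2\exp(-C_2t)\big\}.$$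 (2) If $W$ satisfies the stronger hypothesis that there exist $C>0$ and $K'>0$ such that for all $F_1,F_2\in\mathbb{R}^{2\times2}$ $$\big(S(F_1)-S(F_2),F_1-F_2\big)\ge\Big(C\big(|F_1|^{p-2}+|F_2|^{p-2}\big)-K'\Big)|F_1-F_2|^2,$$ then the same conclusion (constants, range of $t$ and $\delta$, and estimate as in (1)) holds for all $p\ge2$ and for $1<r<\min\{2,\frac p{p-2}\}$ (with $\frac{p}{p-2}=\infty$ if $p=2$).
   Context: $\mathbb{T}^2$ is the flat torus with $|\mathbb{T}^2|=1$. $S(F)=\partial W(F)/\partial F$; $(A,B)=\operatorname{tr}(AB^T)$; $(\operatorname{div}G)_i=\sum_\alpha\partial_\alpha G_{i\alpha}$, $(\nabla u)_{i\alpha}=\partial_\alpha u_i$; $\operatorname{curl}F=0$ means $\partial_\alpha F_{i\beta}=\partial_\beta F_{i\alpha}$. Viscosity is fixed to $1$. Throughout $p\ge2$. $C(0,T;X)$ denotes continuous functions of time with values in $X$. (H1) $W\in C^3(\mathbb{R}^{2\times2};\mathbb{R})$. (H2) There are $c,C>0$ with $c(|F|^p-1)\le W(F)\le C(|F|^p+1)$ for all $F$. (H3) $\tilde W(F):=W(F)+\frac K2|F|^2$ is convex for some $K>0$. Notation: $D^2\tilde W:(\nabla F,\nabla F)=\sum\frac{\partial^2\tilde W(F)}{\partial F_{i\alpha}\partial F_{k\gamma}}\partial_\beta F_{i\alpha}\partial_\beta F_{k\gamma}$. Weak solution for $\delta>0$: a pair $(u,F)$ is a weak solution with initial data $(u_0,F_0)$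 if, with an associated $y:(0,T)\times\mathbb{T}^2\to\mathbb{R}^2$: (i) $u\in C(0,T;L^2)\cap L^2(0,T;H^1)$; $F\in C(0,T;L^p\cap H^1)\cap L^2(0,T;H^1\cap H^2)$; $y\in C(0,T;L^2)\cap L^\infty(0,T;H^1\cap H^2)\cap H^1(0,T;L^2)$ (over $\mathbb{T}^2$). (ii) For all smooth $\phi$ ($\mathbb{R}^2$-valued), $\psi$ ($\mathbb{R}^{2\times2}$-valued) on $[0,T)\times\mathbb{T}^2$, compactly supported in time in $[0,T)$, $$\iint u\cdot\phi_t-\iint S(F):\nabla\phi-\iint\nabla u:\nabla\phi+\delta\iint\Delta F:\nabla\phi+\int u_0\cdot\phi(0,x)dx=0,$$ $$\iint F:\psi_t+\iint\nabla u:\psi+\int F_0:\psi(0,x)dx=0,$$ and $F=\nabla y$ a.e. (iii) For a.e. $t\in(0,T)$, $$\int\tfrac12|u|^2+W(F)+\tfrac\delta2|\nabla F|^2dx+\int_0^t\!\int|\nabla u|^2dxds\le\int\tfrac12|u_0|^2+W(F_0)+\tfrac\delta2|\nabla F_0|^2dx.$$ (iv) For a.e. $t\in(0,T)$, $$\int\Big(\tfrac12|u-\tfrac12\operatorname{div}F|^2+\tfrac18|\operatorname{div}F|^2+W(F)+\tfrac\delta2|\nabla F|^2\Big)dx+\tfrac\delta2\int_0^t\!\int|\Delta F|^2dxds+\tfrac12\int_0^t\!\int\big(D^2\tilde W:(\nabla F,\nabla F)+|\nabla u|^2\big)dxds$$ $$\le\tfrac K2\int_0^t\!\int|\nabla F|^2dxds+\int\Big(\tfrac12|u_0-\tfrac12\operatorname{div}F_0|^2+\tfrac18|\operatorname{div}F_0|^2+W(F_0)+\tfrac\delta2|\nabla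 F_0|^2\Big)dx.$$ Weak solution of the limit system: the same definition with $\delta=0$, where in (i) the requirement on $F$ is $F\in C(0,T;L^p\cap H^1)$ (no $H^2$ regularity). *)

(* Defs.v *)
From HB Require Import structures.
From mathcomp Require Import all_boot all_order all_algebra.
From mathcomp Require Import all_classical all_reals all_analysis.
Set Implicit Arguments.
Unset Strict Implicit.
Unset Printing Implicit Defensive.
Import Order.TTheory GRing.Theory Num.Theory.
Import numFieldNormedType.Exports.
Local Open Scope classical_set_scope.
Local Open Scope ring_scope.

(* The torus is R^2/Z^2.  A field on it is any function on R * R, of which only
   the restriction to the fundamental cell [0,1[^2 matters; only the smooth
   test functions are required to be periodic.  Vectors are 'cV[R]_2, so that
   vector and matrix fields are both 'M[R]_(m, n)-valued.  A family of first
   partial derivatives of f : R * R -> 'M_(m, n) is a function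
   Df : R * R -> 'I_2 -> 'M_(m, n), where Df x a is the derivative of f in the
   direction a at x. *)

Section Algebra.
Context {R : realType}.

Definition frob m n (A B : 'M[R]_(m, n)) : R := \tr (A *m B^T).

(* The canonical norm of 'M[R]_(m, n) in the library is the sup norm. *)
Definition fnorm m n (A : 'M[R]_(m, n)) : R := Num.sqrt (frob A A).

Definition grad_sq m n (D : 'I_2 -> 'M[R]_(m, n)) : R :=
  \sum_a fnorm (D a) ^+ 2.

Definition gradm (D : 'I_2 -> 'cV[R]_2) : 'M[R]_2 := \matrix_(i, a) D a i 0.

Definition dvg (D : 'I_2 -> 'M[R]_2) : 'cV[R]_2 := \col_i \sum_a D a i a.

Definition lapl m n (D2 : 'I_2 -> 'I_2 -> 'M[R]_(m, n)) : 'M[R]_(m, n) :=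
  \sum_a D2 a a.

End Algebra.

Section Smoothness.
Context {R : realType}.

(* For maps defined on a finite-dimensional space this is the class C^k. *)
Fixpoint is_Ck {V U : normedModType R} (k : nat) (f : V -> U) : Prop :=
  continuous f /\
  if k is k'.+1 then
    forall v : V, (forall x, derivable f x v) /\ is_Ck k' (fun x => 'D_v f x)
  else True.

Definition smooth {V U : normedModType R} (f : V -> U) : Prop :=
  forall k, is_Ck k f.

Definition edir (a : 'I_2) : R * R := if a == 0 then (1, 0) else (0, 1).

Definition torus_periodic U (f : R * R -> U) : Prop :=
  forall x, f (x.1 + 1, x.2) = f x /\ f (x.1, x.2 + 1) = f x.

(* Smooth functions on [0, T[ x T^2 that are compactly supported in time in
   [0, T[, given by a smooth extension to negative times. *)
Definition test_fun m n (T : R) (phi : R -> R * R -> 'M[R]_(m.+1, n.+1)) :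
    Prop :=
  [/\ smooth (fun z : R * (R * R) => phi z.1 z.2),
      forall t, torus_periodic (phi t) &
      exists2 T', T' < T & forall t x, T' <= t -> phi t x = 0].

End Smoothness.

Notation leb1 := lebesgue_measure.
Notation leb2 := (lebesgue_measure \x lebesgue_measure)%E.

Section Spaces.
Context {R : realType}.

Definition cell : set (measurableTypeR R * measurableTypeR R) :=
  `[0, 1[%classic `*` `[0, 1[%classic.

Definition xint (f : R * R -> R) : \bar R :=
  (\int[leb2]_(x in cell) (f x)%:E)%E.

Definition txint (t : R) (f : R -> R * R -> R) : \bar R :=
  (\int[leb1]_(s in `]0%R, t[) xint (f s))%E.

Definition xRint (f : R * R -> R) : R := \int[leb2]_(x in cell) f x.

Definition txRint (t : R) (f : R -> R * R -> R) : R :=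
  \int[leb1]_(s in `]0, t[) xRint (f s).

(* The q-th power of the L^q norm over the torus. *)
Definition Lpow m n (q : R) (f : R * R -> 'M[R]_(m, n)) : \bar R :=
  xint (fun x => fnorm (f x) `^ q).

Definition inL m n (q : R) (f : R * R -> 'M[R]_(m, n)) : Prop :=
  (forall i j, measurable_fun cell (fun x => f x i j)) /\
  (Lpow q f < +oo)%E.

(* Df is the weak gradient of f on the torus, and f lies in H^1. *)
Definition inH1 m n (f : R * R -> 'M[R]_(m, n))
    (Df : R * R -> 'I_2 -> 'M[R]_(m, n)) : Prop :=
  inL 2 f /\
  forall a, inL 2 (fun x => Df x a) /\
    forall phi : R * R -> R, smooth phi -> torus_periodic phi ->
    forall i j,
      xRint (fun x => f x i j * 'D_(edir a) phi x) =
      - xRint (fun x => Df x a i j * phi x).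

Definition curl_free (DF : R * R -> 'I_2 -> 'M[R]_2) : Prop :=
  forall i a b,
    {ae leb2, forall x, cell x -> DF x a i b = DF x b i a}.

Definition ae_time (T : R) (P : R -> Prop) : Prop :=
  {ae leb1, forall t, t \in `]0, T[ -> P t}.

Definition tx_measurable m n (T : R) (f : R -> R * R -> 'M[R]_(m, n)) : Prop :=
  forall i j, measurable_fun
    ((`[0, T]%classic : set (measurableTypeR R)) `*` cell)
    (fun z => f z.1 z.2 i j).

(* f \in C([0, T]; L^q), together with joint measurability of the
   representative. *)
Definition C_L m n (T q : R) (f : R -> R * R -> 'M[R]_(m, n)) : Prop :=
  tx_measurable T f /\
  forall t : R, t \in `[0, T] ->
    inL q (f t) /\
    Lpow q (fun x => f s x - f t x)
      @[s --> within `[0, T]%classic (nbhs t)] --> 0%E.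

Definition C_H1 m n (T : R) (f : R -> R * R -> 'M[R]_(m, n))
    (Df : R -> R * R -> 'I_2 -> 'M[R]_(m, n)) : Prop :=
  [/\ C_L T 2 f, forall a, C_L T 2 (fun t x => Df t x a) &
      forall t : R, t \in `[0, T] -> inH1 (f t) (Df t)].

(* f \in L^2(0, T; H^1) with weak spatial gradient Df; measurability into H^1
   is joint measurability of f and Df. *)
Definition L2_H1 m n (T : R) (f : R -> R * R -> 'M[R]_(m, n))
    (Df : R -> R * R -> 'I_2 -> 'M[R]_(m, n)) : Prop :=
  [/\ tx_measurable T f /\ forall a, tx_measurable T (fun t x => Df t x a),
      ae_time T (fun t => inH1 (f t) (Df t)) &
      (txint T (fun t x => (fnorm (f t x) ^+ 2 + grad_sq (Df t x))%R) < +oo)%E].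

Definition Linf_H1 m n (T : R) (f : R -> R * R -> 'M[R]_(m, n))
    (Df : R -> R * R -> 'I_2 -> 'M[R]_(m, n)) : Prop :=
  [/\ tx_measurable T f /\ forall a, tx_measurable T (fun t x => Df t x a),
      ae_time T (fun t => inH1 (f t) (Df t)) &
      exists M : R, ae_time T (fun t =>
        (xint (fun x => (fnorm (f t x) ^+ 2 + grad_sq (Df t x))%R)
           <= M%:E)%E)].

(* f \in H^1(0, T; L^2): ft is the weak time derivative of f as an
   L^2-valued function. *)
Definition H1_L2 m n (T : R) (f : R -> R * R -> 'M[R]_(m, n)) : Prop :=
  exists ft : R -> R * R -> 'M[R]_(m, n),
  [/\ tx_measurable T f /\ tx_measurable T ft,
      (txint T (fun t x => (fnorm (f t x) ^+ 2 + fnorm (ft t x) ^+ 2)%R)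
         < +oo)%E &
      forall eta : R -> R, smooth eta ->
      (exists a b : R, [/\ 0 < a, b < T &
         forall t : R, t \notin `[a, b] -> eta t = 0]) ->
      forall i j, {ae leb2, forall x, cell x ->
        \int[leb1]_(t in `]0, T[) (f t x i j * derive1 eta t) =
        - \int[leb1]_(t in `]0, T[) (ft t x i j * eta t)}].

End Spaces.

Section Energy.
Context {R : realType}.
Implicit Types (W : 'M[R]_2 -> R) (p K : R).

Definition stress W (F : 'M[R]_2) : 'M[R]_2 :=
  \matrix_(i, a) 'D_(delta_mx i a) W F.

Definition hess W (F : 'M[R]_2) (i a k c : 'I_2) : R :=
  'D_(delta_mx k c) (fun G => 'D_(delta_mx i a) W G) F.

Definition hess_norm W (F : 'M[R]_2) : R :=
  Num.sqrt (\sum_i \sum_a \sum_k \sum_c hess W F i a k c ^+ 2).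

(* D^2 W : (DF, DF) at the point F *)
Definition hess_quad W (F : 'M[R]_2) (DF : 'I_2 -> 'M[R]_2) : R :=
  \sum_i \sum_a \sum_k \sum_c \sum_b
    hess W F i a k c * DF b i a * DF b k c.

Definition Wtilde K W (F : 'M[R]_2) : R := W F + K / 2 * fnorm F ^+ 2.

Definition H1_regular W : Prop := is_Ck 3 W.

Definition H2_growth p W : Prop :=
  exists c C : R, [/\ 0 < c, 0 < C & forall F,
    c * (fnorm F `^ p - 1) <= W F <= C * (fnorm F `^ p + 1)].

Definition H3_convex K W : Prop := convex_function setT (Wtilde K W).

Definition hess_growth p W : Prop :=
  exists2 C, 0 < C &
    forall F, hess_norm W F <= C * (1 + fnorm F `^ (p - 2)).

Definition strong_monotone p W : Prop :=
  exists C K' : R, [/\ 0 < C, 0 < K' & forall F1 F2,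
    frob (stress W F1 - stress W F2) (F1 - F2) >=
    (C * (fnorm F1 `^ (p - 2) + fnorm F2 `^ (p - 2)) - K')
      * fnorm (F1 - F2) ^+ 2].

End Energy.

Section WeakSolutions.
Context {R : realType}.
Implicit Types (W : 'M[R]_2 -> R) (T delta p K t : R).
Implicit Types (v uin : R * R -> 'cV[R]_2) (G Fin : R * R -> 'M[R]_2)
  (DG DFin : R * R -> 'I_2 -> 'M[R]_2).
Implicit Types (u ub y : R -> R * R -> 'cV[R]_2)
  (Du : R -> R * R -> 'I_2 -> 'cV[R]_2)
  (F Fb LF : R -> R * R -> 'M[R]_2) (DF : R -> R * R -> 'I_2 -> 'M[R]_2)
  (D2F : R -> R * R -> 'I_2 -> 'I_2 -> 'M[R]_2).

(* In the weak formulation and in the two energy inequalities, LF stands for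
   the Laplacian of F. *)
Definition weak_momentum T delta W uin u Du F LF : Prop :=
  forall phi : R -> R * R -> 'cV[R]_2, test_fun T phi ->
  let Dphi t x := gradm (fun a => 'D_(edir a) (phi t) x) in
  txRint T (fun t x => frob (u t x) (derive1 (phi^~ x) t))
  - txRint T (fun t x => frob (stress W (F t x)) (Dphi t x))
  - txRint T (fun t x => frob (gradm (Du t x)) (Dphi t x))
  + delta * txRint T (fun t x => frob (LF t x) (Dphi t x))
  + xRint (fun x => frob (uin x) (phi 0 x)) = 0.

Definition weak_kinematic T Fin Du F : Prop :=
  forall psi : R -> R * R -> 'M[R]_2, test_fun T psi ->
  txRint T (fun t x => frob (F t x) (derive1 (psi^~ x) t))
  + txRint T (fun t x => frob (gradm (Du t x)) (psi t x))
  + xRint (fun x => frob (Fin x) (psi 0 x)) = 0.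

Definition energy delta W v G DG : \bar R :=
  xint (fun x => 2^-1 * fnorm (v x) ^+ 2 + W (G x)
                 + delta / 2 * grad_sq (DG x)).

Definition energy_ineq T delta W uin Fin DFin u Du F DF : Prop :=
  ae_time T (fun t =>
    (energy delta W (u t) (F t) (DF t)
     + txint t (fun s x => grad_sq (Du s x))
     <= energy delta W uin Fin DFin)%E).

Definition mod_energy delta W v G DG : \bar R :=
  xint (fun x => 2^-1 * fnorm (v x - 2^-1 *: dvg (DG x)) ^+ 2
                 + 8^-1 * fnorm (dvg (DG x)) ^+ 2 + W (G x)
                 + delta / 2 * grad_sq (DG x)).

Definition mod_energy_ineq T delta K W uin Fin DFin u Du F DF LF : Prop :=
  ae_time T (fun t =>
    (mod_energy delta W (u t) (F t) (DF t)
     + (delta / 2)%:E * txint t (fun s x => fnorm (LF s x) ^+ 2)%R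
     + (2^-1)%:E * txint t (fun s x =>
         hess_quad (Wtilde K W) (F s x) (DF s x) + grad_sq (Du s x))%R
     <= (K / 2)%:E * txint t (fun s x => grad_sq (DF s x))
        + mod_energy delta W uin Fin DFin)%E).

Definition potential T F y : Prop :=
  exists (Dy : R -> R * R -> 'I_2 -> 'cV[R]_2)
         (D2y : R -> R * R -> 'I_2 -> 'I_2 -> 'cV[R]_2),
  [/\ C_L T 2 y,
      Linf_H1 T y Dy /\
      forall b, Linf_H1 T (fun t x => Dy t x b) (fun t x => D2y t x b),
      H1_L2 T y &
      ae_time T (fun t =>
        {ae leb2, forall x, cell x -> F t x = gradm (Dy t x)})].

Definition solution_core T delta p K W uin Fin DFin u Du F DF LF y : Prop :=
  [/\ C_L T 2 u /\ L2_H1 T u Du,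
      C_L T p F /\ C_H1 T F DF,
      potential T F y,
      weak_momentum T delta W uin u Du F LF /\ weak_kinematic T Fin Du F &
      energy_ineq T delta W uin Fin DFin u Du F DF /\
      mod_energy_ineq T delta K W uin Fin DFin u Du F DF LF].

(* In both definitions DFin is the weak gradient of Fin. *)
Definition weak_solution T delta p K W uin Fin DFin u F : Prop :=
  exists Du DF D2F y,
  [/\ L2_H1 T F DF,
      forall b, L2_H1 T (fun t x => DF t x b) (fun t x => D2F t x b) &
      solution_core T delta p K W uin Fin DFin u Du F DF
        (fun t x => lapl (D2F t x)) y].

Definition weak_solution_lim T p K W uin Fin DFin u F : Prop :=
  exists Du DF y,
    solution_core T 0 p K W uin Fin DFin u Du F DF (fun _ _ => 0) y.

Definition initial_data p uin Fin DFin : Prop :=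
  [/\ inL 2 uin, inL p Fin, inH1 Fin DFin & curl_free DFin].

Definition hypW p K W : Prop :=
  [/\ H1_regular W, H2_growth p W, 0 < K, H3_convex K W & hess_growth p W].

Definition stability_estimate T p K W r C1 C2 uin Fin DFin : Prop :=
  forall delta u F ub Fb,
    0 < delta ->
    weak_solution T delta p K W uin Fin DFin u F ->
    weak_solution_lim T p K W uin Fin DFin ub Fb ->
    forall t, 0 <= t <= T ->
      delta <= expR (4 / r * (1 - expR (C2 * t))) / C1 `^ (2 / r) ->
      (Lpow r (fun x => F t x - Fb t x)%R
       <= ((C1 * delta `^ (r / 2)) `^ expR (- C2 * t)
           * expR (2 - 2 * expR (- C2 * t)))%:E)%E.

End WeakSolutions.

(* Main.v *)
From HB Require Import structures.
Require Import Defs.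
From mathcomp Require Import all_boot all_order all_algebra.
From mathcomp Require Import all_classical all_reals all_analysis.
From mathcomp Require Import measurable_realfun.
From mathcomp Require Import ring lra.
Import Order.TTheory GRing.Theory Num.Theory.
Set Implicit Arguments.
Unset Strict Implicit.
Unset Printing Implicit Defensive.
Import numFieldNormedType.Exports.
Local Open Scope classical_set_scope.
Local Open Scope ring_scope.

(** Put w = u - ub and G = F - Fb, and let Z be the time integral of w, so that G = grad Z because
    the initial data agree. Subtracting the equations gives w_t = Lap w + div g with g = S(F) -
    S(Fb) - delta Lap F, so X = w - Lap Z satisfies X_t = div g. Let E be half the sum of the
    squared homogeneous H^-1 norms of X and w, and let psi = grad (-Lap)^-1 w. Then E' = - int g :
    (G + 2 psi) - |w|^2, and |G|^2 <= 4 E, all norms without index being those of L^2.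

    The choice of multiplier G + 2 psi is the heart of the matter. Since D^2 W + K >= 0, completing
    the square at G + psi in the stress difference leaves only - D^2 W (psi, psi), up to lower-order
    terms ([monotone_defect_le]). What remains is an integral of (1 + |F|^(p-2) + |Fb|^(p-2))
    |psi|^2. The energy inequality bounds F and Fb in L^p, while |grad psi| = |w| is the viscous
    dissipation; in two dimensions the Gagliardo-Nirenberg inequality then bounds this integral by C
    |psi|^2 + 1/2 |grad psi|^2 ([weighted_span_le], [defect_pairing_le]), and |psi|^2 <= 2 E.
    Writing F = Fb + G in the capillary term and completing a square leaves delta/2 |grad Fb|^2 + 2
    delta |grad psi|^2 ([capillary_le]), whose second part is absorbed when delta <= 1/4. Hence E'
    <= C E + delta B / 2 with B a bound of |grad Fb|^2 and E(0) = 0, and Gronwall's lemma gives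
    |G|^2 <= C B delta on [0, T] ([mode_stability], [weak_stability]).

    For weak solutions the computation is made on finitely many Fourier modes. Testing with a mode
    times a function of time and applying [du_bois_reymond] yields integrated equations for the
    coefficients ([kinematic_modes], [momentum_modes]); the identity for E' becomes
    [mode_power_identity], and [slice_power_le] is the differential inequality at a fixed time.
    Modes are weighted so that their sum is the Fejer kernel. Its positivity makes the means
    converge in L^1 and, by truncation, in the duality between L^q and L^p ([cvg_pairing_sm2]), so
    the error made by replacing G by its mean against the stress vanishes as the number of modes
    grows.

    Finally, |G|^r <= delta^(r/2) (1 + |G|^2 / delta) gives an L^r bound C1 delta^(r/2). In the
    stated range of delta this number is at most 1, so raising it to the power exp(- t) and
    multiplying by exp(2 - 2 exp(- t)) only increases it: the claim holds with C2 = 1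
    ([holder_power_le]). Both parts are obtained from [stability_estimate_holds]. *)

(** * Directional derivatives: linearity in the direction, symmetry, and convexity *)

Section DirectionalCalculus.
Context {R : realType} {V : normedModType R}.
Implicit Types (f g : V -> R) (x v w : V).

Lemma is_derive_line f x v (s : R) : derivable f (x + s *: v) v ->
  is_derive s (1 : R) (fun r : R => f (x + r *: v)) ('D_v f (x + s *: v)).
Proof.
have eqq : (fun h : R => h^-1 *: (((fun r : R => f (x + r *: v)) \o shift s) (h *: 1)
   - f (x + s *: v))) = (fun h : R => h^-1 *: ((f \o shift (x + s *: v)) (h *: v)
   - f (x + s *: v))).
  apply/funext => h /=; congr (_ *: (f _ - _)).
  by rewrite scalerDl /GRing.scale /= mulr1 addrCA.
move=> df; apply: DeriveDef; first by rewrite /derivable eqq.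
by rewrite /derive eqq.
Qed.

Lemma MVT_line f x v (h : R) : (forall y, derivable f y v) ->
  exists2 s : R, `|s| <= `|h| & f (x + h *: v) - f x = h * 'D_v f (x + s *: v).
Proof.
move=> df.
have dl (s : R) : is_derive s (1 : R) (fun r : R => f (x + r *: v)) ('D_v f (x + s *: v)).
  exact: is_derive_line.
have cl : continuous (fun r : R => f (x + r *: v)).
  by move=> s; apply: differentiable_continuous; apply/derivable1_diffP; exact: ex_derive.
have e0 : f x = f (x + (0 : R) *: v) by rewrite scale0r addr0.
have [h0|h0] := leP 0 h.
  have [|s + e] := @MVT_segment R _ _ 0 h h0 (fun s _ => dl s).
    exact: continuous_subspaceT.
  rewrite in_itv /= => /andP[s0 sh]; exists s; first by rewrite !ger0_norm.
  by rewrite e0 e subr0 mulrC.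
have [|s + e] := @MVT_segment R _ _ h 0 (ltW h0) (fun s _ => dl s).
  exact: continuous_subspaceT.
rewrite in_itv /= => /andP[s0 sh]; exists s; first by rewrite !ler0_norm ?lerN2// ltW.
by rewrite e0 -opprB e sub0r mulrN opprK mulrC.
Qed.

Lemma continuous_plane f x v w (e : R) : continuous f -> 0 < e ->
  exists2 h : R, 0 < h & forall a b : R, `|a| <= h -> `|b| <= h ->
    `|f (x + a *: v + b *: w) - f x| < e.
Proof.
move=> cf e0.
have /cvgr_distC_lt /(_ e e0) := cf x.
rewrite near_nbhs => /nbhs_normP[d /= d0 Hd].
pose N : R := `|v| + `|w| + 1.
have N0 : 0 < N by rewrite ltr_pwDr// addr_ge0.
exists (d / N / 2) => [|a b ah bh]; first by rewrite !divr_gt0.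
apply: Hd; rewrite /ball_ /= -addrA opprD addNKr normrN.
rewrite (le_lt_trans (ler_normD _ _))// !normrZ.
have H : `|a| * `|v| + `|b| * `|w| <= d / N / 2 * (`|v| + `|w|).
  by rewrite mulrDr lerD// ler_wpM2r.
apply: (le_lt_trans H); rewrite mulrAC ltr_pdivrMr// mulrAC ltr_pdivrMr//.
have : `|v| + `|w| < N by rewrite ltrDl.
have : 0 <= `|v| + `|w| by rewrite addr_ge0.
nra.
Qed.

Lemma eq_eps (a b : R) : (forall e : R, 0 < e -> `|a - b| <= e) -> a = b.
Proof.
move=> H; apply/eqP; rewrite -subr_eq0 -normr_le0 leNgt; apply/negP => h.
by have := H _ (divr_gt0 h (ltr0Sn _ 1)); rewrite leNgt ltr_pdivrMr// mulr_natr mulr2n ltrDl h.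
Qed.

Lemma dist_eps2 (a b c e : R) : `|c - a| < e / 2 -> `|c - b| < e / 2 -> `|a - b| <= e.
Proof.
rewrite !ltr_norml => /andP[? ?] /andP[? ?].
by rewrite ler_norml; apply/andP; split; lra.
Qed.

Lemma dist_eps3 (a b c b' c' e : R) : `|b' + c' - a| < e / 3 -> `|b' - b| < e / 3 ->
  `|c' - c| < e / 3 -> `|a - (b + c)| <= e.
Proof.
rewrite !ltr_norml => /andP[? ?] /andP[? ?] /andP[? ?].
by rewrite ler_norml; apply/andP; split; lra.
Qed.

(** [is_Ck] speaks of one direction at a time. The increment from [x] to [x + h (v + w)] is compared
    with the two legs through [x + h v]; the mean value theorem on each leg and continuity of the
    three derivatives give the identity as [h] shrinks. *)
Lemma deriveD_dir f x v w : is_Ck 1 f ->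
  'D_(v + w) f x = 'D_v f x + 'D_w f x.
Proof.
move=> [_ Cf]; apply: eq_eps => e e0.
have e30 : 0 < e / 3 by rewrite divr_gt0.
have [dvw [cvw _]] := Cf (v + w); have [dv [cv _]] := Cf v; have [dw [cw _]] := Cf w.
have [h1 h10 H1] := continuous_plane x v w cvw e30.
have [h2 h20 H2] := continuous_plane x v w cv e30.
have [h3 h30 H3] := continuous_plane x v w cw e30.
pose h := Num.min h1 (Num.min h2 h3).
have h0 : 0 < h by rewrite !lt_min h10 h20 h30.
have [s1 sh1 E1] := MVT_line x h dvw.
have [s2 sh2 E2] := MVT_line x h dv.
have [s3 sh3 E3] := MVT_line (x + h *: v) h dw.
have E : 'D_(v + w) f (x + s1 *: (v + w)) =
         'D_v f (x + s2 *: v) + 'D_w f (x + h *: v + s3 *: w).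
  apply: (mulfI (lt0r_neq0 h0)); rewrite mulrDr -E1 -E2 -E3 scalerDr addrA.
  by rewrite [RHS]addrC addrA subrK.
rewrite (gtr0_norm h0) in sh1 sh2 sh3.
have {}H1 : `|'D_(v + w) f (x + s1 *: (v + w)) - 'D_(v + w) f x| < e / 3.
  by rewrite scalerDr addrA; apply: H1; apply: (le_trans sh1); rewrite /h !ge_min lexx ?orbT.
have {}H2 : `|'D_v f (x + s2 *: v) - 'D_v f x| < e / 3.
  have := H2 s2 0; rewrite scale0r addr0; apply; rewrite ?normr0 ?(ltW h20)//.
  by apply: (le_trans sh2); rewrite /h !ge_min lexx ?orbT.
have {}H3 : `|'D_w f (x + h *: v + s3 *: w) - 'D_w f x| < e / 3.
  apply: H3; rewrite ?(gtr0_norm h0) ?(le_trans sh3)//.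
    by rewrite /h !ge_min lexx ?orbT.
  by rewrite /h !ge_min lexx ?orbT.
by rewrite E in H1; exact: dist_eps3 H1 H2 H3.
Qed.

Lemma deriveZ_dir f x v (c : R) : is_Ck 1 f ->
  'D_(c *: v) f x = c * 'D_v f x.
Proof.
move=> [_ Cf]; apply: eq_eps => e e0.
have k0 : 0 < 1 + `|c| by rewrite ltr_pwDl.
have e20 : 0 < e / (1 + `|c|) by rewrite divr_gt0.
have [dcv [ccv _]] := Cf (c *: v); have [dv [cv _]] := Cf v.
have [h1 h10 H1] := continuous_plane x (c *: v) 0 ccv e20.
have [h2 h20 H2] := continuous_plane x v 0 cv e20.
pose h := Num.min h1 (h2 / (1 + `|c|)).
have h0 : 0 < h by rewrite !lt_min h10 divr_gt0.
have [s1 sh1 E1] := MVT_line x h dcv.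
have [s2 sh2 E2] := MVT_line x (h * c) dv.
have E : 'D_(c *: v) f (x + s1 *: (c *: v)) = c * 'D_v f (x + s2 *: v).
  by apply: (mulfI (lt0r_neq0 h0)); rewrite -E1 mulrA -E2 scalerA.
rewrite normrM (gtr0_norm h0) in sh2; rewrite (gtr0_norm h0) in sh1.
have {}H1 : `|'D_(c *: v) f (x + s1 *: (c *: v)) - 'D_(c *: v) f x| < e / (1 + `|c|).
  have := H1 s1 0; rewrite scaler0 addr0; apply; rewrite ?normr0 ?(ltW h10)//.
  by apply: (le_trans sh1); rewrite /h !ge_min lexx ?orbT.
have {}H2 : `|'D_v f (x + s2 *: v) - 'D_v f x| < e / (1 + `|c|).
  have := H2 s2 0; rewrite scaler0 addr0; apply; rewrite ?normr0 ?(ltW h20)//.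
  apply: (le_trans sh2).
  have : h <= h2 / (1 + `|c|) by rewrite /h !ge_min lexx ?orbT.
  rewrite ler_pdivlMr// => hh; apply: (le_trans _ hh).
  by rewrite ler_wpM2l ?lerDr// ltW.
have -> : 'D_(c *: v) f x - c * 'D_v f x =
  ('D_(c *: v) f x - 'D_(c *: v) f (x + s1 *: (c *: v))) +
   c * ('D_v f (x + s2 *: v) - 'D_v f x) by rewrite E; ring.
apply: (le_trans (ler_normD _ _)); rewrite distrC normrM.
have -> : e = e / (1 + `|c|) + `|c| * (e / (1 + `|c|)) by move: k0; move: (`|c|) => k k0; field; rewrite lt0r_neq0.
by apply: lerD; [exact: (ltW H1)|rewrite ler_wpM2l ?normr_ge0 ?(ltW H2)].
Qed.

Lemma derive_sum_dir f x (I : Type) (r : seq I) (c : I -> R) (v : I -> V) :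
  is_Ck 1 f ->
  'D_(\sum_(i <- r) c i *: v i) f x = \sum_(i <- r) c i * 'D_(v i) f x.
Proof.
move=> Cf; elim: r => [|i r IH].
  by rewrite !big_nil -(scale0r (0 : V)) deriveZ_dir// mul0r.
by rewrite !big_cons deriveD_dir// deriveZ_dir// IH.
Qed.

(** Schwarz's argument: the second difference of [f] over a small parallelogram is symmetric in the
    two directions, and it can be expanded by the mean value theorem in either order. *)
Lemma derive_comm f x v w : is_Ck 2 f ->
  'D_w ('D_v f) x = 'D_v ('D_w f) x.
Proof.
move=> [_ Cf]; apply: eq_eps => e e0.
have e20 : 0 < e / 2 by rewrite divr_gt0.
have [dv [cv Cv]] := Cf v; have [dw [cw Cw]] := Cf w.
have [dvw [cvw _]] := Cv w; have [dwv [cwv _]] := Cw v.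
have [h1 h10 H1] := continuous_plane x v w cvw e20.
have [h2 h20 H2] := continuous_plane x v w cwv e20.
pose h := Num.min h1 h2.
have h0 : 0 < h by rewrite !lt_min h10.
have key (a b : V) : (forall y, derivable f y a) -> (forall y, derivable ('D_a f) y b) ->
    exists s t : R, [/\ `|s| <= h, `|t| <= h &
    f (x + h *: a + h *: b) - f (x + h *: a) - f (x + h *: b) + f x =
    h * (h * 'D_b ('D_a f) (x + s *: a + t *: b))].
  move=> da dab.
  have dg y : derivable (fun y => f (y + h *: b) - f y) y a /\
     'D_a (fun y => f (y + h *: b) - f y) y = 'D_a f (y + h *: b) - 'D_a f y.
    have i1 : is_derive y a (fun y => f (y + h *: b)) ('D_a f (y + h *: b)).
      have eqq : (fun k : R => k^-1 *: (((fun y => f (y + h *: b)) \o shift y) (k *: a) - f (y + h *: b)))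
        = (fun k : R => k^-1 *: ((f \o shift (y + h *: b)) (k *: a) - f (y + h *: b))).
        by apply/funext => k /=; rewrite -addrA.
      apply: DeriveDef; first by rewrite /derivable eqq; exact: da.
      by rewrite /derive eqq.
    have i2 : is_derive y a f ('D_a f y) by apply: derivableP.
    have i3 := is_deriveB i1 i2.
    by split; [case: i3|case: i3].
  have [s sh Es] := MVT_line x h (fun y => (dg y).1).
  have [t th Et] := MVT_line (x + s *: a) h dab.
  rewrite (gtr0_norm h0) in sh th.
  exists s, t; split => //.
  by rewrite -Et -(dg _).2 -Es opprB addrA addrAC.
have [s1 [t1 [sh1 th1 E1]]] := key _ _ dv dvw.
have [s2 [t2 [sh2 th2 E2]]] := key _ _ dw dwv.
have E : 'D_w ('D_v f) (x + s1 *: v + t1 *: w) = 'D_v ('D_w f) (x + t2 *: v + s2 *: w).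
  apply: (mulfI (lt0r_neq0 h0)); apply: (mulfI (lt0r_neq0 h0)).
  rewrite (addrAC x (t2 *: v)); apply: etrans (esym E1) (etrans _ E2).
  by rewrite (addrAC x (h *: w)) (addrAC (f _)).
have {}H1 : `|'D_w ('D_v f) (x + s1 *: v + t1 *: w) - 'D_w ('D_v f) x| < e / 2.
  by apply: H1; [apply: (le_trans sh1)|apply: (le_trans th1)]; rewrite /h !ge_min lexx ?orbT.
have {}H2 : `|'D_v ('D_w f) (x + t2 *: v + s2 *: w) - 'D_v ('D_w f) x| < e / 2.
  by apply: H2; [apply: (le_trans th2)|apply: (le_trans sh2)]; rewrite /h !ge_min lexx ?orbT.
by rewrite E in H1; exact: dist_eps2 H1 H2.
Qed.

(** Polarisation of the symmetric form B = D^2 f: B(v, v + 2 w) = B(v + w, v + w) - B(w, w). This is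
    the completion of the square used for the stress. *)
Lemma derive2_square f x (v w : V) : is_Ck 2 f ->
  'D_v ('D_(v + 2 *: w) f) x =
  'D_(v + w) ('D_(v + w) f) x - 'D_w ('D_w f) x.
Proof.
move=> f2.
have D1 u : is_Ck 1 ('D_u f) by case: f2 => _ /(_ u)[].
have [B [BE BD BZ BC]] : exists B : V -> V -> R,
    [/\ forall a b, 'D_a ('D_b f) x = B a b, forall a b c, B (a + b) c = B a c + B b c,
        forall (k : R) a b, B (k *: a) b = k * B a b & forall a b, B a b = B b a].
  exists (fun a b => 'D_a ('D_b f) x); split => [a b|a b c|k a b|a b].
  - reflexivity.
  - exact: (deriveD_dir x a b (D1 c)).
  - exact: (deriveZ_dir x a k (D1 b)).
  - exact: (derive_comm x b a f2).
have BD' a b c : B c (a + b) = B c a + B c b by rewrite BC BD !(BC _ c).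
rewrite !BE !BD' !BD (BC v (2 *: w)) BZ (BC v w).
by move: (B v v) (B w v) (B w w) => a b c; clear; lra.
Qed.

Lemma shift_lt0 (a b k : R) : a - b < - (b + k) -> a + k < 0.
Proof. by lra. Qed.

(** If the second derivative plus [k] were negative at [x], it would be so on a segment around [x],
    and the symmetric second difference would decrease strictly away from 0, against the
    hypothesis. *)
Lemma midconvex_derive2_ge0 f x v (k : R) : is_Ck 2 f ->
  (forall h : R, 0 <= f (x + h *: v) + f (x + (- h) *: v) - 2 * f x + k * h ^+ 2) ->
  0 <= 'D_v ('D_v f) x + k.
Proof.
move=> [_ Cf] mc; rewrite leNgt; apply/negP => neg.
have [dv [cv Cv]] := Cf v; have [dvv [cvv _]] := Cv v.
have e0 : 0 < - ('D_v ('D_v f) x + k) by rewrite oppr_gt0.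
have [h h0 H] := continuous_plane x v 0 cvv e0.
have {}H (s : R) : `|s| <= h -> 'D_v ('D_v f) (x + s *: v) + k < 0.
  move=> sh; have := H s 0 sh; rewrite scaler0 addr0 normr0 => /(_ (ltW h0)).
  by move=> /(le_lt_trans (ler_norm _)); exact: shift_lt0.
pose g (s : R) : R := f (x + s *: v) + f (x + (- s) *: v) + k * s ^+ 2.
have dl (s : R) : is_derive s (1 : R) (fun r : R => f (x + r *: v)) ('D_v f (x + s *: v)).
  exact: is_derive_line.
have dg (s : R) : is_derive s (1 : R) g
   ('D_v f (x + s *: v) - 'D_v f (x + (- s) *: v) + k * (2 * s)).
  have i2 : is_derive s (1 : R) (fun r : R => f (x + (- r) *: v)) (- 'D_v f (x + (- s) *: v)).
    rewrite -mulrN1.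
    apply: (@is_derive1_comp R (fun r : R => f (x + r *: v)) (fun r : R => - r)).
  have i3 : is_derive s (1 : R) (fun r : R => k * r ^+ 2) (k * (2 * s)).
    have j : is_derive s (1 : R) (fun r : R => k * r ^+ 2) (k *: ((2%:R * s ^+ 1) *: 1)).
      exact: (is_deriveZ k (is_deriveX 2 (is_derive_id s 1))).
    apply: (is_derive_eq j).
    by rewrite expr1 /GRing.scale /= mulr1.
  exact: (is_deriveD (is_deriveD (dl s) i2) i3).
have cg : continuous g.
  by move=> s; apply: differentiable_continuous; apply/derivable1_diffP; exact: ex_derive.
(* A third of [h] suffices: the two intermediate points satisfy [s < h / 3] and [|t| <= 2 s], so
   [|t - s| <= 3 s < h]. *)
have h30 : 0 < h / 3 by rewrite divr_gt0.
have [|s + e] := @MVT R g _ 0 (h / 3) h30 (fun s _ => dg s).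
  exact: continuous_subspaceT.
rewrite in_itv /= => /andP[s0 sh].
have [t ts Et] := MVT_line (x + (- s) *: v) (s + s) dvv.
have := mc (h / 3).
have -> : f (x + (h / 3) *: v) + f (x + - (h / 3) *: v) - 2 * f x + k * (h / 3) ^+ 2 =
    g (h / 3) - g 0.
  by rewrite /g oppr0 !scale0r !addr0; ring.
rewrite e subr0.
have -> : 'D_v f (x + s *: v) - 'D_v f (x + - s *: v) =
   (s + s) * 'D_v ('D_v f) (x + (t - s) *: v).
  by move: Et; rewrite -!addrA -!scalerDl addKr (addrC (- s)).
suff : 'D_v ('D_v f) (x + (t - s) *: v) + k < 0.
  set a := 'D_v _ _ => ak; rewrite leNgt => /negP; apply.
  rewrite pmulr_llt0//.
  have -> : (s + s) * a + k * (2 * s) = (2 * s) * (a + k) by ring.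
  by rewrite pmulr_rlt0// mulr_gt0.
apply: H; move: ts; rewrite (ger0_norm (ltW (addr_gt0 s0 s0))) !ler_norml => /andP[t1 t2].
by clear - h0 s0 sh t1 t2; apply/andP; split; lra.
Qed.

End DirectionalCalculus.

(** * The Frobenius product and norm *)

Section Matrices.
Context {R : realType}.

Lemma frobE m n (A B : 'M[R]_(m, n)) : frob A B = \sum_i \sum_j A i j * B i j.
Proof.
rewrite /frob /mxtrace; apply: eq_bigr => i _.
by rewrite mxE; apply: eq_bigr => j _; rewrite mxE.
Qed.

Lemma sqr_fnorm m n (A : 'M[R]_(m, n)) : fnorm A ^+ 2 = \sum_i \sum_j A i j ^+ 2.
Proof.
rewrite /fnorm sqr_sqrtr frobE; last first.
  by apply: sumr_ge0 => i _; apply: sumr_ge0 => j _; rewrite -expr2 sqr_ge0.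
by under eq_bigr do under eq_bigr do rewrite -expr2.
Qed.

Lemma fnorm_ge0 m n (A : 'M[R]_(m, n)) : 0 <= fnorm A.
Proof. exact: sqrtr_ge0. Qed.

Lemma frobDl m n (A B D : 'M[R]_(m, n)) : frob (A + B) D = frob A D + frob B D.
Proof. by rewrite /frob mulmxDl linearD. Qed.

Lemma frobDr m n (A B D : 'M[R]_(m, n)) : frob D (A + B) = frob D A + frob D B.
Proof. by rewrite /frob linearD /= mulmxDr linearD. Qed.

Lemma frobZl m n (c : R) (A D : 'M[R]_(m, n)) : frob (c *: A) D = c * frob A D.
Proof. by rewrite /frob -scalemxAl linearZ. Qed.

Lemma frobZr m n (c : R) (A D : 'M[R]_(m, n)) : frob D (c *: A) = c * frob D A.
Proof. by rewrite /frob linearZ /= -scalemxAr linearZ. Qed.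

Lemma frobNl m n (A D : 'M[R]_(m, n)) : frob (- A) D = - frob A D.
Proof. by rewrite -scaleN1r frobZl mulN1r. Qed.

Lemma frobBl m n (A B D : 'M[R]_(m, n)) : frob (A - B) D = frob A D - frob B D.
Proof. by rewrite frobDl frobNl. Qed.

Lemma abs_entry_le m n (A : 'M[R]_(m, n)) i j : `|A i j| <= fnorm A.
Proof.
rewrite -[leLHS]ger0_norm// -ler_sqr ?nnegrE ?fnorm_ge0//.
rewrite normr_id real_normK ?num_real// sqr_fnorm (bigD1 i)//= (bigD1 j)//= -addrA lerDl.
by rewrite addr_ge0// !sumr_ge0// => k _; rewrite ?sqr_ge0// sumr_ge0// => l _; rewrite sqr_ge0.
Qed.

Lemma sum_sqr_le (I : Type) (r : seq I) (a : I -> R) : (forall i, 0 <= a i) ->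
  \sum_(i <- r) a i ^+ 2 <= (\sum_(i <- r) a i) ^+ 2.
Proof.
move=> a0; elim: r => [|i r IH]; first by rewrite !big_nil expr0n.
rewrite !big_cons sqrrD -addrA lerD2l (le_trans IH)// lerDr.
by rewrite mulrn_wge0// mulr_ge0// sumr_ge0.
Qed.

Lemma fnorm_le_sum m n (A : 'M[R]_(m, n)) : fnorm A <= \sum_i \sum_j `|A i j|.
Proof.
have S0 : 0 <= \sum_i \sum_j `|A i j| by apply: sumr_ge0 => i _; exact: sumr_ge0.
rewrite -ler_sqr ?nnegrE ?fnorm_ge0// sqr_fnorm.
apply: le_trans (_ : \sum_i (\sum_j `|A i j|) ^+ 2 <= _).
  apply: ler_sum => i _; apply: le_trans (_ : \sum_j `|A i j| ^+ 2 <= _).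
    by apply: ler_sum => j _; rewrite real_normK ?num_real.
  by apply: sum_sqr_le => j; exact: normr_ge0.
by apply: sum_sqr_le => i; exact: sumr_ge0.
Qed.

Lemma term_le_sum (I : finType) (f : I -> R) (j : I) : (forall i, 0 <= f i) ->
  f j <= \sum_i f i.
Proof. by move=> f0; rewrite (bigD1 j)//= lerDl sumr_ge0. Qed.

Lemma frobC m n (A B : 'M[R]_(m, n)) : frob A B = frob B A.
Proof. by rewrite !frobE; do 2 (apply: eq_bigr => ? _); rewrite mulrC. Qed.

Lemma frob_sqr m n (A : 'M[R]_(m, n)) : frob A A = fnorm A ^+ 2.
Proof. by rewrite frobE sqr_fnorm. Qed.

(** The same polarisation as in [derive2_square], for the term weighted by [K]. *)
Lemma fnorm_add_sqr m n (A B : 'M[R]_(m, n)) :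
  fnorm (A + B) ^+ 2 = frob A (A + 2 *: B) + fnorm B ^+ 2.
Proof. by rewrite -!frob_sqr frobDl !frobDr frobZr (frobC B A); ring. Qed.

Lemma sum_abs_le (A : 'M[R]_2) : \sum_i \sum_j `|A i j| <= 4 * fnorm A.
Proof.
apply: (@le_trans _ _ (\sum_(i < 2) \sum_(j < 2) fnorm A)).
  by apply: ler_sum => i _; apply: ler_sum => j _; exact: abs_entry_le.
by rewrite !sumr_const card_ord -mulrnA -[leLHS]mulr_natl.
Qed.

(** The factor 4 counts the entries: the bound passes through the sum of their absolute values. *)
Lemma fnorm_segment (A B : 'M[R]_2) (s : R) : 0 <= s <= 1 ->
  fnorm (A + s *: (B - A)) <= 4 * (fnorm A + fnorm B).
Proof.
move=> /andP[s0 s1]; apply: (le_trans (fnorm_le_sum _)).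
rewrite mulrDr; apply: le_trans (lerD (sum_abs_le A) (sum_abs_le B)).
rewrite -big_split/=; apply: ler_sum => i _; rewrite -big_split/=.
apply: ler_sum => j _; rewrite !mxE.
have -> : A i j + s * (B i j - A i j) = (1 - s) * A i j + s * B i j by ring.
rewrite (le_trans (ler_normD _ _))// !normrM ?(ger0_norm s0) ger0_norm ?subr_ge0//.
by rewrite lerD// ler_piMl// gerBl.
Qed.

End Matrices.

(** * The Hessian of the stored energy *)

Section Energy.
Context {R : realType} (W : 'M[R]_2 -> R).

Lemma derive_delta (f : 'M[R]_2 -> R) X V : is_Ck 1 f ->
  'D_V f X = \sum_i \sum_a V i a * 'D_(delta_mx i a) f X.
Proof.
move=> f1; rewrite [in LHS](matrix_sum_delta V) pair_bigA /= derive_sum_dir//.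
by rewrite pair_bigA.
Qed.

Lemma frob_stress X V : is_Ck 1 W -> frob (stress W X) V = 'D_V W X.
Proof.
move=> W1; rewrite frobE derive_delta//.
by apply: eq_bigr => i _; apply: eq_bigr => a _; rewrite mxE mulrC.
Qed.

Lemma is_CkW k (V U : normedModType R) (f : V -> U) : is_Ck k.+1 f -> is_Ck k f.
Proof.
elim: k f => [|k IH] f [cf Hf]; first by split.
by split=> // v; have [dv Cv] := Hf v; split=> //; exact: IH.
Qed.

Lemma derive2_hess X U V : is_Ck 2 W ->
  'D_U ('D_V W) X = \sum_k \sum_c \sum_i \sum_a U k c * V i a * hess W X k c i a.
Proof.
move=> W2; have D1 v : is_Ck 1 ('D_v W) by case: W2 => _ /(_ v)[].
rewrite derive_delta//; apply: eq_bigr => k _; apply: eq_bigr => c _.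
rewrite derive_comm// derive_delta// mulr_sumr; apply: eq_bigr => i _.
by rewrite mulr_sumr; apply: eq_bigr => a _; rewrite mulrA.
Qed.

Lemma hess_le X i a k c : `|hess W X i a k c| <= hess_norm W X.
Proof.
rewrite /hess_norm -sqrtr_sqr ler_wsqrtr//.
have s0 (I : finType) (f : I -> R) : (forall i, 0 <= f i) -> 0 <= \sum_i f i.
  by move=> f0; exact: sumr_ge0.
have h0 i' a' k' c' : 0 <= hess W X i' a' k' c' ^+ 2 by exact: sqr_ge0.
apply: le_trans (term_le_sum i _); last by do 3 (move=> ?; apply: (s0)); move=> ?.
apply: le_trans (term_le_sum a _); last by do 2 (move=> ?; apply: (s0)); move=> ?.
apply: le_trans (term_le_sum k _); last by move=> ?; apply: (s0) => ?.
exact: le_trans (term_le_sum c _).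
Qed.

Lemma derive2_le X U V : is_Ck 2 W ->
  `|'D_U ('D_V W) X| <= 16 * hess_norm W X * fnorm U * fnorm V.
Proof.
move=> W2; rewrite derive2_hess//.
apply: (@le_trans _ _ ((\sum_i \sum_j `|U i j|) * (\sum_i \sum_j `|V i j|) * hess_norm W X)).
  rewrite !mulr_suml; apply: (le_trans (ler_norm_sum _ _ _)); apply: ler_sum => k _.
  rewrite !mulr_suml; apply: (le_trans (ler_norm_sum _ _ _)); apply: ler_sum => c _.
  rewrite !(mulr_sumr, mulr_suml); apply: (le_trans (ler_norm_sum _ _ _)); apply: ler_sum => i _.
  rewrite !(mulr_sumr, mulr_suml); apply: (le_trans (ler_norm_sum _ _ _)); apply: ler_sum => a _.
  by rewrite !normrM ler_wpM2l ?mulr_ge0 ?normr_ge0 ?hess_le.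
have -> : 16 * hess_norm W X * fnorm U * fnorm V =
  (4 * fnorm U) * (4 * fnorm V) * hess_norm W X.
  by move: (hess_norm W X) (fnorm U) (fnorm V) => a b c; ring.
rewrite ler_wpM2r ?sqrtr_ge0// ler_pM ?sum_abs_le//;
  by apply: sumr_ge0 => i _; exact: sumr_ge0.
Qed.

Lemma midpoint (X Y : 'M[R]_2) (h : R) :
  2^-1 *: (X + h *: Y) + 2^-1 *: (X + (- h) *: Y) = X.
Proof.
by apply/matrixP => i j; rewrite !mxE; lra.
Qed.

(** Convexity of [Wtilde K W] at the midpoint of [X + h V] and [X - h V] is the hypothesis of
    [midconvex_derive2_ge0], the quadratic part contributing [K * fnorm V ^+ 2]. *)
Lemma convex_derive2 (K : R) X V : is_Ck 2 W -> H3_convex K W ->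
  0 <= 'D_V ('D_V W) X + K * fnorm V ^+ 2.
Proof.
move=> W2 cW; apply: midconvex_derive2_ge0 => // h.
have h0 : (0 : R) <= 2^-1 by rewrite invr_ge0.
have h1 : (2^-1 : R) <= 1 by lra.
have := cW (Itv01 h0 h1) (X + h *: V) (X + (- h) *: V).
rewrite !in_setE => /(_ I I).
rewrite convRE.
have -> : conv (Itv01 h0 h1) (X + h *: V : convex_lmodType _) (X + (- h) *: V) = X.
  rewrite /conv /= /unstable.onem.
  have -> : (1 - 2^-1 : R) = 2^-1 by lra.
  exact: midpoint.
rewrite /unstable.onem /= /Wtilde.
have -> : fnorm (X + (- h) *: V) ^+ 2 = fnorm X ^+ 2 - 2 * h * frob X V + h ^+ 2 * fnorm V ^+ 2.
  rewrite -!frob_sqr frobDl !frobDr !frobZl !frobZr (frobC V X); ring.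
have -> : fnorm (X + h *: V) ^+ 2 = fnorm X ^+ 2 + 2 * h * frob X V + h ^+ 2 * fnorm V ^+ 2.
  rewrite -!frob_sqr frobDl !frobDr !frobZl !frobZr (frobC V X); ring.
clear; move: (W _) (W _) (W _) (fnorm X ^+ 2) (fnorm V ^+ 2) (frob _ _) => a b c x v y; lra.
Qed.

End Energy.

(** * Growth of the stress and its one-sided monotonicity *)

Lemma powRD_le (R : realType) (p a b : R) : 2 <= p -> 0 <= a -> 0 <= b ->
  (4 * (a + b)) `^ (p - 2) <= 8 `^ (p - 2) * (a `^ (p - 2) + b `^ (p - 2)).
Proof.
move=> p2; have p20 : 0 <= p - 2 by rewrite subr_ge0.
move=> a0 b0; wlog ab : a b a0 b0 / a <= b => [wl|].
  have [/wl|/ltW/wl] := leP a b; first exact.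
  by rewrite (addrC b) (addrC (b `^ _)); apply.
have -> : 8 `^ (p - 2) * (a `^ (p - 2) + b `^ (p - 2)) =
   8 `^ (p - 2) * a `^ (p - 2) + 8 `^ (p - 2) * b `^ (p - 2) by rewrite mulrDr.
rewrite -[X in _ <= _ + X]powRM// ?ler0n//.
apply: (@le_trans _ _ ((8 * b) `^ (p - 2))).
  by apply: ge0_ler_powR; rewrite ?nnegrE; lra.
by rewrite lerDr mulr_ge0 ?powR_ge0.
Qed.

Lemma powR_growth (R : realType) (p x : R) : 2 <= p -> 0 <= x ->
  (1 + x `^ (p - 2)) * x <= 2 * (1 + x `^ (p - 1)).
Proof.
move=> h x0; have p10 : p - 1 != 0 by apply: lt0r_neq0; clear -h; lra.
have p11 : 1 <= p - 1 by clear -h; lra.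
have e1 : x `^ (p - 1) = x * x `^ (p - 2).
  have [->|xn0] := eqVneq x 0; first by rewrite mul0r powR0.
  have -> : p - 1 = 1 + (p - 2) by clear; lra.
  by rewrite (@powRD _ x 1 (p - 2)) ?xn0 ?implybT// powRr1.
have : x <= 1 + x `^ (p - 1).
  have [x1|x1] := leP x 1; first by rewrite (le_trans x1)// lerDl powR_ge0.
  rewrite (@le_trans _ _ (x `^ (p - 1)))//; last by rewrite lerDr.
  rewrite -[leLHS]powRr1//; apply: ler_powR => //; exact: ltW.
rewrite e1; move: (x `^ _) => u; clear -x0; nra.
Qed.

Section PointwiseBounds.
Context {R : realType} (W : 'M[R]_2 -> R) (p K : R).
Hypotheses (p2 : 2 <= p) (K0 : 0 < K) (W3 : H1_regular W) (cW : H3_convex K W)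
  (hW : hess_growth p W).

Let W2 : is_Ck 2 W. Proof. exact: is_CkW. Qed.
Let W1 : is_Ck 1 W. Proof. exact: is_CkW. Qed.

(* Differentiate [s |-> D_(G + 2 psi) W (Fb + s G)]: since [D^2 W + K >= 0], completing the square at [G + psi] leaves only [- D^2 W (psi, psi)]. *)
Lemma stress_diff_ge (F Fb psi : 'M[R]_2) :
  exists2 s : R, 0 <= s <= 1 &
  - (16 * hess_norm W (Fb + s *: (F - Fb)) + K) * fnorm psi ^+ 2 <=
  frob (stress W F - stress W Fb + K *: (F - Fb)) (F - Fb + 2 *: psi).
Proof.
set G := F - Fb; set H := G + 2 *: psi.
have CH : is_Ck 1 ('D_H W) by case: W2 => _ /(_ H)[].
have [dHG _] := CH.2 G.
have dl (s : R) : is_derive s (1 : R) (fun r : R => 'D_H W (Fb + r *: G))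
    ('D_G ('D_H W) (Fb + s *: G)) by exact: is_derive_line.
have cl : continuous (fun r : R => 'D_H W (Fb + r *: G)).
  by move=> s; apply: differentiable_continuous; apply/derivable1_diffP; exact: ex_derive.
have [|s] := @MVT_segment R _ _ 0 1 ler01 (fun s _ => dl s).
  exact: continuous_subspaceT.
rewrite in_itv /= => s01; rewrite scale1r scale0r addr0 subr0 mulr1.
have -> : Fb + G = F by rewrite /G addrC subrK.
rewrite -(frob_stress F)// -(frob_stress Fb)// -frobBl => E; exists s => //.
rewrite frobDl E frobZl; set X := Fb + s *: G.
have D1 v : is_Ck 1 ('D_v W) by case: W2 => _ /(_ v)[].
have EH : 'D_G ('D_H W) X = 'D_(G + psi) ('D_(G + psi) W) X - 'D_psi ('D_psi W) X.
  exact: derive2_square.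
have /ler_normlP[_ h1] : `|'D_psi ('D_psi W) X| <= _ := derive2_le X psi psi W2.
have h2 := convex_derive2 X (G + psi) W2 cW.
have e1 : fnorm (G + psi) ^+ 2 = frob G H + fnorm psi ^+ 2.
  exact: fnorm_add_sqr.
rewrite EH; move: h2 h1; rewrite e1; clear.
move: ('D__ _ X) ('D__ _ X) (hess_norm _ _) (fnorm psi) (frob G H) => a b c d e; lra.
Qed.

(** The right-hand side is quadratic in [psi] alone: every term quadratic in [F - Fb] has been given
    a sign by convexity. The Hessian is taken at a point of the segment from [Fb] to [F], so its
    growth is controlled by the two end points. *)
Lemma monotone_defect_le : exists2 C : R, 0 < C & forall F Fb psi : 'M[R]_2,
  - frob (stress W F - stress W Fb + K *: (F - Fb)) (F - Fb)
  - 2 * frob (stress W F - stress W Fb + K *: (F - Fb)) psi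
  <= C * (1 + fnorm F `^ (p - 2) + fnorm Fb `^ (p - 2)) * fnorm psi ^+ 2.
Proof.
have [C C0 HC] := hW.
pose C' := 16 * C * (1 + 8 `^ (p - 2)) + K.
exists C'; first by rewrite addr_gt0// mulr_gt0 ?mulr_gt0// ltr_pwDl ?powR_ge0.
move=> F Fb psi; have [s s01] := stress_diff_ge F Fb psi.
rewrite frobDr frobZr; set S := _ - _ + _; move=> H.
rewrite -opprD lerNl; apply: le_trans H; rewrite -mulNr ler_wpM2r ?sqr_ge0// lerN2.
have h1 := HC (Fb + s *: (F - Fb)).
have h2 : fnorm (Fb + s *: (F - Fb)) `^ (p - 2) <=
   8 `^ (p - 2) * (fnorm F `^ (p - 2) + fnorm Fb `^ (p - 2)).
  apply: le_trans (powRD_le p2 (fnorm_ge0 _) (fnorm_ge0 _)).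
  rewrite (addrC (fnorm F)); apply: ge0_ler_powR; rewrite ?nnegrE ?fnorm_ge0 ?subr_ge0//.
    by rewrite mulr_ge0// addr_ge0// fnorm_ge0.
  exact: fnorm_segment.
have q1 : 0 <= 8 `^ (p - 2) by exact: powR_ge0.
have q2 : 0 <= fnorm F `^ (p - 2) by exact: powR_ge0.
have q3 : 0 <= fnorm Fb `^ (p - 2) by exact: powR_ge0.
apply: (@le_trans _ _ (16 * (C * (1 + 8 `^ (p - 2) * (fnorm F `^ (p - 2) + fnorm Fb `^ (p - 2)))) + K)).
  by rewrite lerD2r ler_pM2l// (le_trans h1)// ler_pM2l// lerD2l.
rewrite /C' -subr_ge0.
move: (8 `^ _) (fnorm F `^ _) (fnorm Fb `^ _) q1 q2 q3 => e a b e0 a0 b0.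
have -> : (16 * C * (1 + e) + K) * (1 + a + b) - (16 * (C * (1 + e * (a + b))) + K) =
  16 * C * (a + b + e) + K * (a + b) by ring.
by rewrite addr_ge0// mulr_ge0 ?addr_ge0// ?mulr_ge0// ltW.
Qed.

(** Mean value theorem along the ray from 0 to [F], for each entry of the stress; the Hessian bound
    of power [p - 2] gains the factor [fnorm F]. *)
Lemma stress_growth : exists2 C : R, 0 < C & forall F : 'M[R]_2,
  fnorm (stress W F) <= C * (1 + fnorm F `^ (p - 1)).
Proof.
have [C C0 HC] := hW.
pose S0 := \sum_i \sum_a `|stress W 0 i a|.
have S00 : 0 <= S0 by apply: sumr_ge0 => i _; apply: sumr_ge0.
pose N := \sum_(i < 2) \sum_(a < 2) fnorm (delta_mx i a : 'M[R]_2).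
have N0 : 0 <= N by apply: sumr_ge0 => i _; apply: sumr_ge0 => a _; exact: fnorm_ge0.
exists (S0 + 32 * C * N + 1).
  by rewrite ltr_pwDr// addr_ge0// !mulr_ge0// ltW.
move=> F.
have F0 : 0 <= fnorm F by exact: fnorm_ge0.
have H i a : `|stress W F i a| <= `|stress W 0 i a| +
    32 * C * (1 + fnorm F `^ (p - 1)) * fnorm (delta_mx i a : 'M[R]_2).
  have CH : is_Ck 1 ('D_(delta_mx i a) W) by case: W2 => _ /(_ (delta_mx i a))[].
  have [dF _] := CH.2 F.
  have [s s1] := MVT_line 0 1 dF; rewrite scale1r add0r mul1r add0r => E.
  rewrite !mxE -lerBlDl (le_trans (lerB_dist _ _))// E.
  apply: (le_trans (derive2_le _ _ _ W2)).
  rewrite ler_wpM2r ?fnorm_ge0//; clear E dF CH.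
  have sF : fnorm (s *: F) <= fnorm F.
    rewrite -ler_sqr ?nnegrE ?fnorm_ge0// -!frob_sqr frobZl frobZr mulrA frob_sqr.
    rewrite ler_piMl ?sqr_ge0// -expr2 -real_normK ?num_real//.
    by rewrite -[leRHS](expr1n _ 2) ler_sqr ?nnegrE// (le_trans s1)// normr1.
  have h1 := HC (s *: F).
  have h2 : fnorm (s *: F) `^ (p - 2) <= fnorm F `^ (p - 2).
    by apply: ge0_ler_powR; rewrite ?nnegrE ?fnorm_ge0 ?subr_ge0.
  have h3 : hess_norm W (s *: F) <= C * (1 + fnorm F `^ (p - 2)).
    by apply: (le_trans h1); rewrite (ler_pM2l C0) lerD2l; exact: h2.
  have h4 := powR_growth p2 F0.
  apply: (@le_trans _ _ (16 * (C * (1 + fnorm F `^ (p - 2))) * fnorm F)).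
    by rewrite (ler_wpM2r F0)// (ler_pM2l (ltr0Sn _ _)); exact: h3.
  have -> : 32 * C * (1 + fnorm F `^ (p - 1)) = 16 * C * (2 * (1 + fnorm F `^ (p - 1))) by ring.
  by rewrite -!mulrA (ler_pM2l (ltr0Sn _ _)) (ler_pM2l C0); exact: h4.
apply: (le_trans (fnorm_le_sum _)).
apply: (@le_trans _ _ (S0 + 32 * C * (1 + fnorm F `^ (p - 1)) * N)).
  rewrite mulr_sumr -big_split /=; apply: ler_sum => i _.
  by rewrite mulr_sumr -big_split /=; apply: ler_sum => a _; exact: H.
have u0 : 0 <= fnorm F `^ (p - 1) by exact: powR_ge0.
have CN : 0 <= C * N by rewrite mulr_ge0// ltW.
move: (fnorm F `^ _) u0 => u u0.
rewrite -subr_ge0; have -> : (S0 + 32 * C * N + 1) * (1 + u) - (S0 + 32 * C * (1 + u) * N) =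
  S0 * u + 1 + u by move: S0 (N) {S00 N0 CN} => S N'; ring.
by rewrite !addr_ge0 ?mulr_ge0.
Qed.

End PointwiseBounds.

(** * Real-valued integrals and Fubini's theorem on rectangles *)

Section IntegralTools.
Context d (T : measurableType d) (R : realType) (mu : {measure set T -> \bar R}).
Variables (D : set T) (mD : measurable D).
Implicit Types f g : T -> R.
Local Notation Ig f := (mu.-integrable D (EFin \o f)).

Lemma Ig_measurable f : Ig f -> measurable_fun D f.
Proof. by move=> /integrableP[/measurable_EFinP]. Qed.

Lemma eq_Ig f g : (forall x, D x -> f x = g x) -> Ig f -> Ig g.
Proof.
by move=> fg; apply: eq_integrable => // x /[!inE] Dx /=; rewrite fg.
Qed.

Lemma eq_Rint f g : (forall x, D x -> f x = g x) ->
  \int[mu]_(x in D) f x = \int[mu]_(x in D) g x.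
Proof. by move=> fg; apply: eq_Rintegral => x /[!inE]; exact: fg. Qed.

Lemma IgD f g : Ig f -> Ig g -> Ig (fun x => f x + g x).
Proof. by move=> hf hg; exact: (integrableD mD hf hg). Qed.

Lemma IgN f : Ig f -> Ig (fun x => - f x).
Proof. by move=> If; exact: (integrableN If). Qed.

Lemma IgB f g : Ig f -> Ig g -> Ig (fun x => f x - g x).
Proof. by move=> hf hg; exact: (integrableB mD hf hg). Qed.

Lemma IgZ (c : R) f : Ig f -> Ig (fun x => c * f x).
Proof. by move=> If; exact: (integrableZl mD c If). Qed.

Lemma Ig0 : Ig (fun=> 0).
Proof. exact: integrable0. Qed.

Lemma Ig_sum (I : Type) (r : seq I) (f : I -> T -> R) : (forall i, Ig (f i)) ->
  Ig (fun x => \sum_(i <- r) f i x).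
Proof.
move=> If; elim: r => [|i r IH].
  by apply: eq_Ig Ig0 => x _; rewrite big_nil.
by apply: eq_Ig (IgD (If i) IH) => x _; rewrite big_cons.
Qed.

Lemma Ig_abs f : Ig f -> Ig (fun x => `|f x|).
Proof. by move=> If; exact: (integrable_abse If). Qed.

Lemma Ig_le f g : measurable_fun D f -> (forall x, D x -> `|f x| <= g x) -> Ig g -> Ig f.
Proof.
move=> mf fg; apply: le_integrable => //; first exact/measurable_EFinP.
by move=> x Dx /=; rewrite lee_fin (le_trans (fg x Dx))// ler_norm.
Qed.

Lemma Ig_ge0 f : measurable_fun D f -> (forall x, D x -> 0 <= f x) ->
  (\int[mu]_(x in D) (f x)%:E < +oo)%E -> Ig f.
Proof.
move=> mf f0 fi; apply/integrableP; split; first exact/measurable_EFinP.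
rewrite (_ : (\int[mu]_(x in D) _)%E = (\int[mu]_(x in D) (f x)%:E)%E)//.
by apply: eq_integral => x /[!inE] Dx /=; rewrite ger0_norm ?f0.
Qed.

Lemma Ig_fin f : Ig f -> (\int[mu]_(x in D) (f x)%:E)%E = (\int[mu]_(x in D) f x)%:E.
Proof. by move=> If; rewrite fineK//; exact: integrable_fin_num. Qed.

Lemma IgM_bounded f g (M : R) : Ig f -> measurable_fun D g ->
  (forall x, D x -> `|g x| <= M) -> Ig (fun x => f x * g x).
Proof.
move=> If mg gM; apply: (@Ig_le _ (fun x => M * `|f x|)).
- by apply: measurable_funM => //; exact: Ig_measurable.
- by move=> x Dx; rewrite normrM mulrC ler_wpM2r// gM.
- exact/IgZ/Ig_abs.
Qed.

Lemma Rint_zero : \int[mu]_(x in D) 0 = 0 :> R.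
Proof. by rewrite /Rintegral integral0. Qed.

Lemma Rint_opp f : Ig f -> \int[mu]_(x in D) (- f x) = - \int[mu]_(x in D) f x.
Proof.
move=> If; rewrite -[RHS]mulN1r -RintegralZl//.
by apply: eq_Rint => x _; rewrite mulN1r.
Qed.

Lemma Rint_sum (I : Type) (r : seq I) (f : I -> T -> R) : (forall i, Ig (f i)) ->
  \int[mu]_(x in D) (\sum_(i <- r) f i x) = \sum_(i <- r) \int[mu]_(x in D) f i x.
Proof.
move=> If; elim: r => [|i r IH].
  by rewrite big_nil -[RHS]Rint_zero; apply: eq_Rint => x _; rewrite big_nil.
rewrite big_cons -IH -RintegralD//; last exact: Ig_sum.
by apply: eq_Rint => x _; rewrite big_cons.
Qed.

Lemma ae_Rint f g : measurable_fun D f -> measurable_fun D g ->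
  {ae mu, forall x, D x -> f x = g x} -> \int[mu]_(x in D) f x = \int[mu]_(x in D) g x.
Proof.
move=> mf mg fg; congr fine; apply: ae_eq_integral => //; [exact/measurable_EFinP..|].
by apply: filterS fg => x h Dx /=; rewrite h.
Qed.

Lemma ae_Ig f g : measurable_fun D g ->
  {ae mu, forall x, D x -> f x = g x} -> Ig f -> Ig g.
Proof.
move=> mg fg If; have mf := Ig_measurable If; move/integrableP: If => [_ fi].
apply/integrableP; split; first exact/measurable_EFinP.
have -> : (\int[mu]_(x in D) `|(EFin \o g) x| = \int[mu]_(x in D) `|(EFin \o f) x|)%E => //.
apply: ae_eq_integral => //.
- by apply: measurableT_comp => //; exact/measurable_EFinP.
- by apply: measurableT_comp => //; exact/measurable_EFinP.
- by apply: filterS fg => x h Dx /=; rewrite h.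
Qed.

Lemma ae_le_Rint f g : Ig f -> Ig g -> {ae mu, forall x, D x -> f x <= g x} ->
  \int[mu]_(x in D) f x <= \int[mu]_(x in D) g x.
Proof.
move=> hf hg fg; have mf := Ig_measurable hf; have mg := Ig_measurable hg.
(* Replacing [g] by the maximum, which equals it almost everywhere, makes the inequality hold at
   every point. *)
pose h x := Num.max (f x) (g x).
have mh : measurable_fun D h by exact: measurable_maxr.
have E : {ae mu, forall x, D x -> g x = h x}.
  by apply: filterS fg => x H Dx; rewrite /h; move/max_idPr: (H Dx).
rewrite (ae_Rint mg mh E); apply: le_Rintegral => //; first exact: ae_Ig E hg.
by move=> x _; rewrite /h le_max lexx.
Qed.

Lemma Ig_cst (c : R) : (mu D < +oo)%E -> Ig (fun=> c).
Proof.
move=> fD; apply/integrableP; split; first exact/measurable_EFinP.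
by rewrite integral_cst//= lte_mul_pinfty.
Qed.

Lemma Ig_bounded f (M : R) : (mu D < +oo)%E -> measurable_fun D f ->
  (forall x, D x -> `|f x| <= M) -> Ig f.
Proof. by move=> fD mf fM; apply: Ig_le mf fM _; exact: Ig_cst. Qed.

Lemma Rint_Zl (c : R) f : Ig f ->
  \int[mu]_(x in D) (c * f x) = c * \int[mu]_(x in D) f x.
Proof. by move=> If; exact: RintegralZl. Qed.

Lemma cvg_Rint_dominated (f_ : nat -> T -> R) f g :
  (forall n, measurable_fun D (f_ n)) -> measurable_fun D f ->
  {ae mu, forall x, D x -> f_ n x @[n --> \oo] --> f x} ->
  Ig g -> {ae mu, forall x, forall n, D x -> `|f_ n x| <= g x} ->
  \int[mu]_(x in D) f_ n x @[n --> \oo] --> \int[mu]_(x in D) f x.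
Proof.
move=> mf_ mf cf hg fg; apply: fine_cvg.
have h1 n : measurable_fun D (EFin \o f_ n) by exact/measurable_EFinP.
have h2 : measurable_fun D (EFin \o f) by exact/measurable_EFinP.
have h3 : {ae mu, forall x, D x -> (EFin \o f_ n) x @[n --> \oo] --> (EFin \o f) x}.
  apply: filterS cf => x H Dx; apply: cvg_EFin; first exact: nearW.
  exact: H.
have h4 : {ae mu, forall x, forall n, D x -> (`|(EFin \o f_ n) x| <= (EFin \o g) x)%E}.
  by apply: filterS fg => x H n Dx /=; rewrite lee_fin H.
have [If _ H] := dominated_convergence mD h1 h2 h3 hg h4.
by rewrite -Ig_fin.
Qed.

End IntegralTools.

Section FubiniReal.
Context d1 d2 (T1 : measurableType d1) (T2 : measurableType d2) (R : realType)
  (m1 : {sigma_finite_measure set T1 -> \bar R})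
  (m2 : {sigma_finite_measure set T2 -> \bar R}).
Variables (D1 : set T1) (D2 : set T2) (mD1 : measurable D1) (mD2 : measurable D2).
Variable F : T1 * T2 -> R.
Hypothesis IF : (m1 \x m2)%E.-integrable (D1 `*` D2) (EFin \o F).

Let mD : measurable (D1 `*` D2). Proof. exact: measurableX. Qed.
Let F' : T1 * T2 -> \bar R := (EFin \o F) \_ (D1 `*` D2).
Let IF' : (m1 \x m2)%E.-integrable setT F'.
Proof. by rewrite /F' -integrable_mkcond. Qed.

Let F'E x y : F' (x, y) = (if x \in D1 then ((fun y => (F (x, y))%:E) \_ D2) y else 0)%E.
Proof.
rewrite /F' /patch in_setX /=; case: ifPn => [/andP[-> ->]//|].
by rewrite negb_and; case: ifPn => //= _; case: ifPn.
Qed.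

Let F'E2 x y : F' (x, y) = (if y \in D2 then ((fun x => (F (x, y))%:E) \_ D1) x else 0)%E.
Proof. by rewrite F'E /patch; case: ifPn => //; case: ifPn. Qed.

Let FE1 : fubini_F m2 F' = (fun x => (\int[m2]_(y in D2) (F (x, y))%:E)%E) \_ D1.
Proof.
apply/funext => x; rewrite /fubini_F /patch; case: ifPn => xD.
  rewrite [RHS]integral_mkcond; apply: eq_integral => y _.
  by rewrite F'E xD.
by rewrite integral0_eq// => y _; rewrite F'E (negbTE xD).
Qed.

Let FE2 : fubini_G m1 F' = (fun y => (\int[m1]_(x in D1) (F (x, y))%:E)%E) \_ D2.
Proof.
apply/funext => y; rewrite /fubini_G /patch; case: ifPn => yD.
  rewrite [RHS]integral_mkcond; apply: eq_integral => x _.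
  by rewrite F'E2 yD.
by rewrite integral0_eq// => x _; rewrite F'E2 (negbTE yD).
Qed.

Let I1 : m1.-integrable D1 (fun x => \int[m2]_(y in D2) (F (x, y))%:E)%E.
Proof. by apply/integrable_mkcond => //; rewrite -FE1; exact: integrable_fubini_F. Qed.

Let I2 : m2.-integrable D2 (fun y => \int[m1]_(x in D1) (F (x, y))%:E)%E.
Proof.
apply/integrable_mkcond => //; rewrite -FE2.
have mF' : measurable_fun setT F' by case/integrableP: IF'.
apply/integrableP; split; first exact: (measurable_fubini_G IF').
have hF : (\int[m2]_y \int[m1]_x `|F' (x, y)| < +oo)%E by apply/integrable21ltyP.
apply: le_lt_trans hF; apply: ge0_le_integral => //.
- by apply: measurableT_comp => //; exact: (measurable_fubini_G IF').
- apply: (@measurable_fun_fubini_tonelli_G _ _ _ _ _ m1 (fun z => `|F' z|)%E) => //.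
  exact: measurableT_comp.
- move=> y _; apply: le_abse_integral => //.
  by apply: (measurableT_comp mF'); exact: measurable_pair2.
Qed.

(** The real inner integral is 0 wherever the extended one is infinite, so its absolute value never
    exceeds that of the extended one. *)
Lemma Fubini_Ig1 : m1.-integrable D1 (EFin \o (fun x => \int[m2]_(y in D2) F (x, y))).
Proof.
apply/integrableP; have [mI fI] := integrableP _ _ _ I1; split.
  by apply/measurable_EFinP; apply: measurableT_comp mI; exact: fine_measurable.
apply: le_lt_trans fI; apply: ge0_le_integral => //.
- do 2 apply: measurableT_comp => //; apply: measurableT_comp mI; exact: fine_measurable.
- exact: measurableT_comp.
- move=> x _ /=; rewrite /Rintegral; case: (\int[m2]_(y in D2) _)%E => //= *.
  by rewrite normr0 leey.
  by rewrite normr0 leey.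
Qed.

Lemma Fubini_Ig2 : m2.-integrable D2 (EFin \o (fun y => \int[m1]_(x in D1) F (x, y))).
Proof.
apply/integrableP; have [mI fI] := integrableP _ _ _ I2; split.
  by apply/measurable_EFinP; apply: measurableT_comp mI; exact: fine_measurable.
apply: le_lt_trans fI; apply: ge0_le_integral => //.
- do 2 apply: measurableT_comp => //; apply: measurableT_comp mI; exact: fine_measurable.
- exact: measurableT_comp.
- move=> x _ /=; rewrite /Rintegral; case: (\int[m1]_(y in D1) _)%E => //= *.
  by rewrite normr0 leey.
  by rewrite normr0 leey.
Qed.

Lemma ae_Ig_slice1 : {ae m1, forall x, D1 x -> m2.-integrable D2 (EFin \o (fun y => F (x, y)))}.
Proof.
have := ae_integrable1 IF'; apply: filterS => x H Dx.
rewrite integrable_mkcond//; move: H.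
by apply: eq_integrable => // y _; rewrite F'E mem_set.
Qed.

Lemma ae_Ig_slice2 : {ae m2, forall y, D2 y -> m1.-integrable D1 (EFin \o (fun x => F (x, y)))}.
Proof.
have := ae_integrable2 IF'; apply: filterS => x H Dx.
rewrite integrable_mkcond//; move: H.
by apply: eq_integrable => // y _; rewrite F'E2 mem_set.
Qed.

Lemma Fubini_Rint1 : \int[(m1 \x m2)%E]_(z in D1 `*` D2) F z =
  \int[m1]_(x in D1) \int[m2]_(y in D2) F (x, y).
Proof.
rewrite {1}/Rintegral integral_mkcond -[X in fine X](integral12_prod_meas1 IF').
rewrite -/F' FE1 -integral_mkcond; congr fine.
apply: ae_eq_integral => //; first by case/integrableP: I1.
  by case/integrableP: Fubini_Ig1.
apply: filterS ae_Ig_slice1 => x H Dx /=.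
by rewrite -Ig_fin//; exact: H.
Qed.

Lemma Fubini_Rint2 : \int[(m1 \x m2)%E]_(z in D1 `*` D2) F z =
  \int[m2]_(y in D2) \int[m1]_(x in D1) F (x, y).
Proof.
rewrite {1}/Rintegral integral_mkcond -[X in fine X](integral21_prod_meas1 IF').
rewrite -/F' FE2 -integral_mkcond; congr fine.
apply: ae_eq_integral => //; first by case/integrableP: I2.
  by case/integrableP: Fubini_Ig2.
apply: filterS ae_Ig_slice2 => x H Dx /=.
by rewrite -Ig_fin//; exact: H.
Qed.

End FubiniReal.

(** * Averaging against a positive kernel of finite rank *)

Lemma young2 (R : realType) (a b : R) : a * b <= 2^-1 * a ^+ 2 + 2^-1 * b ^+ 2.
Proof. by have := sqr_ge0 (a - b); rewrite sqrrB; lra. Qed.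

Lemma half_double (R : realType) (a : R) : 2^-1 * a + 2^-1 * a = a.
Proof. by field. Qed.

Lemma absorb_le (R : realType) (a b z : R) : 2 * a <= b + z -> z <= a -> a <= b.
Proof. by lra. Qed.

Section PositiveKernel.
Context d (T : measurableType d) (R : realType) (mu : {measure set T -> \bar R}).
Variables (D : set T) (mD : measurable D) (fD : (mu D < +oo)%E).
Variables (M : finType) (w : R) (e : M -> T -> R).
Hypotheses (w0 : 0 <= w) (me : forall m, measurable_fun D (e m))
  (e1 : forall m x, `|e m x| <= 1).
(** An abstract Fejer kernel, instantiated on the circle and on the torus. Positivity and unit mass
    give contraction; the finite rank turns integrals against means into finite sums over modes. The
    modes may be repeated and need not be orthogonal. *)
Definition kern x y := w * \sum_m e m x * e m y.
Hypotheses (k0 : forall x y, 0 <= kern x y)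
  (k1 : forall x, \int[mu]_(y in D) kern x y = 1).
Local Notation Ig f := (mu.-integrable D (EFin \o f)).
Implicit Types f g : T -> R.

Definition coef m f : R := \int[mu]_(y in D) (f y * e m y).
Definition av f x : R := \int[mu]_(y in D) (kern x y * f y).

Lemma Ig_mul_mode m f : Ig f -> Ig (fun y => f y * e m y).
Proof. by move=> hf; apply: (IgM_bounded mD hf (M := 1)) => // y _; exact: e1. Qed.

Lemma Ig_mode m : Ig (e m).
Proof. exact: (Ig_bounded mD fD (me m) (fun x _ => e1 m x)). Qed.

Lemma Ig_span (c : M -> R) : Ig (fun x => w * \sum_m c m * e m x).
Proof. by apply: IgZ => //; apply: Ig_sum => // m; apply: IgZ => //; exact: Ig_mode. Qed.

Lemma Ig_kern x : Ig (kern x).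
Proof. exact: Ig_span. Qed.

Lemma kern_mulE f x : (fun y => kern x y * f y) =
  (fun y => w * \sum_m e m x * (f y * e m y)).
Proof.
apply/funext => y; rewrite /kern -mulrA; congr (_ * _); rewrite mulr_suml.
by apply: eq_bigr => m _; ring.
Qed.

Lemma Ig_kernM f x : Ig f -> Ig (fun y => kern x y * f y).
Proof.
move=> hf; rewrite kern_mulE; apply: IgZ => //; apply: Ig_sum => // m; apply: IgZ => //.
exact: Ig_mul_mode.
Qed.

Lemma avE f x : Ig f -> av f x = w * \sum_m coef m f * e m x.
Proof.
move=> hf; rewrite /av kern_mulE Rint_Zl ?Rint_sum//.
- congr (_ * _); apply: eq_bigr => m _; rewrite Rint_Zl//; first exact: mulrC.
  exact: Ig_mul_mode.
- by move=> m; apply: IgZ => //; exact: Ig_mul_mode.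
- by apply: Ig_sum => // m; apply: IgZ => //; exact: Ig_mul_mode.
Qed.

Lemma Ig_av f : Ig f -> Ig (av f).
Proof.
move=> hf; apply: (eq_Ig mD _ (Ig_span (fun m => coef m f))) => x _.
by rewrite avE.
Qed.

Lemma avB f g x : Ig f -> Ig g -> av (fun y => f y - g y) x = av f x - av g x.
Proof.
move=> hf hg; rewrite /av -RintegralB//; try exact: Ig_kernM.
by apply: eq_Rint => y _; rewrite mulrBr.
Qed.

Lemma av_cst (c : R) z : av (fun=> c) z = c.
Proof.
rewrite /av (_ : (fun y => kern z y * c) = (fun y => c * kern z y)).
  by rewrite Rint_Zl ?k1 ?mulr1//; exact: Ig_kern.
by apply/funext => y; rewrite mulrC.
Qed.

Lemma le_av f g x : Ig f -> Ig g -> (forall y, D y -> f y <= g y) -> av f x <= av g x.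
Proof.
move=> hf hg fg; apply: le_Rintegral => //; try exact: Ig_kernM.
by move=> y Dy; rewrite ler_wpM2l// fg.
Qed.

Lemma abs_av_le f x : Ig f -> `|av f x| <= av (fun y => `|f y|) x.
Proof.
move=> hf; apply: (le_trans (le_normr_Rintegral mD (Ig_kernM x hf))).
rewrite le_eqVlt; apply/orP; left; apply/eqP; apply: eq_Rint => y _.
by rewrite normrM (ger0_norm (k0 _ _)).
Qed.

Lemma Rint_span_mul (c : M -> R) f : Ig f ->
  \int[mu]_(x in D) (f x * (w * \sum_m c m * e m x)) = w * \sum_m c m * coef m f.
Proof.
move=> hf; rewrite (_ : (fun _ => _) = (fun x => w * \sum_m c m * (f x * e m x))); last first.
  apply/funext => x; rewrite mulrCA; congr (_ * _); rewrite mulr_sumr.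
  by apply: eq_bigr => m _; rewrite mulrCA.
rewrite Rint_Zl ?Rint_sum//.
- congr (_ * _); apply: eq_bigr => m _; rewrite Rint_Zl//; exact: Ig_mul_mode.
- by move=> m; apply: IgZ => //; exact: Ig_mul_mode.
- by apply: Ig_sum => // m; apply: IgZ => //; exact: Ig_mul_mode.
Qed.

Lemma Rint_mul_av f g : Ig f -> Ig g ->
  \int[mu]_(x in D) (f x * av g x) = w * \sum_m coef m g * coef m f.
Proof.
move=> hf hg; rewrite -Rint_span_mul//.
by apply: eq_Rint => x _; rewrite avE.
Qed.

Lemma Ig_mul_av f g : Ig f -> Ig g -> Ig (fun x => f x * av g x).
Proof.
move=> hf hg; apply: (eq_Ig mD (f := fun x => w * \sum_m coef m g * (f x * e m x))).
  move=> x _; rewrite avE// mulrCA; congr (_ * _); rewrite mulr_sumr.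
  by apply: eq_bigr => m _; rewrite mulrCA.
by apply: IgZ => //; apply: Ig_sum => // m; apply: IgZ => //; exact: Ig_mul_mode.
Qed.

(** By [Rint_mul_av] the pairing of one function with the mean of another is symmetric, and the mean
    of the constant 1 is 1. *)
Lemma Rint_av f : Ig f -> \int[mu]_(x in D) av f x = \int[mu]_(x in D) f x.
Proof.
move=> hf; have h1 : Ig (fun=> 1) by exact: Ig_cst.
transitivity (\int[mu]_(x in D) (1 * av f x)).
  by apply: eq_Rint => x _; rewrite mul1r.
rewrite Rint_mul_av// (eq_bigr (fun m => coef m (fun=> 1) * coef m f)); last first.
  by move=> m _; exact: mulrC.
rewrite -Rint_mul_av//; apply: eq_Rint => x _.
by rewrite av_cst ?mulr1.
Qed.

Lemma av_contraction f : Ig f ->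
  \int[mu]_(x in D) `|av f x| <= \int[mu]_(x in D) `|f x|.
Proof.
move=> hf; rewrite -(Rint_av (Ig_abs hf)); apply: le_Rintegral => //.
- exact/Ig_abs/Ig_av.
- exact/Ig_av/Ig_abs.
- by move=> x _; exact: abs_av_le.
Qed.

(** Split [f - av g] as [(f - av f) + av (f - g)] and use the L^1 contraction. *)
Lemma dist_av_le f g : Ig f -> Ig g ->
  \int[mu]_(x in D) `|f x - av g x| <=
  \int[mu]_(x in D) `|f x - av f x| + \int[mu]_(x in D) `|f x - g x|.
Proof.
move=> hf hg; have hd := IgB mD hf hg.
have h1 : Ig (fun x => `|f x - av f x|) by apply: Ig_abs; apply: IgB => //; exact: Ig_av.
have h2 := Ig_abs (Ig_av hd).
apply: (@le_trans _ _ (\int[mu]_(x in D) (`|f x - av f x| + `|av (fun x => f x - g x) x|))).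
  apply: le_Rintegral => //; [apply: Ig_abs; apply: IgB => //; exact: Ig_av|exact: IgD|].
  move=> x _; rewrite avB//.
  by rewrite (le_trans _ (ler_normD _ _))// addrA subrK.
by rewrite RintegralD// lerD2l; exact: av_contraction.
Qed.

(** A Young-type inequality in separated variables survives averaging in [y], because averaging
    preserves the integral of [psi] and leaves [phi x] alone. This yields bounds that do not depend
    on the kernel. *)
Lemma Rint_mul_av_le f g phi psi : Ig f -> Ig g -> Ig phi -> Ig psi ->
  (forall x y, D x -> D y -> `|f x * g y| <= phi x + psi y) ->
  \int[mu]_(x in D) `|f x * av g x| <= \int[mu]_(x in D) phi x + \int[mu]_(x in D) psi x.
Proof.
move=> hf hg hphi hpsi H; rewrite -(Rint_av hpsi) -RintegralD//; last exact: Ig_av.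
apply: le_Rintegral => //; [exact/Ig_abs/Ig_mul_av|by apply: IgD => //; exact: Ig_av|].
move=> x Dx; rewrite normrM.
apply: (@le_trans _ _ (`|f x| * av (fun y => `|g y|) x)).
  by rewrite ler_wpM2l//; exact: abs_av_le.
have hz := Ig_abs hg.
have -> : `|f x| * av (fun y => `|g y|) x = av (fun y => `|f x| * `|g y|) x.
  rewrite /av -Rint_Zl//; last exact: Ig_kernM.
  by apply: eq_Rint => y _; rewrite mulrCA.
rewrite -[X in _ <= X + _](av_cst (phi x) x).
have -> : av (fun=> phi x) x + av psi x = av (fun y => phi x + psi y) x.
  rewrite /av -RintegralD//; try by apply: Ig_kernM => //; exact: Ig_cst.
  by apply: eq_Rint => y _; rewrite mulrDr.
apply: le_av; first exact: IgZ.
- by apply: IgD => //; exact: Ig_cst.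
- by move=> y Dy; rewrite -normrM; exact: H.
Qed.

(** Bessel's inequality: the left-hand side is the integral of [f] times its mean, to which
    [Rint_mul_av_le] applies with half squares. *)
Lemma sum_coef_sqr_le f : Ig f -> Ig (fun x => f x ^+ 2) ->
  w * \sum_m coef m f ^+ 2 <= \int[mu]_(x in D) f x ^+ 2.
Proof.
move=> hf hf2.
have h : Ig (fun x => 2^-1 * f x ^+ 2) by exact: IgZ.
have H x y : D x -> D y -> `|f x * f y| <= 2^-1 * f x ^+ 2 + 2^-1 * f y ^+ 2.
  move=> _ _; rewrite normrM -(real_normK (num_real (f x))) -(real_normK (num_real (f y))).
  exact: young2.
have := Rint_mul_av_le hf hf h h H; rewrite !Rint_Zl// => H1.
under eq_bigr do rewrite expr2.
rewrite -Rint_mul_av//; apply: (le_trans (ler_norm _)).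
apply: (le_trans (le_normr_Rintegral mD (Ig_mul_av hf hf))).
by apply: (le_trans H1); rewrite half_double.
Qed.

(* Duality with [sum_coef_sqr_le] replaces the orthogonality of the modes. *)
Lemma span_sqr_le (c : M -> R) :
  \int[mu]_(x in D) (w * \sum_m c m * e m x) ^+ 2 <= w * \sum_m c m ^+ 2.
Proof.
set psi := fun x => w * \sum_m c m * e m x.
have hp : Ig psi by exact: Ig_span.
have hp2 : Ig (fun x => psi x ^+ 2).
  apply: (eq_Ig mD (f := fun x => psi x * psi x)) => [x _|]; first by rewrite expr2.
  apply: (IgM_bounded mD hp (M := w * \sum_m `|c m|)); first exact: Ig_measurable hp.
  move=> x _; rewrite /psi normrM ger0_norm// ler_wpM2l//.
  apply: (le_trans (ler_norm_sum _ _ _)); apply: ler_sum => m _.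
  by rewrite normrM ler_piMr.
have E : \int[mu]_(x in D) psi x ^+ 2 = w * \sum_m c m * coef m psi.
  by rewrite -Rint_span_mul//; apply: eq_Rint => x _; rewrite expr2.
have := sum_coef_sqr_le hp hp2; rewrite E.
suff : w * \sum_m (2 * (c m * coef m psi)) <= w * \sum_m (c m ^+ 2 + coef m psi ^+ 2).
  rewrite big_split /= -mulr_sumr mulrDr mulrCA => h1 h2.
  exact: absorb_le h1 h2.
rewrite ler_wpM2l//; apply: ler_sum => m _.
have := young2 (c m) (coef m psi); rewrite -mulrDr => h.
by rewrite -ler_pdivlMl.
Qed.

End PositiveKernel.

(** * Trigonometric modes and the Fejer kernel on the circle *)

Section Modes1.
Context {R : realType}.

Definition mode1 (N : nat) : Type := ('I_N.+1 * 'I_N.+1 * bool)%type.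
HB.instance Definition _ N := Finite.on (mode1 N).

(* The frequency of the mode (k, l, s) is k - l, so that summing over all modes with equal weights produces the Fejer kernel. *)
Definition om N (m : mode1 N) : R := 2 * pi * (m.1.1%:R - m.1.2%:R).
Definition tr1 N (m : mode1 N) (x : R) : R := if m.2 then sin (om m * x) else cos (om m * x).
(** Differentiation exchanges sine and cosine; [flip1] records the exchange and [sg1] the signed
    frequency, so that the derivative of [tr1 m] is [- sg1 m] times [tr1 (flip1 m)]. *)
Definition flip1 N (m : mode1 N) : mode1 N := (m.1, ~~ m.2).
Definition sg1 N (m : mode1 N) : R := if m.2 then - om m else om m.

Definition fejer N (x y : R) : R := N.+1%:R^-1 * \sum_(m : mode1 N) tr1 m x * tr1 m y.

Lemma flip1K N : involutive (@flip1 N).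
Proof. by move=> [m s]; rewrite /flip1 /= negbK. Qed.

Lemma om_flip1 N (m : mode1 N) : om (flip1 m) = om m.
Proof. by []. Qed.

Lemma sg1_flip1 N (m : mode1 N) : sg1 (flip1 m) = - sg1 m.
Proof. by case: m => m []; rewrite /sg1 /= ?opprK. Qed.

Lemma sqr_sg1 N (m : mode1 N) : sg1 m ^+ 2 = om m ^+ 2.
Proof. by rewrite /sg1; case: ifP; rewrite ?sqrrN. Qed.

Lemma is_derive_tr1 N (m : mode1 N) (x : R) :
  is_derive x (1 : R) (tr1 m) (- sg1 m * tr1 (flip1 m) x).
Proof.
have dl : is_derive x (1 : R) (fun y : R => om m * y) (om m).
  have := is_deriveZ (om m) (is_derive_id x (1 : R)).
  by rewrite /GRing.scale /= mulr1.
case: m dl => m [] dl; rewrite /tr1 /sg1 /=.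
- have := is_derive1_comp (is_derive_sin _) dl.
  by rewrite opprK mulrC.
- have := is_derive1_comp (is_derive_cos _) dl.
  by rewrite mulNr mulrC mulNr.
Qed.

Lemma continuous_tr1 N (m : mode1 N) : continuous (tr1 m).
Proof.
move=> x; apply: differentiable_continuous; apply/derivable1_diffP.
by have [] := is_derive_tr1 m x.
Qed.

Lemma abs_tr1_le1 N (m : mode1 N) x : `|tr1 m x| <= 1.
Proof. by rewrite /tr1; case: ifP => _; rewrite ler_norml ?sin_geN1 ?sin_le1 ?cos_geN1 ?cos_le1. Qed.

Lemma cos_sin_natpi (k : nat) : cos (2 * pi * k%:R : R) = 1 /\ sin (2 * pi * k%:R : R) = 0.
Proof.
elim: k => [|k [IH1 IH2]]; first by rewrite mulr0 cos0 sin0.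
rewrite -(natr1 k) mulrDr mulr1 cosD sinD IH1 IH2.
by rewrite mulr_natl cos2pi sin2pi; split; ring.
Qed.

Lemma cos_sin_om N (m : mode1 N) : cos (om m) = 1 /\ sin (om m) = 0.
Proof.
have [c1 s1] := cos_sin_natpi m.1.1; have [c2 s2] := cos_sin_natpi m.1.2.
by rewrite /om mulrBr cosB sinB c1 s1 c2 s2; split; ring.
Qed.

Lemma tr1_periodic N (m : mode1 N) x : tr1 m (x + 1) = tr1 m x.
Proof.
have [c s] := cos_sin_om m.
by rewrite /tr1 mulrDr mulr1 cosD sinD c s; case: ifP => _; ring.
Qed.

Lemma sum_mode1 N (F : mode1 N -> R) :
  \sum_m F m = \sum_(k < N.+1) \sum_(l < N.+1) (F (k, l, false) + F (k, l, true)).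
Proof.
rewrite pair_bigA /=.
rewrite [LHS](_ : _ = \sum_(kl : 'I_N.+1 * 'I_N.+1) \sum_(s : bool) F (kl, s)); last first.
  by rewrite pair_bigA /=; apply: eq_bigr => -[].
by apply: eq_bigr => -[k l] _; rewrite big_bool addrC.
Qed.

(** The double sum of cos(2 pi (k - l) (x - y)) is the squared modulus of a geometric sum of
    exponentials, whence positivity. *)
Lemma fejerE N x y : fejer N x y = N.+1%:R^-1 *
  ((\sum_(k < N.+1) cos (2 * pi * k%:R * (x - y))) ^+ 2 +
   (\sum_(k < N.+1) sin (2 * pi * k%:R * (x - y))) ^+ 2).
Proof.
rewrite /fejer; congr (_ * _); rewrite sum_mode1 !expr2 !mulr_suml -big_split /=.
apply: eq_bigr => k _; rewrite !mulr_sumr -big_split /=; apply: eq_bigr => l _.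
by rewrite /tr1 /= -cosB -cosB /om /=; congr cos; ring.
Qed.

Lemma fejer_ge0 N x y : 0 <= fejer N x y.
Proof. by rewrite fejerE mulr_ge0 ?invr_ge0// addr_ge0// sqr_ge0. Qed.

Lemma fejerC N x y : fejer N x y = fejer N y x.
Proof. by rewrite /fejer; congr (_ * _); apply: eq_bigr => m _; rewrite mulrC. Qed.

Lemma dirichlet_sum (d : R) n :
  2 * sin (pi * d) * \sum_(k < n) cos (2 * pi * k%:R * d) =
    sin ((2 * n%:R - 1) * (pi * d)) + sin (pi * d) /\
  2 * sin (pi * d) * \sum_(k < n) sin (2 * pi * k%:R * d) =
    cos (pi * d) - cos ((2 * n%:R - 1) * (pi * d)).
Proof.
elim: n => [|n [IH1 IH2]].
  by rewrite !big_ord0 !mulr0 sub0r mulN1r sinN cosN addNr subrr.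
have E1 : 2 * pi * n%:R * d = 2 * n%:R * (pi * d) by ring.
have E2 : (2 * n.+1%:R - 1) * (pi * d) = 2 * n%:R * (pi * d) + pi * d.
  by rewrite -(natr1 n); ring.
have E3 : (2 * n%:R - 1) * (pi * d) = 2 * n%:R * (pi * d) - pi * d by ring.
by split; rewrite big_ord_recr /= mulrDr ?IH1 ?IH2 E1 E2 E3 ?sinD ?cosD ?sinN ?cosN; ring.
Qed.

(** The telescoped sums of [dirichlet_sum] are at most 2 in absolute value, so the kernel
    concentrates where the sine vanishes, that is at integer values of [x - y]. *)
Lemma fejer_tail N x y : fejer N x y * sin (pi * (x - y)) ^+ 2 <= 2 / N.+1%:R.
Proof.
rewrite fejerE; set d := x - y.
have [h1 h2] := dirichlet_sum d N.+1; move: h1 h2.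
set A := \sum_(k < _) _; set B := \sum_(k < _) _; set s := sin (pi * d) => h1 h2.
have bd (a b : R) : `|a| <= 1 -> `|b| <= 1 -> (a + b) ^+ 2 <= 4.
  rewrite !ler_norml => /andP[? ?] /andP[? ?].
  have : `|a + b| <= 2 by rewrite ler_norml; apply/andP; split; lra.
  rewrite -ler_sqr ?nnegrE// real_normK ?num_real// => /le_trans; apply.
  by lra.
have bs (z : R) : `|sin z| <= 1 by rewrite ler_norml sin_geN1 sin_le1.
have bc (z : R) : `|cos z| <= 1 by rewrite ler_norml cos_geN1 cos_le1.
have k1 : (2 * s * A) ^+ 2 <= 4 by rewrite h1; apply: bd; [exact: bs|exact: bs].
have k2 : (2 * s * B) ^+ 2 <= 4 by rewrite h2; apply: bd; [exact: bc|rewrite normrN; exact: bc].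
have -> : N.+1%:R^-1 * (A ^+ 2 + B ^+ 2) * s ^+ 2 =
  (((2 * s * A) ^+ 2 + (2 * s * B) ^+ 2) / 4) * N.+1%:R^-1 by field.
rewrite ler_wpM2r ?invr_ge0//; clear -k1 k2; lra.
Qed.

Local Notation mu := (@lebesgue_measure R).
Definition I01 : set (measurableTypeR R) := `[0%R, 1%R[%classic.

Lemma measurable_I01 : measurable I01. Proof. exact: measurable_itv. Qed.

Lemma mu_I01 : mu I01 = 1%:E.
Proof. by rewrite /I01 lebesgue_measure_itv /= lte_fin ltr01 sube0. Qed.

Lemma fin_I01 : (mu I01 < +oo)%E. Proof. by rewrite mu_I01 ltry. Qed.

Lemma Ig_I01_bounded (f : R -> R) (M : R) : measurable_fun I01 f ->
  (forall x, I01 x -> `|f x| <= M) -> mu.-integrable I01 (EFin \o f).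
Proof.
have fin : (mu I01 < +oo)%E by rewrite mu_I01 ltry.
exact: (Ig_bounded measurable_I01 fin).
Qed.

Lemma measurable_tr1 N (m : mode1 N) (D : set (measurableTypeR R)) : measurable_fun D (tr1 m).
Proof.
apply: measurable_funTS; apply: continuous_measurable_fun; exact: continuous_tr1.
Qed.

Lemma Ig_tr1 N (m : mode1 N) : mu.-integrable I01 (EFin \o tr1 m).
Proof.
by apply: (@Ig_I01_bounded _ 1) => [|x _]; [exact: measurable_tr1|exact: abs_tr1_le1].
Qed.

Lemma Rint_cst1 (c : R) : \int[mu]_(x in I01) c = c.
Proof.
rewrite Rintegral_cst; last exact: measurable_I01.
by rewrite [X in fine X]mu_I01 /= mulr1.
Qed.

Lemma Rint_derive (f F : R -> R) : continuous f ->
  (forall x : R, is_derive x (1 : R) F (f x)) ->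
  \int[mu]_(x in I01) f x = F 1 - F 0.
Proof.
move=> cf dF.
have cF : continuous F.
  by move=> x; apply: differentiable_continuous; apply/derivable1_diffP; have [] := dF x.
rewrite /I01 /Rintegral integral_itv_bndo_bndc; last first.
  by apply/measurable_EFinP; apply: measurable_funTS; exact: continuous_measurable_fun.
rewrite (@continuous_FTC2 R f F)//.
- exact: continuous_subspaceT.
- split.
  + by move=> x _; have [] := dF x.
  + exact/cvg_at_right_filter/cF.
  + exact/cvg_at_left_filter/cF.
- by move=> x _; rewrite derive1E; have [] := dF x.
Qed.

Lemma Rint_tr1 N (m : mode1 N) :
  \int[mu]_(x in I01) tr1 m x = if om m == 0 then (~~ m.2)%:R else 0.
Proof.
have [w0|w0] := eqVneq (om m) 0.
  rewrite -[RHS]Rint_cst1; apply: eq_Rint => x _.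
  by rewrite /tr1 w0 mul0r; case: ifP => _; rewrite ?sin0 ?cos0.
have s0 : - sg1 (flip1 m) != 0.
  by rewrite -sqrf_eq0 sqrrN sqr_sg1 sqrf_eq0.
pose F x := (- sg1 (flip1 m))^-1 * tr1 (flip1 m) x.
have dF x : is_derive x (1 : R) F (tr1 m x).
  have := is_deriveZ (- sg1 (flip1 m))^-1 (is_derive_tr1 (flip1 m) x).
  by rewrite flip1K /GRing.scale /= mulrA mulVf// mul1r.
rewrite (Rint_derive (@continuous_tr1 _ m) dF) /F.
by rewrite -[in tr1 _ 1](add0r 1) tr1_periodic subrr.
Qed.

Lemma Rint_fejer N x : \int[mu]_(y in I01) fejer N x y = 1.
Proof.
rewrite /fejer Rint_Zl ?Rint_sum; try exact: measurable_I01; last 2 first.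
- by move=> m; apply: IgZ; [exact: measurable_I01|exact: Ig_tr1].
- by apply: Ig_sum => [|m]; [exact: measurable_I01|
    apply: IgZ; [exact: measurable_I01|exact: Ig_tr1]].
rewrite (eq_bigr (fun m => tr1 m x * (if om m == 0 then (~~ m.2)%:R else 0))); last first.
  move=> m _; rewrite Rint_Zl ?Rint_tr1//; [exact: measurable_I01|exact: Ig_tr1].
(* Only the cosines with [k = l] have a nonzero integral; there are [N.+1] of them and each
   contributes 1. *)
rewrite sum_mode1 (eq_bigr (fun=> 1)); last first.
  move=> k _; rewrite (bigD1 k)//= big1 ?addr0.
    by rewrite /om /= subrr mulr0 eqxx mulr0 addr0 mulr1 /tr1 /om /= subrr mulr0 mul0r cos0.
  move=> l lk; have -> : om (k, l, false) == 0 = false.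
    apply/negbTE; rewrite /om /= mulf_neq0 ?subr_eq0 ?eqr_nat 1?eq_sym//.
    by rewrite lt_eqF// mulr_gt0// pi_gt0.
  by rewrite !mulr0 addr0.
by rewrite sumr_const card_ord mulVf// pnatr_eq0.
Qed.

End Modes1.

(** * Convergence of Fejer means in one variable *)

Lemma quarters_le (R : realType) (e a b c : R) :
  0 < e -> a <= e / 4 -> b <= e / 4 -> c <= a + b -> b + c <= e.
Proof. by move=> *; lra. Qed.

Lemma mul4_le (R : realType) (C a b : R) : 4 * C < a -> a <= b -> C * 2 * 2 <= b.
Proof. by move=> *; lra. Qed.

Section FejerMean1.
Context {R : realType}.
Local Notation mu := (@lebesgue_measure R).
Local Notation I01 := (@I01 R).
Local Notation Ig f := (mu.-integrable I01 (EFin \o f)).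
Let mI : measurable I01 := @measurable_I01 R.
Let fI : (mu I01 < +oo)%E := @fin_I01 R.
Implicit Types f g : R -> R.
Let me N (m : mode1 N) : measurable_fun I01 (tr1 m). Proof. exact: measurable_tr1. Qed.
Let e1 N (m : mode1 N) x : `|@tr1 R N m x| <= 1. Proof. exact: abs_tr1_le1. Qed.
Let k0 N x y : 0 <= kern N.+1%:R^-1 (@tr1 R N) x y. Proof. exact: fejer_ge0. Qed.
Let k1 N x : \int[mu]_(y in I01) kern N.+1%:R^-1 (@tr1 R N) x y = 1.
Proof. exact: Rint_fejer. Qed.

Definition sm1 N f : R -> R := av mu I01 N.+1%:R^-1 (@tr1 R N) f.

Lemma Ig_fejer N x : Ig (fejer N x). Proof. exact: (Ig_kern mI fI _ (@me N) (@e1 N)). Qed.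
Lemma Ig_fejerM N f x : Ig f -> Ig (fun y => fejer N x y * f y).
Proof. exact: (Ig_kernM mI _ (@me N) (@e1 N)). Qed.
Lemma Ig_sm1 N f : Ig f -> Ig (sm1 N f). Proof. exact: Ig_av. Qed.
Let hfejer := Ig_fejer.
Let hsm1 := Ig_sm1.

(** Near [x] continuity gives [e]. Away from [x] the sine is bounded below, as [x] is interior to
    the cell, and a large multiple of its square dominates the oscillation. The form is chosen to
    match [fejer_tail]. *)
Lemma osc_le_sin (g : R -> R) (x e : R) : continuous g -> 0 < x < 1 -> 0 < e ->
  exists2 C : R, 0 < C & forall y : R, 0 <= y < 1 ->
    `|g y - g x| <= e + C * sin (pi * (x - y)) ^+ 2.
Proof.
move=> cg /andP[x0 x1] e0.
have /cvgr_distC_lt /(_ e e0) := cg x.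
rewrite near_nbhs => /nbhs_normP[d /= d0 Hd].
(* For [y] in [0, 1[ the distance [|x - y|] is at most [L < 1], so the far points have [|x - y|] in
   [d', L], where sin(pi t) has a positive minimum. *)
pose L := Num.max x (1 - x); pose d' := Num.min d L.
have L0 : 0 < L by rewrite /L lt_max x0.
have L1 : L < 1 by rewrite /L gt_max x1 /= ltrBlDr ltrDl.
have d'0 : 0 < d' by rewrite /d' lt_min d0.
have d'L : d' <= L by rewrite /d' ge_min lexx orbT.
have [c cI Hc] : exists2 c, c \in `[d', L]%R &
    forall t, t \in `[d', L]%R -> sin (pi * c) <= sin (pi * t).
  apply: (@EVT_min R (fun t => sin (pi * t))) => //.
  apply: continuous_subspaceT => t; apply: continuous_comp; last exact: continuous_sin.
  by apply: cvgM; [exact: cvg_cst|exact: cvg_id].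
move: cI; rewrite in_itv /= => /andP[c1 c2].
have s0 : 0 < sin (pi * c).
  apply: sin_gt0_pi; apply/andP; split.
    by apply: mulr_gt0; [exact: pi_gt0|exact: lt_le_trans c1].
  by rewrite gtr_pMr ?pi_gt0// (le_lt_trans c2).
have [M [_ HM]] : bounded_set (g @` `[0, 1]).
  apply: compact_bounded; apply: continuous_compact; last exact: segment_compact.
  exact: continuous_subspaceT.
pose M' := `|M| + 1.
have M'0 : 0 < M' by rewrite /M' ltr_wpDl.
have {}HM y : 0 <= y <= 1 -> `|g y| <= M'.
  move=> y01; apply: (HM M'); last by exists y => //=; rewrite in_itv.
  by rewrite /M' (le_lt_trans (ler_norm _))// ltrDl.
exists (2 * M' / sin (pi * c) ^+ 2) => [|y /andP[y0 y1]].
  by rewrite divr_gt0 ?mulr_gt0// exprn_gt0.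
have [xy|xy] := ltP `|x - y| d'.
  rewrite (@le_trans _ _ e)//; last first.
    by rewrite lerDl mulr_ge0 ?sqr_ge0// divr_ge0 ?sqr_ge0// mulr_ge0// ltW.
  by apply: ltW; apply: Hd; rewrite /ball_ /= (lt_le_trans xy)// ge_min lexx.
apply: (@le_trans _ _ (2 * M' / sin (pi * c) ^+ 2 * sin (pi * (x - y)) ^+ 2)); last first.
  by rewrite lerDr ltW.
apply: (@le_trans _ _ (2 * M')).
  rewrite (le_trans (ler_normB _ _))// mulr_natl mulr2n lerD ?HM//.
    by rewrite y0 ltW.
  by rewrite !ltW.
rewrite mulrAC ler_pdivlMr ?exprn_gt0// ler_wpM2l ?mulr_ge0 ?(ltW M'0)//.
have -> : sin (pi * (x - y)) ^+ 2 = sin (pi * `|x - y|) ^+ 2.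
  by case: (ger0P (x - y)) => _ //; rewrite mulrN sinN sqrrN.
rewrite ler_sqr ?nnegrE ?(ltW s0)//.
  apply: Hc; rewrite in_itv /= xy /= /L le_max.
  by case: (ger0P (x - y)) => h; apply/orP; [left|right]; lra.
rewrite (le_trans (ltW s0))//; apply: Hc.
rewrite in_itv /= xy /= /L le_max.
by case: (ger0P (x - y)) => h; apply/orP; [left|right]; lra.
Qed.

(** The point must be interior because [g] need not be periodic: at an end point the mean would see
    the values at both ends. *)
Lemma cvg_sm1_continuous g x : continuous g -> 0 < x < 1 ->
  sm1 N g x @[N --> \oo] --> g x.
Proof.
move=> cg x01; apply/cvgrPdist_le => e e0.
have e20 : 0 < e / 2 by rewrite divr_gt0.
have [C C0 HC] := osc_le_sin cg x01 e20.
have hg : Ig g.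
  have [M [_ HM]] : bounded_set (g @` `[0, 1]).
    apply: compact_bounded; apply: continuous_compact; last exact: segment_compact.
    exact: continuous_subspaceT.
  apply: (@Ig_I01_bounded _ _ (`|M| + 1)).
    by apply: measurable_funTS; exact: continuous_measurable_fun.
  move=> y; rewrite /I01 /= in_itv /= => /andP[y0 y1]; apply: HM.
    by rewrite (le_lt_trans (ler_norm _))// ltrDl.
  by exists y => //=; rewrite in_itv /= y0 ltW.
near=> N.
have ms : measurable_fun I01 (fun y : R => sin (pi * (x - y)) ^+ 2).
  apply: measurable_funTS; apply: continuous_measurable_fun => y.
  apply: (@continuous_comp _ _ _ (fun y => sin (pi * (x - y))) (fun z : R => z ^+ 2));
    last exact: exprn_continuous.
  apply: (@continuous_comp _ _ _ (fun y => pi * (x - y)) (@sin R)); last exact: continuous_sin.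
  by apply: cvgM; [exact: cvg_cst|apply: cvgB; [exact: cvg_cst|exact: cvg_id]].
have hc (c : R) : Ig (fun=> c) by exact: Ig_cst.
have -> : g x - sm1 N g x = \int[mu]_(y in I01) (fejer N x y * (g x - g y)).
  rewrite /sm1 /av -[in LHS](mulr1 (g x)) -[X in _ * X - _](Rint_fejer N x) -Rint_Zl//.
  rewrite -RintegralB//; last 2 first.
  - by have := Ig_fejerM N x (hc (g x)); apply: eq_Ig => // y _; rewrite mulrC.
  - exact: Ig_fejerM.
  by apply: eq_Rint => y _; rewrite mulrBr (mulrC (g x)).
have h1 : Ig (fun y => fejer N x y * (g x - g y)).
  by apply: Ig_fejerM; apply: IgB.
have h2 : Ig (fun y => e / 2 * fejer N x y).
  by apply: IgZ => //; exact: Ig_fejer.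
have h3 : Ig (fun y => C * (2 / N.+1%:R)) by exact: hc.
apply: (le_trans (le_normr_Rintegral mI h1)).
apply: (@le_trans _ _ (\int[mu]_(y in I01) (e / 2 * fejer N x y + C * (2 / N.+1%:R)))).
  apply: le_Rintegral => //; [exact: Ig_abs|exact: IgD|].
  move=> y; rewrite /I01 /= in_itv /= => y01.
  rewrite normrM ger0_norm ?fejer_ge0// distrC.
  apply: (le_trans (ler_wpM2l (fejer_ge0 N x y) (HC y y01))).
  rewrite mulrDr mulrC lerD2l mulrCA ler_wpM2l ?(ltW C0)//.
  exact: fejer_tail.
rewrite RintegralD// (Rint_Zl mI (e / 2) (Ig_fejer N x)) Rint_fejer.
rewrite Rint_cst1 mulr1.
have H : (4 * C / e) < N%:R by near: N; exact: nbhs_infty_gtr.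
have : C * (2 / N.+1%:R) <= e / 2.
  rewrite mulrA ler_pdivrMr// mulrAC ler_pdivlMr//.
  move: H; rewrite ltr_pdivrMr// (mulrC _ e) => H.
  have : e * N%:R <= e * N.+1%:R by rewrite ler_pM2l// ler_nat.
  exact: mul4_le H.
by move=> h; rewrite [leRHS](splitr e) lerD2l.
Unshelve. all: by end_near.
Qed.

(** Density of continuous functions in L^1 together with [dist_av_le], which transfers convergence
    from the approximation to [f]. *)
Lemma cvg_L1_sm1 f : Ig f ->
  \int[mu]_(x in I01) `|f x - sm1 N f x| @[N --> \oo] --> (0 : R).
Proof.
move=> hf; apply/cvgrPdist_le => e e0.
have e40 : 0 < e / 4 by rewrite divr_gt0.
have [g_ [cg Ig_ /fine_cvgP[_ cvg_g]]] := approximation_continuous_integrable mI fI hf.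
have {cvg_g} [n Hn] : exists n, \int[mu]_(x in I01) `|f x - g_ n x| <= e / 4.
  move/cvgrPdist_le : cvg_g => /(_ _ e40)[n _ /(_ n (leqnn n))]; rewrite sub0r normrN => H.
  by exists n; apply: (le_trans (ler_norm _)); exact: H.
pose g := g_ n; have hg : Ig g := Ig_ n; have cgn : continuous g := cg n.
have cvg_g : \int[mu]_(x in I01) `|g x - sm1 N g x| @[N --> \oo] --> (0 : R).
  have [M [_ HM]] : bounded_set (g @` `[0, 1]).
    apply: compact_bounded; apply: continuous_compact; last exact: segment_compact.
    exact: continuous_subspaceT.
  pose M' := `|M| + 1.
  have {}HM y : I01 y -> `|g y| <= M'.
    rewrite /I01 /= in_itv /= => /andP[y0 y1]; apply: HM.
      by rewrite /M' (le_lt_trans (ler_norm _))// ltrDl.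
    by exists y => //=; rewrite in_itv /= y0 ltW.
  rewrite -[X in _ --> X](Rint_zero mu I01).
  apply: (@cvg_Rint_dominated _ _ _ mu I01 mI (fun N x => `|g x - sm1 N g x|) _ (fun=> M' + M')).
  - move=> N; apply: measurableT_comp => //; apply: measurable_funB.
      exact: Ig_measurable hg.
    exact: Ig_measurable (Ig_sm1 N hg).
  - exact: measurable_cst.
  (* The only point of [0, 1[ that is not interior is the null set {0}. *)
  - exists [set 0]; split => //; first exact: lebesgue_measure_set1.
    move=> x /= /not_implyP[]; rewrite /I01 /= in_itv /= => /andP[x0 x1] H.
    apply: contrapT => xn0; apply: H.
    have x01 : 0 < x < 1 by rewrite x1 lt_neqAle x0 andbT eq_sym; apply/andP; split => //; apply/eqP.
    rewrite -(normr0 R) -(subrr (g x)).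
    by apply: cvg_norm; apply: cvgB; [exact: cvg_cst|exact: cvg_sm1_continuous].
  - exact: Ig_cst.
  - apply: aeW => x N Ix; rewrite normr_id (le_trans (ler_normB _ _))// lerD ?HM//.
    rewrite (le_trans (abs_av_le mI (@me N) (@e1 N) (@k0 N) _ hg))//.
    rewrite -[leRHS](av_cst mI fI (@me N) (@e1 N) (@k1 N) M' x).
    exact: (le_av mI (@me N) (@e1 N) (@k0 N) x (Ig_abs hg) (Ig_cst mI M' fI) HM).
move/cvgrPdist_le : cvg_g => /(_ _ e40); apply: filterS => N.
rewrite !sub0r !normrN => /(le_trans (ler_norm _)) H.
rewrite ger0_norm; last exact: Rintegral_ge0.
have hd : Ig (fun x => f x - g x) by exact: IgB.
have hs : Ig (fun x => g x - sm1 N f x) by apply: IgB => //; exact: Ig_sm1.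
apply: (@le_trans _ _ (\int[mu]_(x in I01) (`|f x - g x| + `|g x - sm1 N f x|))).
  apply: le_Rintegral => //.
  - by apply: Ig_abs; apply: IgB => //; exact: Ig_sm1.
  - by apply: IgD => //; exact: Ig_abs.
  - by move=> x _; rewrite (le_trans _ (ler_normD _ _))// addrA subrK.
rewrite RintegralD//; [|exact: Ig_abs..].
have := dist_av_le mI fI (@me N) (@e1 N) (@k0 N) (@k1 N) hg hf.
have -> : \int[mu]_(x in I01) `|g x - f x| = \int[mu]_(x in I01) `|f x - g x|.
  by apply: eq_Rint => x _; rewrite distrC.
move: H Hn; rewrite -/g -/(sm1 N f) -/(sm1 N g).
move: (\int[mu]_(x in I01) _) (\int[mu]_(x in I01) _) (\int[mu]_(x in I01) _) => a b c.
exact: quarters_le.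
Qed.

End FejerMean1.

(** * Fejer means on the two-dimensional torus *)

Section ProductIntegrable.
Context d1 d2 (T1 : measurableType d1) (T2 : measurableType d2) (R : realType)
  (m1 : {sigma_finite_measure set T1 -> \bar R})
  (m2 : {sigma_finite_measure set T2 -> \bar R}).
Variables (D1 : set T1) (D2 : set T2) (mD1 : measurable D1) (mD2 : measurable D2).

Lemma measurable_fst_fun (f : T1 -> R) : measurable_fun D1 f ->
  measurable_fun (D1 `*` D2) (fun z : T1 * T2 => f z.1).
Proof.
move=> mf; apply: (@measurable_comp _ _ _ _ _ _ D1 f) => //; last first.
  by apply: measurable_funTS; exact: measurable_fst.
by move=> _ [[x y] /= [Dx _] <-].
Qed.

Lemma measurable_snd_fun (f : T2 -> R) : measurable_fun D2 f ->
  measurable_fun (D1 `*` D2) (fun z : T1 * T2 => f z.2).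
Proof.
move=> mf; apply: (@measurable_comp _ _ _ _ _ _ D2 f) => //; last first.
  by apply: measurable_funTS; exact: measurable_snd.
by move=> _ [[x y] /= [_ Dy] <-].
Qed.

Lemma Ig_tensor (f : T1 -> R) (g : T2 -> R) :
  m1.-integrable D1 (EFin \o f) -> m2.-integrable D2 (EFin \o g) ->
  (m1 \x m2)%E.-integrable (D1 `*` D2) (EFin \o (fun z => f z.1 * g z.2)).
Proof.
move=> hf hg; have mD : measurable (D1 `*` D2) by exact: measurableX.
have mfg : measurable_fun (D1 `*` D2) (fun z : T1 * T2 => f z.1 * g z.2).
  apply: measurable_funM.
    by apply: measurable_fst_fun; exact: Ig_measurable hf.
  by apply: measurable_snd_fun; exact: Ig_measurable hg.
apply/integrable_mkcond => //; apply/integrable12ltyP.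
  by apply/measurable_restrict => //; rewrite setTI; exact/measurable_EFinP.
rewrite (_ : (\int[m1]_x _)%E = (\int[m1]_(x in D1) (`|f x| * \int[m2]_(y in D2) `|g y|)%:E)%E).
  rewrite Ig_fin ?ltry//.
  apply: (eq_Ig mD1 (f := fun x => (\int[m2]_(y in D2) `|g y|) * `|f x|)) => [x _|].
    exact: mulrC.
  by apply: IgZ => //; exact: Ig_abs.
rewrite [RHS]integral_mkcond; apply: eq_integral => x _; rewrite [RHS]/patch.
case: ifPn => xD; last first.
  apply: integral0_eq => y _; rewrite /patch in_setX /= (negbTE xD) /=.
  by rewrite normr0.
rewrite EFinM -Ig_fin ?Ig_abs// -integralZl//; last exact: Ig_abs.
rewrite [RHS]integral_mkcond; apply: eq_integral => y _.
rewrite /patch in_setX /= xD /=; case: ifPn => _ /=.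
  by rewrite normrM EFinM.
by rewrite ?normr0 ?abse0.
Qed.

Lemma ae_prod1 (P : T1 -> Prop) :
  {ae m1, forall x, D1 x -> P x} ->
  {ae (m1 \x m2)%E, forall z, (D1 `*` D2) z -> P z.1}.
Proof.
Abort.

End ProductIntegrable.

Section Modes2.
Context {R : realType}.

Definition mode (N : nat) : Type := (mode1 N * mode1 N)%type.
HB.instance Definition _ N := Finite.on (mode N).

Definition e2 N (m : mode N) (x : R * R) : R := tr1 m.1 x.1 * tr1 m.2 x.2.
Definition flip N (a : 'I_2) (m : mode N) : mode N :=
  if a == 0 then (flip1 m.1, m.2) else (m.1, flip1 m.2).
Definition sg N (a : 'I_2) (m : mode N) : R := if a == 0 then sg1 m.1 else sg1 m.2.
Definition wt N : R := N.+1%:R^-1 ^+ 2.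

Local Notation mu := (@lebesgue_measure R).
Local Notation mu2 := (@lebesgue_measure R \x @lebesgue_measure R)%E.
Local Notation I01 := (@I01 R).
Local Notation cell := (@cell R).
Local Notation Ig f := (mu2.-integrable cell (EFin \o f)).

Lemma cellE : cell = I01 `*` I01. Proof. by []. Qed.

Lemma measurable_cell : measurable cell.
Proof. by apply: measurableX; exact: measurable_I01. Qed.

Lemma mu_cell : mu2 cell = 1%:E.
Proof.
rewrite product_measure1E; [|exact: measurable_I01..].
rewrite [X in (X * _)%E](mu_I01 (R := R)).
by rewrite [X in (_ * X)%E](mu_I01 (R := R)) mule1.
Qed.

Lemma fin_cell : (mu2 cell < +oo)%E. Proof. by rewrite mu_cell ltry. Qed.

Lemma abs_e2_le1 N (m : mode N) x : `|e2 m x| <= 1.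
Proof. by rewrite /e2 normrM mulr_ile1// abs_tr1_le1. Qed.

Lemma measurable_e2 N (m : mode N) : measurable_fun cell (e2 m).
Proof.
have mI := @measurable_I01 R.
apply: measurable_funM.
  by apply: (@measurable_fst_fun _ _ _ _ R I01 I01 mI); exact: measurable_tr1.
by apply: (@measurable_snd_fun _ _ _ _ R I01 I01 mI); exact: measurable_tr1.
Qed.

Lemma kern_e2 N x y : kern (wt N) (@e2 N) x y = fejer N x.1 y.1 * fejer N x.2 y.2.
Proof.
rewrite /kern /fejer /wt expr2 -!mulrA; congr (_ * _); rewrite mulrCA; congr (_ * _).
rewrite mulr_suml -(pair_bigA _ (fun a b => e2 (a, b) x * e2 (a, b) y)) /=.
apply: eq_bigr => a _; rewrite mulr_sumr; apply: eq_bigr => b _.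
by rewrite /e2 /= mulrACA.
Qed.

Lemma kern_e2_ge0 N x y : 0 <= kern (wt N) (@e2 N) x y.
Proof. by rewrite kern_e2 mulr_ge0// fejer_ge0. Qed.

Lemma wt_ge0 N : 0 <= wt N. Proof. exact: sqr_ge0. Qed.

Lemma Rint_kern_e2 N x : \int[mu2]_(y in cell) kern (wt N) (@e2 N) x y = 1.
Proof.
have -> : kern (wt N) (@e2 N) x = fun y => fejer N x.1 y.1 * fejer N x.2 y.2.
  by apply/funext => y; rewrite kern_e2.
have mI := @measurable_I01 R.
rewrite cellE Fubini_Rint1//; last by apply: Ig_tensor => //; exact: Ig_fejer.
rewrite -[RHS](Rint_fejer N x.1); apply: eq_Rint => y1 _ /=.
by rewrite Rint_Zl ?Rint_fejer ?mulr1//; exact: Ig_fejer.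
Qed.

Definition sm2 N (f : R * R -> R) : R * R -> R := av mu2 cell (wt N) (@e2 N) f.

Let mI : measurable I01 := @measurable_I01 R.
Let fI : (mu I01 < +oo)%E := @fin_I01 R.
Let me N (m : mode1 N) : measurable_fun I01 (tr1 m). Proof. exact: measurable_tr1. Qed.
Let e1 N (m : mode1 N) x : `|@tr1 R N m x| <= 1. Proof. exact: abs_tr1_le1. Qed.
Let k0 N x y : 0 <= kern N.+1%:R^-1 (@tr1 R N) x y. Proof. exact: fejer_ge0. Qed.
Let k1 N x : \int[mu]_(y in I01) kern N.+1%:R^-1 (@tr1 R N) x y = 1.
Proof. exact: Rint_fejer. Qed.

Lemma sm2E N f x : Ig f ->
  sm2 N f x = wt N * \sum_(m : mode N) coef mu2 cell (@e2 N) m f * e2 m x.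
Proof. by move=> hf; apply: (avE measurable_cell) => // m *; [exact: measurable_e2|exact: abs_e2_le1]. Qed.

Section Slices.
Variables (f : R * R -> R) (hf : Ig f).

(* Fejer mean in the first, respectively second, variable, in a form that is jointly measurable. *)
Definition sm21 N (x : R * R) : R := N.+1%:R^-1 *
  \sum_(m : mode1 N) (\int[mu]_(y in I01) (f (y, x.2) * tr1 m y)) * tr1 m x.1.
Definition sm22 N (x : R * R) : R := N.+1%:R^-1 *
  \sum_(m : mode1 N) (\int[mu]_(y in I01) (f (x.1, y) * tr1 m y)) * tr1 m x.2.

Let Ig1 N (m : mode1 N) : Ig (fun z => f z * tr1 m z.1).
Proof.
apply: (IgM_bounded measurable_cell hf (M := 1)) => [|z _]; last exact: e1.
by apply: (@measurable_fst_fun _ _ _ _ R I01 I01 mI); exact: measurable_tr1.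
Qed.

Let Ig2 N (m : mode1 N) : Ig (fun z => f z * tr1 m z.2).
Proof.
apply: (IgM_bounded measurable_cell hf (M := 1)) => [|z _]; last exact: e1.
by apply: (@measurable_snd_fun _ _ _ _ R I01 I01 mI); exact: measurable_tr1.
Qed.

Lemma Ig_sm21 N : Ig (sm21 N).
Proof.
apply: IgZ; first exact: measurable_cell.
apply: Ig_sum => [|m]; first exact: measurable_cell.
apply: (eq_Ig measurable_cell (f := fun x => tr1 m x.1 *
   \int[mu]_(y in I01) (f (y, x.2) * tr1 m y))) => [x _|]; first exact: mulrC.
apply: (@Ig_tensor _ _ _ _ _ mu mu I01 I01 mI mI (tr1 m)
   (fun x => \int[mu]_(y in I01) (f (y, x) * tr1 m y))); first exact: Ig_tr1.
exact: (Fubini_Ig2 mI mI (Ig1 m)).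
Qed.

Lemma Ig_sm22 N : Ig (sm22 N).
Proof.
apply: IgZ; first exact: measurable_cell.
apply: Ig_sum => [|m]; first exact: measurable_cell.
apply: (@Ig_tensor _ _ _ _ _ mu mu I01 I01 mI mI
   (fun x => \int[mu]_(y in I01) (f (x, y) * tr1 m y))); last exact: Ig_tr1.
exact: (Fubini_Ig1 mI mI (Ig2 m)).
Qed.

(** The one-dimensional convergence holds on almost every slice; contraction bounds the slice errors
    by twice the slice norm of [f], so dominated convergence in the other variable concludes. *)
Lemma cvg_sm21 : \int[mu2]_(x in cell) `|f x - sm21 N x| @[N --> \oo] --> (0 : R).
Proof.
have hd N : Ig (fun x => `|f x - sm21 N x|).
  by apply: Ig_abs; apply: IgB => //; [exact: measurable_cell|exact: Ig_sm21].
have sl : {ae mu, forall y, I01 y -> mu.-integrable I01 (EFin \o (fun x => f (x, y)))}.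
  exact: ae_Ig_slice2.
have slE y : mu.-integrable I01 (EFin \o (fun x => f (x, y))) -> forall N,
    (fun x => `|f (x, y) - sm21 N (x, y)|) =
    (fun x => `|f (x, y) - sm1 N (fun x => f (x, y)) x|).
  by move=> hy N; apply/funext => x; rewrite /sm1 (avE mI _ (@me N) (@e1 N) _ hy).
pose h N y := \int[mu]_(x in I01) `|f (x, y) - sm21 N (x, y)|.
have -> : (fun N => \int[mu2]_(x in cell) `|f x - sm21 N x|) =
    (fun N => \int[mu]_(y in I01) h N y).
  by apply/funext => N; rewrite cellE (Fubini_Rint2 mI mI (hd N)).
rewrite -[X in _ --> X](Rint_zero mu I01).
pose b y := 2 * \int[mu]_(x in I01) `|f (x, y)|.
apply: (@cvg_Rint_dominated _ _ _ mu I01 mI h _ b).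
- by move=> N; exact: Ig_measurable (Fubini_Ig2 mI mI (hd N)).
- exact: measurable_cst.
- apply: filterS sl => y H Iy; rewrite /h.
  under eq_fun do rewrite (slE _ (H Iy)).
  by apply: cvg_L1_sm1; exact: H.
- apply: IgZ => //; exact: (Fubini_Ig2 mI mI (Ig_abs hf)).
- apply: filterS sl => y H N Iy; have hy := H Iy.
  rewrite /h (slE _ hy) /b ger0_norm; last exact: Rintegral_ge0.
  have hs : mu.-integrable I01 (EFin \o sm1 N (fun x => f (x, y))) by exact: Ig_sm1.
  apply: (@le_trans _ _ (\int[mu]_(x in I01)
     (`|f (x, y)| + `|sm1 N (fun x => f (x, y)) x|))).
    apply: le_Rintegral => //; [by apply: Ig_abs; exact: IgB|by apply: IgD => //; exact: Ig_abs|].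
    by move=> x _; exact: ler_normB.
  rewrite RintegralD//; try exact: Ig_abs.
  by rewrite mulr_natl mulr2n lerD2l;
    exact: (av_contraction mI fI (@me N) (@e1 N) (@k0 N) (@k1 N) hy).
Qed.

Lemma cvg_sm22 : \int[mu2]_(x in cell) `|f x - sm22 N x| @[N --> \oo] --> (0 : R).
Proof.
have hd N : Ig (fun x => `|f x - sm22 N x|).
  by apply: Ig_abs; apply: IgB => //; [exact: measurable_cell|exact: Ig_sm22].
have sl : {ae mu, forall y, I01 y -> mu.-integrable I01 (EFin \o (fun x => f (y, x)))}.
  exact: ae_Ig_slice1.
have slE y : mu.-integrable I01 (EFin \o (fun x => f (y, x))) -> forall N,
    (fun x => `|f (y, x) - sm22 N (y, x)|) =
    (fun x => `|f (y, x) - sm1 N (fun x => f (y, x)) x|).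
  by move=> hy N; apply/funext => x; rewrite /sm1 (avE mI _ (@me N) (@e1 N) _ hy).
pose h N y := \int[mu]_(x in I01) `|f (y, x) - sm22 N (y, x)|.
have -> : (fun N => \int[mu2]_(x in cell) `|f x - sm22 N x|) =
    (fun N => \int[mu]_(y in I01) h N y).
  by apply/funext => N; rewrite cellE (Fubini_Rint1 mI mI (hd N)).
rewrite -[X in _ --> X](Rint_zero mu I01).
pose b y := 2 * \int[mu]_(x in I01) `|f (y, x)|.
apply: (@cvg_Rint_dominated _ _ _ mu I01 mI h _ b).
- by move=> N; exact: Ig_measurable (Fubini_Ig1 mI mI (hd N)).
- exact: measurable_cst.
- apply: filterS sl => y H Iy; rewrite /h.
  under eq_fun do rewrite (slE _ (H Iy)).
  by apply: cvg_L1_sm1; exact: H.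
- apply: IgZ => //; exact: (Fubini_Ig1 mI mI (Ig_abs hf)).
- apply: filterS sl => y H N Iy; have hy := H Iy.
  rewrite /h (slE _ hy) /b ger0_norm; last exact: Rintegral_ge0.
  have hs : mu.-integrable I01 (EFin \o sm1 N (fun x => f (y, x))) by exact: Ig_sm1.
  apply: (@le_trans _ _ (\int[mu]_(x in I01)
     (`|f (y, x)| + `|sm1 N (fun x => f (y, x)) x|))).
    apply: le_Rintegral => //; [by apply: Ig_abs; exact: IgB|by apply: IgD => //; exact: Ig_abs|].
    by move=> x _; exact: ler_normB.
  rewrite RintegralD//; try exact: Ig_abs.
  by rewrite mulr_natl mulr2n lerD2l;
    exact: (av_contraction mI fI (@me N) (@e1 N) (@k0 N) (@k1 N) hy).
Qed.

End Slices.

(** The two-dimensional kernel is a tensor product, so its mean is a composition of one-variable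
    means. *)
Lemma sm21_sm22 N f x : Ig f -> sm21 (sm22 f N) N x = sm2 N f x.
Proof.
move=> hf; rewrite sm2E// /sm21 /wt expr2 -mulrA; congr (_ * _).
rewrite mulr_sumr -(pair_bigA _ (fun a b => N.+1%:R^-1 *
  (coef mu2 cell (@e2 N) (a, b) f * e2 (a, b) x))) /=.
apply: eq_bigr => a _; rewrite -mulr_sumr.
have Ih : Ig (fun z => f z * tr1 a z.1).
  apply: (IgM_bounded measurable_cell hf (M := 1)) => [|z _]; last exact: e1.
  by apply: (@measurable_fst_fun _ _ _ _ R I01 I01 mI); exact: measurable_tr1.
have Ic (b : mode1 N) : Ig (fun z => f z * e2 (a, b) z).
  apply: (IgM_bounded measurable_cell hf (M := 1)) => [|z _]; last exact: abs_e2_le1.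
  exact: measurable_e2.
have If (b : mode1 N) : Ig (fun z => f z * tr1 b z.2).
  apply: (IgM_bounded measurable_cell hf (M := 1)) => [|z _]; last exact: e1.
  by apply: (@measurable_snd_fun _ _ _ _ R I01 I01 mI); exact: measurable_tr1.
have Ib (b : mode1 N) : mu.-integrable I01
    (EFin \o (fun y => (\int[mu]_(z in I01) (f (y, z) * tr1 b z)) * tr1 a y)).
  apply: (IgM_bounded mI _ (M := 1)) => [|//|y _]; last exact: e1.
  exact: (Fubini_Ig1 mI mI (If b)).
have E : (fun y : R => sm22 f N (y, x.2) * tr1 a y) = (fun y : R => N.+1%:R^-1 *
   \sum_(b : mode1 N) tr1 b x.2 * ((\int[mu]_(z in I01) (f (y, z) * tr1 b z)) * tr1 a y)).
  apply/funext => y; rewrite /sm22 /= -mulrA; congr (_ * _); rewrite mulr_suml.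
  by apply: eq_bigr => b _; rewrite mulrAC mulrC.
rewrite E Rint_Zl ?Rint_sum//; last 2 first.
- by move=> b; apply: IgZ.
- by apply: Ig_sum => // b; apply: IgZ.
rewrite -mulrA; congr (_ * _); rewrite mulr_suml; apply: eq_bigr => b _.
rewrite Rint_Zl// /e2 /= mulrAC mulrC; congr (_ * _); last exact: mulrC.
rewrite /coef (@Fubini_Rint1 _ _ _ _ _ mu mu I01 I01 mI mI _ (Ic b)).
apply: ae_Rint => //.
- exact: Ig_measurable (Ib b).
- exact: Ig_measurable (Fubini_Ig1 mI mI (Ic b)).
have sl : {ae mu, forall y, I01 y -> mu.-integrable I01 (EFin \o (fun z => f (y, z)))}.
  exact: ae_Ig_slice1.
apply: filterS sl => y H Iy; rewrite mulrC -Rint_Zl//.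
  by apply: eq_Rint => z _; rewrite /e2 /=; ring.
by apply: (IgM_bounded mI (H Iy) (M := 1)) => // z _; exact: e1.
Qed.

(** On each slice [dist_av_le], applied to [f] and its mean in the second variable, bounds the error
    by the sum of the two one-variable errors. *)
Lemma cvg_L1_sm2 f : Ig f ->
  \int[mu2]_(x in cell) `|f x - sm2 N f x| @[N --> \oo] --> (0 : R).
Proof.
move=> hf; have mC := measurable_cell.
have h1 N := Ig_sm21 hf N; have h2 N := Ig_sm22 hf N.
have h3 N := Ig_sm21 (h2 N) N.
have hS N : Ig (sm2 N f).
  by apply: (eq_Ig mC _ (h3 N)) => x _; exact: sm21_sm22.
have IB (g k : R * R -> R) : Ig g -> Ig k -> Ig (fun x => `|g x - k x|).
  by move=> hg hk; apply: Ig_abs; exact: IgB.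
have H0 : (\int[mu2]_(x in cell) `|f x - sm21 f N x| +
           \int[mu2]_(x in cell) `|f x - sm22 f N x|) @[N --> \oo] --> (0 : R).
  by rewrite -[X in _ --> X]addr0; apply: cvgD; [exact: cvg_sm21|exact: cvg_sm22].
apply: (@squeeze_cvgr _ _ _ _ (fun=> 0) _ _ _ _ (cvg_cst 0) H0).
apply: nearW => N; apply/andP; split; first exact: Rintegral_ge0.
have -> : (fun x => `|f x - sm2 N f x|) = (fun x => `|f x - sm21 (sm22 f N) N x|).
  by apply/funext => x; rewrite sm21_sm22.
rewrite cellE (Fubini_Rint2 mI mI (IB _ _ hf (h3 N))) (Fubini_Rint2 mI mI (IB _ _ hf (h1 N))).
rewrite (Fubini_Rint2 mI mI (IB _ _ hf (h2 N))) -RintegralD//; last 2 first.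
- exact: (Fubini_Ig2 mI mI (IB _ _ hf (h1 N))).
- exact: (Fubini_Ig2 mI mI (IB _ _ hf (h2 N))).
apply: ae_le_Rint => //.
- exact: (Fubini_Ig2 mI mI (IB _ _ hf (h3 N))).
- apply: IgD => //; first exact: (Fubini_Ig2 mI mI (IB _ _ hf (h1 N))).
  exact: (Fubini_Ig2 mI mI (IB _ _ hf (h2 N))).
have sl : {ae mu, forall y, I01 y -> mu.-integrable I01 (EFin \o (fun x => f (x, y)))}.
  exact: ae_Ig_slice2.
have sl2 : {ae mu, forall y, I01 y -> mu.-integrable I01 (EFin \o (fun x => sm22 f N (x, y)))}.
  exact: (ae_Ig_slice2 mI mI (h2 N)).
apply: filterS2 sl sl2 => y H1 H2 Iy.
have hy := H1 Iy; have hy2 := H2 Iy.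
have := dist_av_le mI fI (@me N) (@e1 N) (@k0 N) (@k1 N) hy hy2.
have E (g : R * R -> R) : mu.-integrable I01 (EFin \o (fun x => g (x, y))) ->
   (fun x : R => sm21 g N (x, y)) = av mu I01 N.+1%:R^-1 (@tr1 R N) (fun x => g (x, y)).
  by move=> hg; apply/funext => x; rewrite (avE mI _ (@me N) (@e1 N) _ hg).
by rewrite -(E _ hy) -(E _ hy2).
Qed.

End Modes2.

(** * Convergence of Fejer means in the duality between L^q and L^p *)

Lemma pairing_eps (R : realType) (e a b c u v : R) : `|a| <= e / 2 -> `|b| <= u + v ->
  `|c| <= u + v -> u <= e / 8 -> v <= e / 8 -> `|a + (b - c)| <= e.
Proof.
move=> ha hb hc hu hv; rewrite (le_trans (ler_normD _ _))//.
have := ler_normB b c; lra.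
Qed.

Section WeakConvergence.
Context {R : realType}.
Local Notation mu2 := (@lebesgue_measure R \x @lebesgue_measure R)%E.
Local Notation cell := (@cell R).
Local Notation Ig f := (mu2.-integrable cell (EFin \o f)).
Let mC : measurable cell := @measurable_cell R.
Let fC : (mu2 cell < +oo)%E := @fin_cell R.
Implicit Types f g : R * R -> R.

Let me N (m : mode N) : measurable_fun cell (@e2 R N m). Proof. exact: measurable_e2. Qed.
Let e1 N (m : mode N) x : `|@e2 R N m x| <= 1. Proof. exact: abs_e2_le1. Qed.
Let k0 N x y : 0 <= kern (wt N) (@e2 R N) x y. Proof. exact: kern_e2_ge0. Qed.
Let k1 N x : \int[mu2]_(y in cell) kern (wt N) (@e2 R N) x y = 1.
Proof. exact: Rint_kern_e2. Qed.

Lemma Ig_sm2 N f : Ig f -> Ig (sm2 N f).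
Proof. exact: (Ig_av mC fC _ (@me N) (@e1 N)). Qed.

Lemma Ig_mul_sm2 N f g : Ig f -> Ig g -> Ig (fun x => f x * sm2 N g x).
Proof. exact: (Ig_mul_av mC _ (@me N) (@e1 N)). Qed.

Definition coef2 N (m : mode N) f : R := coef mu2 cell (@e2 R N) m f.

Lemma Rint_mul_sm2 N f g : Ig f -> Ig g ->
  \int[mu2]_(x in cell) (f x * sm2 N g x) = wt N * \sum_(m : mode N) coef2 m g * coef2 m f.
Proof. exact: (Rint_mul_av mC _ (@me N) (@e1 N)). Qed.

Lemma Rint_mul_sm2_le N f g phi psi : Ig f -> Ig g -> Ig phi -> Ig psi ->
  (forall x y, cell x -> cell y -> `|f x * g y| <= phi x + psi y) ->
  \int[mu2]_(x in cell) `|f x * sm2 N g x| <=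
  \int[mu2]_(x in cell) phi x + \int[mu2]_(x in cell) psi x.
Proof. exact: (Rint_mul_av_le mC fC (@me N) (@e1 N) (@k0 N) (@k1 N)). Qed.

Lemma coef2_sqr_le N f : Ig f -> Ig (fun x => f x ^+ 2) ->
  wt N * \sum_(m : mode N) coef2 m f ^+ 2 <= \int[mu2]_(x in cell) f x ^+ 2.
Proof. exact: (sum_coef_sqr_le mC fC (@me N) (@e1 N) (@k0 N) (@k1 N)). Qed.

Lemma span2_sqr_le N (c : mode N -> R) :
  \int[mu2]_(x in cell) (wt N * \sum_m c m * e2 m x) ^+ 2 <= wt N * \sum_m c m ^+ 2.
Proof. exact: (span_sqr_le mC fC (wt_ge0 N) (@me N) (@e1 N) (@k0 N) (@k1 N)). Qed.

Lemma Rint_span2_mul N (c : mode N -> R) f : Ig f ->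
  \int[mu2]_(x in cell) (f x * (wt N * \sum_m c m * e2 m x)) =
  wt N * \sum_m c m * coef2 m f.
Proof. exact: (Rint_span_mul mC _ (@me N) (@e1 N)). Qed.

Variables (p q : R) (p0 : 0 < p) (q0 : 0 < q) (pq : q^-1 + p^-1 = 1).

Lemma young_scaled (a b eta : R) : 0 < eta ->
  `|a * b| <= eta^-1 `^ q * `|a| `^ q + eta `^ p * `|b| `^ p.
Proof.
move=> eta0; have i0 : 0 <= eta^-1 by rewrite invr_ge0 ltW.
have -> : `|a * b| = (eta^-1 * `|a|) * (eta * `|b|).
  by rewrite normrM mulrACA mulVf ?mul1r// gt_eqF.
rewrite -!powRM ?(ltW eta0)//.
have h1 : 0 <= eta^-1 * `|a| by rewrite mulr_ge0.
have h2 : 0 <= eta * `|b| by rewrite mulr_ge0// ltW.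
apply: (le_trans (conjugate_powR h1 h2 q0 p0 pq)).
have q1 : q^-1 <= 1 by rewrite -pq lerDl invr_ge0 ltW.
have p1 : p^-1 <= 1 by rewrite -pq lerDr invr_ge0 ltW.
by rewrite lerD// ler_piMr// powR_ge0.
Qed.

(** The bound is uniform in [N], and [eta] lets the share of [g] be made small at the expense of
    that of [f]. *)
Lemma dual_pairing_le N f g eta : 0 < eta -> Ig f -> Ig g ->
  Ig (fun x => `|f x| `^ q) -> Ig (fun x => `|g x| `^ p) ->
  `|\int[mu2]_(x in cell) (f x * sm2 N g x)| <=
    eta^-1 `^ q * \int[mu2]_(x in cell) `|f x| `^ q +
    eta `^ p * \int[mu2]_(x in cell) `|g x| `^ p.
Proof.
move=> eta0 hf hg hfq hgp.
apply: (le_trans (le_normr_Rintegral mC (Ig_mul_sm2 N hf hg))).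
rewrite -!Rint_Zl//; apply: Rint_mul_sm2_le => //; [exact: IgZ|exact: IgZ|].
by move=> x y _ _; exact: young_scaled.
Qed.

Lemma Ig_mul_young f g : measurable_fun cell f -> measurable_fun cell g ->
  Ig (fun x => `|f x| `^ q) -> Ig (fun x => `|g x| `^ p) -> Ig (fun x => f x * g x).
Proof.
move=> mf mg hfq hgp; apply: (@Ig_le _ _ _ _ _ mC _ (fun x => `|f x| `^ q + `|g x| `^ p)).
- exact: measurable_funM.
- move=> x _; have := young_scaled (f x) (g x) ltr01.
  by rewrite invr1 !powR1 !mul1r.
- exact: IgD.
Qed.

Lemma Rint_mul_young_le f g eta : 0 < eta -> measurable_fun cell f -> measurable_fun cell g ->
  Ig (fun x => `|f x| `^ q) -> Ig (fun x => `|g x| `^ p) ->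
  `|\int[mu2]_(x in cell) (f x * g x)| <=
    eta^-1 `^ q * \int[mu2]_(x in cell) `|f x| `^ q +
    eta `^ p * \int[mu2]_(x in cell) `|g x| `^ p.
Proof.
move=> eta0 mf mg hfq hgp; have hfg := Ig_mul_young mf mg hfq hgp.
apply: (le_trans (le_normr_Rintegral mC hfg)).
rewrite -!Rint_Zl// -RintegralD//; [|exact: IgZ..].
apply: le_Rintegral => //; first exact: Ig_abs.
- by apply: IgD => //; exact: IgZ.
- by move=> x _; exact: young_scaled.
Qed.

(** The part of [f] below a level [n] is bounded, and L^1 convergence of the means of [g] suffices
    for it. The part above is small in L^q; against both [g] and its mean it is controlled by the
    scaled Young inequality, uniformly in [N]. First [eta] is chosen for [g], then [n] for [f]. *)
Lemma cvg_pairing_sm2 f g : Ig f -> Ig g ->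
  Ig (fun x => `|f x| `^ q) -> Ig (fun x => `|g x| `^ p) ->
  \int[mu2]_(x in cell) (f x * (g x - sm2 N g x)) @[N --> \oo] --> (0 : R).
Proof.
move=> hf hg hfq hgp; apply/cvgrPdist_le => e e0.
have mf := Ig_measurable hf; have mg := Ig_measurable hg.
pose B := \int[mu2]_(x in cell) `|g x| `^ p.
have B0 : 0 <= B by apply: Rintegral_ge0 => x _; exact: powR_ge0.
(* With [eta = c^(1/p)] the term [eta^p * B] is at most [e / 8]; adding 1 avoids a division by zero
   when [g] vanishes. *)
pose c := e / 8 / (B + 1).
have c0 : 0 < c by rewrite !divr_gt0// ltr_wpDl.
pose eta := c `^ p^-1.
have eta0 : 0 < eta by exact: powR_gt0.
have etaB : eta `^ p * B <= e / 8.
  rewrite /eta -powRrM mulVf ?gt_eqF// powRr1 ?(ltW c0)// /c -(mulrA (e / 8)).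
  rewrite ler_piMr ?divr_ge0 ?(ltW e0)//.
  by rewrite mulrC ler_pdivrMr ?ltr_wpDl// mul1r lerDl.
pose tail n x := if `|f x| <= n%:R then 0 else f x.
have mt n : measurable_fun cell (tail n).
  apply: measurable_fun_if => //; last by apply: measurable_funS mf => //; exact: subIsetl.
  by apply: measurable_fun_ler => //; apply: measurableT_comp.
have tf n x : `|tail n x| <= `|f x| by rewrite /tail; case: ifP; rewrite ?normr0.
have tfq n x : `|tail n x| `^ q <= `|f x| `^ q.
  by apply: ge0_ler_powR; rewrite ?nnegrE// ltW.
have mpow (h : R * R -> R) (r : R) : measurable_fun cell h -> measurable_fun cell (fun x => `|h x| `^ r).
  move=> mh; apply: (measurableT_comp (measurable_powR r)).
  exact: measurableT_comp.
have It n : Ig (tail n) by apply: Ig_le (Ig_abs hf) => //.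
have Itq n : Ig (fun x => `|tail n x| `^ q).
  apply: Ig_le hfq => //; first exact: mpow.
  by move=> x _; rewrite ger0_norm ?powR_ge0.
have cvt : \int[mu2]_(x in cell) `|tail n x| `^ q @[n --> \oo] --> (0 : R).
  rewrite -[X in _ --> X](Rint_zero mu2 cell).
  apply: (@cvg_Rint_dominated _ _ _ mu2 cell mC (fun n x => `|tail n x| `^ q) (fun=> 0) (fun x => `|f x| `^ q)) => //.
  - by move=> n; exact: mpow.
  - apply: aeW => x _; apply/cvgrPdist_le => d d0; near=> n.
    rewrite /tail ifT; last by near: n; exact: nbhs_infty_ger.
    by rewrite normr0 powR0 ?gt_eqF// subr0 normr0 ltW.
  - by apply: aeW => x n _; rewrite ger0_norm ?powR_ge0.
have ei0 : 0 < e / 8 / eta^-1 `^ q by rewrite divr_gt0 ?divr_gt0// powR_gt0 ?invr_gt0.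
have [n Hn] : exists n : nat, eta^-1 `^ q * \int[mu2]_(x in cell) `|tail n x| `^ q <= e / 8.
  move/cvgrPdist_le : cvt => /(_ _ ei0)[n _ /(_ n (leqnn n))]; rewrite sub0r normrN => H.
  exists n; rewrite mulrC -ler_pdivlMr ?powR_gt0 ?invr_gt0//.
  exact: le_trans (ler_norm _) H.
have n10 : 0 < n%:R + 1 :> R by rewrite ltr_wpDl.
have e20 : 0 < e / 2 / (n%:R + 1) by rewrite !divr_gt0.
have /cvgrPdist_le/(_ _ e20) := cvg_L1_sm2 hg; apply: filterS => N.
rewrite !sub0r !normrN => /(le_trans (ler_norm _)) HN.
have hs := Ig_sm2 N hg.
have hgs : Ig (fun x => g x - sm2 N g x) by exact: IgB.
have hb x : `|f x - tail n x| <= n%:R.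
  by rewrite /tail; case: ifPn => h; rewrite ?subr0// subrr normr0.
have i1 : Ig (fun x => (g x - sm2 N g x) * (f x - tail n x)).
  by apply: (IgM_bounded mC hgs (M := n%:R)) => //; exact: measurable_funB.
have i2 : Ig (fun x => tail n x * g x) by exact: Ig_mul_young.
have i3 : Ig (fun x => tail n x * sm2 N g x) by exact: Ig_mul_sm2.
have -> : (fun x => f x * (g x - sm2 N g x)) = (fun x =>
   (g x - sm2 N g x) * (f x - tail n x) + (tail n x * g x - tail n x * sm2 N g x)).
  by apply/funext => x; ring.
rewrite RintegralD//; last exact: IgB.
rewrite RintegralB//.
have h1 := Rint_mul_young_le eta0 (mt n) mg (Itq n) hgp.
have h2 := dual_pairing_le N eta0 (It n) hg (Itq n) hgp.
have h3 : `|\int[mu2]_(x in cell) ((g x - sm2 N g x) * (f x - tail n x))| <= e / 2.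
  apply: (le_trans (le_normr_Rintegral mC i1)).
  apply: (@le_trans _ _ (n%:R * \int[mu2]_(x in cell) `|g x - sm2 N g x|)).
    rewrite -Rint_Zl//; last exact: Ig_abs.
    apply: le_Rintegral => //; [exact: Ig_abs|by apply: IgZ => //; exact: Ig_abs|].
    by move=> x _; rewrite normrM mulrC ler_wpM2r.
  apply: (@le_trans _ _ ((n%:R + 1) * (e / 2 / (n%:R + 1)))).
    apply: ler_pM => //; first exact: Rintegral_ge0.
    by rewrite lerDl.
  by rewrite mulrC divfK// gt_eqF.
exact: pairing_eps h3 h1 h2 Hn etaB.
Unshelve. all: by end_near.
Qed.

End WeakConvergence.

(** * The Gagliardo-Nirenberg inequality for trigonometric polynomials *)

Lemma half_sum_sqr (R : realType) (a b : R) : a * b <= 2^-1 * (a ^+ 2 + b ^+ 2).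
Proof. by have := young2 a b; lra. Qed.

(* Either [s] or [a] dominates, according to whether [s <= th * a^(1/k)]. *)
Lemma young_split (R : realType) (a s th : R) (k : nat) : 0 <= a -> 0 <= s -> 0 < th ->
  a * s <= th * (a * a `^ k.+1%:R^-1) + th^-1 ^+ k.+1 * s ^+ k.+2.
Proof.
move=> a0 s0 th0; set b := a `^ _.
have b0 : 0 <= b by exact: powR_ge0.
have bk : b ^+ k.+1 = a by rewrite -powR_mulrn// -powRrM mulVf ?powRr1.
have [sb|sb] := leP s (th * b).
  apply: (@le_trans _ _ (th * (a * b))); first by rewrite mulrCA ler_wpM2l.
  by rewrite lerDl mulr_ge0// ?exprn_ge0// invr_ge0 ltW.
apply: (@le_trans _ _ (th^-1 ^+ k.+1 * s ^+ k.+2)); last first.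
  by rewrite lerDr mulr_ge0 ?(ltW th0)// mulr_ge0.
rewrite (exprS s) mulrCA mulrC ler_wpM2l// -exprMn -bk.
by rewrite lerXn2r ?nnegrE ?mulr_ge0 ?invr_ge0 ?(ltW th0)// ler_pdivlMl// ltW.
Qed.

Lemma sqr_sum_le (R : realType) (a b n : R) :
  (a + n * b) ^+ 2 <= 2 * a ^+ 2 + 2 * n ^+ 2 * b ^+ 2.
Proof. by have := sqr_ge0 (a - n * b); rewrite sqrrB sqrrD exprMn; lra. Qed.

Lemma gn_step (R : realType) (X0 X1 D0 D1 m1 mk m n : R) : m <= X0 * X1 ->
  X0 ^+ 2 <= mk * (2 * m1 + 2 * n * D0) -> X1 ^+ 2 <= mk * (2 * m1 + 2 * n * D1) ->
  1 <= n -> 0 <= mk -> 0 <= m1 -> 0 <= D0 -> 0 <= D1 ->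
  m <= 2 * n * mk * (m1 + (D0 + D1)).
Proof.
move=> h h0 h1 n1 mk0 m10 d0 d1; have := half_sum_sqr X0 X1.
have : mk * m1 <= n * (mk * m1) by rewrite ler_peMl// mulr_ge0.
have : 0 <= n * (mk * (D0 + D1)).
  by apply: mulr_ge0; [exact: le_trans ler01 n1|rewrite mulr_ge0// addr_ge0].
have -> : 2 * n * mk * (m1 + (D0 + D1)) =
  2 * (n * (mk * m1)) + 2 * (n * (mk * (D0 + D1))) by ring.
have e0 : mk * (2 * m1 + 2 * n * D0) = 2 * (mk * m1) + 2 * (n * (mk * D0)) by ring.
have e1 : mk * (2 * m1 + 2 * n * D1) = 2 * (mk * m1) + 2 * (n * (mk * D1)) by ring.
have -> : n * (mk * (D0 + D1)) = n * (mk * D0) + n * (mk * D1) by ring.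
by rewrite e0 in h0; rewrite e1 in h1; lra.
Qed.

Section CauchySchwarzIntegral.
Context d (T : measurableType d) (R : realType) (mu : {measure set T -> \bar R}).
Variables (D : set T) (mD : measurable D).

Lemma discriminant_le (A B X : R) : 0 <= B -> (forall t : R, 0 <= A - 2 * t * X + t ^+ 2 * B) ->
  X ^+ 2 <= A * B.
Proof.
move=> B0 H; have [B0'|Bn0] := eqVneq B 0.
  have [->|Xn0] := eqVneq X 0; first by rewrite expr0n /= B0' mulr0.
  (* With [B = 0] the expression is affine in [t], and this value of [t] would give -1. *)
  have := H ((A + 1) / (2 * X)); rewrite B0' mulr0 addr0.
  have -> : 2 * ((A + 1) / (2 * X)) * X = A + 1 by field.
  by rewrite opprD addrA subrr add0r oppr_ge0 ler10.
have Bp : 0 < B by rewrite lt_def Bn0.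
have := H (X / B).
have -> : A - 2 * (X / B) * X + (X / B) ^+ 2 * B = A - X ^+ 2 / B by field.
by rewrite subr_ge0 ler_pdivrMr.
Qed.

Lemma cauchy_schwarz_Rint (f g : T -> R) :
  mu.-integrable D (EFin \o (fun x => f x ^+ 2)) ->
  mu.-integrable D (EFin \o (fun x => g x ^+ 2)) ->
  mu.-integrable D (EFin \o (fun x => f x * g x)) ->
  (\int[mu]_(x in D) (f x * g x)) ^+ 2 <=
  (\int[mu]_(x in D) f x ^+ 2) * \int[mu]_(x in D) g x ^+ 2.
Proof.
move=> hf hg hfg; apply: discriminant_le.
  by apply: Rintegral_ge0 => x _; exact: sqr_ge0.
move=> t.
have -> : \int[mu]_(x in D) f x ^+ 2 - 2 * t * \int[mu]_(x in D) (f x * g x) +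
    t ^+ 2 * \int[mu]_(x in D) g x ^+ 2 = \int[mu]_(x in D) (f x - t * g x) ^+ 2.
  rewrite -!Rint_Zl// -RintegralB//; last exact: IgZ.
  rewrite -RintegralD//; [|by apply: IgB => //; exact: IgZ|exact: IgZ].
  by apply: eq_Rint => x _; ring.
by apply: Rintegral_ge0 => x _; exact: sqr_ge0.
Qed.

End CauchySchwarzIntegral.

Section Slice.
Context {R : realType}.
Local Notation mu := (@lebesgue_measure R).
Local Notation I01 := (@I01 R).
Let mI : measurable I01 := @measurable_I01 R.
Let fI : (mu I01 < +oo)%E := @fin_I01 R.

Lemma Ig_I01_continuous (f : R -> R) : continuous f -> mu.-integrable I01 (EFin \o f).
Proof.
move=> cf.
have [M [_ HM]] : bounded_set (f @` `[0, 1]).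
  apply: compact_bounded; apply: continuous_compact; last exact: segment_compact.
  exact: continuous_subspaceT.
apply: (@Ig_I01_bounded _ _ (`|M| + 1)).
  by apply: measurable_funTS; exact: continuous_measurable_fun.
move=> y; rewrite /I01 /= in_itv /= => /andP[y0 y1]; apply: HM.
  by rewrite (le_lt_trans (ler_norm _))// ltrDl.
by exists y => //=; rewrite in_itv /= y0 ltW.
Qed.

Lemma increment_le (F f : R -> R) (x y : R) : continuous f ->
  (forall z : R, is_derive z (1 : R) F (f z)) -> I01 x -> I01 y ->
  `|F x - F y| <= \int[mu]_(z in I01) `|f z|.
Proof.
move=> cf dF; wlog xy : x y / y < x => [wl Ix Iy|Ix Iy].
  have [xy|xy|->] := ltgtP x y; [|exact: wl|].
    by rewrite distrC; exact: wl.
  by rewrite subrr normr0; exact: Rintegral_ge0.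
have cF : continuous F.
  by move=> z; apply: differentiable_continuous; apply/derivable1_diffP; have [] := dF z.
have mf (D : set (measurableTypeR R)) : measurable_fun D f.
  by apply: measurable_funTS; exact: continuous_measurable_fun.
have sub : `[y, x]%classic `<=` I01.
  move=> z; move: Ix Iy; rewrite /I01 /= !in_itv /= => /andP[x0 x1] /andP[y0 y1] /andP[yz zx].
  by rewrite (le_trans y0)//= (le_lt_trans zx).
have hf := Ig_I01_continuous cf.
have hfs : mu.-integrable `[y, x]%classic (EFin \o f).
  by apply: integrableS hf => //.
have -> : F x - F y = \int[mu]_(z in `[y, x]%classic) f z.
  rewrite /Rintegral (@continuous_FTC2 R f F)//.
  - exact: continuous_subspaceT.
  - split.
    + by move=> z _; have [] := dF z.
    + exact/cvg_at_right_filter/cF.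
    + exact/cvg_at_left_filter/cF.
  - by move=> z _; rewrite derive1E; have [] := dF z.
apply: (le_trans (le_normr_Rintegral _ hfs)) => //.
rewrite /Rintegral fine_le//.
- by apply: integrable_fin_num => //; exact: (Ig_abs hfs).
- by apply: integrable_fin_num => //; exact: (Ig_abs hf).
apply: ge0_subset_integral => //.
by apply/measurable_EFinP; apply: measurableT_comp.
Qed.

(** Average [|F x| <= |F z| + |F x - F z|] over [z] in the unit interval. *)
Lemma slice_bound (F f : R -> R) (x : R) : continuous f ->
  (forall z : R, is_derive z (1 : R) F (f z)) -> I01 x ->
  `|F x| <= \int[mu]_(z in I01) (`|F z| + `|f z|).
Proof.
move=> cf dF Ix.
have cF : continuous F.
  by move=> z; apply: differentiable_continuous; apply/derivable1_diffP; have [] := dF z.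
have hF := Ig_abs (Ig_I01_continuous cF); have hf := Ig_abs (Ig_I01_continuous cf).
rewrite RintegralD// -[leLHS]Rint_cst1.
apply: (@le_trans _ _ (\int[mu]_(z in I01) (`|F z| + \int[mu]_(z in I01) `|f z|))).
  apply: le_Rintegral => //; [exact: Ig_cst|by apply: IgD => //; exact: Ig_cst|].
  move=> z Iz; rewrite -lerBlDl (le_trans (lerB_dist _ _))//.
  exact: increment_le.
by rewrite RintegralD ?Rint_cst1//; exact: Ig_cst.
Qed.

End Slice.

Section GagliardoNirenberg.
Context {R : realType}.
Local Notation mu := (@lebesgue_measure R).
Local Notation mu2 := (@lebesgue_measure R \x @lebesgue_measure R)%E.
Local Notation I01 := (@I01 R).
Local Notation cell := (@cell R).
Local Notation Ig f := (mu2.-integrable cell (EFin \o f)).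
Let mI : measurable I01 := @measurable_I01 R.
Let fI : (mu I01 < +oo)%E := @fin_I01 R.
Let mC : measurable cell := @measurable_cell R.
Let fC : (mu2 cell < +oo)%E := @fin_cell R.

(** Gagliardo's argument: by [slice_bound] along the two lines through a point, the square of [f] is
    at most a function of the first coordinate times a function of the second, and the integral of
    such a product factorises. *)
Lemma product_slice_bound (f f1 f2 : R * R -> R) :
  (forall x2, continuous (fun x1 => f1 (x1, x2))) ->
  (forall x1, continuous (fun x2 => f2 (x1, x2))) ->
  (forall x2 x1 : R, is_derive x1 (1 : R) (fun x1 => f (x1, x2)) (f1 (x1, x2))) ->
  (forall x1 x2 : R, is_derive x2 (1 : R) (fun x2 => f (x1, x2)) (f2 (x1, x2))) ->
  Ig f -> Ig f1 -> Ig f2 -> Ig (fun x => f x ^+ 2) ->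
  \int[mu2]_(x in cell) f x ^+ 2 <=
  (\int[mu2]_(x in cell) (`|f x| + `|f1 x|)) * \int[mu2]_(x in cell) (`|f x| + `|f2 x|).
Proof.
move=> c1 c2 d1 d2 hf hf1 hf2 hff.
have h1 : Ig (fun x => `|f x| + `|f1 x|) by apply: IgD => //; exact: Ig_abs.
have h2 : Ig (fun x => `|f x| + `|f2 x|) by apply: IgD => //; exact: Ig_abs.
pose A y := \int[mu]_(x in I01) (`|f (x, y)| + `|f1 (x, y)|).
pose B x := \int[mu]_(y in I01) (`|f (x, y)| + `|f2 (x, y)|).
have hA : mu.-integrable I01 (EFin \o A) := Fubini_Ig2 mI mI h1.
have hB : mu.-integrable I01 (EFin \o B) := Fubini_Ig1 mI mI h2.
have hBA : Ig (fun x => B x.1 * A x.2) by exact: (Ig_tensor mI mI hB hA).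
apply: (@le_trans _ _ (\int[mu2]_(x in cell) (B x.1 * A x.2))).
  apply: le_Rintegral => // -[x y] /= [Ix Iy].
  rewrite -real_normK ?num_real// expr2 mulrC; apply: ler_pM => //.
    exact: (slice_bound (c2 x) (d2 x) Iy).
  exact: (slice_bound (c1 y) (d1 y) Ix).
rewrite cellE (Fubini_Rint1 mI mI hBA) (Fubini_Rint2 mI mI h1) (Fubini_Rint1 mI mI h2).
rewrite mulrC -[leRHS]RintegralZr//.
apply: le_Rintegral => //.
- exact: (Fubini_Ig1 mI mI hBA).
- have := IgZ mI (\int[mu]_(y in I01) A y) hB.
  by apply: eq_Ig => // x _; rewrite mulrC.
- by move=> x _; rewrite /= -/(B x) Rint_Zl.
Qed.


Definition span2 N (c : mode N -> R) (x : R * R) : R := wt N * \sum_m c m * e2 m x.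
(** Coefficients of the partial derivative of [span2 c] in direction [a]; see [is_derive_span1] and
    [is_derive_span2]. *)
Definition dcoef N (a : 'I_2) (c : mode N -> R) (m : mode N) : R := sg a m * c (flip a m).

Lemma flipK N a : involutive (@flip N a).
Proof. by move=> [m n]; rewrite /flip; case: (a == 0) => /=; rewrite flip1K. Qed.

Lemma sg_flip N a (m : mode N) : sg a (flip a m) = - sg a m :> R.
Proof. by rewrite /sg /flip; case: (a == 0) => /=; exact: sg1_flip1. Qed.

Lemma is_derive_fsum (V : normedModType R) (x v : V) (I : Type) (r : seq I) (h : I -> V -> R) (dh : I -> R) :
  (forall i, is_derive x v (h i) (dh i)) ->
  is_derive x v (fun y => \sum_(i <- r) h i y) (\sum_(i <- r) dh i).
Proof.
move=> H; elim: r => [|i r IH].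
  rewrite big_nil (_ : (fun _ => _) = cst 0); first exact: is_derive_cst.
  by apply/funext => y; rewrite big_nil.
rewrite big_cons (_ : (fun _ => _) = h i + (fun y => \sum_(j <- r) h j y)).
  exact: is_deriveD.
by apply/funext => y; rewrite big_cons.
Qed.

Lemma span_dcoef N (a : 'I_2) (c : mode N -> R) x :
  span2 (dcoef a c) x = wt N * \sum_m c m * (- sg a m * e2 (flip a m) x).
Proof.
rewrite /span2 (reindex_inj (inv_inj (@flipK N a))); congr (_ * _).
apply: eq_bigr => m _ /=; rewrite /dcoef flipK sg_flip; ring.
Qed.

Lemma is_derive_span1 N (c : mode N -> R) (x1 x2 : R) :
  is_derive x1 (1 : R) (fun y => span2 c (y, x2)) (span2 (dcoef 0 c) (x1, x2)).
Proof.
rewrite span_dcoef /span2.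
have H : is_derive x1 (1 : R) (fun y => \sum_m c m * e2 m (y, x2))
    (\sum_m c m * (- sg 0 m * e2 (flip 0 m) (x1, x2))).
  apply: is_derive_fsum => m.
  have := is_deriveZ (c m * tr1 m.2 x2) (is_derive_tr1 m.1 x1).
  rewrite /e2 /sg /flip eqxx /= => h.
  rewrite (_ : (fun y => _) = (c m * tr1 m.2 x2) \*: tr1 m.1); last first.
    by apply/funext => y; rewrite /= mulrCA mulrC.
  by apply: (is_derive_eq h); rewrite /GRing.scale /=; ring.
exact: (is_deriveZ (wt N) H).
Qed.

Lemma is_derive_span2 N (c : mode N -> R) (x1 x2 : R) :
  is_derive x2 (1 : R) (fun y => span2 c (x1, y)) (span2 (dcoef 1 c) (x1, x2)).
Proof.
rewrite span_dcoef /span2.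
have H : is_derive x2 (1 : R) (fun y => \sum_m c m * e2 m (x1, y))
    (\sum_m c m * (- sg 1 m * e2 (flip 1 m) (x1, x2))).
  apply: is_derive_fsum => m.
  have := is_deriveZ (c m * tr1 m.1 x1) (is_derive_tr1 m.2 x2).
  rewrite /e2 /sg /flip /= => h.
  rewrite (_ : (fun y => _) = (c m * tr1 m.1 x1) \*: tr1 m.2); last first.
    by apply/funext => y; rewrite /= mulrA.
  by apply: (is_derive_eq h); rewrite /GRing.scale /=; ring.
exact: (is_deriveZ (wt N) H).
Qed.

Definition bounded_measurable (f : R * R -> R) :=
  measurable_fun cell f /\ exists M : R, forall x, `|f x| <= M.

Lemma bm_Ig f : bounded_measurable f -> Ig f.
Proof. by move=> [mf [M fM]]; apply: (Ig_bounded mC fC mf (fun x _ => fM x)). Qed.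

Lemma bmM f g : bounded_measurable f -> bounded_measurable g ->
  bounded_measurable (fun x => f x * g x).
Proof.
move=> [mf [M fM]] [mg [L gL]]; split; first exact: measurable_funM.
by exists (M * L) => x; rewrite normrM ler_pM.
Qed.

Lemma bmD f g : bounded_measurable f -> bounded_measurable g ->
  bounded_measurable (fun x => f x + g x).
Proof.
move=> [mf [M fM]] [mg [L gL]]; split; first exact: measurable_funD.
by exists (M + L) => x; rewrite (le_trans (ler_normD _ _))// lerD.
Qed.

Lemma bm_cst (c : R) : bounded_measurable (fun=> c).
Proof. by split; [exact: measurable_cst|exists `|c|]. Qed.

Lemma bm_abs f : bounded_measurable f -> bounded_measurable (fun x => `|f x|).
Proof.
by move=> [mf [M fM]]; split; [exact: measurableT_comp|exists M => x; rewrite normr_id].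
Qed.

Lemma bmX f k : bounded_measurable f -> bounded_measurable (fun x => f x ^+ k).
Proof.
move=> hf; elim: k => [|k IH].
  by rewrite (_ : (fun _ => _) = fun=> 1); [exact: bm_cst|apply/funext => x; rewrite expr0].
rewrite (_ : (fun _ => _) = fun x => f x * f x ^+ k); first exact: bmM.
by apply/funext => x; rewrite exprS.
Qed.

Lemma bm_span N (c : mode N -> R) : bounded_measurable (span2 c).
Proof.
split; last first.
  exists (wt N * \sum_m `|c m|) => x; rewrite normrM ger0_norm ?wt_ge0// ler_wpM2l ?wt_ge0//.
  apply: (le_trans (ler_norm_sum _ _ _)); apply: ler_sum => m _.
  by rewrite normrM ler_piMr// abs_e2_le1.
apply: measurable_funM; first exact: measurable_cst.
apply: measurable_sum => m; apply: measurable_funM; first exact: measurable_cst.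
exact: measurable_e2.
Qed.

Let cont_of_derive (f df : R -> R) : (forall x : R, is_derive x (1 : R) f (df x)) -> continuous f.
Proof.
by move=> H x; apply: differentiable_continuous; apply/derivable1_diffP; have [] := H x.
Qed.

Lemma continuous_span1 N (c : mode N -> R) x2 : continuous (fun x1 => span2 c (x1, x2)).
Proof. by apply: cont_of_derive => x; exact: is_derive_span1. Qed.

Lemma continuous_span2 N (c : mode N -> R) x1 : continuous (fun x2 => span2 c (x1, x2)).
Proof. by apply: cont_of_derive => x; exact: is_derive_span2. Qed.

Definition moment N (c : mode N -> R) k : R := \int[mu2]_(x in cell) (span2 c x ^+ k) ^+ 2.
Definition dirichlet N (c : mode N -> R) : R :=
  \int[mu2]_(x in cell) span2 (dcoef 0 c) x ^+ 2 + \int[mu2]_(x in cell) span2 (dcoef 1 c) x ^+ 2.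

Lemma moment_ge0 N (c : mode N -> R) k : 0 <= moment c k.
Proof. by apply: Rintegral_ge0 => x _; exact: sqr_ge0. Qed.

Lemma dirichlet_ge0 N (c : mode N -> R) : 0 <= dirichlet c.
Proof. by apply: addr_ge0; apply: Rintegral_ge0 => x _; exact: sqr_ge0. Qed.

(** [product_slice_bound] is applied to the power [k.+1] of the polynomial, whose derivatives carry
    a factor of power [k]; Cauchy-Schwarz extracts that factor from both integrals as
    [moment c k]. *)
Lemma momentS N (c : mode N -> R) k :
  moment c k.+1 <= 2 * k.+1%:R ^+ 2 * moment c k * (moment c 1 + dirichlet c).
Proof.
pose f x := span2 c x ^+ k.+1.
pose fa a x := k.+1%:R * span2 c x ^+ k * span2 (dcoef a c) x.
have bs := bm_span c; have bd a := bm_span (dcoef a c).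
have bfa a : bounded_measurable (fa a).
  by apply: bmM => //; apply: bmM; [exact: bm_cst|exact: bmX].
have bf : bounded_measurable f by exact: bmX.
have cX (g : R -> R) n : continuous g -> continuous (fun x => g x ^+ n).
  by move=> cg x; apply: (@continuous_comp _ _ _ g (fun z : R => z ^+ n));
     [exact: cg|exact: exprn_continuous].
have pow_derive (g : R -> R) (dg x : R) : is_derive x (1 : R) g dg ->
    is_derive x (1 : R) (fun y => g y ^+ k.+1) (k.+1%:R * g x ^+ k * dg).
  move=> h; have -> : (fun y => g y ^+ k.+1) = g ^+ k.+1 by apply/funext => y; rewrite fctE.
  by apply: is_derive_eq; rewrite /= mulr_natl.
have H : moment c k.+1 <= (\int[mu2]_(x in cell) (`|f x| + `|fa 0 x|)) *
    \int[mu2]_(x in cell) (`|f x| + `|fa 1 x|).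
  apply: product_slice_bound; try exact: bm_Ig; last exact/bm_Ig/bmX.
  - move=> x2 x; apply: cvgM; last exact: continuous_span1.
    by apply: cvgM; [exact: cvg_cst|exact: (cX (fun x1 => span2 c (x1, x2)) k (@continuous_span1 _ c x2) x)].
  - move=> x1 x; apply: cvgM; last exact: continuous_span2.
    by apply: cvgM; [exact: cvg_cst|exact: (cX (fun x2 => span2 c (x1, x2)) k (@continuous_span2 _ c x1) x)].
  - by move=> x2 x1; apply: pow_derive; exact: is_derive_span1.
  - by move=> x1 x2; apply: pow_derive; exact: is_derive_span2.
have X a : (\int[mu2]_(x in cell) (`|f x| + `|fa a x|)) ^+ 2 <= moment c k *
   (2 * moment c 1 + 2 * k.+1%:R ^+ 2 * \int[mu2]_(x in cell) span2 (dcoef a c) x ^+ 2).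
  pose h x := `|span2 c x| + k.+1%:R * `|span2 (dcoef a c) x|.
  have bh : bounded_measurable h.
    by apply: bmD; [exact: bm_abs|apply: bmM; [exact: bm_cst|exact: bm_abs]].
  have -> : (fun x => `|f x| + `|fa a x|) = (fun x => `|span2 c x ^+ k| * h x).
    apply/funext => x; rewrite /f /fa /h exprS !normrM (normr_nat _ k.+1); ring.
  have bk : bounded_measurable (fun x => `|span2 c x ^+ k|) by apply: bm_abs; exact: bmX.
  apply: le_trans (cauchy_schwarz_Rint mC _ _ _) _; try exact/bm_Ig/bmX.
    by apply: bm_Ig; exact: bmM.
  have -> : \int[mu2]_(x in cell) `|span2 c x ^+ k| ^+ 2 = moment c k.
    by apply: eq_Rint => x _; rewrite real_normK ?num_real.
  rewrite ler_wpM2l ?moment_ge0//.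
  have b1 : bounded_measurable (fun x => 2 * (span2 c x ^+ 1) ^+ 2).
    by apply: bmM; [exact: bm_cst|apply: bmX; exact: bmX].
  have b2 : bounded_measurable (fun x => 2 * k.+1%:R ^+ 2 * span2 (dcoef a c) x ^+ 2).
    by apply: bmM; [exact: bm_cst|exact: bmX].
  rewrite /moment -!Rint_Zl//; try by apply/bm_Ig; repeat apply: bmX.
  rewrite -RintegralD//; try exact: bm_Ig.
  apply: le_Rintegral => //; [exact/bm_Ig/bmX|exact/bm_Ig/bmD|].
  move=> x _; rewrite /h expr1.
  rewrite -(real_normK (num_real (span2 c x))) -(real_normK (num_real (span2 (dcoef a c) x))).
  exact: sqr_sum_le.
have n1 : 1 <= k.+1%:R ^+ 2 :> R by rewrite exprn_ege1// ler1n.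
apply: gn_step H (X 0) (X 1) n1 (moment_ge0 c k) (moment_ge0 c 1) _ _;
  by apply: Rintegral_ge0 => x _; exact: sqr_ge0.
Qed.

Fixpoint gn_const (k : nat) : R :=
  if k is j.+1 then 2 * k.+1%:R ^+ 2 * gn_const j else 1.

Lemma gn_const_ge0 k : 0 <= gn_const k.
Proof. by elim: k => [|k IH] //=; rewrite mulr_ge0// mulr_ge0// sqr_ge0. Qed.

(** Iterating [momentS] gives the embedding of H^1 into every L^(2k+2) in the multiplicative form
    that keeps one factor [moment c 1], the squared L^2 norm. *)
Lemma moment_le N (c : mode N -> R) k :
  moment c k.+1 <= gn_const k * moment c 1 * (moment c 1 + dirichlet c) ^+ k.
Proof.
have H0 : 0 <= moment c 1 + dirichlet c by rewrite addr_ge0 ?moment_ge0 ?dirichlet_ge0.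
elim: k => [|k IH]; first by rewrite /= mul1r mulr1.
apply: (le_trans (momentS c k.+1)).
move: IH H0; rewrite [gn_const k.+1]/=; move: (_ + _) (moment c k.+1) => S M IH S0.
rewrite [S ^+ k.+1]exprSr -2!mulrA -3!mulrA ler_wpM2l// ler_wpM2l ?sqr_ge0//.
by rewrite !mulrA ler_wpM2r.
Qed.

End GagliardoNirenberg.

(** * Quadratic forms weighted by a power of an L^p function *)

Section WeightedBound.
Context {R : realType}.
Local Notation mu2 := (@lebesgue_measure R \x @lebesgue_measure R)%E.
Local Notation cell := (@cell R).
Local Notation Ig f := (mu2.-integrable cell (EFin \o f)).

Lemma powR_le1 (x s : R) : 0 <= x -> x <= 1 -> 0 <= s -> x `^ s <= 1.
Proof.
move=> x0 x1 s0; rewrite (_ : 1 = 1 `^ s); last by rewrite powR1.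
by apply: ge0_ler_powR; rewrite ?nnegrE.
Qed.

(** The total exponent is (p - 2)(k + 2)/(k + 1), and it is at most p exactly when p <= 2 (k +
    2). *)
Lemma powR_interp (p x : R) (k : nat) : 2 <= p -> p <= 2 * k.+2%:R -> 0 <= x ->
  x `^ (p - 2) * (x `^ (p - 2)) `^ k.+1%:R^-1 <= 1 + x `^ p.
Proof.
move=> p2 pk x0; have p0 : p != 0 by apply: lt0r_neq0; lra.
set r := p - 2; have r0 : 0 <= r by rewrite /r; lra.
have [x1|x1] := leP x 1.
  rewrite -[leLHS]mulr1 -[leLHS]mulr1 -(mulr1 (1 + _)).
  rewrite !mulr1 -powRrM (@le_trans _ _ 1)//; last by rewrite lerDl powR_ge0.
  by rewrite mulr_ile1 ?powR_ge0 ?powR_le1// mulr_ge0 ?invr_ge0.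
rewrite -powRrM -powRD; last by rewrite (gt_eqF (lt_trans ltr01 x1)) implybT.
rewrite (@le_trans _ _ (x `^ p)) ?lerDr//; apply: ler_powR; first exact: ltW.
have k0 : 0 < k.+1%:R :> R by [].
rewrite -(ler_pM2r k0) mulrDl mulfVK ?gt_eqF//.
have -> : k.+1%:R = k.+2%:R - 1 :> R by rewrite -(natr1 k.+1) addrK.
move: pk; rewrite /r; move: (k.+2%:R) => n pk; lra.
Qed.

(** [young_split] separates the weight, whose power is controlled by the L^p bound, from a moment of
    order 2 (k + 2), controlled by [moment_le]. A threshold proportional to the squared H^1 norm
    makes the first part [eps] times that norm and cancels the power of it in the second, leaving a
    multiple of the L^2 part. The number [k] depends on [p] only. *)
Lemma weighted_span_le (p A eps : R) : 2 <= p -> 0 <= A -> 0 < eps ->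
  exists2 C : R, 0 <= C & forall N (c : mode N -> R) (f : R * R -> R),
    measurable_fun cell f -> (forall x, 0 <= f x) -> Ig (fun x => f x `^ p) ->
    \int[mu2]_(x in cell) f x `^ p <= A ->
    \int[mu2]_(x in cell) (f x `^ (p - 2) * span2 c x ^+ 2) <=
      eps * (moment c 1 + dirichlet c) + C * moment c 1.
Proof.
move=> p2 A0 eps0; have mC := @measurable_cell R.
have [k pk] : exists k : nat, p <= 2 * k.+2%:R.
  have [k kp] : exists k : nat, p <= k%:R.
    by exists (Num.bound p); apply: ltW; apply: archi_boundP; exact: le_trans p2.
  exists k; rewrite (le_trans kp)// -natrM ler_nat.
  by rewrite mul2n -addnn addSn ltnW// ltnS (leq_trans _ (leq_addr _ _))// -addn2 leq_addr.
have A1 : 0 < 1 + A by rewrite ltr_pwDl.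
have p20 : 0 <= p - 2 by rewrite subr_ge0.
pose L := ((1 + A) / eps) ^+ k.+1 * gn_const k.+1.
exists L; first by rewrite mulr_ge0 ?gn_const_ge0// exprn_ge0// divr_ge0 ?ltW.
move=> N c f mf f0 hf fA.
have mfr (r : R) : measurable_fun cell (fun x => f x `^ r).
  exact: (measurableT_comp (measurable_powR r)).
set M := moment c 1; set D := dirichlet c.
have M0 : 0 <= M := moment_ge0 c 1; have D0 : 0 <= D := dirichlet_ge0 c.
have hfr : Ig (fun x => f x `^ (p - 2)).
  apply: (Ig_le mC _ _ (IgD mC (Ig_cst mC 1 (@fin_cell R)) hf)); first exact: mfr.
  move=> x _; rewrite ger0_norm ?powR_ge0//; have [x1|x1] := leP (f x) 1.
    by rewrite (@le_trans _ _ 1) ?lerDl ?powR_ge0// powR_le1.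
  rewrite (@le_trans _ _ (f x `^ p)) ?lerDr//; apply: ler_powR; first exact: ltW.
  by rewrite gerBl.
have [ms2 [B HB]] := bmX 2 (bm_span c).
have hl : Ig (fun x => f x `^ (p - 2) * span2 c x ^+ 2).
  by apply: (IgM_bounded mC hfr ms2 (M := B)) => x _; exact: HB.
apply/ler_addgt0Pr => eta eta0.
(* The extra [eta / eps] keeps [H] positive when the polynomial vanishes; it costs [eta], which is
   arbitrary. *)
pose H := M + D + eta / eps.
have H0 : 0 < H by apply: ltr_wpDl; [exact: addr_ge0|exact: divr_gt0].
pose th := eps * H / (1 + A).
have th0 : 0 < th by apply: divr_gt0 => //; exact: mulr_gt0.
have hw : Ig (fun x => f x `^ (p - 2) * (f x `^ (p - 2)) `^ k.+1%:R^-1).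
  apply: (Ig_le mC _ _ (IgD mC (Ig_cst mC 1 (@fin_cell R)) hf)).
    apply: measurable_funM => //; apply: (measurableT_comp (measurable_powR _)).
    exact: mfr.
  by move=> x _; rewrite ger0_norm ?mulr_ge0 ?powR_ge0//; exact: powR_interp.
have hs : Ig (fun x => (span2 c x ^+ k.+2) ^+ 2) by apply: bm_Ig; apply: bmX; apply: bmX; exact: bm_span.
apply: (@le_trans _ _ (th * (1 + A) + th^-1 ^+ k.+1 * moment c k.+2)).
  apply: (@le_trans _ _ (\int[mu2]_(x in cell) (th * (f x `^ (p - 2) * (f x `^ (p - 2)) `^ k.+1%:R^-1)
     + th^-1 ^+ k.+1 * (span2 c x ^+ k.+2) ^+ 2))).
    apply: le_Rintegral => //; first by apply: IgD => //; exact: IgZ.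
    move=> x _; rewrite -exprM mulnC exprM.
    by apply: young_split => //; [exact: powR_ge0|exact: sqr_ge0].
  rewrite RintegralD//; [|exact: IgZ..].
  rewrite !Rint_Zl// lerD2r ler_wpM2l ?(ltW th0)//.
  apply: (@le_trans _ _ (\int[mu2]_(x in cell) (1 + f x `^ p))).
    apply: le_Rintegral => //; first by apply: IgD => //; exact: Ig_cst (@fin_cell R).
    by move=> x _; exact: powR_interp.
  rewrite RintegralD//; last exact: Ig_cst (@fin_cell R).
  rewrite Rintegral_cst// [X in _ * fine X](mu_cell (R := R)) /= mulr1.
  by rewrite lerD2l.
have -> : th * (1 + A) = eps * (M + D) + eta.
  by rewrite /th mulfVK ?gt_eqF// /H mulrDr mulrCA mulfV ?mulr1// gt_eqF.
rewrite addrAC lerD2r lerD2l.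
apply: (@le_trans _ _ (th^-1 ^+ k.+1 * (gn_const k.+1 * M * H ^+ k.+1))).
  rewrite ler_wpM2l ?exprn_ge0 ?invr_ge0 ?(ltW th0)//.
  apply: (le_trans (moment_le c k.+1)).
  apply: ler_wpM2l; first by apply: mulr_ge0 => //; exact: gn_const_ge0.
  apply: lerXn2r; rewrite ?nnegrE ?(ltW H0)//; first exact: addr_ge0.
  by rewrite /H lerDl divr_ge0// ltW.
have -> : th^-1 = (1 + A) / eps / H.
  by rewrite /th invf_div invfM mulrA.
have HN : H ^+ k.+1 != 0 by rewrite expf_neq0// gt_eqF.
rewrite exprMn exprVn /L; move: (_ ^+ k.+1) (H ^+ k.+1) HN (gn_const k.+1) => a h hn g.
by rewrite le_eqVlt; apply/orP; left; apply/eqP; field.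
Qed.

End WeightedBound.

(* Rounding the entries of [F] to multiples of [1/N] gives a measurable map with
   countably many values, so no Borel structure on matrices is needed. *)
Lemma measurable_continuous_mx d (T : measurableType d) (R : realType) (D : set T)
    m n (h : 'M[R]_(m.+1, n.+1) -> R) (F : T -> 'M[R]_(m.+1, n.+1)) :
  measurable D -> continuous h ->
  (forall i j, measurable_fun D (fun x => F x i j)) -> measurable_fun D (fun x => h (F x)).
Proof.
move=> mD ch mF.
pose k N x : 'M[int]_(m.+1, n.+1) := \matrix_(i, j) Num.floor (N.+1%:R * F x i j).
pose r N (k : 'M[int]_(m.+1, n.+1)) : 'M[R]_(m.+1, n.+1) := \matrix_(i, j) ((k i j)%:~R / N.+1%:R).
apply: (measurable_fun_cvg (h := fun N x => h (r N (k N x)))).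
  move=> N _ B mB.
  pose A (k0 : 'M[int]_(m.+1, n.+1)) : set T := \bigcap_(ij in [set: 'I_m.+1 * 'I_n.+1])
    (D `&` (fun x => F x ij.1 ij.2) @^-1` `[(k0 ij.1 ij.2)%:~R / N.+1%:R, (k0 ij.1 ij.2 + 1)%:~R / N.+1%:R[).
  have mA k0 : measurable (A k0).
    apply: fin_bigcap_measurable; first exact: finite_finset.
    by move=> ij _; apply: mF => //; exact: measurable_itv.
  have AE k0 x : A k0 x <-> D x /\ k N x = k0.
    have N0 : 0 < N.+1%:R :> R by [].
    split=> [Ax|[Dx kx] [i j] _].
      split; first by case: (Ax (ord0, ord0) I).
      apply/matrixP => i j; rewrite mxE; case: (Ax (i, j) I) => _ /=.
      rewrite in_itv /= ler_pdivrMr// ltr_pdivlMr// mulrC => /andP[a b].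
      by apply: floor_def; rewrite a.
    split=> //=; rewrite in_itv /= ler_pdivrMr// ltr_pdivlMr// mulrC.
    by rewrite -kx mxE; exact: floor_itv.
  rewrite (_ : _ `&` _ = \bigcup_j (if unpickle j is Some k0 then
      if `[< B (h (r N k0)) >] then A k0 else set0 else set0)).
    apply: bigcup_measurable => j _; case: unpickle => [k0|]; last exact: measurable0.
    by case: ifP => _; [exact: mA|exact: measurable0].
  apply/seteqP; split=> x.
    move=> [Dx Bx]; exists (pickle (k N x)) => //; rewrite pickleK.
    by case: asboolP => // _; exact/AE.
  move=> [j _]; case: unpickle => [k0|//]; case: asboolP => // Bk /AE[Dx kx].
  by split=> //=; rewrite kx.
move=> x Dx; apply: continuous_cvg; first exact: ch.
apply/cvgrPdist_le => e e0; near=> N.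
rewrite -[leLHS]/(mx_norm _) mx_normrE; apply: bigmax_le; first exact: ltW.
move=> [i j] _; rewrite !mxE /=.
have N0 : 0 < N.+1%:R :> R by [].
have Ne : N.+1%:R^-1 <= e by apply: ltW; near: N; exact: (near_infty_natSinv_lt (PosNum e0)).
have /andP[a b] := floor_itv (N.+1%:R * F x i j).
rewrite intrD in b.
have -> : F x i j - (Num.floor (N.+1%:R * F x i j))%:~R / N.+1%:R =
  (N.+1%:R * F x i j - (Num.floor (N.+1%:R * F x i j))%:~R) / N.+1%:R.
  by rewrite mulrBl mulrAC mulfV ?mul1r// gt_eqF.
rewrite normrM [X in _ * X]ger0_norm ?invr_ge0// (le_trans _ Ne)//.
by rewrite ler_piMl ?invr_ge0// ger0_norm ?subr_ge0// lerBlDl ltW// addrC.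
Unshelve. all: by end_near.
Qed.

(** * The H^-1 energy of finitely many modes and its power *)

Section ModeAlgebra.
Context {R : realType} (N : nat).
Implicit Types (Z w c : mode N -> R) (g : 'I_2 -> mode N -> R).

(** The symbol of minus the Laplacian. *)
Definition ksq (m : mode N) : R := \sum_a sg a m ^+ 2.

Lemma sg_flip2 a b (m : mode N) : sg a (flip b m) ^+ 2 = sg a m ^+ 2 :> R.
Proof.
by rewrite /sg /flip; case: (a == 0); case: (b == 0) => //=; rewrite sg1_flip1 sqrrN.
Qed.

Lemma ksq_flip a (m : mode N) : ksq (flip a m) = ksq m.
Proof. by apply: eq_bigr => b _; exact: sg_flip2. Qed.

Lemma ksq_ge0 (m : mode N) : 0 <= ksq m.
Proof. by apply: sumr_ge0 => a _; exact: sqr_ge0. Qed.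

Lemma sg_le_ksq a (m : mode N) : sg a m ^+ 2 <= ksq m.
Proof. by apply: term_le_sum => b; exact: sqr_ge0. Qed.

Lemma ksqV_sg a (m : mode N) : (ksq m)^-1 * ksq m * sg a m = sg a m.
Proof.
have [k0|k0] := eqVneq (ksq m) 0; last by rewrite mulVf// mul1r.
have := sg_le_ksq a m; rewrite k0 => h.
have /eqP : sg a m ^+ 2 = 0 :> R by apply/eqP; rewrite eq_le h sqr_ge0.
by rewrite sqrf_eq0 => /eqP->; rewrite !mulr0.
Qed.

Lemma reindex_flip a (f : mode N -> R) : \sum_m f m = \sum_m f (flip a m).
Proof. by rewrite (reindex_inj (inv_inj (@flipK N a))). Qed.

Lemma sum_dcoef_sqr c : \sum_a \sum_m dcoef a c m ^+ 2 = \sum_m ksq m * c m ^+ 2.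
Proof.
under eq_bigr => a _ do rewrite (reindex_flip a).
rewrite exchange_big; apply: eq_bigr => m _; rewrite /ksq mulr_suml.
by apply: eq_bigr => a _; rewrite /dcoef flipK exprMn sg_flip sqrrN.
Qed.

(** Coefficients of the field psi = grad (-Lap)^-1 w. Modes of zero frequency drop out because the
    inverse of 0 is 0. *)
Definition lift_grad w a (m : mode N) : R := (ksq m)^-1 * dcoef a w m.
(** The factor [(ksq m)^-1 * ksq m] is 1 except at zero frequency, where it is 0: this is the
    squared norm of [w] without its mean. *)
Definition dissip w : R := \sum_m (ksq m)^-1 * ksq m * w m ^+ 2.
(** Half the sum of the squared H^-1 norms of w - Lap Z and of w. *)
Definition mode_energy Z w : R :=
  2^-1 * \sum_m (ksq m)^-1 * ((ksq m * Z m + w m) ^+ 2 + w m ^+ 2).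
(** Coefficients of the divergence of the field with coefficients [g]. *)
Definition forcing g (m : mode N) : R := \sum_a sg a m * g a (flip a m).
(** The time derivative of [mode_energy] along Z' = w and w' = div g + Lap w; then w - Lap Z has
    derivative div g. *)
Definition mode_power Z w g : R :=
  \sum_m (ksq m)^-1 * (ksq m * (Z m * forcing g m) + 2 * (w m * forcing g m) - ksq m * w m ^+ 2).

Lemma sum_lift_grad_sqr w :
  \sum_a \sum_m lift_grad w a m ^+ 2 = \sum_m (ksq m)^-1 * w m ^+ 2.
Proof.
under eq_bigr => a _ do rewrite (reindex_flip a).
rewrite exchange_big; apply: eq_bigr => m _.
transitivity ((ksq m)^-1 ^+ 2 * ksq m * w m ^+ 2); last first.
  have [->|k0] := eqVneq (ksq m) 0; first by rewrite invr0 expr0n /= !mul0r.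
  by move: (ksq m) k0 (w m) => k k0 x; field.
rewrite /ksq mulr_sumr mulr_suml.
apply: eq_bigr => a _; rewrite /lift_grad /dcoef flipK sg_flip -/(ksq _) ksq_flip.
by rewrite exprMn exprMn sqrrN mulrA.
Qed.

Lemma sum_ksq_lift_grad_sqr w :
  \sum_a \sum_m ksq m * lift_grad w a m ^+ 2 = dissip w.
Proof.
under eq_bigr => a _ do rewrite (reindex_flip a).
rewrite exchange_big; apply: eq_bigr => m _.
transitivity ((ksq m)^-1 ^+ 2 * ksq m * ksq m * w m ^+ 2); last first.
  have [->|k0] := eqVneq (ksq m) 0; first by rewrite !mulr0 !mul0r.
  by move: (ksq m) k0 (w m) => k k0 x; field.
rewrite [X in _ = _ * X * _]/ksq mulr_sumr mulr_suml.
apply: eq_bigr => a _; rewrite /lift_grad /dcoef flipK sg_flip ksq_flip.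
by rewrite !exprMn sqrrN; ring.
Qed.

(** Summation by parts: reindexing by [flip] moves the divergence from [g] onto Z and onto (-Lap)^-1
    w, producing the two gradients [dcoef] and [lift_grad]. *)
Lemma mode_power_identity Z w g : mode_power Z w g =
  - (\sum_a \sum_m dcoef a Z m * g a m) - 2 * (\sum_a \sum_m lift_grad w a m * g a m) - dissip w.
Proof.
have e1 : \sum_a \sum_m dcoef a Z m * g a m = - \sum_m Z m * forcing g m.
  under eq_bigr => a _ do rewrite (reindex_flip a).
  rewrite exchange_big -sumrN; apply: eq_bigr => m _; rewrite /forcing mulr_sumr -sumrN.
  by apply: eq_bigr => a _; rewrite /dcoef flipK sg_flip; ring.
have e2 : \sum_a \sum_m lift_grad w a m * g a m = - \sum_m (ksq m)^-1 * (w m * forcing g m).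
  under eq_bigr => a _ do rewrite (reindex_flip a).
  rewrite exchange_big -sumrN; apply: eq_bigr => m _; rewrite /forcing !mulr_sumr -sumrN.
  by apply: eq_bigr => a _; rewrite /lift_grad /dcoef flipK sg_flip ksq_flip; ring.
rewrite e1 e2 mulrN !opprK mulr_sumr /dissip /mode_power -big_split -sumrB /=.
apply: eq_bigr => m _; rewrite mulrBr mulrDr mulrA; congr (_ + _ - _); last by rewrite mulrA.
  rewrite /forcing !mulr_sumr; apply: eq_bigr => a _.
  (* The factor [(ksq m)^-1 * ksq m] may be inserted even at zero frequency, because [sg a m]
     vanishes there. *)
  by rewrite -[in RHS](ksqV_sg a m); ring.
by rewrite mulrCA.
Qed.

Lemma mode_energy_ge0 Z w : 0 <= mode_energy Z w.
Proof.
apply: mulr_ge0 => //; apply: sumr_ge0 => m _.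
by rewrite mulr_ge0 ?invr_ge0 ?ksq_ge0// addr_ge0// sqr_ge0.
Qed.

Lemma velocity_le_energy Z w : \sum_m (ksq m)^-1 * w m ^+ 2 <= 2 * mode_energy Z w.
Proof.
rewrite mulrA mulfV// mul1r; apply: ler_sum => m _.
by rewrite ler_wpM2l ?invr_ge0 ?ksq_ge0// lerDr sqr_ge0.
Qed.

(** [ksq m * Z m] is the difference of the two quantities squared in the energy, and the left-hand
    side is the squared norm of grad Z. *)
Lemma displacement_le_energy Z w : \sum_m ksq m * Z m ^+ 2 <= 4 * mode_energy Z w.
Proof.
rewrite /mode_energy mulrA (_ : 4 * 2^-1 = 2); last by lra.
rewrite mulr_sumr; apply: ler_sum => m _; have k0 := ksq_ge0 m.
have [->|kn0] := eqVneq (ksq m) 0; first by rewrite invr0 !mul0r mulr0.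
have -> : ksq m * Z m ^+ 2 = (ksq m)^-1 * (ksq m * Z m) ^+ 2 by field.
rewrite [leRHS]mulrCA ler_wpM2l ?invr_ge0//; move: (ksq m * Z m) (w m) => x y.
by have := sqr_ge0 (x + 2 * y); rewrite !sqrrD exprMn; lra.
Qed.

(* Completing the square in [x]; the capillary term is handled mode by mode. *)
Lemma capillary_le (x y z : R) : - ((x + y) * x) - 2 * ((x + y) * z) <= 2^-1 * y ^+ 2 + 2 * z ^+ 2.
Proof.
have h1 := sqr_ge0 (x + 2^-1 * y + z); have h2 := sqr_ge0 (2^-1 * y + z).
by rewrite !sqrrD !exprMn in h1 h2; lra.
Qed.

End ModeAlgebra.

(** * Integrability of the stress difference on a time slice *)

Lemma cvg_sum (R : realType) (T I : Type) (F : set_system T) (FF : Filter F) (r : seq I)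
    (f : I -> T -> R) (l : I -> R) : (forall i, f i x @[x --> F] --> l i) ->
  \sum_(i <- r) f i x @[x --> F] --> \sum_(i <- r) l i.
Proof.
move=> H; elim: r => [|i r IH].
  rewrite big_nil (_ : (fun x => _) = cst 0); first exact: cvg_cst.
  by apply/funext => x; rewrite big_nil.
rewrite big_cons (_ : (fun x => _) = (fun x => f i x + \sum_(j <- r) f j x)).
  exact: cvgD.
by apply/funext => x; rewrite big_cons.
Qed.

Lemma powR_sum3_le (R : realType) (p x y : R) : 0 <= p -> 0 <= x -> 0 <= y ->
  (1 + x + y) `^ p <= 3 `^ p * (1 + x `^ p + y `^ p).
Proof.
move=> p0 x0 y0; pose m := Num.max 1 (Num.max x y).
have m0 : 0 <= m by rewrite /m le_max ler01.
have h : m `^ p <= 1 + x `^ p + y `^ p.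
  have : [\/ m = 1, m = x | m = y].
    by rewrite /m /Num.max; do 2?case: ifP => _; by [constructor 1|constructor 2|constructor 3].
  have xp := powR_ge0 x p; have yp := powR_ge0 y p.
  by case=> ->; rewrite ?powR1; lra.
apply: (@le_trans _ _ ((3 * m) `^ p)).
  apply: ge0_ler_powR; rewrite ?nnegrE ?mulr_ge0// ?addr_ge0//.
  have [h1 h2 h3] : [/\ 1 <= m, x <= m & y <= m] by rewrite /m !le_max !lexx !orbT.
  by lra.
by rewrite powRM// ler_wpM2l// powR_ge0.
Qed.

Lemma ler_one_powR (R : realType) (q x : R) : 1 <= q -> 0 <= x -> x <= 1 + x `^ q.
Proof.
move=> q1 x0; have [x1|x1] := leP x 1; first by rewrite (le_trans x1)// lerDl powR_ge0.
by rewrite (@le_trans _ _ (x `^ q)) ?lerDr// -[leLHS]powRr1// ler_powR// ltW.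
Qed.

Section SliceBounds.
Context {R : realType} (W : 'M[R]_2 -> R) (p K : R).
Hypotheses (p2 : 2 <= p) (K0 : 0 < K) (W3 : is_Ck 3 W) (cW : H3_convex K W) (hW : hess_growth p W).
Local Notation mu2 := (@lebesgue_measure R \x @lebesgue_measure R)%E.
Local Notation cell := (@cell R).
Local Notation Ig f := (mu2.-integrable cell (EFin \o f)).
Let mC : measurable cell := @measurable_cell R.
Let fC : (mu2 cell < +oo)%E := @fin_cell R.
Let q := p / (p - 1).

(** The difference of the gradients of the convex function [Wtilde K W]. *)
Definition defect (F Fb : 'M[R]_2) : 'M[R]_2 := stress W F - stress W Fb + K *: (F - Fb).

Lemma conj_exponent : [/\ 0 < p, 0 < q, 1 <= q, q^-1 + p^-1 = 1 & q * (p - 1) = p].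
Proof.
have p0 : 0 < p by apply: lt_le_trans p2.
have p1 : 0 < p - 1 by move: p2 => h; lra.
split=> //.
- exact: divr_gt0.
- by rewrite /q ler_pdivlMr// mul1r lerBlDr lerDl.
- by rewrite /q invf_div -[X in _ + X]div1r -mulrDl subrK divff// gt_eqF.
- by rewrite /q divfK// gt_eqF.
Qed.

Lemma continuous_stress i a : continuous (fun F => stress W F i a).
Proof.
have [_ /(_ (delta_mx i a)) [_ [c _]]] := W3.
by rewrite (_ : (fun _ => _) = 'D_(delta_mx i a) W)//; apply/funext => F; rewrite mxE.
Qed.

(** The defect grows with power p - 1 and q (p - 1) = p, so the L^p bounds put it in L^q, in duality
    with the strain difference in L^p. *)
Lemma defect_growth : exists2 C : R, 0 < C & forall (F Fb : 'M[R]_2) i a,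
  `|defect F Fb i a| `^ q <= C * (1 + fnorm F `^ p + fnorm Fb `^ p) /\
  `|(F - Fb) i a| `^ p <= C * (1 + fnorm F `^ p + fnorm Fb `^ p).
Proof.
have [C C0 HC] := stress_growth p2 W3 hW.
have [p0 q0 _ _ qp] := conj_exponent.
have p1 : 0 <= p - 1 by move: p2 => h; lra.
exists ((4 * C + K) `^ q * 3 `^ p + 3 `^ p).
  by rewrite addr_gt0 ?powR_gt0// mulr_gt0// powR_gt0// addr_gt0// mulr_gt0.
move=> F Fb i a; set x := fnorm F; set y := fnorm Fb.
have x0 : 0 <= x := fnorm_ge0 F; have y0 : 0 <= y := fnorm_ge0 Fb.
have S0 : 0 <= 1 + x `^ p + y `^ p by rewrite !addr_ge0// powR_ge0.
have s1 : 1 <= 1 + x + y by rewrite -addrA lerDl addr_ge0.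
have H3 := powR_sum3_le (ltW p0) x0 y0.
have G : `|(F - Fb) i a| <= 1 + x + y.
  rewrite !mxE (le_trans (ler_normB _ _))//.
  rewrite (@le_trans _ _ (x + y)) ?lerD// ?abs_entry_le//.
  by rewrite lerDr.
split; last first.
  apply: (@le_trans _ _ (3 `^ p * (1 + x `^ p + y `^ p))).
    apply: (le_trans _ H3); apply: ge0_ler_powR; rewrite ?nnegrE ?(ltW p0)//.
    exact: le_trans s1.
  by rewrite ler_wpM2r// lerDr mulr_ge0// powR_ge0.
have mono (z : R) : 0 <= z -> z <= 1 + x + y -> z `^ (p - 1) <= (1 + x + y) `^ (p - 1).
  by move=> z0 zs; apply: ge0_ler_powR; rewrite ?nnegrE//; exact: le_trans zs.
have D : `|defect F Fb i a| <= (4 * C + K) * (1 + x + y) `^ (p - 1).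
  have -> : defect F Fb i a = stress W F i a - stress W Fb i a + K * (F - Fb) i a.
    by rewrite /defect !mxE.
  set P := (1 + x + y) `^ (p - 1).
  have P1 : 1 <= P by have := mono 1 ler01 s1; rewrite powR1.
  have Px : x `^ (p - 1) <= P by apply: mono => //; rewrite addrAC lerDr addr_ge0.
  have Py : y `^ (p - 1) <= P by apply: mono => //; rewrite lerDr addr_ge0.
  have PE : 2 * C * P = C * (P + P) by ring.
  have h1 : `|stress W F i a| <= 2 * C * P.
    rewrite (le_trans (abs_entry_le _ _ _))// (le_trans (HC F))// PE.
    exact: (ler_wpM2l (ltW C0) (lerD P1 Px)).
  have h2 : `|stress W Fb i a| <= 2 * C * P.
    rewrite (le_trans (abs_entry_le _ _ _))// (le_trans (HC Fb))// PE.
    exact: (ler_wpM2l (ltW C0) (lerD P1 Py)).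
  have h3 : `|K * (F - Fb) i a| <= K * P.
    rewrite normrM gtr0_norm// ler_wpM2l ?(ltW K0)// (le_trans G)//.
    by rewrite -[leLHS]powRr1 ?(le_trans ler01 s1)// ler_powR// lerBrDr.
  rewrite (le_trans (ler_normD _ _))// (le_trans (lerD (ler_normB _ _) h3))//.
  by rewrite mulrDl lerD2r (le_trans (lerD h1 h2))// (_ : 4 * C * P = 2 * C * P + 2 * C * P)//; ring.
have CK0 : 0 <= 4 * C + K by apply: ltW; rewrite addr_gt0// mulr_gt0.
apply: (@le_trans _ _ (((4 * C + K) * (1 + x + y) `^ (p - 1)) `^ q)).
  apply: ge0_ler_powR; rewrite ?nnegrE ?(ltW q0)//.
  by rewrite mulr_ge0 ?powR_ge0.
rewrite powRM ?powR_ge0//.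
rewrite -powRrM [(p - 1) * q]mulrC qp.
rewrite (@le_trans _ _ ((4 * C + K) `^ q * (3 `^ p * (1 + x `^ p + y `^ p))))//.
  by rewrite ler_wpM2l// powR_ge0.
by rewrite mulrA ler_wpM2r// lerDl powR_ge0.
Qed.

Definition p_slice (A : R) (F : R * R -> 'M[R]_2) : Prop :=
  [/\ forall i a, measurable_fun cell (fun x => F x i a), Ig (fun x => fnorm (F x) `^ p)
    & \int[mu2]_(x in cell) fnorm (F x) `^ p <= A].

Lemma measurable_fnorm d (T : measurableType d) (D : set T) m n (F : T -> 'M[R]_(m, n)) : measurable D ->
  (forall i a, measurable_fun D (fun x => F x i a)) -> measurable_fun D (fun x => fnorm (F x)).
Proof.
move=> mD mF; have -> : (fun x => fnorm (F x)) = Num.sqrt \o (fun x => \sum_i \sum_j F x i j ^+ 2).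
  by apply/funext => x; rewrite /= -sqr_fnorm sqrtr_sqr ger0_norm// fnorm_ge0.
apply: (@measurableT_comp _ _ _ _ _ _ (fun y : R => Num.sqrt y)).
  by apply: continuous_measurable_fun; exact: sqrt_continuous.
apply: measurable_sum => i; apply: measurable_sum => j.
exact: measurable_funX.
Qed.

Section Pair.
Variables (A : R) (F Fb : R * R -> 'M[R]_2).
Hypotheses (hF : p_slice A F) (hFb : p_slice A Fb).

Let mF i a : measurable_fun cell (fun x => F x i a). Proof. by case: hF. Qed.
Let mFb i a : measurable_fun cell (fun x => Fb x i a). Proof. by case: hFb. Qed.

Lemma Ig_majorant (C : R) :
  Ig (fun x => C * (1 + fnorm (F x) `^ p + fnorm (Fb x) `^ p)).
Proof.
apply: IgZ => //; apply: IgD => //; last by case: hFb.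
by apply: IgD => //; [exact: Ig_cst|case: hF].
Qed.

Lemma Rint_majorant (C : R) : 0 <= C ->
  \int[mu2]_(x in cell) (C * (1 + fnorm (F x) `^ p + fnorm (Fb x) `^ p)) <= C * (1 + A + A).
Proof.
move=> C0; case: hF => _ iF aF; case: hFb => _ iFb aFb.
have i1 : Ig (fun=> 1 : R) by exact: Ig_cst.
have i2 := IgD mC i1 iF; have i3 := IgD mC i2 iFb.
rewrite (Rint_Zl mC C i3); apply: ler_wpM2l => //.
rewrite (RintegralD mC i2 iFb) (RintegralD mC i1 iF).
have e1 : \int[mu2]_(x in cell) (1 : R) <= 1.
  by rewrite Rintegral_cst// [X in _ * fine X](mu_cell (R := R)) /= mulr1.
exact: (lerD (lerD e1 aF) aFb).
Qed.

Lemma measurable_defect i a : measurable_fun cell (fun x => defect (F x) (Fb x) i a).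
Proof.
have -> : (fun x => defect (F x) (Fb x) i a) =
    (fun x => stress W (F x) i a - stress W (Fb x) i a + K * (F x i a - Fb x i a)).
  by apply/funext => x; rewrite /defect !mxE.
apply: measurable_funD.
  by apply: measurable_funB; apply: (measurable_continuous_mx (h := fun F => stress W F i a));
     rewrite //; exact: continuous_stress.
by apply: measurable_funM; [exact: measurable_cst|exact: measurable_funB].
Qed.

Lemma Ig_of_power (f : R * R -> R) (s : R) : 1 <= s -> measurable_fun cell f ->
  Ig (fun x => `|f x| `^ s) -> Ig f.
Proof.
move=> s1 mf h; apply: (Ig_le mC mf _ (IgD mC (Ig_cst mC 1 fC) h)).
by move=> x _; exact: ler_one_powR.
Qed.

Lemma slice_integrable i a :
  [/\ Ig (fun x => `|defect (F x) (Fb x) i a| `^ q),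
      Ig (fun x => `|(F x - Fb x) i a| `^ p),
      Ig (fun x => defect (F x) (Fb x) i a) & Ig (fun x => (F x - Fb x) i a)].
Proof.
have [C C0 HC] := defect_growth; have [p0 q0 q1 pq qp] := conj_exponent.
have mG : measurable_fun cell (fun x => (F x - Fb x) i a).
  rewrite (_ : (fun _ => _) = fun x => F x i a - Fb x i a); first exact: measurable_funB.
  by apply/funext => x; rewrite !mxE.
have mS := measurable_defect i a.
have mpow (f : R * R -> R) s : measurable_fun cell f -> measurable_fun cell (fun x => `|f x| `^ s).
  by move=> mf; apply: (measurableT_comp (measurable_powR s)); exact: measurableT_comp.
have h1 : Ig (fun x => `|defect (F x) (Fb x) i a| `^ q).
  apply: (Ig_le mC _ _ (Ig_majorant C)); first exact: mpow.
  by move=> x _; rewrite ger0_norm ?powR_ge0//; exact: (HC _ _ _ _).1.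
have h2 : Ig (fun x => `|(F x - Fb x) i a| `^ p).
  apply: (Ig_le mC _ _ (Ig_majorant C)); first exact: mpow.
  by move=> x _; rewrite ger0_norm ?powR_ge0//; exact: (HC _ _ _ _).2.
split=> //; first exact: Ig_of_power h1.
by apply: Ig_of_power h2; rewrite ?(le_trans _ p2)// ler1n.
Qed.

End Pair.

(** The error made when the strain difference is replaced by its Fejer mean against the defect. *)
Definition slice_error N (F Fb : R * R -> 'M[R]_2) : R :=
  \sum_i \sum_a \int[mu2]_(x in cell) (defect (F x) (Fb x) i a *
    ((F x - Fb x) i a - sm2 N (fun y => (F y - Fb y) i a) x)).

Lemma slice_error_cvg A F Fb : p_slice A F -> p_slice A Fb ->
  slice_error N F Fb @[N --> \oo] --> (0 : R).
Proof.
move=> hF hFb; have [p0 q0 q1 pq qp] := conj_exponent.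
have H : (\sum_(i < 2) \sum_(a < 2) (0 : R)) = 0 by rewrite big1// => i _; rewrite big1.
rewrite -[X in _ --> X]H; apply: cvg_sum => i; apply: cvg_sum => a.
have [h1 h2 h3 h4] := slice_integrable hF hFb i a.
exact: cvg_pairing_sm2 p0 q0 pq _ _ h3 h4 h1 h2.
Qed.

(** A bound uniform in [N], which serves as majorant for dominated convergence in time. *)
Lemma slice_error_le A : 0 <= A -> exists2 C : R, 0 <= C & forall N F Fb,
  p_slice A F -> p_slice A Fb -> `|slice_error N F Fb| <= C.
Proof.
move=> A0; have [p0 q0 q1 pq qp] := conj_exponent; have [C C0 HC] := defect_growth.
pose L := C * (1 + A + A); have L0 : 0 <= L by rewrite mulr_ge0 ?(ltW C0)// !addr_ge0.
exists (\sum_(i < 2) \sum_(a < 2) (2 * (L + L))).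
  by apply: sumr_ge0 => i _; apply: sumr_ge0 => a _; rewrite mulr_ge0// addr_ge0.
move=> N F Fb hF hFb; rewrite (le_trans (ler_norm_sum _ _ _))//; apply: ler_sum => i _.
rewrite (le_trans (ler_norm_sum _ _ _))//; apply: ler_sum => a _.
have [h1 h2 h3 h4] := slice_integrable hF hFb i a.
have b1 : \int[mu2]_(x in cell) `|defect (F x) (Fb x) i a| `^ q <= L.
  apply: (le_trans _ (Rint_majorant hF hFb (ltW C0))); apply: le_Rintegral => //.
    exact: Ig_majorant hF hFb C.
  by move=> x _; exact: (HC _ _ _ _).1.
have b2 : \int[mu2]_(x in cell) `|(F x - Fb x) i a| `^ p <= L.
  apply: (le_trans _ (Rint_majorant hF hFb (ltW C0))); apply: le_Rintegral => //.
    exact: Ig_majorant hF hFb C.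
  by move=> x _; exact: (HC _ _ _ _).2.
have t1 := Rint_mul_young_le p0 q0 pq ltr01 (Ig_measurable h3) (Ig_measurable h4) h1 h2.
have t2 := dual_pairing_le p0 q0 pq N ltr01 h3 h4 h1 h2.
have E (x y : R) : 1^-1 `^ q * x + 1 `^ p * y = x + y by rewrite invr1 !powR1 !mul1r.
rewrite E in t1; rewrite E in t2.
have -> : (fun x => defect (F x) (Fb x) i a * ((F x - Fb x) i a - sm2 N (fun y => (F y - Fb y) i a) x)) =
  (fun x => defect (F x) (Fb x) i a * (F x - Fb x) i a -
     defect (F x) (Fb x) i a * sm2 N (fun y => (F y - Fb y) i a) x).
  by apply/funext => x; rewrite mulrBr.
rewrite RintegralB//; last exact: Ig_mul_sm2.
  rewrite (le_trans (ler_normB _ _))// mulr_natl mulr2n lerD//.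
    exact: (le_trans t1 (lerD b1 b2)).
  exact: (le_trans t2 (lerD b1 b2)).
exact: (Ig_mul_young p0 q0 pq (Ig_measurable h3) (Ig_measurable h4)).
Qed.

End SliceBounds.

(** * The differential inequality at a fixed time *)

Lemma absorb_dirichlet (R : realType) (C0 C1 eps M D X Y P Q : R) : 0 < C0 -> 0 <= C1 -> 0 <= eps ->
  2 * (C0 * eps) = 2^-1 -> X <= eps * (M + D) + C1 * M -> Y <= eps * (M + D) + C1 * M ->
  M <= P -> D <= Q -> C0 * (M + X + Y) <= C0 * (1 + 2 * (eps + C1)) * P + 2^-1 * Q.
Proof.
move=> C00 C10 e0 e1 hX hY hM hD; rewrite -e1.
have h1 : M + X + Y <= (1 + 2 * (eps + C1)) * M + 2 * eps * D by lra.
have h2 : (1 + 2 * (eps + C1)) * M <= (1 + 2 * (eps + C1)) * P.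
  by rewrite ler_wpM2l// addr_ge0// mulr_ge0// addr_ge0.
have h3 : 2 * eps * D <= 2 * eps * Q by rewrite ler_wpM2l// mulr_ge0.
rewrite (_ : _ + _ = C0 * ((1 + 2 * (eps + C1)) * P + 2 * eps * Q)); last by ring.
by rewrite ler_wpM2l ?(ltW C00)//; apply: (le_trans h1); exact: lerD.
Qed.

Lemma mode_power_bound (R : realType) (K delta k G S ph y : R) : 0 <= delta -> 0 <= K -> 0 <= k ->
  - (G * (S - K * G + delta * (k * (G + y)))) + - (2 * (ph * (S - K * G + delta * (k * (G + y))))) <=
  - (G * S) + - (2 * (ph * S)) +
  (K * (2 * G ^+ 2 + ph ^+ 2) + delta * (2^-1 * (k * y ^+ 2) + 2 * (k * ph ^+ 2))).
Proof.
move=> d0 K0 k0; have h := capillary_le G y ph.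
have {h} : delta * k * (- ((G + y) * G) - 2 * ((G + y) * ph)) <=
    delta * k * (2^-1 * y ^+ 2 + 2 * ph ^+ 2) by rewrite ler_wpM2l// mulr_ge0.
have : K * (2 * (ph * G)) <= K * (G ^+ 2 + ph ^+ 2).
  by rewrite ler_wpM2l//; have := sqr_ge0 (G - ph); rewrite sqrrB; lra.
rewrite -subr_ge0 => h1; rewrite -subr_ge0 => h2.
rewrite -subr_ge0; have := addr_ge0 h1 h2.
by congr (0 <= _); ring.
Qed.

(** The dissipation [D] is spent in two halves: one absorbs the gradient left by
    [defect_pairing_le], the other the capillary term [2 d D], since [d <= 1/4]. *)
Lemma power_balance (R : realType) (w M E err C K d SG Sp Q P GS Y D B : R) :
  0 <= w -> 0 <= C -> 0 <= K -> 0 <= d -> d <= 4^-1 -> 0 <= D ->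
  M <= - GS - 2 * Q + (K * (2 * SG + Sp) + d * (2^-1 * Y + 2 * D)) - D ->
  w * SG <= 4 * E -> w * Sp <= 2 * E ->
  - P - 2 * (w * Q) <= C * (w * Sp) + 2^-1 * (w * D) -> - (w * GS) = err - P ->
  w * Y <= B -> w * M <= err + (2 * C + 10 * K) * E + d / 2 * B.
Proof.
move=> w0 C0 K0 d0 d1 D0 hM hSG hSp hP hGS hY.
apply: (le_trans (ler_wpM2l w0 hM)).
have wD : 0 <= w * D by exact: mulr_ge0.
have e1 : d * (w * D) <= 4^-1 * (w * D) by exact: ler_wpM2r.
have e2 : d * (w * Y) <= d * B by exact: ler_wpM2l.
have e3 : C * (w * Sp) <= C * (2 * E) by exact: ler_wpM2l.
have e4 : K * (2 * (w * SG) + w * Sp) <= K * (10 * E) by apply: ler_wpM2l => //; lra.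
have -> : w * (- GS - 2 * Q + (K * (2 * SG + Sp) + d * (2^-1 * Y + 2 * D)) - D) =
  - (w * GS) - 2 * (w * Q) + K * (2 * (w * SG) + w * Sp) + 2^-1 * (d * (w * Y)) +
  2 * (d * (w * D)) - w * D by ring.
have -> : (2 * C + 10 * K) * E = C * (2 * E) + K * (10 * E) by ring.
have -> : d / 2 * B = 2^-1 * (d * B) by ring.
rewrite hGS; lra.
Qed.

Section SlicePower.
Context {R : realType} (W : 'M[R]_2 -> R) (p K : R).
Hypotheses (p2 : 2 <= p) (K0 : 0 < K) (W3 : is_Ck 3 W) (cW : H3_convex K W) (hW : hess_growth p W).
Local Notation mu2 := (@lebesgue_measure R \x @lebesgue_measure R)%E.
Local Notation cell := (@cell R).
Local Notation Ig f := (mu2.-integrable cell (EFin \o f)).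
Let mC : measurable cell := @measurable_cell R.
Let fC : (mu2 cell < +oo)%E := @fin_cell R.

Lemma moment1_le N (c : mode N -> R) : moment c 1 <= wt N * \sum_m c m ^+ 2.
Proof. by under [X in X <= _]eq_Rintegral do rewrite expr1; exact: span2_sqr_le. Qed.

Lemma dirichlet_le N (c : mode N -> R) : dirichlet c <= wt N * \sum_m ksq m * c m ^+ 2.
Proof.
rewrite -sum_dcoef_sqr big_ord_recl big_ord1 mulrDr; apply: lerD; first exact: span2_sqr_le.
by rewrite (_ : lift ord0 ord0 = 1 :> 'I_2); [exact: span2_sqr_le|exact/val_inj].
Qed.

Lemma Rint_sum2 (f : 'I_2 -> 'I_2 -> R * R -> R) : (forall i a, Ig (f i a)) ->
  \sum_i \sum_a \int[mu2]_(x in cell) f i a x = \int[mu2]_(x in cell) \sum_i \sum_a f i a x.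
Proof.
move=> h; rewrite Rint_sum//; last by move=> i; apply: Ig_sum => // a.
by apply: eq_bigr => i _; rewrite Rint_sum.
Qed.

(** [monotone_defect_le] integrated over the torus, for a trigonometric field psi with coefficients
    [c]; the weights of power p - 2 are removed by [weighted_span_le]. *)
Lemma defect_pairing_le (A : R) : 0 <= A -> exists2 C : R, 0 <= C &
  forall N (F Fb : R * R -> 'M[R]_2) (c : 'I_2 -> 'I_2 -> mode N -> R),
  p_slice p A F -> p_slice p A Fb ->
  - (\sum_i \sum_a \int[mu2]_(x in cell) (defect W K (F x) (Fb x) i a * (F x - Fb x) i a)) -
  2 * (\sum_i \sum_a \int[mu2]_(x in cell) (defect W K (F x) (Fb x) i a * span2 (c i a) x)) <=
  C * (wt N * \sum_i \sum_a \sum_m c i a m ^+ 2) +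
  2^-1 * (wt N * \sum_i \sum_a \sum_m ksq m * c i a m ^+ 2).
Proof.
move=> A0; have [C0 C00 H0] := monotone_defect_le p2 K0 W3 cW hW.
(* There are two weights, from [F] and from [Fb], so this [eps] leaves the gradient term with
   coefficient 1/2, half of the viscous dissipation. *)
pose eps := (4 * C0)^-1; have eps0 : 0 < eps by rewrite invr_gt0 mulr_gt0.
have eE : 2 * (C0 * eps) = 2^-1 by rewrite /eps; field; rewrite gt_eqF.
have fac (C a b s : R) : C * (1 + a + b) * s = C * (s + a * s + b * s) by ring.
have [C1 C10 H1] := weighted_span_le p2 A0 eps0.
exists (C0 * (1 + 2 * (eps + C1))).
  by rewrite mulr_ge0 ?(ltW C00)// addr_ge0// mulr_ge0// addr_ge0// ltW.
move=> N F Fb c hF hFb.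
have [p0 q0 q1 pq qp] := conj_exponent p2.
have I1 i a : Ig (fun x => defect W K (F x) (Fb x) i a * (F x - Fb x) i a).
  have [h1 h2 h3 h4] := slice_integrable p2 K0 W3 hW hF hFb i a.
  exact: (Ig_mul_young p0 q0 pq (Ig_measurable h3) (Ig_measurable h4) h1 h2).
have bS i a := bm_span (c i a).
have I2 i a : Ig (fun x => defect W K (F x) (Fb x) i a * span2 (c i a) x).
  have [_ _ h3 _] := slice_integrable p2 K0 W3 hW hF hFb i a.
  by have [ms [B HB]] := bS i a; apply: (IgM_bounded mC h3 ms (M := B)) => x _.
pose psi x : 'M[R]_2 := \matrix_(i, a) span2 (c i a) x.
pose f1 i a x := span2 (c i a) x ^+ 2.
pose f2 i a x := fnorm (F x) `^ (p - 2) * span2 (c i a) x ^+ 2.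
pose f3 i a x := fnorm (Fb x) `^ (p - 2) * span2 (c i a) x ^+ 2.
have hpow G : p_slice p A G -> Ig (fun x => fnorm (G x) `^ (p - 2)).
  move=> [mG iG _]; apply: (Ig_le mC _ _ (IgD mC (Ig_cst mC 1 fC) iG)).
    apply: (measurableT_comp (measurable_powR _)); exact: measurable_fnorm.
  move=> x _; rewrite ger0_norm ?powR_ge0//.
  have y0 := fnorm_ge0 (G x); have [x1|x1] := leP (fnorm (G x)) 1.
    apply: (@le_trans _ _ 1); last by rewrite lerDl powR_ge0.
    by apply: powR_le1 => //; rewrite subr_ge0.
  apply: (@le_trans _ _ (fnorm (G x) `^ p)); last by rewrite lerDr.
  by apply: ler_powR; [exact: ltW|rewrite gerBl].
have I3 i a : Ig (f1 i a) by apply: bm_Ig; exact: bmX.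
have I45 G i a : p_slice p A G -> Ig (fun x => fnorm (G x) `^ (p - 2) * span2 (c i a) x ^+ 2).
  move=> hG; have [ms [B HB]] := bmX 2 (bS i a).
  by apply: (IgM_bounded mC (hpow G hG) ms (M := B)) => x _.
have I4 i a : Ig (f2 i a) by exact: I45.
have I5 i a : Ig (f3 i a) by exact: I45.
have I345 i a : Ig (fun x => C0 * (f1 i a x + f2 i a x + f3 i a x)).
  exact: (IgZ mC C0 (IgD mC (IgD mC (I3 i a) (I4 i a)) (I5 i a))).
have I12 i a : Ig (fun x => - (defect W K (F x) (Fb x) i a * (F x - Fb x) i a) -
    2 * (defect W K (F x) (Fb x) i a * span2 (c i a) x)).
  exact: (IgB mC (IgN (I1 i a)) (IgZ mC 2 (I2 i a))).
apply: (@le_trans _ _ (\sum_i \sum_a \int[mu2]_(x in cell) (C0 * (f1 i a x + f2 i a x + f3 i a x)))).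
  have -> : - (\sum_i \sum_a \int[mu2]_(x in cell) (defect W K (F x) (Fb x) i a * (F x - Fb x) i a)) -
    2 * (\sum_i \sum_a \int[mu2]_(x in cell) (defect W K (F x) (Fb x) i a * span2 (c i a) x)) =
    \sum_i \sum_a \int[mu2]_(x in cell) (- (defect W K (F x) (Fb x) i a * (F x - Fb x) i a) -
      2 * (defect W K (F x) (Fb x) i a * span2 (c i a) x)).
    rewrite mulr_sumr -!sumrN -big_split; apply: eq_bigr => i _ /=.
    rewrite mulr_sumr -!sumrN -big_split; apply: eq_bigr => a _ /=.
    rewrite (RintegralB mC (IgN (I1 i a)) (IgZ mC 2 (I2 i a))).
    by rewrite (Rint_opp mC (I1 i a)) (Rint_Zl mC 2 (I2 i a)).
  rewrite (Rint_sum2 I12) (Rint_sum2 I345); apply: le_Rintegral => //.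
  - by apply: Ig_sum => // i; apply: Ig_sum => // a; exact: I12.
  - by apply: Ig_sum => // i; apply: Ig_sum => // a; exact: I345.
  - move=> x _; have := H0 (F x) (Fb x) (psi x); rewrite -/(defect W K (F x) (Fb x)).
    rewrite !frobE sqr_fnorm.
    rewrite mulr_sumr -sumrN mulr_sumr -sumrB => h.
    have eqW (a b : R) : a = b -> a <= b by move=> ->.
    apply: (le_trans (le_trans (eqW _ _ _) h)); last apply: eqW.
      apply: eq_bigr => i _; rewrite mulr_sumr -sumrN -sumrB.
      by apply: eq_bigr => a _; rewrite [psi x i a]mxE.
    apply: eq_bigr => i _; rewrite mulr_sumr; apply: eq_bigr => a _.
    rewrite [psi x i a]mxE; exact: fac.
apply: (@le_trans _ _ (\sum_i \sum_a (C0 * (1 + 2 * (eps + C1)) * (wt N * \sum_m c i a m ^+ 2) +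
    2^-1 * (wt N * \sum_m ksq m * c i a m ^+ 2)))); last first.
  rewrite !mulr_sumr -big_split; apply: ler_sum => i _ /=.
  by rewrite !mulr_sumr -big_split.
apply: ler_sum => i _; apply: ler_sum => a _.
rewrite (Rint_Zl mC C0 (IgD mC (IgD mC (I3 i a) (I4 i a)) (I5 i a))).
rewrite (RintegralD mC (IgD mC (I3 i a) (I4 i a)) (I5 i a)) (RintegralD mC (I3 i a) (I4 i a)).
have mf G : p_slice p A G -> measurable_fun cell (fun x => fnorm (G x)).
  by move=> [mG _ _]; exact: measurable_fnorm.
have n0 (G : R * R -> 'M[R]_2) x : 0 <= fnorm (G x) by exact: fnorm_ge0.
have g4 : \int[mu2]_(x in cell) f2 i a x <= eps * (moment (c i a) 1 + dirichlet (c i a)) + C1 * moment (c i a) 1.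
  by case: (hF) => _ iF aF; exact: H1 (mf _ hF) (n0 F) iF aF.
have g5 : \int[mu2]_(x in cell) f3 i a x <= eps * (moment (c i a) 1 + dirichlet (c i a)) + C1 * moment (c i a) 1.
  by case: (hFb) => _ iF aF; exact: H1 (mf _ hFb) (n0 Fb) iF aF.
have g3 : \int[mu2]_(x in cell) f1 i a x = moment (c i a) 1.
  by rewrite /moment; apply: eq_Rintegral => x _; rewrite expr1.
have m1 := moment1_le (c i a); have d1 := dirichlet_le (c i a).
rewrite g3; exact: absorb_dirichlet C00 C10 (ltW eps0) eE g4 g5 m1 d1.
Qed.

Definition total_power N (Z w : 'I_2 -> mode N -> R) (g : 'I_2 -> 'I_2 -> mode N -> R) : R :=
  wt N * \sum_i mode_power (Z i) (w i) (g i).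
Definition total_energy N (Z w : 'I_2 -> mode N -> R) : R :=
  wt N * \sum_i mode_energy (Z i) (w i).

Lemma Rint_defect_sm2 A N (F Fb : R * R -> 'M[R]_2) : p_slice p A F -> p_slice p A Fb ->
  - (wt N * \sum_i \sum_a \sum_(m : mode N) coef2 m (fun x => (F x - Fb x) i a) *
      coef2 m (fun x => defect W K (F x) (Fb x) i a)) =
  slice_error W K N F Fb -
  \sum_i \sum_a \int[mu2]_(x in cell) (defect W K (F x) (Fb x) i a * (F x - Fb x) i a).
Proof.
move=> hF hFb; rewrite mulr_sumr /slice_error -sumrB -sumrN; apply: eq_bigr => i _.
rewrite mulr_sumr -sumrB -sumrN; apply: eq_bigr => a _.
have [p0 q0 q1 pq qp] := conj_exponent p2.
have [h1 h2 h3 h4] := slice_integrable p2 K0 W3 hW hF hFb i a.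
rewrite -(Rint_mul_sm2 N h3 h4).
have e : (fun x => defect W K (F x) (Fb x) i a * ((F x - Fb x) i a - sm2 N (fun y => (F y - Fb y) i a) x)) =
  (fun x => defect W K (F x) (Fb x) i a * (F x - Fb x) i a -
     defect W K (F x) (Fb x) i a * sm2 N (fun y => (F y - Fb y) i a) x).
  by apply/funext => x; rewrite mulrBr.
have hm := Ig_mul_young p0 q0 pq (Ig_measurable h3) (Ig_measurable h4) h1 h2.
by rewrite e (RintegralB mC hm (Ig_mul_sm2 N h3 h4)) addrAC subrr add0r.
Qed.

(** The inequality E' <= error + C E + delta B / 2. The hypothesis on [g] reads S(F) - S(Fb) =
    defect - K G and - delta Lap F = - delta Lap (G + Fb), with [y] the coefficients of [Fb] and [B]
    a bound of the squared norm of its gradient. *)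
Lemma slice_power_le (A : R) : 0 <= A -> exists2 C : R, 0 <= C &
  forall N (delta B : R) (F Fb : R * R -> 'M[R]_2) (Z w : 'I_2 -> mode N -> R)
    (y g : 'I_2 -> 'I_2 -> mode N -> R),
  0 <= delta -> delta <= 4^-1 -> p_slice p A F -> p_slice p A Fb ->
  (forall i a m, coef2 m (fun x => (F x - Fb x) i a) = dcoef a (Z i) m) ->
  (forall i a m, g i a m = coef2 m (fun x => defect W K (F x) (Fb x) i a) -
     K * dcoef a (Z i) m + delta * (ksq m * (dcoef a (Z i) m + y i a m))) ->
  wt N * \sum_i \sum_a \sum_m ksq m * y i a m ^+ 2 <= B ->
  total_power Z w g <= slice_error W K N F Fb + C * total_energy Z w + delta / 2 * B.
Proof.
move=> A0; have [C C0 HC] := defect_pairing_le A0.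
exists (2 * C + 10 * K); first by rewrite addr_ge0 ?mulr_ge0// ltW.
move=> N delta B F Fb Z w y g d0 d1 hF hFb hZ hg hB.
pose G i a m := dcoef a (Z i) m; pose ph i a m := lift_grad (w i) a m.
pose S (i a : 'I_2) (m : mode N) := coef2 m (fun x => defect W K (F x) (Fb x) i a).
have w0 := wt_ge0 (R := R) N.
have eG : wt N * \sum_i \sum_a \sum_m G i a m ^+ 2 <= 4 * total_energy Z w.
  rewrite /total_energy mulrCA ler_wpM2l// mulr_sumr; apply: ler_sum => i _.
  by rewrite sum_dcoef_sqr; exact: displacement_le_energy.
have eph : wt N * \sum_i \sum_a \sum_m ph i a m ^+ 2 <= 2 * total_energy Z w.
  rewrite /total_energy mulrCA ler_wpM2l// mulr_sumr; apply: ler_sum => i _.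
  by rewrite sum_lift_grad_sqr; exact: velocity_le_energy.
have eD : \sum_i \sum_a \sum_m ksq m * ph i a m ^+ 2 = \sum_i dissip (w i).
  by apply: eq_bigr => i _; exact: sum_ksq_lift_grad_sqr.
have h1 := HC N F Fb ph hF hFb.
have h2 := Rint_defect_sm2 N hF hFb.
have h3 : \sum_i \sum_a \int[mu2]_(x in cell) (defect W K (F x) (Fb x) i a * span2 (ph i a) x) =
    wt N * \sum_i \sum_a \sum_m ph i a m * S i a m.
  rewrite mulr_sumr; apply: eq_bigr => i _; rewrite mulr_sumr; apply: eq_bigr => a _.
  have [_ _ hS _] := slice_integrable p2 K0 W3 hW hF hFb i a.
  exact: Rint_span2_mul.
have {}h2 : - (wt N * \sum_i \sum_a \sum_m G i a m * S i a m) = slice_error W K N F Fb -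
    \sum_i \sum_a \int[mu2]_(x in cell) (defect W K (F x) (Fb x) i a * (F x - Fb x) i a).
  rewrite -h2; congr (- (_ * _)); apply: eq_bigr => i _; apply: eq_bigr => a _.
  by apply: eq_bigr => m _; rewrite hZ.
have h4 : \sum_i mode_power (Z i) (w i) (g i) <=
    - (\sum_i \sum_a \sum_m G i a m * S i a m) - 2 * (\sum_i \sum_a \sum_m ph i a m * S i a m)
    + (K * (2 * (\sum_i \sum_a \sum_m G i a m ^+ 2) + \sum_i \sum_a \sum_m ph i a m ^+ 2)
    + delta * (2^-1 * (\sum_i \sum_a \sum_m ksq m * y i a m ^+ 2) +
               2 * (\sum_i \sum_a \sum_m ksq m * ph i a m ^+ 2)))
    - \sum_i dissip (w i).
  rewrite !mulr_sumr -!big_split !mulr_sumr -!sumrN -!big_split; apply: ler_sum => i _ /=.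
  rewrite mode_power_identity lerD2r.
  rewrite !mulr_sumr -!big_split !mulr_sumr -!sumrN -!big_split; apply: ler_sum => a _ /=.
  rewrite !mulr_sumr -!big_split !mulr_sumr -!sumrN -!big_split; apply: ler_sum => m _ /=.
  rewrite hg -/(S i a m) -/(G i a m) -/(ph i a m).
  have k0 := ksq_ge0 (R := R) m.
  exact: mode_power_bound d0 (ltW K0) k0.
rewrite h3 eD in h1; rewrite eD in h4.
apply: power_balance h4 eG eph h1 h2 hB => //; first exact: ltW.
apply: sumr_ge0 => i _; rewrite -sum_ksq_lift_grad_sqr.
apply: sumr_ge0 => a _; apply: sumr_ge0 => m _.
by apply: mulr_ge0; [exact: ksq_ge0|exact: sqr_ge0].
Qed.

End SlicePower.

(** * Smooth flat functions and separated test fields *)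

Section FlatFunctions.
Context {R : realType}.
Implicit Types p : {poly R}.

(** The polynomial factor makes the family stable under differentiation ([dflatp]), so smoothness of
    exp(- 1/x) extended by 0 needs a single derivative. *)
Definition flatp p (x : R) : R := if 0 < x then p.[x^-1] * expR (- x^-1) else 0.
Definition dflatp p : {poly R} := 'X^2 * (p - p^`()).

Lemma horner_growth p (y : R) : 0 <= y ->
  `|p.[y]| <= (\sum_(i < size p) `|p`_i|) * (1 + y ^+ size p).
Proof.
move=> y0; rewrite horner_coef (le_trans (ler_norm_sum _ _ _))// mulr_suml ler_sum// => i _.
rewrite normrM ler_wpM2l// ger0_norm ?exprn_ge0//; have [y1|y1] := leP y 1.
  by rewrite (@le_trans _ _ 1) ?exprn_ile1// lerDl exprn_ge0.
apply: (@le_trans _ _ (y ^+ size p)); last by rewrite lerDr.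
by apply: ler_weXn2l; rewrite ?(ltnW (ltn_ord i))// ltW.
Qed.

Lemma flatp_le p : exists2 C : R, 0 <= C & forall x, `|flatp p x| <= C * `|x|.
Proof.
set A := \sum_(i < size p) `|p`_i|; set n := size p.
have A0 : 0 <= A by apply: sumr_ge0.
exists (A * (1 + n.+1`!%:R)); first by rewrite mulr_ge0// addr_ge0.
move=> x; rewrite /flatp; case: ifPn => [x0|_]; last first.
  by rewrite normr0 mulr_ge0// mulr_ge0// addr_ge0.
set y := x^-1; have y0 : 0 < y by rewrite invr_gt0.
rewrite [`|x|]gtr0_norm// normrM (ger0_norm (expR_ge0 _)) expRN ler_pdivrMr ?expR_gt0//.
have h1 : y <= expR y by rewrite (le_trans _ (expR_ge1Dx y))// lerDr.
have h2 : y ^+ n.+1 <= n.+1`!%:R * expR y.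
  rewrite -ler_pdivrMl ?ltr0n ?fact_gt0// mulrC (le_trans _ (expR_ge1Dxn n (ltW y0)))//.
  by rewrite lerDr.
apply: (le_trans (horner_growth p (ltW y0))); rewrite -/A -/n -!mulrA ler_wpM2l//.
have h3 : y * (1 + y ^+ n) <= (1 + n.+1`!%:R) * expR y.
  by rewrite mulrDr mulr1 -exprS mulrDl mul1r lerD.
rewrite -(ler_pM2l y0) (le_trans h3)// mulrCA [y * _]mulrA mulVf ?mul1r// gt_eqF//.
Qed.

Lemma is_derive_flatp p (x : R) : is_derive x (1 : R) (flatp p) (flatp (dflatp p) x).
Proof.
have [x0|x0|->] := ltgtP x 0.
- apply: (@near_eq_is_derive _ _ _ (cst 0)).
    near=> z; rewrite /flatp ltNge ltW//=.
    by near: z; exact: lt_nbhsl.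
  rewrite [flatp _ x]/flatp ltNge ltW//=; exact: is_derive_cst.
- apply: (@near_eq_is_derive R R R (fun z => p.[z^-1] * expR (- z^-1))).
    near=> z; rewrite /flatp; have -> // : 0 < z.
    by near: z; exact: lt_nbhsr.
  have xn0 : x != 0 by rewrite gt_eqF.
  have di : is_derive x (1 : R) (@GRing.inv R) (- x ^- 2).
    by apply: (is_derive_eq (@is_deriveV R id x 1 1 xn0 (is_derive_id _ _))); rewrite /GRing.scale /= mulr1.
  have dp : is_derive x (1 : R) (fun z => p.[z^-1]) (p^`().[x^-1] * (- x ^- 2)).
    exact: (@is_derive1_comp _ (fun y => p.[y]) (@GRing.inv R) x _ _ (is_derive_poly p _) di).
  have de : is_derive x (1 : R) (fun z => expR (- z^-1)) (expR (- x^-1) * x ^- 2).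
    have := @is_derive1_comp _ expR (fun z => - z^-1) x _ _ (is_derive_expR _) (is_deriveN di).
    by rewrite opprK.
  apply: (is_derive_eq (is_deriveM dp de)).
  rewrite /flatp x0 /dflatp !hornerE /GRing.scale /= -exprVn; ring.
have f0 q : flatp q 0 = 0 by rewrite /flatp ltxx.
rewrite f0.
(* Dividing by [h] multiplies the polynomial by ['X], so the linear bound for ['X * p] sends the
   difference quotient at 0 to 0. *)
have [C C0 HC] := flatp_le ('X * p).
have H : h^-1 *: (flatp p (h *: (1 : R) + 0) - flatp p 0) @[h --> 0^'] --> (0 : R).
  apply/cvgrPdist_le => e e0; near=> h.
  rewrite f0 subr0 addr0 sub0r normrN /GRing.scale /= mulr1.
  have -> : h^-1 * flatp p h = flatp ('X * p) h.
    by rewrite /flatp; case: ifP => _; rewrite ?mulr0// hornerM hornerX mulrA.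
  apply: (le_trans (HC h)).
  have hC : `|h| <= e / (C + 1).
    by near: h; apply: dnbhs0_le; rewrite divr_gt0// ltr_wpDl.
  rewrite (@le_trans _ _ ((C + 1) * `|h|))//; first by rewrite ler_wpM2r// lerDl.
  by rewrite mulrC -ler_pdivlMr// ltr_wpDl.
apply: DeriveDef; first by apply/cvg_ex; exists 0.
exact: cvg_lim.
Unshelve. all: by end_near. Qed.

(** Smoothness is stated coinductively: [g] belongs to some class of functions closed under
    differentiation. *)
Definition smooth1 (g : R -> R) : Prop := exists2 P : (R -> R) -> Prop, P g &
  forall f, P f -> exists2 f', P f' & forall x : R, is_derive x (1 : R) f (f' x).

Lemma smooth1_derive g : smooth1 g ->
  exists2 g', smooth1 g' & forall x : R, is_derive x (1 : R) g (g' x).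
Proof. by move=> [P Pg HP]; have [g' Pg' dg] := HP g Pg; exists g' => //; exists P. Qed.

Lemma smooth1_tr1 N (m : mode1 N) : smooth1 (tr1 m).
Proof.
exists (fun f => exists c (m' : mode1 N), f = c \*: tr1 m').
  by exists 1, m; apply/funext => x; rewrite /= scale1r.
move=> _ [c [m' ->]]; exists ((c * - sg1 m') \*: tr1 (flip1 m')); first by exists (c * - sg1 m'), (flip1 m').
move=> x; apply: (is_derive_eq (is_deriveZ c (is_derive_tr1 m' x))).
by rewrite /GRing.scale /= mulrA.
Qed.

Lemma is_derive_comp_affine (f : R -> R) (k t0 t df : R) : is_derive (k * (t0 - t)) (1 : R) f df ->
  is_derive t (1 : R) (fun s => f (k * (t0 - s))) (- k * df).
Proof.
move=> h; have ha : is_derive t (1 : R) (fun s : R => k * (t0 - s)) (- k).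
  have := is_deriveZ k (is_deriveB (is_derive_cst t0 t 1) (is_derive_id t 1)).
  by move=> h'; apply: (is_derive_eq h'); rewrite sub0r /GRing.scale /= mulrN1.
have H := @is_derive1_comp R f (fun s => k * (t0 - s)) t df (- k) h ha.
by apply: (is_derive_eq H); rewrite mulrC.
Qed.

Lemma smooth1_flatp p (k t0 : R) : smooth1 (fun t => flatp p (k * (t0 - t))).
Proof.
exists (fun f => exists q, f = (fun t => flatp q (k * (t0 - t)))); first by exists p.
move=> _ [q ->]; exists (fun t => flatp (- k *: dflatp q) (k * (t0 - t))).
  by exists (- k *: dflatp q).
move=> t; apply: (is_derive_eq (is_derive_comp_affine (is_derive_flatp q _))).
by rewrite /flatp; case: ifP => _; rewrite ?mulr0// hornerZ mulrA.
Qed.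

End FlatFunctions.

Section Elementary.
Context {R : realType} {V : normedModType R}.

Lemma is_derive_from_line (U : normedModType R) (f : V -> U) x v d :
  is_derive (0 : R) (1 : R) (fun h : R => f (x + h *: v)) d -> is_derive x v f d.
Proof.
have E : (fun h : R => h^-1 *: ((fun s : R => f (x + s *: v)) (h *: (1 : R) + 0) -
    (fun s : R => f (x + s *: v)) 0)) = (fun h : R => h^-1 *: (f (h *: v + x) - f x)).
  apply/funext => h; have -> : h *: (1 : R) + 0 = h by rewrite addr0; exact: mulr1.
  by rewrite scale0r addr0 [x + _]addrC.
move=> [D1 D2]; rewrite /derivable E in D1; rewrite /derive E in D2.
by apply: DeriveDef.
Qed.

Lemma is_deriveZl (f : V -> R) (U : normedModType R) (M : U) x v d :
  is_derive x v f d -> is_derive x v (fun y => f y *: M) (d *: M).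
Proof.
move=> [D1 D2]; have H : h^-1 *: (f (h *: v + x) *: M - f x *: M) @[h --> 0^'] --> d *: M.
  have -> : (fun h : R => h^-1 *: (f (h *: v + x) *: M - f x *: M)) =
      (fun h : R => (h^-1 *: (f (h *: v + x) - f x)) *: M).
    by apply/funext => h; rewrite -scalerBl scalerA.
  by apply: cvgZr_tmp; rewrite -D2; exact: D1.
apply: DeriveDef; first by apply/cvg_ex; exists (d *: M).
exact: cvg_lim.
Qed.

(** A class closed under directional derivatives, hence made of smooth functions, and large enough
    for a function of time multiplied by modes in the space coordinates. *)
Inductive elementary : (V -> R) -> Prop :=
| elementary_comp g (l : V -> R) : smooth1 g -> continuous l ->
    (forall x v (h : R), l (x + h *: v) = l x + h * l v) -> elementary (fun x => g (l x))
| elementary_mul f g : elementary f -> elementary g -> elementary (fun x => f x * g x)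
| elementary_add f g : elementary f -> elementary g -> elementary (fun x => f x + g x).

Lemma smooth1_continuous (g : R -> R) : smooth1 g -> continuous g.
Proof.
move=> /smooth1_derive[g' _ dg] x; apply: differentiable_continuous.
by apply/derivable1_diffP; have [] := dg x.
Qed.

Lemma smooth1_cst (c : R) : smooth1 (cst c).
Proof.
exists (fun f => exists d, f = cst d); first by exists c.
by move=> _ [d ->]; exists (cst 0); [exists 0|move=> x; exact: is_derive_cst].
Qed.

Lemma elementary_derive f : elementary f -> continuous f /\
  forall v, exists2 f', elementary f' & forall x, is_derive x v f (f' x).
Proof.
elim=> {f} [g l sg cl ll|f g ef [cf df] eg [cg dg]|f g ef [cf df] eg [cg dg]].
- split; first by move=> x; apply: continuous_comp; [exact: cl|exact: smooth1_continuous].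
  have [g' sg' dg] := smooth1_derive sg; move=> v.
  exists (fun x => cst (l v) (l x) * g' (l x)).
    by apply: elementary_mul; apply: elementary_comp => //; exact: smooth1_cst.
  move=> x; apply: is_derive_from_line.
  have E : (fun h : R => g (l (x + h *: v))) = g \o (fun h : R => l x + h * l v).
    by apply/funext => h; rewrite /= ll.
  have da : is_derive (0 : R) (1 : R) (fun h : R => l x + h * l v) (l v).
    have := is_deriveD (is_derive_cst (l x) (0 : R) (1 : R)) (is_deriveZ (l v) (is_derive_id (0 : R) (1 : R))).
    rewrite add0r /GRing.scale /= mulr1 => h.
    by rewrite (_ : (fun _ => _) = cst (l x) + l v \*: id)//; apply/funext => y; congr (_ + _); exact: mulrC.
  rewrite E; have := @is_derive1_comp R g (fun h : R => l x + h * l v) 0 _ _ (dg _) da.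
  by rewrite mul0r addr0 mulrC.
- split=> [x|v]; first by apply: cvgM; [exact: cf|exact: cg].
  have [f' ef' df'] := df v; have [g' eg' dg'] := dg v.
  exists (fun x => f x * g' x + g x * f' x).
    by apply: elementary_add; exact: elementary_mul.
  by move=> x; exact: is_deriveM.
- split=> [x|v]; first by apply: cvgD; [exact: cf|exact: cg].
  have [f' ef' df'] := df v; have [g' eg' dg'] := dg v.
  by exists (fun x => f' x + g' x); [exact: elementary_add|move=> x; exact: is_deriveD].
Qed.

Lemma elementary_smooth f : elementary f -> smooth f.
Proof.
move=> ef k; elim: k f ef => [|k IH] f ef; have [cf df] := elementary_derive ef; split=> // v.
have [f' ef' df'] := df v.
split=> [x|]; first by have [] := df' x.
rewrite (_ : (fun x => _) = f'); first exact: IH.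
by apply/funext => x; have [] := df' x.
Qed.

Lemma smoothZl (f : V -> R) (U : normedModType R) (M : U) : smooth f -> smooth (fun x => f x *: M).
Proof.
move=> sf k; elim: k f sf => [|k IH] f sf; have [cf _] := sf 1.
  by split=> // x; apply: cvgZr_tmp; exact: cf.
split=> [x|v]; first by apply: cvgZr_tmp; exact: cf.
have df x : derivable f x v by have [_ /(_ v)[]] := sf 1.
have H x : is_derive x v (fun y => f y *: M) ('D_v f x *: M).
  by apply: is_deriveZl; apply: DeriveDef.
split=> [x|]; first by have [] := H x.
rewrite (_ : (fun x => _) = (fun x => 'D_v f x *: M)).
  by apply: IH => j; have [_ /(_ v)[]] := sf j.+1.
by apply/funext => x; have [] := H x.
Qed.

End Elementary.

Section TestFunctions.
Context {R : realType}.

Lemma is_derive_shift (f : R -> R) (x d : R) : is_derive x (1 : R) f d ->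
  is_derive (0 : R) (1 : R) (fun h : R => f (x + h)) d.
Proof.
move=> df; have da : is_derive (0 : R) (1 : R) (fun h : R => x + h) 1.
  have := is_deriveD (is_derive_cst x (0 : R) (1 : R)) (is_derive_id (0 : R) (1 : R)).
  by rewrite add0r.
have := @is_derive1_comp R f (fun h : R => x + h) 0 d 1.
by rewrite addr0 mulr1; apply.
Qed.

Lemma is_derive_e2 N (m : mode N) a (x : R * R) :
  is_derive x (edir a) (e2 m) (- sg a m * e2 (flip a m) x).
Proof.
apply: is_derive_from_line; rewrite /e2 /edir /sg /flip; case: (a == 0) => /=.
  have -> : (fun h : R => tr1 m.1 (x.1 + h *: (1 : R)) * tr1 m.2 (x.2 + h *: (0 : R))) =
      tr1 m.2 x.2 \*: (fun h : R => tr1 m.1 (x.1 + h)).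
    by apply/funext => h; rewrite scaler0 addr0 (_ : h *: (1 : R) = h); [exact: mulrC|exact: mulr1].
  apply: (is_derive_eq (is_deriveZ _ (is_derive_shift (is_derive_tr1 m.1 x.1)))).
  by rewrite /GRing.scale /= mulrC mulrA.
have -> : (fun h : R => tr1 m.1 (x.1 + h *: (0 : R)) * tr1 m.2 (x.2 + h *: (1 : R))) =
    tr1 m.1 x.1 \*: (fun h : R => tr1 m.2 (x.2 + h)).
  by apply/funext => h; rewrite scaler0 addr0 (_ : h *: (1 : R) = h)//; exact: mulr1.
apply: (is_derive_eq (is_deriveZ _ (is_derive_shift (is_derive_tr1 m.2 x.2)))).
by rewrite /GRing.scale /= mulrCA.
Qed.

Lemma continuous_fst (U V : topologicalType) : continuous (fst : U * V -> U).
Proof. by move=> x; exact: cvg_fst. Qed.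

Lemma continuous_snd (U V : topologicalType) : continuous (snd : U * V -> V).
Proof. by move=> x; exact: cvg_snd. Qed.

Lemma elementary_e2 N (m : mode N) : elementary (e2 m : R * R -> R).
Proof.
apply: elementary_mul.
  by apply: (elementary_comp (smooth1_tr1 m.1)); [exact: continuous_fst|].
by apply: (elementary_comp (smooth1_tr1 m.2)); [exact: continuous_snd|].
Qed.

Lemma torus_periodic_e2 N (m : mode N) : torus_periodic (e2 m : R * R -> R).
Proof. by move=> x; rewrite /e2 /= !tr1_periodic. Qed.

Definition separated_field k l (eta : R -> R) N (m : mode N) (M : 'M[R]_(k, l)) (t : R) (x : R * R) :=
  (eta t * e2 m x) *: M.

Lemma test_fun_separated k l (T T' : R) (eta : R -> R) N (m : mode N) (M : 'M[R]_(k.+1, l.+1)) :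
  smooth1 eta -> T' < T -> (forall t, T' <= t -> eta t = 0) ->
  test_fun T (separated_field eta m M).
Proof.
move=> seta TT heta; split.
- apply: smoothZl; apply: elementary_smooth; apply: elementary_mul.
    by apply: (elementary_comp seta); [exact: continuous_fst|].
  apply: elementary_mul.
    apply: (elementary_comp (l := fun z : R * (R * R) => z.2.1) (smooth1_tr1 m.1)) => //.
    by move=> z; apply: (@continuous_comp _ _ _ snd fst); [exact: continuous_snd|exact: continuous_fst].
  apply: (elementary_comp (l := fun z : R * (R * R) => z.2.2) (smooth1_tr1 m.2)) => //.
  by move=> z; apply: (@continuous_comp _ _ _ snd snd); exact: continuous_snd.
- move=> t x; have [h1 h2] := torus_periodic_e2 m x.
  by rewrite /separated_field h1 h2.
- by exists T' => // t x /heta h; rewrite /separated_field h mul0r scale0r.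
Qed.

Lemma derive_separated_time k l (eta eta' : R -> R) N (m : mode N) (M : 'M[R]_(k.+1, l.+1)) t x :
  (forall s : R, is_derive s (1 : R) eta (eta' s)) ->
  derive1 ((separated_field eta m M)^~ x) t = (eta' t * e2 m x) *: M.
Proof.
move=> deta; rewrite derive1E.
have h := is_deriveZ (e2 m x) (deta t).
have [_ H] := is_deriveZl M h.
rewrite (_ : _^~ x = (fun y => (e2 m x \*: eta) y *: M)).
  by rewrite H; congr (_ *: M); exact: mulrC.
by apply/funext => s; congr (_ *: M); exact: mulrC.
Qed.

Lemma derive_separated_space k l (eta : R -> R) N (m : mode N) (M : 'M[R]_(k.+1, l.+1)) t x a :
  'D_(edir a) (separated_field eta m M t) x = (eta t * (- sg a m * e2 (flip a m) x)) *: M.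
Proof.
have h := is_deriveZ (eta t) (is_derive_e2 m a x).
by have [_ H] := is_deriveZl M h.
Qed.

End TestFunctions.

(** * Continuous functions of time and the du Bois-Reymond lemma *)

Section TimeContinuity.
Context {R : realType}.
Local Notation mu := (@lebesgue_measure R).
Local Notation "'I_T' T" := (`]0%R, T%R[%classic : set (measurableTypeR R)) (at level 0, T at level 0).
Implicit Types (a b f : R -> R) (T t : R).

Definition continuous_on T a := forall t, t \in `[0, T] ->
  a s @[s --> within `[0, T]%classic (nbhs t)] --> a t.

Lemma continuous_on_within T a : continuous_on T a -> {within `[0, T], continuous a}.
Proof. by move=> h; apply/subspace_continuousP => t /= th; apply: h. Qed.

Lemma continuous_on_bounded T a : continuous_on T a ->
  exists2 M : R, 0 <= M & forall t, t \in `[0, T] -> `|a t| <= M.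
Proof.
move=> /continuous_on_within ca.
have [M [_ HM]] : bounded_set (a @` `[0, T]).
  by apply: compact_bounded; apply: continuous_compact => //; exact: segment_compact.
exists (`|M| + 1); first by rewrite addr_ge0.
move=> t ht; apply: (HM (`|M| + 1)); last by exists t.
by rewrite (le_lt_trans (ler_norm _))// ltrDl.
Qed.

Lemma open_sub_closed T : I_T T `<=` `[0, T]%classic.
Proof. by move=> t; rewrite /= !in_itv /= => /andP[/ltW-> /ltW->]. Qed.

Lemma continuous_on_measurable T a : continuous_on T a -> measurable_fun (I_T T) a.
Proof.
move=> /continuous_on_within ca.
apply: (@measurable_funS _ _ _ _ (`[0, T]%classic : set (measurableTypeR R))).
- exact: measurable_itv.
- exact: open_sub_closed.
- exact: subspace_continuous_measurable_fun.
Qed.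

Lemma fin_time T : (mu (I_T T) < +oo)%E.
Proof. by rewrite lebesgue_measure_itv /=; case: ifP => _; rewrite ?oppr0 ?adde0 ltry. Qed.

Lemma continuous_on_Ig T a : continuous_on T a -> mu.-integrable (I_T T) (EFin \o a).
Proof.
move=> ca; have [M _ HM] := continuous_on_bounded ca.
have mI : measurable (I_T T) by exact: measurable_itv.
apply: (Ig_bounded (M := M) mI (fin_time T) (continuous_on_measurable ca)).
by move=> t /open_sub_closed; exact: HM.
Qed.

Lemma IgS T t f : t <= T -> mu.-integrable (I_T T) (EFin \o f) ->
  mu.-integrable (I_T t) (EFin \o f).
Proof.
move=> tT; apply: integrableS; [exact: measurable_itv|exact: measurable_itv|].
by move=> s; rewrite /= !in_itv /= => /andP[->/= st]; exact: lt_le_trans tT.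
Qed.

(** The quadratic remainder matches [dcutoff_concentrates], as the squared sine of [osc_le_sin]
    matches [fejer_tail]. *)
Lemma continuity_modulus T a t0 (e : R) : continuous_on T a -> t0 \in `[0, T] -> 0 < e ->
  exists2 C : R, 0 <= C & forall t, t \in `[0, T] -> `|a t - a t0| <= e + C * (t0 - t) ^+ 2.
Proof.
move=> ca ht0 e0; have [M M0 HM] := continuous_on_bounded ca.
have /cvgrPdist_le/(_ _ e0) := ca _ ht0.
rewrite /prop_near1 /within => /nbhs_ballP[r /= r0 Hr].
exists (2 * M / r ^+ 2); first by rewrite mulr_ge0 ?mulr_ge0// invr_ge0 exprn_ge0// ltW.
move=> t ht; have [tr|tr] := ltP `|t0 - t| r.
  have := Hr t tr ht; rewrite distrC => h.
  by rewrite (le_trans h)// lerDl mulr_ge0 ?sqr_ge0// mulr_ge0 ?mulr_ge0// invr_ge0 exprn_ge0// ltW.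
rewrite (le_trans (ler_normB _ _))// (le_trans (lerD (HM _ ht) (HM _ ht0)))//.
rewrite (@le_trans _ _ (2 * M / r ^+ 2 * (t0 - t) ^+ 2)) ?lerDr ?(ltW e0)//.
rewrite -(real_normK (num_real (t0 - t))) mulrAC ler_pdivlMr ?exprn_gt0//.
rewrite [M + M](_ : _ = 2 * M); last by ring.
by rewrite ler_wpM2l ?mulr_ge0// lerXn2r ?nnegrE// ltW.
Qed.

Lemma Rint_derive_time T (f F : R -> R) : 0 < T -> continuous f ->
  (forall x : R, is_derive x (1 : R) F (f x)) ->
  \int[mu]_(x in I_T T) f x = F T - F 0.
Proof.
move=> T0 cf dF.
have cF : continuous F.
  by move=> x; apply: differentiable_continuous; apply/derivable1_diffP; have [] := dF x.
have mf (D : set (measurableTypeR R)) : measurable_fun D (EFin \o f).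
  by apply/measurable_EFinP; apply: measurable_funTS; exact: continuous_measurable_fun.
rewrite /Rintegral integral_itv_bndo_bndc ?integral_itv_obnd_cbnd//.
rewrite (@continuous_FTC2 R f F)//.
- exact: continuous_subspaceT.
- split.
  + by move=> x _; have [] := dF x.
  + exact/cvg_at_right_filter/cF.
  + exact/cvg_at_left_filter/cF.
- by move=> x _; rewrite derive1E; have [] := dF x.
- exact: mf.
- exact: mf.
Qed.

End TimeContinuity.

Section FundamentalLemma.
Context {R : realType}.
Local Notation mu := (@lebesgue_measure R).
Local Notation "'I_T' T" := (`]0%R, T%R[%classic : set (measurableTypeR R)) (at level 0, T at level 0).
Implicit Types (a b f : R -> R) (T t : R).

(* [cutoff k t0] increases to the indicator of [t < t0] as [k] grows, and
   [(t0 - t)^2 |cutoff'| <= 1/k], so that [cutoff'] concentrates at [t0]. *)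
Definition cutoff (k t0 t : R) : R := flatp 1 (k * (t0 - t)).
Definition dcutoff (k t0 t : R) : R := - k * flatp 'X^2 (k * (t0 - t)).

Lemma smooth1_cutoff k t0 : smooth1 (cutoff k t0).
Proof. exact: smooth1_flatp. Qed.

Lemma is_derive_cutoff k t0 t : is_derive t (1 : R) (cutoff k t0) (dcutoff k t0 t).
Proof.
have := is_derive_comp_affine (is_derive_flatp 1 (k * (t0 - t))).
by rewrite /dflatp derivC subr0 mulr1.
Qed.

Lemma cutoff_bounds k t0 t : 0 <= cutoff k t0 t <= 1.
Proof.
rewrite /cutoff /flatp; case: ifPn => [h|_]; last by rewrite lexx ler01.
by rewrite hornerC mul1r expR_ge0 expR_le1 oppr_le0 invr_ge0 ltW.
Qed.

Lemma cutoff_out k t0 t : 0 < k -> t0 <= t -> cutoff k t0 t = 0.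
Proof.
move=> k0 h; rewrite /cutoff /flatp ifF//; apply/negbTE.
by rewrite -leNgt pmulr_rle0// subr_le0.
Qed.

Lemma dcutoff_le0 k t0 t : 0 < k -> dcutoff k t0 t <= 0.
Proof.
move=> k0; rewrite /dcutoff /flatp; case: ifPn => [h|_]; last by rewrite mulr0.
by rewrite mulNr oppr_le0 mulr_ge0 ?(ltW k0)// hornerXn mulr_ge0 ?expR_ge0// exprn_ge0// invr_ge0 ltW.
Qed.

Lemma dcutoff_concentrates k t0 t : 0 < k -> (t0 - t) ^+ 2 * `|dcutoff k t0 t| <= k^-1.
Proof.
move=> k0; rewrite /dcutoff normrM normrN (gtr0_norm k0) /flatp.
case: ifPn => [h|_]; last by rewrite normr0 !mulr0 invr_ge0 ltW.
have h0 : 0 < t0 - t by move: h; rewrite pmulr_rgt0.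
have e1 : expR (- (k * (t0 - t))^-1) <= 1 by rewrite expR_le1 oppr_le0 invr_ge0 ltW.
rewrite hornerXn normrM (ger0_norm (expR_ge0 _)) ger0_norm ?exprn_ge0 ?invr_ge0 ?(ltW h)//.
move: (expR _) e1 => e e1.
have -> : (t0 - t) ^+ 2 * (k * ((k * (t0 - t))^-1 ^+ 2 * e)) = k^-1 * e.
  by field; rewrite !gt_eqF.
by rewrite ler_piMr// invr_ge0 ltW.
Qed.

Lemma continuous_flatp (p : {poly R}) : continuous (flatp p).
Proof.
move=> x; apply: differentiable_continuous; apply/derivable1_diffP.
by have [] := is_derive_flatp p x.
Qed.

Lemma continuous_dcutoff k t0 : continuous (dcutoff k t0).
Proof.
move=> t; apply: cvgM; first exact: cvg_cst.
apply: (@continuous_comp _ _ _ (fun s : R => k * (t0 - s)) (flatp 'X^2)); last exact: continuous_flatp.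
apply: cvgM; first exact: cvg_cst.
by apply: cvgB; [exact: cvg_cst|exact: cvg_id].
Qed.

Lemma cvg_flatp1 (c : R) : 0 < c -> flatp 1 (n.+1%:R * c) @[n --> \oo] --> (1 : R).
Proof.
move=> c0; have -> : (fun n => flatp 1 (n.+1%:R * c)) = (fun n => expR (- (c^-1 * n.+1%:R^-1))).
  by apply/funext => n; rewrite /flatp mulr_gt0// hornerC mul1r invfM mulrC.
have E : expR (- (c^-1 * 0)) = 1 :> R by rewrite mulr0 oppr0 expR0.
rewrite -[X in _ --> X]E.
apply: continuous_cvg; first exact: continuous_expR.
by apply: cvgN; apply: cvgM; [exact: cvg_cst|exact: cvg_harmonic].
Qed.

Lemma Rint_indicator T t0 (f : R -> R) : t0 <= T ->
  \int[mu]_(t in I_T T) (f t * (t < t0)%R%:R) = \int[mu]_(t in I_T t0) f t.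
Proof.
move=> t0T.
have -> : I_T t0 = I_T T `&` [set t | t < t0].
  apply/seteqP; split=> t /=; rewrite !in_itv /=.
    by move=> /andP[-> h]; split=> //=; exact: lt_le_trans t0T.
  by move=> [/andP[-> _] ->].
rewrite Rintegral_mkcondr; apply: eq_Rintegral => t _; rewrite patchE.
case: ifPn => [|]; first by rewrite inE /= => ->; rewrite mulr1.
by rewrite notin_setE /= => /negP/negbTE->; rewrite mulr0.
Qed.

(** Testing with cutoffs that increase to the indicator of t < t0: their derivatives tend to minus a
    unit mass at t0, so the weak equation tends to - a(t0) + int_0^t0 b + a0 = 0. *)
Lemma du_bois_reymond_interior T a b (a0 t0 : R) : continuous_on T a ->
  mu.-integrable (I_T T) (EFin \o b) ->
  (forall eta eta', smooth1 eta -> (forall t : R, is_derive t (1 : R) eta (eta' t)) ->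
    (exists2 T', T' < T & forall t, T' <= t -> eta t = 0) -> continuous eta' ->
    \int[mu]_(t in I_T T) (a t * eta' t) + \int[mu]_(t in I_T T) (b t * eta t) + a0 * eta 0 = 0) ->
  0 < t0 < T -> a t0 = a0 + \int[mu]_(t in I_T t0) b t.
Proof.
move=> ca hb H /andP[t00 t0T]; have T0 : 0 < T by exact: lt_trans t0T.
have mI : measurable (I_T T) by exact: measurable_itv.
pose k (n : nat) : R := n.+1%:R; have k0 n : 0 < k n by [].
pose c n := cutoff (k n) t0; pose dc n := dcutoff (k n) t0.
have Hn n : \int[mu]_(t in I_T T) (a t * dc n t) + \int[mu]_(t in I_T T) (b t * c n t) + a0 * c n 0 = 0.
  apply: H; [exact: smooth1_cutoff|exact: is_derive_cutoff| |exact: continuous_dcutoff].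
  by exists t0 => // t; exact: cutoff_out.
have cdc n : continuous (dc n) by exact: continuous_dcutoff.
have mdc n : measurable_fun (I_T T) (dc n).
  by apply: measurable_funTS; apply: continuous_measurable_fun; exact: continuous_dcutoff.
have mc n : measurable_fun (I_T T) (c n).
  apply: measurable_funTS; apply: continuous_measurable_fun => t.
  apply: differentiable_continuous; apply/derivable1_diffP.
  by have [] := is_derive_cutoff (k n) t0 t.
have idc n : mu.-integrable (I_T T) (EFin \o dc n).
  by apply: continuous_on_Ig => t _; apply: cvg_within_filter; exact: continuous_dcutoff.
have FTC n : \int[mu]_(t in I_T T) dc n t = - c n 0.
  rewrite (@Rint_derive_time R T (dc n) (c n) T0 (cdc n) (is_derive_cutoff (k n) t0)).
  by rewrite /c (cutoff_out (k0 n) (ltW t0T)) sub0r.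
have dcE n : \int[mu]_(t in I_T T) `|dc n t| = c n 0.
  have -> : (fun t => `|dc n t|) = (fun t => - dc n t).
    by apply/funext => t; rewrite ler0_norm// dcutoff_le0.
  by rewrite (Rint_opp mI (idc n)) FTC opprK.
pose B := \int[mu]_(t in I_T t0) b t.
have lim_c : c n 0 @[n --> \oo] --> (1 : R).
  by rewrite /c /cutoff /k subr0; exact: cvg_flatp1.
have lim_b : \int[mu]_(t in I_T T) (b t * c n t) @[n --> \oo] --> B.
  rewrite /B -(Rint_indicator b (ltW t0T)).
  have mb := Ig_measurable hb.
  apply: (cvg_Rint_dominated mI (f_ := fun n t => b t * c n t) (f := fun t => b t * (t < t0)%R%:R) _ _ _ (Ig_abs hb)).
  - by move=> n; exact: measurable_funM.
  - apply: measurable_funM => //.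
    rewrite (_ : (fun t => (t < t0)%R%:R) = \1_(`]-oo, t0[%classic : set (measurableTypeR R))).
      by apply: measurable_indic; exact: measurable_itv.
    by apply/funext => t; rewrite indicE mem_setE in_itv.
  - apply: aeW => t _; apply: cvgM; first exact: cvg_cst.
    rewrite /c /cutoff /k; have [tt0|tt0] := ltP t t0; last first.
      rewrite (_ : (fun n => _) = cst 0); first exact: cvg_cst.
      by apply/funext => n; apply: cutoff_out.
    by apply: cvg_flatp1; rewrite subr_gt0.
  - apply: aeW => t n _; rewrite normrM ler_piMr//.
    by have /andP[h1 h2] := cutoff_bounds (k n) t0 t; rewrite ger0_norm.
have lim : a t0 * c n 0 - (a0 * c n 0 + \int[mu]_(t in I_T T) (b t * c n t)) @[n --> \oo]
    --> a t0 * 1 - (a0 * 1 + B).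
  by apply: cvgB; [|apply: cvgD => //]; apply: cvgM => //; exact: cvg_cst.
(* By the weak equation this expression is the integral of [(a t - a t0) * dc n t], which is small
   because [dc n] concentrates at [t0]; the claim is the uniqueness of its limit. *)
have lim0 : a t0 * c n 0 - (a0 * c n 0 + \int[mu]_(t in I_T T) (b t * c n t)) @[n --> \oo] --> (0 : R).
  apply/cvgrPdist_le => e e0.
  have t0in : t0 \in `[0, T] by rewrite in_itv /= !ltW.
  have e2 : 0 < e / 2 by rewrite divr_gt0.
  have [C C0 HC] := continuity_modulus ca t0in e2.
  have CT : 0 < C * T + 1 by rewrite ltr_wpDl// mulr_ge0// ltW.
  near=> n; rewrite sub0r normrN.
  have ia : mu.-integrable (I_T T) (EFin \o (fun t => a t * dc n t)).
    have [M M0 HM] := continuous_on_bounded ca.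
    rewrite (_ : (fun t => _) = fun t => dc n t * a t); last by apply/funext => t; rewrite mulrC.
    apply: (IgM_bounded mI (idc n) (continuous_on_measurable ca) (M := M)).
    by move=> t /open_sub_closed; exact: HM.
  have E : (fun t => (a t - a t0) * dc n t) = (fun t => a t * dc n t - a t0 * dc n t).
    by apply/funext => t; rewrite mulrBl.
  have iE : mu.-integrable (I_T T) (EFin \o (fun t => (a t - a t0) * dc n t)).
    by rewrite E; exact: (IgB mI ia (IgZ mI (a t0) (idc n))).
  have -> : a t0 * c n 0 - (a0 * c n 0 + \int[mu]_(t in I_T T) (b t * c n t)) =
      \int[mu]_(t in I_T T) ((a t - a t0) * dc n t).
    rewrite E (RintegralB mI ia (IgZ mI (a t0) (idc n))) (Rint_Zl mI (a t0) (idc n)) FTC.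
    have := Hn n; move: (\int[mu]_(t in I_T T) (a t * dc n t)) => X.
    move: (\int[mu]_(t in I_T T) (b t * c n t)) => Y h.
    have -> : X = - (Y + a0 * c n 0) by apply/eqP; rewrite -subr_eq0 opprK addrA; apply/eqP.
    by ring.
  have ib := IgD mI (IgZ mI (e / 2) (Ig_abs (idc n))) (Ig_cst mI (C * (k n)^-1) (fin_time T)).
  have ineq : \int[mu]_(t in I_T T) `|(a t - a t0) * dc n t| <=
      \int[mu]_(t in I_T T) (e / 2 * `|dc n t| + C * (k n)^-1).
    apply: le_Rintegral => //; first exact: Ig_abs.
    move=> t /open_sub_closed ht; rewrite normrM.
    apply: (@le_trans _ _ ((e / 2 + C * (t0 - t) ^+ 2) * `|dc n t|)).
      by apply: ler_wpM2r => //; exact: HC.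
    rewrite mulrDl lerD2l -mulrA; apply: ler_wpM2l => //; exact: dcutoff_concentrates.
  apply: (le_trans (le_normr_Rintegral mI iE)); apply: (le_trans ineq).
  rewrite (RintegralD mI (IgZ mI (e / 2) (Ig_abs (idc n))) (Ig_cst mI (C * (k n)^-1) (fin_time T))).
  rewrite (Rint_Zl mI (e / 2) (Ig_abs (idc n))) dcE Rintegral_cst//.
  rewrite [X in fine X](_ : _ = T%:E); last first.
    by rewrite [LHS]lebesgue_measure_itv /= lte_fin T0 oppr0 adde0.
  have kn : n.+1%:R^-1 < e / 2 / (C * T + 1).
    by near: n; exact: (near_infty_natSinv_lt (PosNum (divr_gt0 e2 CT))).
  have h1 : e / 2 * c n 0 <= e / 2.
    by rewrite ler_piMr ?(ltW e2)//; have /andP[] := cutoff_bounds (k n) t0 0.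
  have h2 : C * (k n)^-1 * T <= e / 2.
    rewrite mulrAC (le_trans _ (ltW (_ : (C * T + 1) * (k n)^-1 < e / 2)))//.
      by rewrite ler_wpM2r ?invr_ge0 ?lerDl// ltW.
    by rewrite mulrC -ltr_pdivlMr.
  by rewrite (le_trans (lerD h1 h2))// -splitr.
have e : a t0 * 1 - (a0 * 1 + B) = 0.
  exact: (etrans (esym (cvg_lim (@norm_hausdorff _ _) lim)) (cvg_lim (@norm_hausdorff _ _) lim0)).
by apply/eqP; rewrite -subr_eq0; apply/eqP; move: e; rewrite !mulr1.
Unshelve. all: by end_near. Qed.


End FundamentalLemma.

(** * Primitives, Gronwall's lemma and the square of a primitive *)

Section TimeIntegrals.
Context {R : realType}.
Local Notation mu := (@lebesgue_measure R).
Local Notation "'I_T' T" := (`]0%R, T%R[%classic : set (measurableTypeR R)) (at level 0, T at level 0).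
Implicit Types (a b f : R -> R) (T t : R).

Definition primitive f t : R := \int[mu]_(s in I_T t) f s.

Lemma primitive0 f : primitive f 0 = 0.
Proof. by rewrite /primitive set_itv_ge ?Rintegral_set0// bnd_simp ltxx. Qed.

Lemma primitive_continuous T f : 0 < T -> mu.-integrable (I_T T) (EFin \o f) ->
  continuous_on T (primitive f).
Proof.
move=> T0 hf; have mI t : measurable (I_T t) by exact: measurable_itv.
pose g := f \_ (I_T T).
have hg (D : set (measurableTypeR R)) : measurable D -> mu.-integrable D (EFin \o g).
  move=> mD; apply: (integrableS measurableT mD (@subsetT _ _)).
  rewrite (_ : EFin \o g = (EFin \o f) \_ (I_T T)).
    by apply/(integrable_mkcond (mu := mu) (EFin \o f) (mI T)).
  by apply/funext => t; rewrite /g /= !patchE; case: ifP.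
have gE t : t \in `[0, T] -> parameterized_integral mu 0 t g = primitive f t.
  rewrite in_itv /= => /andP[t0 tT].
  rewrite /parameterized_integral -Rintegral_itv_obnd_cbnd; last exact: hg (measurable_itv _).
  rewrite -Rintegral_itv_bndo_bndc; last exact: hg (measurable_itv _).
  apply: eq_Rintegral => s; rewrite inE /= in_itv /= => /andP[s0 st].
  by rewrite /g patchE ifT// inE /= in_itv /= s0 (lt_le_trans st).
have := parameterized_integral_continuous (ltW T0) (hg _ (measurable_itv _)).
move=> /subspace_continuousP ch t ht.
rewrite -(gE t ht); apply: cvg_trans (ch t ht).
apply: near_eq_cvg; rewrite near_withinE; apply: nearW => s hs.
exact: gE.
Qed.

Lemma continuous_on_eq0 T a : 0 < T -> continuous_on T a -> (forall t, 0 < t < T -> a t = 0) ->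
  forall t, t \in `[0, T] -> a t = 0.
Proof.
move=> T0 ca a0 t ht; apply: eq_eps => e e0; rewrite subr0.
have e2 : 0 < e / 2 by rewrite divr_gt0.
have [C C0 HC] := continuity_modulus ca ht e2.
have CT : 0 <= C * T ^+ 2 by rewrite mulr_ge0 ?sqr_ge0.
(* The point [t] is moved by the fraction [r] towards the middle of the interval: the new point is
   interior, and [C (r T)^2 <= e / 2]. *)
pose r := e / 2 / (e / 2 + C * T ^+ 2).
have d0 : 0 < e / 2 + C * T ^+ 2 by rewrite ltr_pwDl.
have r0 : 0 < r by rewrite divr_gt0.
have r1 : r <= 1 by rewrite ler_pdivrMr// mul1r lerDl.
have /andP[t0 tT] : 0 <= t <= T by move: ht; rewrite in_itv.
pose s := t + r * (T / 2 - t).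
have s0 : 0 < s.
  rewrite /s (_ : _ + _ = (1 - r) * t + r * (T / 2)); last by ring.
  by rewrite ltr_wpDl ?mulr_ge0 ?subr_ge0// mulr_gt0// divr_gt0.
have sT : s < T.
  rewrite -subr_gt0 (_ : T - s = (1 - r) * (T - t) + r * (T / 2)); last first.
    by rewrite /s; field.
  by rewrite ltr_wpDl ?mulr_ge0 ?subr_ge0// mulr_gt0// divr_gt0.
have as0 : a s = 0 by apply: a0; rewrite s0.
have sin : s \in `[0, T] by rewrite in_itv /= (ltW s0) (ltW sT).
have := HC s sin; rewrite as0 sub0r normrN => h.
rewrite (le_trans h)// [leRHS]splitr lerD2l.
have -> : t - s = - r * (T / 2 - t) by rewrite /s; ring.
rewrite exprMn sqrrN.
have h1 : (T / 2 - t) ^+ 2 <= T ^+ 2.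
  by rewrite -subr_ge0 subr_sqr mulr_ge0; lra.
have h2 : r ^+ 2 <= r by rewrite expr2 ler_piMr// ltW.
apply: (@le_trans _ _ (C * (r * T ^+ 2))).
  by rewrite ler_wpM2l// ler_pM// sqr_ge0.
rewrite mulrCA /r mulrAC ler_pdivrMr// ler_wpM2l ?(ltW e2)// lerDr; exact: ltW.
Qed.

Lemma du_bois_reymond T a b (a0 : R) : 0 < T -> continuous_on T a ->
  mu.-integrable (I_T T) (EFin \o b) ->
  (forall eta eta', smooth1 eta -> (forall t : R, is_derive t (1 : R) eta (eta' t)) ->
    (exists2 T', T' < T & forall t, T' <= t -> eta t = 0) -> continuous eta' ->
    \int[mu]_(t in I_T T) (a t * eta' t) + \int[mu]_(t in I_T T) (b t * eta t) + a0 * eta 0 = 0) ->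
  forall t, t \in `[0, T] -> a t = a0 + primitive b t.
Proof.
move=> T0 ca hb H t ht; apply/eqP; rewrite -subr_eq0; apply/eqP.
apply: (continuous_on_eq0 (a := fun t => a t - (a0 + primitive b t)) T0 _ _ ht).
  move=> s hs; apply: cvgB; first exact: ca.
  by apply: cvgD; [exact: cvg_cst|exact: primitive_continuous].
by move=> s hs; rewrite (du_bois_reymond_interior ca hb H hs) subrr.
Qed.

(** Let m be the maximum of E(t) exp(- 2 C t). At the point where it is attained the integral term
    contributes at most m / 2, thanks to the doubled rate, so m <= 2 H. No derivative of [E] is
    taken. *)
Lemma gronwall T (E : R -> R) (C H : R) : 0 < T -> 0 < C -> 0 <= H -> continuous_on T E ->
  (forall t, t \in `[0, T] -> E t <= H + C * primitive E t) ->
  forall t, t \in `[0, T] -> E t <= 2 * H * expR (2 * C * T).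
Proof.
move=> T0 C0 H0 cE HE.
have cX (t : R) : expR (- (2 * C * s)) @[s --> within `[0, T]%classic (nbhs t)] --> expR (- (2 * C * t)).
  apply: cvg_within_filter; apply: continuous_cvg; first exact: continuous_expR.
  by apply: cvgN; apply: cvgM; [exact: cvg_cst|exact: cvg_id].
have [c hc Hc] : exists2 c, c \in `[0, T]%R & forall t, t \in `[0, T]%R ->
    E t * expR (- (2 * C * t)) <= E c * expR (- (2 * C * c)).
  apply: (@EVT_max R (fun t => E t * expR (- (2 * C * t)))); first exact: ltW.
  by apply: continuous_on_within => t ht; apply: cvgM; [exact: cE|exact: cX].
set m := E c * expR _ in Hc.
have Em t : t \in `[0, T] -> E t <= m * expR (2 * C * t).
  by move=> ht; rewrite -ler_pdivrMr ?expR_gt0// -expRN; exact: Hc.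
have m2 : m <= 2 * H.
  have [m0|m0] := leP m 0; first by rewrite (le_trans m0)// mulr_ge0.
  have /andP[c0 cT] : 0 <= c <= T by move: hc; rewrite in_itv.
  have mI t : measurable (I_T t) by exact: measurable_itv.
  pose G t : R := m / (2 * C) * expR (2 * C * t).
  have dG (x : R) : is_derive x (1 : R) G (m * expR (2 * C * x)).
    have d1 : is_derive x (1 : R) (fun t : R => 2 * C * t) (2 * C).
      have := is_deriveZ (2 * C) (is_derive_id x (1 : R)); rewrite /GRing.scale /= mulr1.
      exact.
    have d2 := @is_derive1_comp R expR (fun t : R => 2 * C * t) x _ _ (is_derive_expR _) d1.
    apply: (is_derive_eq (is_deriveZ (m / (2 * C)) d2)); rewrite /GRing.scale /=.
    by field; rewrite gt_eqF.
  have cg : continuous (fun t : R => m * expR (2 * C * t)).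
    move=> x; apply: cvgM; first exact: cvg_cst.
    apply: continuous_cvg; first exact: continuous_expR.
    by apply: cvgM; [exact: cvg_cst|exact: cvg_id].
  have mC0 : 0 <= m / (2 * C) by apply: divr_ge0; [exact: ltW|rewrite mulr_ge0// ltW].
  have le1 : primitive E c <= m / (2 * C) * expR (2 * C * c).
    have [c0'|c00] := eqVneq c 0.
      by rewrite c0' primitive0 mulr_ge0 ?expR_ge0.
    have cp : 0 < c by rewrite lt_def c00.
    apply: (@le_trans _ _ (\int[mu]_(t in I_T c) (m * expR (2 * C * t)))).
      apply: le_Rintegral => //.
      - exact: IgS cT (continuous_on_Ig cE).
      - by apply: continuous_on_Ig => t _; apply: cvg_within_filter; exact: cg.
      - move=> t; rewrite /= in_itv /= => /andP[t0 tc]; apply: Em.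
        by rewrite in_itv /= ltW//= (le_trans (ltW tc)).
    rewrite (Rint_derive_time cp cg dG) /G lerBlDr lerDl.
    by rewrite mulr_ge0 ?expR_ge0.
  have h := HE c hc.
  have h2 : E c <= H + 2^-1 * (m * expR (2 * C * c)).
    rewrite (le_trans h)// lerD2l (le_trans (ler_wpM2l (ltW C0) le1))//.
    by rewrite le_eqVlt; apply/orP; left; apply/eqP; field; rewrite gt_eqF.
  have h3 : m <= H * expR (- (2 * C * c)) + 2^-1 * m.
    rewrite {1}/m (le_trans (ler_wpM2r (expR_ge0 _) h2))// mulrDl lerD2l.
    have aux (x z : R) : 2^-1 * (x * expR z) * expR (- z) = 2^-1 * x.
      by rewrite -mulrA -[X in 2^-1 * X]mulrA -expRD subrr expR0 mulr1.
    by rewrite aux.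
  have h4 : H * expR (- (2 * C * c)) <= H.
    by rewrite ler_piMr// expR_le1 oppr_le0 mulr_ge0// mulr_ge0// ltW.
  have aux (x y : R) : x <= y + 2^-1 * x -> y <= H -> x <= 2 * H by clear; lra.
  exact: aux h3 h4.
move=> t ht; rewrite (le_trans (Em t ht))//.
have [m0|m0] := leP m 0.
  apply: (@le_trans _ _ 0); first by apply: mulr_le0_ge0 => //; exact: expR_ge0.
  by apply: mulr_ge0; [exact: mulr_ge0|exact: expR_ge0].
apply: (ler_pM (ltW m0) (expR_ge0 _) m2).
rewrite ler_expR ler_wpM2l ?mulr_ge0 ?(ltW C0)//.
by move: ht; rewrite in_itv => /andP[].
Qed.

Lemma measurable_before (D : set (measurableTypeR R)) r : measurable_fun D (fun s => (s < r)%R%:R : R).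
Proof.
apply: measurable_funTS; rewrite (_ : (fun s => _) = \1_(`]-oo, r[%classic : set (measurableTypeR R))).
  by apply: measurable_indic; exact: measurable_itv.
by apply/funext => s; rewrite indicE mem_setE in_itv.
Qed.

Lemma Ig_before f t r : mu.-integrable (I_T t) (EFin \o f) ->
  mu.-integrable (I_T t) (EFin \o (fun s => f s * (s < r)%R%:R)).
Proof.
move=> hf; have mI : measurable (I_T t) by exact: measurable_itv.
apply: (IgM_bounded mI hf (@measurable_before (I_T t) r) (M := 1)).
by move=> s _; case: (s < r); rewrite ?normr1 ?normr0.
Qed.

(** Here [f] is merely integrable, so the product rule is replaced by Fubini: the square ]0,
    t[ x ]0, t[ is cut along its diagonal, and each triangle gives the integral of [primitive f]
    times [f]. *)
Lemma sqr_primitive T f : 0 < T -> mu.-integrable (I_T T) (EFin \o f) ->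
  forall t, t \in `[0, T] -> primitive f t ^+ 2 = primitive (fun s => 2 * (primitive f s * f s)) t.
Proof.
move=> T0 hf t ht; have mI s : measurable (I_T s) by exact: measurable_itv.
have /andP[t0 tT] : 0 <= t <= T by move: ht; rewrite in_itv.
have cp := primitive_continuous T0 hf; have {}hf := IgS tT hf.
pose P (z : measurableTypeR R * measurableTypeR R) := f z.1 * f z.2.
have hP : (mu \x mu)%E.-integrable (I_T t `*` I_T t) (EFin \o P) by exact: Ig_tensor.
pose A : set (measurableTypeR R * measurableTypeR R) := [set z | z.2 < z.1].
have mP := measurableX (mI t) (mI t).
have mA : measurable_fun (I_T t `*` I_T t) (\1_A : _ -> R).
  apply: measurable_funTS; apply: measurable_indic.
  have -> : A = (fun z : measurableTypeR R * measurableTypeR R => z.1 - z.2) @^-1` `]0, +oo[%classic.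
    by apply/seteqP; split=> z /=; rewrite in_itv /= andbT subr_gt0.
  rewrite -[X in measurable X]setTI.
  have : measurable_fun setT (fun z : measurableTypeR R * measurableTypeR R => (z.1 : R) - z.2).
    by apply: measurable_funB.
  by apply => //; exact: measurable_itv.
have hPA : (mu \x mu)%E.-integrable (I_T t `*` I_T t) (EFin \o (fun z => P z * \1_A z)).
  apply: (IgM_bounded mP hP mA (M := 1)) => z _.
  by rewrite indicE; case: (z \in A); rewrite ?normr1 ?normr0.
have hPB : (mu \x mu)%E.-integrable (I_T t `*` I_T t) (EFin \o (fun z => P z - P z * \1_A z)).
  exact: (IgB mP hP hPA).
have e1 : \int[(mu \x mu)%E]_(z in I_T t `*` I_T t) P z = primitive f t ^+ 2.
  rewrite (Fubini_Rint1 (mI t) (mI t) hP) /P /= expr2.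
  under eq_Rintegral do rewrite (Rint_Zl (mI t) _ hf).
  rewrite -[LHS]/(\int[mu]_(x in I_T t) (f x * primitive f t)).
  under eq_Rintegral do rewrite mulrC.
  by rewrite (Rint_Zl (mI t) _ hf).
have slice r : I_T t r -> primitive f r = \int[mu]_(s in I_T t) (f s * (s < r)%R%:R).
  by rewrite /= in_itv /= => /andP[_ /ltW rt]; rewrite (Rint_indicator f rt).
have e2 : \int[(mu \x mu)%E]_(z in I_T t `*` I_T t) (P z * \1_A z) =
    \int[mu]_(r in I_T t) (primitive f r * f r).
  rewrite (Fubini_Rint1 (mI t) (mI t) hPA) /=; apply: eq_Rintegral => r; rewrite inE => rt.
  have hi := Ig_before r hf.
  rewrite (slice r rt) mulrC -(Rint_Zl (mI t) _ hi).
  by apply: eq_Rintegral => s _; rewrite /P /= indicE mem_setE /= mulrA.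
have e3 : \int[(mu \x mu)%E]_(z in I_T t `*` I_T t) (P z - P z * \1_A z) =
    \int[mu]_(s in I_T t) (primitive f s * f s).
  rewrite (Fubini_Rint2 (mI t) (mI t) hPB) /=; apply: eq_Rintegral => s; rewrite inE => st.
  have ms : measurable_fun (I_T t) (fun r => 1 - \1_A (r, s) : R).
    apply: measurable_funB; first exact: measurable_cst.
    apply: measurable_funTS.
    rewrite (_ : (fun r => _) = \1_(`]s, +oo[%classic : set (measurableTypeR R))).
      by apply: measurable_indic; exact: measurable_itv.
    by apply/funext => r; rewrite !indicE !mem_setE in_itv /= andbT.
  have hi : mu.-integrable (I_T t) (EFin \o (fun r => f r * (1 - \1_A (r, s)))).
    apply: (IgM_bounded (mI t) hf ms (M := 1)).
    by move=> r _; rewrite indicE; case: (_ \in A); rewrite ?subr0 ?subrr ?normr1 ?normr0.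
  have -> : primitive f s = \int[mu]_(r in I_T t) (f r * (1 - \1_A (r, s))).
    move: st; rewrite /= in_itv /= => /andP[s0 st].
    rewrite /primitive Rintegral_itv_bndo_bndc; last exact: IgS (ltW st) hf.
    have -> : `]0, s]%classic = I_T t `&` [set r | r <= s].
      apply/seteqP; split=> r /=; rewrite !in_itv /=.
        by move=> /andP[-> h]; split=> //=; exact: le_lt_trans st.
      by move=> [/andP[-> _] ->].
    rewrite Rintegral_mkcondr; apply: eq_Rintegral => r _; rewrite patchE indicE.
    case: ifPn => [|]; rewrite ?inE ?notin_setE /= => h.
      by rewrite memNset ?subr0 ?mulr1//= /A /=; apply/negP; rewrite -leNgt.
    by rewrite mem_set ?subrr ?mulr0// /A /= ltNge; exact/negP.
  rewrite mulrC -(Rint_Zl (mI t) _ hi).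
  by apply: eq_Rintegral => r _; rewrite /P /=; ring.
have hpf : mu.-integrable (I_T t) (EFin \o (fun s => primitive f s * f s)).
  have [M M0 HM] := continuous_on_bounded cp.
  have mp : measurable_fun (I_T t) (primitive f).
    apply: (measurable_funS (mI T) _ (continuous_on_measurable cp)) => s.
    by rewrite /= !in_itv /= => /andP[-> st]; exact: lt_le_trans tT.
  rewrite (_ : (fun s => _) = fun s => f s * primitive f s); last by apply/funext => s; rewrite mulrC.
  apply: (IgM_bounded (mI t) hf mp (M := M)) => s; rewrite /= in_itv /= => /andP[s0 st].
  by apply: HM; rewrite in_itv /= ltW//= (le_trans (ltW st)).
rewrite -e1 /primitive -/(primitive f) (Rint_Zl (mI t) 2 hpf).
have -> : P = (fun z => P z * \1_A z + (P z - P z * \1_A z)) by apply/funext => z; rewrite addrC subrK.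
by rewrite (RintegralD mP hPA hPB) e2 e3 mulr_natl mulr2n.
Qed.

End TimeIntegrals.

(** * Joint integrability, and continuity in time of coefficients and norms *)

Section Tonelli.
Context d1 d2 (T1 : measurableType d1) (T2 : measurableType d2) (R : realType)
  (m1 : {sigma_finite_measure set T1 -> \bar R})
  (m2 : {sigma_finite_measure set T2 -> \bar R}).
Variables (D1 : set T1) (D2 : set T2) (mD1 : measurable D1) (mD2 : measurable D2).
Variable h : T1 * T2 -> R.
Hypothesis mh : measurable_fun (D1 `*` D2) h.

Let mD : measurable (D1 `*` D2). Proof. exact: measurableX. Qed.
Let h' : T1 * T2 -> \bar R := (EFin \o (fun z => `|h z|)) \_ (D1 `*` D2).
Let mh' : measurable_fun setT h'.
Proof.
apply/(measurable_restrictT _ mD)/measurable_EFinP.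
exact: measurableT_comp.
Qed.

Let slice x : (\int[m2]_y h' (x, y) = ((fun x => \int[m2]_(y in D2) `|h (x, y)|%:E) \_ D1) x)%E.
Proof.
rewrite [RHS]patchE; case: ifPn => xD.
  rewrite [RHS]integral_mkcond; apply: eq_integral => y _.
  by rewrite /h' /patch in_setX /= xD.
by rewrite integral0_eq// => y _; rewrite /h' /patch in_setX /= (negbTE xD).
Qed.

Let mslice : measurable_fun D1 (fun x => \int[m2]_(y in D2) `|h (x, y)|%:E)%E.
Proof.
apply/(measurable_restrictT _ mD1).
rewrite (_ : _ \_ _ = (fun x => \int[m2]_y h' (x, y))%E); last by apply/funext => x; rewrite slice.
apply: (@measurable_fun_fubini_tonelli_F _ _ _ _ _ m2 h') => // z.
by rewrite /h' /patch; case: ifP => // _; rewrite lee_fin.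
Qed.

Lemma Ig_tonelli : (\int[m1]_(x in D1) \int[m2]_(y in D2) `|h (x, y)|%:E < +oo)%E ->
  (m1 \x m2)%E.-integrable (D1 `*` D2) (EFin \o h).
Proof.
move=> hlt.
have : (m1 \x m2)%E.-integrable (D1 `*` D2) (EFin \o (fun z => `|h z|)).
  rewrite (integrable_mkcond _ mD); apply/(integrable12ltyP _ _ mh').
  apply: le_lt_trans hlt; rewrite [leRHS]integral_mkcond le_eqVlt; apply/orP; left; apply/eqP.
  apply: eq_integral => x _; rewrite -slice; apply: eq_integral => y _.
  by rewrite gee0_abs// /h' /patch; case: ifP => // _; rewrite lee_fin.
move=> hi; apply: (Ig_le mD mh _ hi) => z _; exact: lexx.
Qed.

Lemma Ig_tonelli_ae (B : R) : (m1 D1 < +oo)%E -> 0 <= B ->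
  {ae m1, forall x, D1 x -> m2.-integrable D2 (EFin \o (fun y => h (x, y))) /\
    \int[m2]_(y in D2) `|h (x, y)| <= B} ->
  (m1 \x m2)%E.-integrable (D1 `*` D2) (EFin \o h).
Proof.
move=> fD B0 H; apply: Ig_tonelli.
apply: (@le_lt_trans _ _ (\int[m1]_(x in D1) (cst B%:E) x)%E).
  apply: ae_ge0_le_integral => //.
  - by move=> x _; apply: integral_ge0 => y _; rewrite lee_fin.
  - move: H; apply: filterS => x Hx /Hx[hi le].
    by rewrite (Ig_fin mD2 (Ig_abs hi)) lee_fin.
by rewrite integral_cst// lte_mul_pinfty.
Qed.

End Tonelli.

Section FieldSlices.
Context {R : realType}.
Local Notation mu := (@lebesgue_measure R).
Local Notation mu2 := (@lebesgue_measure R \x @lebesgue_measure R)%E.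
Local Notation cell := (@cell R).
Local Notation Ig f := (mu2.-integrable cell (EFin \o f)).
Let mC : measurable cell := @measurable_cell R.
Let fC : (mu2 cell < +oo)%E := @fin_cell R.

Lemma powR_sqr (x : R) : 0 <= x -> x `^ 2 = x ^+ 2.
Proof. exact: (@powR_mulrn R x 2). Qed.

Lemma inL_Ig m n q (f : R * R -> 'M[R]_(m, n)) : inL q f -> Ig (fun x => fnorm (f x) `^ q).
Proof.
move=> [mf ltf]; apply: Ig_ge0 => //; last by move=> x _; exact: powR_ge0.
by apply: (measurableT_comp (measurable_powR q)); exact: measurable_fnorm.
Qed.

Lemma inL2_sqr m n (f : R * R -> 'M[R]_(m, n)) i j : inL 2 f -> Ig (fun x => f x i j ^+ 2).
Proof.
move=> hf; have [mf _] := hf; apply: (Ig_le mC _ _ (inL_Ig hf)); first exact: measurable_funX.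
move=> x _; rewrite powR_sqr ?fnorm_ge0// ger0_norm ?sqr_ge0//.
rewrite -(real_normK (num_real (f x i j))) lerXn2r ?nnegrE ?fnorm_ge0//; exact: abs_entry_le.
Qed.

Lemma Ig_of_sqr (g : R * R -> R) : measurable_fun cell g -> Ig (fun x => g x ^+ 2) -> Ig g.
Proof.
move=> mg hg; apply: (Ig_le mC mg _ (IgD mC (Ig_cst mC 1 fC) hg)) => x _.
rewrite -(real_normK (num_real (g x))); move: (`|g x|) => y.
by have := sqr_ge0 (y - 2^-1); rewrite sqrrB; lra.
Qed.

Lemma inL2_Ig m n (f : R * R -> 'M[R]_(m, n)) i j : inL 2 f -> Ig (fun x => f x i j).
Proof. by move=> hf; apply: Ig_of_sqr; [case: hf|exact: inL2_sqr]. Qed.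

Lemma inL2_sqr_fnorm m n (f : R * R -> 'M[R]_(m, n)) : inL 2 f -> Ig (fun x => fnorm (f x) ^+ 2).
Proof.
move=> /inL_Ig h; rewrite (_ : (fun x => _) = (fun x => fnorm (f x) `^ 2))//.
by apply/funext => x; rewrite powR_sqr ?fnorm_ge0.
Qed.

Lemma inL2B m n (f g : R * R -> 'M[R]_(m, n)) i j : inL 2 f -> inL 2 g ->
  Ig (fun x => (f x i j - g x i j) ^+ 2).
Proof.
move=> hf hg; have h := IgZ mC 2 (IgD mC (inL2_sqr i j hf) (inL2_sqr i j hg)).
apply: (Ig_le mC _ _ h).
  by apply: measurable_funX; apply: measurable_funB; [case: hf|case: hg].
move=> x _; rewrite ger0_norm ?sqr_ge0//; move: (f x i j) (g x i j) => a b.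
by have := sqr_ge0 (a + b); rewrite sqrrB sqrrD; lra.
Qed.

Variable T : R.

Lemma slice_dist_near m n (f : R -> R * R -> 'M[R]_(m, n)) i j t (e : R) : C_L T 2 f ->
  t \in `[0, T] -> 0 < e -> \forall s \near within `[0, T]%classic (nbhs t),
    s \in `[0, T] /\ \int[mu2]_(x in cell) (f s x i j - f t x i j) ^+ 2 <= e.
Proof.
move=> [_ hf] ht e0; have [hft /fine_cvgP[_ /cvgrPdist_le/(_ _ e0) H]] := hf t ht.
near=> s.
have hs : s \in `[0, T] by near: s; rewrite near_withinE; apply: nearW => s'.
split=> //; have [hfs _] := hf s hs.
have hd : Ig (fun x => fnorm (f s x - f t x) ^+ 2).
  rewrite (_ : (fun x => _) = (fun x => \sum_k \sum_l (f s x k l - f t x k l) ^+ 2)).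
    by apply: Ig_sum => // k; apply: Ig_sum => // l; exact: inL2B.
  by apply/funext => x; rewrite sqr_fnorm; do 2 (apply: eq_bigr => ? _); rewrite !mxE.
apply: (@le_trans _ _ (\int[mu2]_(x in cell) fnorm (f s x - f t x) ^+ 2)).
  apply: le_Rintegral => //; first exact: inL2B.
  move=> x _; rewrite -(real_normK (num_real (f s x i j - f t x i j))).
  rewrite lerXn2r ?nnegrE ?fnorm_ge0//.
  by have := abs_entry_le (f s x - f t x) i j; rewrite !mxE.
have : `|0 - fine (Lpow 2 (fun x => f s x - f t x))| <= e by near: s; exact: H.
rewrite sub0r normrN => /(le_trans (ler_norm _)).
rewrite /Lpow /xint -/(Rintegral _ _ _).
by under eq_Rintegral do rewrite (powR_sqr (fnorm_ge0 _)).
Unshelve. all: by end_near. Qed.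

Lemma coef2_continuous m n (f : R -> R * R -> 'M[R]_(m, n)) i j N (k : mode N) : C_L T 2 f ->
  continuous_on T (fun t => coef2 k (fun x => f t x i j)).
Proof.
move=> hf t ht; apply/cvgrPdist_le => e e0.
have e20 : 0 < e ^+ 2 by rewrite exprn_gt0.
near=> s.
have [hs hd] : s \in `[0, T] /\ \int[mu2]_(x in cell) (f s x i j - f t x i j) ^+ 2 <= e ^+ 2.
  by near: s; exact: slice_dist_near.
have [hfs _] := hf.2 s hs; have [hft _] := hf.2 t ht.
have it := inL2_Ig i j hft; have is_ := inL2_Ig i j hfs; have i2 := inL2B i j hfs hft.
have im g : Ig g -> Ig (fun x => g x * e2 k x).
  move=> hg; apply: (IgM_bounded mC hg (measurable_e2 k) (M := 1)) => x _; exact: abs_e2_le1.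
rewrite /coef2 /coef -(RintegralB mC (im _ it) (im _ is_)).
apply: (le_trans (le_normr_Rintegral mC (IgB mC (im _ it) (im _ is_)))).
(* The majorant comes from [y <= e / 2 + y ^+ 2 / (2 * e)], whose integral is at most [e] since the
   squared distance is at most [e ^+ 2]. *)
have h1 := IgD mC (Ig_cst mC (e / 2) fC) (IgZ mC (2 * e)^-1 i2).
apply: (@le_trans _ _ (\int[mu2]_(x in cell) (e / 2 + (2 * e)^-1 * (f s x i j - f t x i j) ^+ 2))).
  apply: le_Rintegral => //; first exact: (Ig_abs (IgB mC (im _ it) (im _ is_))).
  move=> x _; rewrite -mulrBl normrM.
  apply: (@le_trans _ _ `|f t x i j - f s x i j|); first by rewrite ler_piMr// abs_e2_le1.
  rewrite distrC -(real_normK (num_real (f s x i j - f t x i j))); move: (`|f s x i j - _|) => y.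
  rewrite -subr_ge0 (_ : _ - y = (2 * e)^-1 * (y - e) ^+ 2); last by field; rewrite gt_eqF.
  by rewrite mulr_ge0 ?sqr_ge0// invr_ge0 mulr_ge0// ltW.
rewrite (RintegralD mC (Ig_cst mC (e / 2) fC) (IgZ mC (2 * e)^-1 i2)) (Rint_Zl mC (2 * e)^-1 i2).
rewrite Rintegral_cst// [X in _ * fine X](mu_cell (R := R)) /= mulr1.
rewrite [leRHS]splitr lerD2l (le_trans (ler_wpM2l _ hd))//; first by rewrite invr_ge0 mulr_ge0// ltW.
by rewrite le_eqVlt; apply/orP; left; apply/eqP; field; rewrite gt_eqF.
Unshelve. all: by end_near. Qed.

Lemma sqr_dist_le (a b eta : R) : 0 < eta ->
  `|a ^+ 2 - b ^+ 2| <= (1 + eta^-1) * (b - a) ^+ 2 + eta * a ^+ 2.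
Proof.
move=> eta0; have e0 : 0 < eta^-1 by rewrite invr_gt0.
have h : 2 * `|(b - a) * a| <= eta^-1 * (b - a) ^+ 2 + eta * a ^+ 2.
  rewrite -(real_normK (num_real (b - a))) -(real_normK (num_real a)) normrM.
  move: (`|b - a|) (`|a|) => x y; rewrite -subr_ge0.
  rewrite (_ : _ - _ = eta^-1 * (x - eta * y) ^+ 2); last by field; rewrite gt_eqF.
  by rewrite mulr_ge0 ?sqr_ge0// ltW.
have -> : a ^+ 2 - b ^+ 2 = - ((b - a) ^+ 2 + 2 * ((b - a) * a)) by ring.
rewrite normrN [leRHS](_ : _ = (b - a) ^+ 2 + (eta^-1 * (b - a) ^+ 2 + eta * a ^+ 2)); last by ring.
rewrite (le_trans (ler_normD _ _))// lerD//.
  by rewrite ger0_norm// sqr_ge0.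
by rewrite normrM ger0_norm.
Qed.

Lemma sqnorm_continuous m n (f : R -> R * R -> 'M[R]_(m, n)) i j : C_L T 2 f ->
  continuous_on T (fun t => \int[mu2]_(x in cell) f t x i j ^+ 2).
Proof.
move=> hf t ht; apply/cvgrPdist_le => e e0.
have [hft _] := hf.2 t ht; have it := inL2_sqr i j hft.
set A := \int[mu2]_(x in cell) f t x i j ^+ 2.
have A0 : 0 <= A by apply: Rintegral_ge0 => x _; exact: sqr_ge0.
have A1 : 0 < A + 1 by rewrite ltr_wpDl.
pose eta := e / 2 / (A + 1); have eta0 : 0 < eta by rewrite divr_gt0// divr_gt0.
have k0 : 0 < 1 + eta^-1 by rewrite addr_gt0// invr_gt0.
have r0 : 0 < e / 2 / (1 + eta^-1) by rewrite divr_gt0// divr_gt0.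
near=> s.
have [hs hd] : s \in `[0, T] /\
    \int[mu2]_(x in cell) (f s x i j - f t x i j) ^+ 2 <= e / 2 / (1 + eta^-1).
  by near: s; exact: slice_dist_near.
have [hfs _] := hf.2 s hs; have is_ := inL2_sqr i j hfs; have i2 := inL2B i j hfs hft.
rewrite /A -(RintegralB mC it is_).
apply: (le_trans (le_normr_Rintegral mC (IgB mC it is_))).
have h1 := IgZ mC (1 + eta^-1) i2; have h2 := IgZ mC eta it.
apply: (@le_trans _ _ (\int[mu2]_(x in cell)
   ((1 + eta^-1) * (f s x i j - f t x i j) ^+ 2 + eta * f t x i j ^+ 2))).
  apply: le_Rintegral => //; [exact: (Ig_abs (IgB mC it is_))|exact: IgD|].
  by move=> x _; exact: sqr_dist_le.
rewrite (RintegralD mC h1 h2) (Rint_Zl mC _ i2) (Rint_Zl mC _ it) -/A [leRHS]splitr lerD//.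
  by rewrite mulrC -ler_pdivlMr.
by rewrite /eta mulrAC ler_pdivrMr// ler_wpM2l ?lerDl// divr_ge0// ltW.
Unshelve. all: by end_near. Qed.

End FieldSlices.

(* The library's canonical inference does not find that a product of
   sigma-finite measures is sigma-finite; [area] is [leb2] with this structure. *)
Section Area.
Context {R : realType}.

Definition area : set (measurableTypeR R * measurableTypeR R) -> \bar R :=
  (@lebesgue_measure R \x @lebesgue_measure R)%E.

HB.instance Definition _ := Measure.on area.

Let area_sigma_finite : sigma_finite setT area.
Proof.
have /sigma_finiteP[F [TF ndF Foo]] := sigma_finiteT (@lebesgue_measure R).
exists (fun n => F n `*` F n).
  rewrite -setXTT TF; apply/seteqP; split=> -[x y] /=.
    move=> [[n _ Fx] [k _ Fy]]; exists (maxn n k) => //; split.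
      by move: x Fx; exact/subsetPset/ndF/leq_maxl.
    by move: y Fy; exact/subsetPset/ndF/leq_maxr.
  by move=> [n _ [Fx Fy]]; split; exists n.
move=> k; have [mF Fk] := Foo k; split; first exact: measurableX.
have -> : area (F k `*` F k) = (lebesgue_measure (F k) * lebesgue_measure (F k))%E.
  exact: product_measure1E.
by apply: lte_mul_pinfty; rewrite ?ge0_fin_numE.
Qed.

HB.instance Definition _ := Measure_isSigmaFinite.Build _ _ _ area area_sigma_finite.

End Area.

(** * Coefficients of weak derivatives and integrability over space-time *)

Section ModeEquations.
Context {R : realType}.
Local Notation mu := (@lebesgue_measure R).
Local Notation mu2 := (@lebesgue_measure R \x @lebesgue_measure R)%E.
Local Notation cell := (@cell R).
Local Notation Ig f := (mu2.-integrable cell (EFin \o f)).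
Local Notation "'I_T' T" := (`]0%R, T%R[%classic : set (measurableTypeR R)) (at level 0, T at level 0).
Let mC : measurable cell := @measurable_cell R.
Let fC : (mu2 cell < +oo)%E := @fin_cell R.

Lemma frob_delta m n (A : 'M[R]_(m, n)) i j (c : R) : frob A (c *: delta_mx i j) = c * A i j.
Proof.
rewrite frobZr frobE; congr (_ * _); rewrite (bigD1 i)//= (bigD1 j)//= !mxE !eqxx mulr1.
rewrite !big1 ?addr0// => k kn.
  by rewrite big1// => l _; rewrite mxE (negbTE kn) mulr0.
by rewrite mxE eqxx (negbTE kn) mulr0.
Qed.

Lemma frob_gradm_delta (A : 'M[R]_2) i (g : 'I_2 -> R) :
  frob A (gradm (fun a => g a *: delta_mx i 0)) = \sum_a g a * A i a.
Proof.
rewrite frobE (bigD1 i)//= [X in _ + X]big1 ?addr0; last first.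
  by move=> k kn; rewrite big1// => l _; rewrite !mxE (negbTE kn) /= !mulr0.
by apply: eq_bigr => a _; rewrite !mxE !eqxx mulr1 mulrC.
Qed.

(** The mode is itself an admissible periodic test function; the sign of the integration by parts
    cancels the one in [is_derive_e2]. *)
Lemma coef2_weak_derivative m n (f : R * R -> 'M[R]_(m, n)) Df N (k : mode N) a i j : inH1 f Df ->
  coef2 k (fun x => Df x a i j) = sg a k * coef2 (flip a k) (fun x => f x i j).
Proof.
move=> [hf /(_ a)[hD /(_ (e2 k))]] H.
have {H} := H (elementary_smooth (elementary_e2 k)) (torus_periodic_e2 k) i j.
have he g (l : mode N) : Ig g -> Ig (fun x => g x * e2 l x).
  move=> hg; apply: (IgM_bounded mC hg (measurable_e2 l) (M := 1)) => x _; exact: abs_e2_le1.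
have -> : (fun x => f x i j * 'D_(edir a) (e2 k) x) =
    (fun x => - sg a k * (f x i j * e2 (flip a k) x)).
  by apply/funext => x; have [_ ->] := is_derive_e2 k a x; ring.
rewrite /xRint (Rint_Zl mC _ (he _ _ (inL2_Ig i j hf))) mulNr => /oppr_inj h.
by rewrite /coef2 /coef h.
Qed.

Definition tx_Ig T (g : R -> R * R -> R) : Prop :=
  (mu \x area)%E.-integrable (I_T T `*` cell) (EFin \o (fun z => g z.1 z.2)).

Let mI T : measurable (I_T T). Proof. exact: measurable_itv. Qed.

Lemma coef2_time_Ig T g N (k : mode N) : tx_Ig T g ->
  mu.-integrable (I_T T) (EFin \o (fun t => coef2 k (g t))).
Proof.
move=> hg; have me : measurable_fun (I_T T `*` cell) (fun z => e2 k z.2).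
  exact: (measurable_snd_fun mC (measurable_e2 k)).
rewrite /tx_Ig in hg; have := IgM_bounded (measurableX (mI T) mC) hg me (M := 1).
move=> /(_ (fun z _ => abs_e2_le1 k z.2)) h.
exact: (Fubini_Ig1 (mI T) mC h).
Qed.

Lemma tx_sub T : (I_T T `*` cell) `<=` ((`[0, T]%classic : set (measurableTypeR R)) `*` cell).
Proof. by move=> z [/open_sub_closed ? ?]; split. Qed.

Lemma tx_measurable_sub m n T (f : R -> R * R -> 'M[R]_(m, n)) i j : tx_measurable T f ->
  measurable_fun (I_T T `*` cell) (fun z => f z.1 z.2 i j).
Proof.
move=> /(_ i j); apply: measurable_funS; last exact: tx_sub.
by apply: measurableX => //; exact: measurable_itv.
Qed.

Lemma tx_Ig_of_sqr T (g : R -> R * R -> R) :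
  measurable_fun (I_T T `*` cell) (fun z => g z.1 z.2) ->
  tx_Ig T (fun t x => g t x ^+ 2) -> tx_Ig T g.
Proof.
move=> mg hg; have mD := measurableX (mI T) mC.
have fD : ((mu \x area)%E (I_T T `*` cell) < +oo)%E.
  by rewrite product_measure1E//; apply: lte_mul_pinfty => //; rewrite ?ge0_fin_numE//; exact: fin_time.
apply: (Ig_le mD mg _ (IgD mD (Ig_cst mD 1 fD) hg)) => z _.
rewrite -(real_normK (num_real (g z.1 z.2))); move: (`|g z.1 z.2|) => y.
by have := sqr_ge0 (y - 2^-1); rewrite sqrrB; lra.
Qed.

Lemma L2_H1_gradient m n T (f : R -> R * R -> 'M[R]_(m, n)) Df a i j : L2_H1 T f Df ->
  tx_Ig T (fun t x => Df t x a i j).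
Proof.
move=> [[mf mDf] _ fin]; have mD := measurableX (mI T) mC.
have m1 k l := tx_measurable_sub k l mf; have m2 b k l := tx_measurable_sub k l (mDf b).
have mh : measurable_fun (I_T T `*` cell) (fun z => fnorm (f z.1 z.2) ^+ 2 + grad_sq (Df z.1 z.2)).
  apply: measurable_funD; first by apply: measurable_funX; exact: measurable_fnorm.
  by apply: measurable_sum => b; apply: measurable_funX; exact: measurable_fnorm.
have h0 t x : 0 <= fnorm (f t x) ^+ 2 + grad_sq (Df t x).
  by rewrite addr_ge0 ?sqr_ge0// sumr_ge0// => b _; exact: sqr_ge0.
have hi : tx_Ig T (fun t x => fnorm (f t x) ^+ 2 + grad_sq (Df t x)).
  apply: (Ig_tonelli (mI T) mC mh); apply: le_lt_trans fin.
  rewrite /txint /xint le_eqVlt; apply/orP; left; apply/eqP.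
  by apply: eq_integral => t _; apply: eq_integral => x _; rewrite ger0_norm.
apply: tx_Ig_of_sqr; first exact: m2.
apply: (Ig_le mD _ _ hi); first by apply: measurable_funX; exact: m2.
move=> z _; rewrite ger0_norm ?sqr_ge0//.
apply: (@le_trans _ _ (fnorm (Df z.1 z.2 a) ^+ 2)).
  rewrite -(real_normK (num_real (Df z.1 z.2 a i j))) lerXn2r ?nnegrE ?fnorm_ge0//.
  exact: abs_entry_le.
apply: (@le_trans _ _ (grad_sq (Df z.1 z.2))); last by rewrite lerDr sqr_ge0.
by apply: term_le_sum => b; exact: sqr_ge0.
Qed.

End ModeEquations.

(** * Integrated evolution equations of the Fourier coefficients *)

Section EvolutionEquations.
Context {R : realType}.
Local Notation mu := (@lebesgue_measure R).
Local Notation mu2 := (@lebesgue_measure R \x @lebesgue_measure R)%E.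
Local Notation cell := (@cell R).
Local Notation Ig f := (mu2.-integrable cell (EFin \o f)).
Local Notation "'I_T' T" := (`]0%R, T%R[%classic : set (measurableTypeR R)) (at level 0, T at level 0).
Let mC : measurable cell := @measurable_cell R.
Let fC : (mu2 cell < +oo)%E := @fin_cell R.
Let mI T : measurable (I_T T). Proof. exact: measurable_itv. Qed.

Lemma ae_timeS T (P Q : R -> Prop) : ae_time T P -> (forall t, I_T T t -> P t -> Q t) ->
  {ae mu, forall t, I_T T t -> Q t}.
Proof.
move=> [N [mN N0 sub]] PQ; exists N; split=> // t /= nQ; apply: sub => nP.
by apply: nQ => tT; apply: PQ => //; exact: nP.
Qed.

Lemma tx_Ig_C_L m n T (f : R -> R * R -> 'M[R]_(m, n)) i j : C_L T 2 f ->
  tx_Ig T (fun t x => f t x i j).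
Proof.
move=> hf; have [mf _] := hf; have mfij := tx_measurable_sub i j mf.
have [M M0 HM] := continuous_on_bounded (sqnorm_continuous (i := i) (j := j) hf).
apply: tx_Ig_of_sqr => //; apply: (Ig_tonelli_ae (mI T) mC _ (fin_time T) M0).
  exact: measurable_funX.
apply: aeW => t /open_sub_closed ht; have [hft _] := hf.2 t ht.
split; first exact: inL2_sqr.
have := HM t ht; apply: le_trans; rewrite (le_trans _ (ler_norm _))//.
rewrite le_eqVlt; apply/orP; left; apply/eqP; apply: eq_Rintegral => x _.
by rewrite ger0_norm// sqr_ge0.
Qed.

Lemma continuous_time_bounded T (eta : R -> R) : continuous eta ->
  exists2 M : R, 0 <= M & forall t, t \in `[0, T] -> `|eta t| <= M.
Proof.
move=> ceta; apply: continuous_on_bounded => t _.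
by apply: cvg_within_filter; exact: ceta.
Qed.

Lemma tx_pairing T g (eta : R -> R) N (k : mode N) : continuous eta -> tx_Ig T g ->
  tx_Ig T (fun t x => (eta t * e2 k x) * g t x) /\
  txRint T (fun t x => (eta t * e2 k x) * g t x) = \int[mu]_(t in I_T T) (coef2 k (g t) * eta t).
Proof.
move=> ceta hg; have [M M0 HM] := continuous_time_bounded T ceta.
have me : measurable_fun (I_T T `*` cell) (fun z => eta z.1 * e2 k z.2).
  apply: measurable_funM; last exact: (measurable_snd_fun mC (measurable_e2 k)).
  apply: (measurable_fst_fun (mI T)); apply: measurable_funTS.
  exact: continuous_measurable_fun.
have hge : (mu \x area)%E.-integrable (I_T T `*` cell) (EFin \o (fun z => (eta z.1 * e2 k z.2) * g z.1 z.2)).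
  rewrite (_ : (fun z => _) = (fun z => g z.1 z.2 * (eta z.1 * e2 k z.2))); last first.
    by apply/funext => z; rewrite mulrC.
  rewrite /tx_Ig in hg; apply: (IgM_bounded (measurableX (mI T) mC) hg me (M := M)).
  move=> z [/open_sub_closed z1 _]; rewrite normrM -[leRHS]mulr1.
  by apply: ler_pM => //; [exact: HM|exact: abs_e2_le1].
have h1 := Fubini_Ig1 (mI T) mC hge.
split; first exact: hge.
apply: ae_Rint => //; first exact: (Ig_measurable h1).
  apply: measurable_funM; first exact: (Ig_measurable (coef2_time_Ig k hg)).
  by apply: measurable_funTS; exact: continuous_measurable_fun.
rewrite /tx_Ig in hg.
have := ae_Ig_slice1 (mI T) mC hg; apply: filterS => t /= H /H hgt.
have hgk : Ig (fun x => g t x * e2 k x).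
  apply: (IgM_bounded mC hgt (measurable_e2 k) (M := 1)) => x _; exact: abs_e2_le1.
rewrite /xRint mulrC -(Rint_Zl mC (eta t) hgk); apply: eq_Rintegral => x _; ring.
Qed.

Implicit Types (Fin : R * R -> 'M[R]_2) (u : R -> R * R -> 'cV[R]_2) (F LF : R -> R * R -> 'M[R]_2)
  (Du : R -> R * R -> 'I_2 -> 'cV[R]_2).

(** The test field is a function of time times a mode times a matrix unit; [du_bois_reymond]
    integrates the resulting weak equation, in which the coefficients of grad u are expressed
    through those of u at almost every time. *)
Lemma kinematic_modes T Fin u Du F i a N (m : mode N) : 0 < T -> inL 2 Fin ->
  C_L T 2 u -> L2_H1 T u Du -> C_L T 2 F -> weak_kinematic T Fin Du F ->
  forall t, t \in `[0, T] -> coef2 m (fun x => F t x i a) = coef2 m (fun x => Fin x i a) +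
    primitive (fun s => dcoef a (fun k => coef2 k (fun x => u s x i 0)) m) t.
Proof.
move=> T0 hFin hu hDu hF hk.
have cu : continuous_on T (fun t => coef2 (flip a m) (fun x => u t x i 0)) by exact: coef2_continuous.
have iu := IgZ (mI T) (sg a m) (continuous_on_Ig cu).
apply: (du_bois_reymond T0 (coef2_continuous (i := i) (j := a) (k := m) hF) iu).
move=> eta eta' seta deta [T' TT heta] ceta'.
have := hk _ (test_fun_separated m (delta_mx i a) seta TT heta).
have ceta := smooth1_continuous seta.
have -> : txRint T (fun t x => frob (F t x) (derive1 ((separated_field eta m (delta_mx i a))^~ x) t)) =
    \int[mu]_(t in I_T T) (coef2 m (fun x => F t x i a) * eta' t).
  rewrite -(tx_pairing m ceta' (tx_Ig_C_L i a hF)).2.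
  congr (txRint T _); apply/funext => t; apply/funext => x.
  by rewrite (derive_separated_time m _ _ _ deta) frob_delta.
have -> : txRint T (fun t x => frob (gradm (Du t x)) (separated_field eta m (delta_mx i a) t x)) =
    \int[mu]_(t in I_T T) (dcoef a (fun k => coef2 k (fun x => u t x i 0)) m * eta t).
  have hD := L2_H1_gradient a i 0 hDu.
  transitivity (txRint T (fun t x => (eta t * e2 m x) * Du t x a i 0)).
    congr (txRint T _); apply/funext => t; apply/funext => x.
    by rewrite frob_delta mxE.
  rewrite (tx_pairing m ceta hD).2; apply: ae_Rint => //.
  - apply: measurable_funM; first exact: (Ig_measurable (coef2_time_Ig m hD)).
    by apply: measurable_funTS; exact: continuous_measurable_fun.
  - apply: measurable_funM; first exact: (Ig_measurable iu).
    by apply: measurable_funTS; exact: continuous_measurable_fun.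
  - case: hDu => _ hae _; apply: (ae_timeS hae) => t _ H.
    by rewrite (coef2_weak_derivative m a i 0 H).
have -> : xRint (fun x => frob (Fin x) (separated_field eta m (delta_mx i a) 0 x)) =
    coef2 m (fun x => Fin x i a) * eta 0.
  have hg : Ig (fun x => Fin x i a * e2 m x).
    apply: (IgM_bounded mC (inL2_Ig i a hFin) (measurable_e2 m) (M := 1)) => x _; exact: abs_e2_le1.
  rewrite mulrC -(Rint_Zl mC (eta 0) hg); apply: eq_Rintegral => x _.
  by rewrite frob_delta; ring.
exact.
Qed.

Lemma txRint_joint T f : tx_Ig T f ->
  txRint T f = \int[(mu \x area)%E]_(z in I_T T `*` cell) f z.1 z.2.
Proof. by move=> hf; rewrite (Fubini_Rint1 (mI T) mC hf). Qed.

Lemma txRint_sum T (I : Type) (r : seq I) (c : I -> R) (f : I -> R -> R * R -> R) :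
  (forall i, tx_Ig T (f i)) ->
  txRint T (fun t x => \sum_(i <- r) c i * f i t x) = \sum_(i <- r) c i * txRint T (f i).
Proof.
move=> hf; have mD := measurableX (mI T) mC.
have hz i : (mu \x area)%E.-integrable (I_T T `*` cell) (EFin \o (fun z => c i * f i z.1 z.2)).
  exact: (IgZ mD (c i) (hf i)).
have hs : tx_Ig T (fun t x => \sum_(i <- r) c i * f i t x) by exact: (Ig_sum mD r hz).
rewrite (txRint_joint hs) (Rint_sum mD r hz); apply: eq_bigr => i _.
by rewrite (txRint_joint (hf i)); exact: (Rint_Zl mD (c i) (hf i)).
Qed.

Lemma tx_pairing_gradient T (g : 'I_2 -> R -> R * R -> R) (eta : R -> R) N (m : mode N) :
  continuous eta -> (forall a, tx_Ig T (g a)) ->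
  txRint T (fun t x => \sum_a eta t * (- sg a m * e2 (flip a m) x) * g a t x) =
  - \int[mu]_(t in I_T T) (forcing (fun a k => coef2 k (g a t)) m * eta t).
Proof.
move=> ceta hg.
have hb a := (tx_pairing (flip a m) ceta (hg a)).
have me : measurable_fun (I_T T) eta.
  by apply: measurable_funTS; exact: continuous_measurable_fun.
have [M M0 HM] := continuous_time_bounded T ceta.
have hc a : mu.-integrable (I_T T) (EFin \o (fun t => coef2 (flip a m) (g a t) * eta t)).
  apply: (IgM_bounded (mI T) (coef2_time_Ig (flip a m) (hg a)) me (M := M)) => t /open_sub_closed.
  exact: HM.
have -> : (fun t x => \sum_a eta t * (- sg a m * e2 (flip a m) x) * g a t x) =
    (fun t x => \sum_a - sg a m * (eta t * e2 (flip a m) x * g a t x)).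
  by apply/funext => t; apply/funext => x; apply: eq_bigr => a _; ring.
rewrite (txRint_sum _ _ (fun a => (hb a).1)).
have -> : (fun t => forcing (fun a k => coef2 k (g a t)) m * eta t) =
    (fun t => \sum_a sg a m * (coef2 (flip a m) (g a t) * eta t)).
  by apply/funext => t; rewrite /forcing mulr_suml; apply: eq_bigr => a _; rewrite mulrA.
rewrite (Rint_sum (mI T) _ (fun a => IgZ (mI T) (sg a m) (hc a))) -sumrN.
apply: eq_bigr => a _; rewrite (hb a).2 (Rint_Zl (mI T) _ (hc a)).
by rewrite mulNr.
Qed.

(** Coefficients of div S(F) - delta div Lap F + Lap u. *)
Definition momentum_rate W delta u F i N (m : mode N) (s : R) : R :=
  forcing (fun a k => coef2 k (fun x => stress W (F s x) i a) +
     delta * (ksq k * coef2 k (fun x => F s x i a))) m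
  - ksq m * coef2 m (fun x => u s x i 0).

(** The argument of [kinematic_modes] for the momentum equation. The condition on [LF] carries the
    factor [delta] so that it also covers the limit system, where both of its sides are 0. *)
Lemma momentum_modes T delta W uin u Du F LF i N (m : mode N) : 0 < T -> inL 2 uin ->
  C_L T 2 u -> L2_H1 T u Du -> C_L T 2 F ->
  (forall i a, tx_Ig T (fun t x => stress W (F t x) i a)) ->
  (forall i a, tx_Ig T (fun t x => LF t x i a)) ->
  ae_time T (fun t => forall i a N (k : mode N), delta * coef2 k (fun x => LF t x i a) =
    - (delta * (ksq k * coef2 k (fun x => F t x i a)))) ->
  weak_momentum T delta W uin u Du F LF ->
  forall t, t \in `[0, T] -> coef2 m (fun x => u t x i 0) = coef2 m (fun x => uin x i 0) +
    primitive (momentum_rate W delta u F i m) t.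
Proof.
move=> T0 huin hu hDu hF hS hL hLap hm.
have cu k : continuous_on T (fun t => coef2 k (fun x => u t x i 0)) by exact: coef2_continuous.
have cF k a : continuous_on T (fun t => coef2 k (fun x => F t x i a)) by exact: coef2_continuous.
have iu k := continuous_on_Ig (cu N k); have iF k a := continuous_on_Ig (cF N k a).
have iS k a := coef2_time_Ig k (hS i a).
have iforc (G : R -> 'I_2 -> mode N -> R) :
    (forall k a, mu.-integrable (I_T T) (EFin \o (fun t => G t a k))) ->
    mu.-integrable (I_T T) (EFin \o (fun t => forcing (G t) m)).
  by move=> h; apply: (Ig_sum (mI T)) => a; apply: (IgZ (mI T)); exact: h.
have i1 : mu.-integrable (I_T T) (EFin \o (fun t => forcing (fun a k => coef2 k (fun x => stress W (F t x) i a)) m)).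
  by apply: iforc => k a; exact: iS.
have i2 : mu.-integrable (I_T T) (EFin \o (fun t => ksq m * coef2 m (fun x => u t x i 0))).
  exact: (IgZ (mI T) _ (iu m)).
have i3 : mu.-integrable (I_T T) (EFin \o (fun t => delta * (ksq m *
    forcing (fun a k => coef2 k (fun x => F t x i a)) m))).
  by apply: (IgZ (mI T)); apply: (IgZ (mI T)); apply: iforc => k a; exact: iF.
have rE t : momentum_rate W delta u F i m t =
   forcing (fun a k => coef2 k (fun x => stress W (F t x) i a)) m +
   delta * (ksq m * forcing (fun a k => coef2 k (fun x => F t x i a)) m) -
   ksq m * coef2 m (fun x => u t x i 0).
  rewrite /momentum_rate; congr (_ - _); rewrite /forcing !mulr_sumr -big_split /=.
  by apply: eq_bigr => a _; rewrite ksq_flip; ring.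
have hb : mu.-integrable (I_T T) (EFin \o momentum_rate W delta u F i m).
  rewrite (funext rE).
  exact: (IgB (mI T) (IgD (mI T) i1 i3) i2).
apply: (du_bois_reymond T0 (cu N m) hb).
move=> eta eta' seta deta [T' TT heta] ceta'.
have ceta := smooth1_continuous seta.
have me : measurable_fun (I_T T) eta.
  by apply: measurable_funTS; exact: continuous_measurable_fun.
have [M M0 HM] := continuous_time_bounded T ceta.
have ie g : mu.-integrable (I_T T) (EFin \o g) -> mu.-integrable (I_T T) (EFin \o (fun t => g t * eta t)).
  by move=> hg; apply: (IgM_bounded (mI T) hg me (M := M)) => t /open_sub_closed; exact: HM.
have := hm _ (test_fun_separated m (delta_mx i 0) seta TT heta).
rewrite /=.
have gradE (A : R -> R * R -> 'M[R]_2) :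
    txRint T (fun t x => frob (A t x) (gradm (fun a => 'D_(edir a) (separated_field eta m (delta_mx i 0) t) x))) =
    txRint T (fun t x => \sum_a eta t * (- sg a m * e2 (flip a m) x) * A t x i a).
  congr (txRint T _); apply/funext => t; apply/funext => x; rewrite -frob_gradm_delta.
  congr (frob _ (gradm _)); apply/funext => a; exact: derive_separated_space.
rewrite !gradE (tx_pairing_gradient (g := fun a t x => stress W (F t x) i a) m ceta (hS i)).
rewrite (tx_pairing_gradient (g := fun a t x => LF t x i a) m ceta (hL i)).
have hD a := L2_H1_gradient a i 0 hDu.
have -> : (fun t x => \sum_a eta t * (- sg a m * e2 (flip a m) x) * gradm (Du t x) i a) =
    (fun t x => \sum_a eta t * (- sg a m * e2 (flip a m) x) * Du t x a i 0).
  by apply/funext => t; apply/funext => x; apply: eq_bigr => a _; rewrite mxE.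
rewrite (tx_pairing_gradient (g := fun a t x => Du t x a i 0) m ceta hD).
have -> : txRint T (fun t x => frob (u t x) (derive1 ((separated_field eta m (delta_mx i 0))^~ x) t)) =
    \int[mu]_(t in I_T T) (coef2 m (fun x => u t x i 0) * eta' t).
  rewrite -(tx_pairing m ceta' (tx_Ig_C_L i 0 hu)).2.
  congr (txRint T _); apply/funext => t; apply/funext => x.
  by rewrite (derive_separated_time m _ _ _ deta) frob_delta.
have -> : xRint (fun x => frob (uin x) (separated_field eta m (delta_mx i 0) 0 x)) =
    coef2 m (fun x => uin x i 0) * eta 0.
  have hg : Ig (fun x => uin x i 0 * e2 m x).
    apply: (IgM_bounded mC (inL2_Ig i 0 huin) (measurable_e2 m) (M := 1)) => x _; exact: abs_e2_le1.
  rewrite mulrC -(Rint_Zl mC (eta 0) hg); apply: eq_Rintegral => x _.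
  by rewrite frob_delta; ring.
have -> : \int[mu]_(t in I_T T) (forcing (fun a k => coef2 k (fun x => Du t x a i 0)) m * eta t) =
    \int[mu]_(t in I_T T) (- (ksq m * coef2 m (fun x => u t x i 0)) * eta t).
  apply: ae_Rint => //.
  - apply: measurable_funM => //; apply: (Ig_measurable (mu := mu)).
    by apply: iforc => k a; exact: coef2_time_Ig.
  - by apply: measurable_funM => //; apply: (Ig_measurable (mu := mu)); exact: IgN.
  - case: hDu => _ hae _; apply: (ae_timeS hae) => t _ H; congr (_ * _).
    rewrite /forcing /ksq mulr_suml -sumrN; apply: eq_bigr => a _.
    by rewrite (coef2_weak_derivative (flip a m) a i 0 H) flipK sg_flip; ring.
have iL : mu.-integrable (I_T T) (EFin \o (fun t => forcing (fun a k => coef2 k (fun x => LF t x i a)) m)).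
  by apply: iforc => k a; exact: coef2_time_Ig.
have eL : delta * (- (\int[mu]_(t in I_T T) (forcing (fun a k => coef2 k (fun x => LF t x i a)) m * eta t))) =
    \int[mu]_(t in I_T T) (delta * (ksq m * forcing (fun a k => coef2 k (fun x => F t x i a)) m) * eta t).
  rewrite mulrN -mulNr -(Rint_Zl (mI T) _ (ie _ iL)); apply: ae_Rint => //.
  - exact: (Ig_measurable (IgZ (mI T) _ (ie _ iL))).
  - exact: (Ig_measurable (ie _ i3)).
  - apply: (ae_timeS hLap) => t _ H; rewrite mulrA; congr (_ * _).
    rewrite /forcing !mulr_sumr; apply: eq_bigr => a _.
    by rewrite mulNr mulrCA H ksq_flip; ring.
rewrite eL !opprK.
have e3 : \int[mu]_(t in I_T T) (momentum_rate W delta u F i m t * eta t) =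
   \int[mu]_(t in I_T T) (forcing (fun a k => coef2 k (fun x => stress W (F t x) i a)) m * eta t) +
   \int[mu]_(t in I_T T) (delta * (ksq m * forcing (fun a k => coef2 k (fun x => F t x i a)) m) * eta t) +
   \int[mu]_(t in I_T T) (- (ksq m * coef2 m (fun x => u t x i 0)) * eta t).
  rewrite -(RintegralD (mI T) (ie _ i1) (ie _ i3)).
  rewrite -(RintegralD (mI T) (IgD (mI T) (ie _ i1) (ie _ i3)) (ie _ (IgN i2))).
  by apply: eq_Rintegral => t _; rewrite rE; ring.
by rewrite e3 => h; rewrite -[RHS]h; ring.
Qed.

End EvolutionEquations.

(** * Bounds drawn from the energy inequality *)

Lemma half_le1 (R : realType) (d : R) : d <= 4^-1 -> d / 2 <= 1.
Proof. by move=> h; lra. Qed.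

Lemma drop_nonneg (R : realType) (V W1 Z U W0 X Y : R) :
  2^-1 * V + W1 + Z <= U + W0 + Y -> Y <= X -> 0 <= Z -> 0 <= V -> W1 <= U + W0 + X.
Proof. by move=> *; lra. Qed.

Section SolutionBounds.
Context {R : realType} (W : 'M[R]_2 -> R) (p K : R).
Hypotheses (p2 : 2 <= p) (W3 : H1_regular W) (W2 : H2_growth p W) (K0 : 0 < K)
  (cW : H3_convex K W) (hW : hess_growth p W).
Local Notation mu := (@lebesgue_measure R).
Local Notation mu2 := (@lebesgue_measure R \x @lebesgue_measure R)%E.
Local Notation cell := (@cell R).
Local Notation Ig f := (mu2.-integrable cell (EFin \o f)).
Local Notation "'I_T' T" := (`]0%R, T%R[%classic : set (measurableTypeR R)) (at level 0, T at level 0).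
Let mC : measurable cell := @measurable_cell R.
Let fC : (mu2 cell < +oo)%E := @fin_cell R.
Let mI T : measurable (I_T T). Proof. exact: measurable_itv. Qed.

Lemma Ig_stored_energy (G : R * R -> 'M[R]_2) : inL p G -> Ig (fun x => W (G x)).
Proof.
move=> hG; have [c [C [c0 C0 HW]]] := W2; have [mG _] := hG.
have mW : measurable_fun cell (fun x => W (G x)).
  by apply: measurable_continuous_mx => //; case: W3.
have h := IgZ mC (c + C) (IgD mC (inL_Ig hG) (Ig_cst mC 1 fC)).
apply: (Ig_le mC mW _ h) => x _; have /andP[h1 h2] := HW (G x).
have x0 : 0 <= fnorm (G x) `^ p := powR_ge0 _ _.
rewrite ler_norml mulrDl (le_trans h2) ?lerDr ?mulr_ge0 ?addr_ge0 ?(ltW c0)// andbT.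
rewrite (le_trans _ h1)//; move: (fnorm (G x) `^ p) x0 => y y0.
have -> : c * (y - 1) = - (c * (y + 1) + C * (y + 1)) + (2 * (c * y) + C * (y + 1)) by ring.
by rewrite lerDl addr_ge0// ?mulr_ge0 ?addr_ge0 ?(ltW c0) ?(ltW C0).
Qed.

Lemma Ig_grad_sq m n (D : R * R -> 'I_2 -> 'M[R]_(m, n)) :
  (forall a, inL 2 (fun x => D x a)) -> Ig (fun x => grad_sq (D x)).
Proof. by move=> h; apply: Ig_sum => // a; exact: inL2_sqr_fnorm (h a). Qed.

Lemma energyE delta v G (DG : R * R -> 'I_2 -> 'M[R]_2) : inL 2 v -> inL p G ->
  (forall a, inL 2 (fun x => DG x a)) ->
  energy delta W v G DG = (2^-1 * \int[mu2]_(x in cell) fnorm (v x) ^+ 2 +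
    \int[mu2]_(x in cell) W (G x) + delta / 2 * \int[mu2]_(x in cell) grad_sq (DG x))%:E.
Proof.
move=> hv hG hD; have i1 := inL2_sqr_fnorm hv; have i2 := Ig_stored_energy hG.
have i3 := Ig_grad_sq hD; have i1' := IgZ mC 2^-1 i1; have i3' := IgZ mC (delta / 2) i3.
rewrite /energy /xint (Ig_fin mC (IgD mC (IgD mC i1' i2) i3')); congr EFin.
rewrite (RintegralD mC (IgD mC i1' i2) i3') (RintegralD mC i1' i2).
by rewrite (Rint_Zl mC _ i1) (Rint_Zl mC _ i3).
Qed.

(** The lower growth bound of [W] turns the energy into an L^p bound. Since delta / 2 <= 1, the
    initial capillary energy is at most the squared norm of the initial gradient, so [A] serves
    every delta in [0, 1/4]. *)
Lemma energy_bound uin Fin DFin : initial_data p uin Fin DFin -> exists2 A : R, 0 <= A &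
  forall T delta u Du F DF, 0 <= delta -> delta <= 4^-1 -> C_L T 2 u -> C_L T p F -> C_H1 T F DF ->
    energy_ineq T delta W uin Fin DFin u Du F DF -> ae_time T (fun t => p_slice p A (F t)).
Proof.
move=> [huin hFin [_ hDin] _]; have hDin' a : inL 2 (fun x => DFin x a) by case: (hDin a).
have [c [C [c0 C0 HW]]] := W2.
pose E0 := 2^-1 * (\int[mu2]_(x in cell) fnorm (uin x) ^+ 2) +
    \int[mu2]_(x in cell) W (Fin x) + \int[mu2]_(x in cell) grad_sq (DFin x).
exists `|E0 / c + 1|; first exact: normr_ge0.
move=> T delta u Du F DF d0 d1 hu hF [_ hDF _] hE.
have := hE; rewrite /energy_ineq => [[N [mN N0 sub]]]; exists N; split=> // t /= nt; apply: sub => /= ht.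
apply: nt => tT; have {ht} := ht tT.
have tin : t \in `[0, T] by apply: open_sub_closed; move: tT.
have [hut _] := hu.2 t tin; have [hFt _] := hF.2 t tin.
have hDt a : inL 2 (fun x => DF t x a) by case: ((hDF a).2 t tin).
rewrite (energyE delta hut hFt hDt) (energyE delta huin hFin hDin') => le1.
have {le1} : 2^-1 * \int[mu2]_(x in cell) fnorm (u t x) ^+ 2 + \int[mu2]_(x in cell) W (F t x) +
    delta / 2 * \int[mu2]_(x in cell) grad_sq (DF t x) <=
    2^-1 * \int[mu2]_(x in cell) fnorm (uin x) ^+ 2 + \int[mu2]_(x in cell) W (Fin x) +
    delta / 2 * \int[mu2]_(x in cell) grad_sq (DFin x).
  rewrite -lee_fin; apply: le_trans le1; rewrite leeDl//.
  apply: integral_ge0 => s _; apply: integral_ge0 => x _; rewrite lee_fin.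
  by apply: sumr_ge0 => a _; exact: sqr_ge0.
have n1 : 0 <= \int[mu2]_(x in cell) fnorm (u t x) ^+ 2.
  by apply: Rintegral_ge0 => x _; exact: sqr_ge0.
have n2 (D : R * R -> 'I_2 -> 'M[R]_2) : 0 <= \int[mu2]_(x in cell) grad_sq (D x).
  by apply: Rintegral_ge0 => x _; apply: sumr_ge0 => a _; exact: sqr_ge0.
have iFt := inL_Ig hFt; have i1 := Ig_cst mC (1 : R) fC.
have lower : c * (\int[mu2]_(x in cell) fnorm (F t x) `^ p - 1) <= \int[mu2]_(x in cell) W (F t x).
  have e : \int[mu2]_(x in cell) (1 : R) = 1.
    by rewrite Rintegral_cst// [X in _ * fine X](mu_cell (R := R)) /= mulr1.
  rewrite -[X in _ - X]e -(RintegralB mC iFt i1) -(Rint_Zl mC c (IgB mC iFt i1)).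
  apply: le_Rintegral => //; [exact: (IgZ mC c (IgB mC iFt i1))|exact: Ig_stored_energy|].
  by move=> x _; have /andP[] := HW (F t x).
have n3 := n2 (DF t); have n4 := n2 DFin; move=> le1.
split=> //; first by case: hFt.
rewrite (le_trans _ (ler_norm _))// -lerBlDr ler_pdivlMr// mulrC (le_trans lower)//.
have dd : delta / 2 * \int[mu2]_(x in cell) grad_sq (DFin x) <= \int[mu2]_(x in cell) grad_sq (DFin x).
  exact: (ler_piMl n4 (half_le1 d1)).
have d3 : 0 <= delta / 2 * \int[mu2]_(x in cell) grad_sq (DF t x) by rewrite mulr_ge0// divr_ge0.
exact: drop_nonneg le1 dd d3 n1.
Qed.

Lemma stress_tx_Ig T A F i a : 0 <= A -> C_L T p F -> ae_time T (fun t => p_slice p A (F t)) ->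
  tx_Ig T (fun t x => stress W (F t x) i a).
Proof.
move=> A0 [mF hF] hA; have [C C0 HC] := stress_growth p2 W3 hW.
have mS : measurable_fun (I_T T `*` cell) (fun z => stress W (F z.1 z.2) i a).
  apply: (measurable_continuous_mx (h := fun G => stress W G i a)).
  - by apply: measurableX.
  - exact: continuous_stress.
  - by move=> k l; exact: tx_measurable_sub.
apply: (Ig_tonelli_ae (mI T) mC mS (B := C * (2 + A)) (fin_time T)).
  by rewrite mulr_ge0 ?(ltW C0)// addr_ge0.
apply: (ae_timeS hA) => t tT [mFt iFt aFt].
have bnd x : `|stress W (F t x) i a| <= C * (1 + 1 + fnorm (F t x) `^ p).
  rewrite (le_trans (abs_entry_le _ _ _))// (le_trans (HC _))//.
  apply: ler_wpM2l; first exact: ltW.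
  rewrite -addrA lerD2l; have y0 := fnorm_ge0 (F t x).
  have [x1|x1] := leP (fnorm (F t x)) 1.
    by rewrite (@le_trans _ _ 1) ?lerDl ?powR_ge0// powR_le1//; move: p2 => h; lra.
  apply: (@le_trans _ _ (fnorm (F t x) `^ p)); last by rewrite lerDr.
  by apply: ler_powR; [exact: ltW|rewrite gerBl].
have iM := IgZ mC C (IgD mC (Ig_cst mC (1 + 1 : R) fC) iFt).
have mSt : measurable_fun cell (fun x => stress W (F t x) i a).
  by apply: (measurable_continuous_mx (h := fun G => stress W G i a)) => //; exact: continuous_stress.
have iS : Ig (fun x => stress W (F t x) i a) by apply: (Ig_le mC mSt _ iM) => x _; exact: bnd.
split=> //; apply: (@le_trans _ _ (\int[mu2]_(x in cell) (C * (1 + 1 + fnorm (F t x) `^ p)))).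
  by apply: le_Rintegral => //; exact: Ig_abs.
rewrite (Rint_Zl mC C (IgD mC (Ig_cst mC (1 + 1 : R) fC) iFt)) (RintegralD mC (Ig_cst mC (1 + 1 : R) fC) iFt).
rewrite Rintegral_cst// [X in _ * fine X](mu_cell (R := R)) /= mulr1.
by apply: (ler_wpM2l (ltW C0)); rewrite lerD2l.
Qed.

Lemma defect_tx_Ig T A F Fb i a : 0 <= A -> C_L T p F -> C_L T p Fb ->
  ae_time T (fun t => p_slice p A (F t)) -> ae_time T (fun t => p_slice p A (Fb t)) ->
  tx_Ig T (fun t x => defect W K (F t x) (Fb t x) i a * (F t x - Fb t x) i a).
Proof.
move=> A0 [mF _] [mFb _] hA hAb; have [C C0 HC] := defect_growth p2 K0 W3 hW.
have [p0 q0 q1 pq qp] := conj_exponent p2.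
have mf k l := tx_measurable_sub k l mF; have mfb k l := tx_measurable_sub k l mFb.
have mD : measurable (I_T T `*` cell) by apply: measurableX.
have mG : measurable_fun (I_T T `*` cell) (fun z => (F z.1 z.2 - Fb z.1 z.2) i a).
  rewrite (_ : (fun z => _) = fun z => F z.1 z.2 i a - Fb z.1 z.2 i a); first exact: measurable_funB.
  by apply/funext => z; rewrite !mxE.
have mS (H : R -> R * R -> 'M[R]_2) : tx_measurable T H ->
    measurable_fun (I_T T `*` cell) (fun z => stress W (H z.1 z.2) i a).
  move=> mH; apply: (measurable_continuous_mx (h := fun G => stress W G i a)) => //.
    exact: continuous_stress.
  by move=> k l; exact: tx_measurable_sub.
have mdef : measurable_fun (I_T T `*` cell) (fun z => defect W K (F z.1 z.2) (Fb z.1 z.2) i a).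
  rewrite (_ : (fun z => _) = fun z => stress W (F z.1 z.2) i a - stress W (Fb z.1 z.2) i a +
      K * (F z.1 z.2 - Fb z.1 z.2) i a).
    apply: measurable_funD; first by apply: measurable_funB; exact: mS.
    by apply: measurable_funM => //; exact: measurable_cst.
  by apply/funext => z; rewrite /defect !mxE.
apply: (Ig_tonelli_ae (mI T) mC (measurable_funM mdef mG) (B := 2 * C * (1 + A + A)) (fin_time T)).
  by rewrite !mulr_ge0 ?(ltW C0)// !addr_ge0.
have [N1 [mN1 N10 s1]] := hA; have [N2 [mN2 N20 s2]] := hAb.
exists (N1 `|` N2); split; [exact: measurableU|by rewrite measureU0|].
move=> t /= nt; apply: contrapT => /not_orP[n1 n2].
have {}n1 : t \in `]0, T[ -> p_slice p A (F t) by apply: contrapT => h; exact/n1/s1.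
have {}n2 : t \in `]0, T[ -> p_slice p A (Fb t) by apply: contrapT => h; exact/n2/s2.
apply: nt => tT; have hFt := n1 tT; have hFbt := n2 tT.
have [h1 h2 h3 h4] := slice_integrable p2 K0 W3 hW hFt hFbt i a.
have hm := Ig_mul_young p0 q0 pq (Ig_measurable h3) (Ig_measurable h4) h1 h2.
split=> //; apply: le_trans (Rint_majorant hFt hFbt _); last by rewrite mulr_ge0// ltW.
apply: le_Rintegral => //; [exact: Ig_abs|exact: (Ig_majorant hFt hFbt)|].
move=> x _; have [b1 b2] := HC (F t x) (Fb t x) i a.
have := young_scaled p0 q0 pq (defect W K (F t x) (Fb t x) i a) ((F t x - Fb t x) i a) ltr01.
move=> h; apply: (le_trans h); rewrite invr1 !powR1 !mul1r -mulrA mulr_natl mulr2n.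
exact: lerD.
Qed.

End SolutionBounds.

(** * Time evolution of the mode energy *)

Section EnergyEvolution.
Context {R : realType}.
Local Notation mu := (@lebesgue_measure R).
Local Notation "'I_T' T" := (`]0%R, T%R[%classic : set (measurableTypeR R)) (at level 0, T at level 0).
Let mI T : measurable (I_T T). Proof. exact: measurable_itv. Qed.

Lemma eq_primitive (f g : R -> R) T t : t \in `[0, T] -> (forall s, s \in `[0, T] -> f s = g s) ->
  primitive f t = primitive g t.
Proof.
rewrite in_itv => /andP[t0 tT] H; apply: eq_Rintegral => s; rewrite inE /= in_itv => /andP[s0 st].
by apply: H; rewrite in_itv /= (ltW s0) (le_trans (ltW st)).
Qed.

Lemma IgM_continuous T (a f : R -> R) : continuous_on T a -> mu.-integrable (I_T T) (EFin \o f) ->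
  mu.-integrable (I_T T) (EFin \o (fun s => a s * f s)).
Proof.
move=> ca hf; have [M M0 HM] := continuous_on_bounded ca.
rewrite (_ : (fun s => _) = fun s => f s * a s); last by apply/funext => s; rewrite mulrC.
apply: (IgM_bounded (mI T) hf (continuous_on_measurable ca) (M := M)) => s /open_sub_closed.
exact: HM.
Qed.

(** [k * primitive w + w] is the primitive of [f], and [w] is the primitive of [f - k * w];
    [sqr_primitive] differentiates both squares, and the sum is the power. *)
Lemma mode_energy_evolution T (f w : R -> R) (k : R) : 0 < T ->
  mu.-integrable (I_T T) (EFin \o f) -> continuous_on T w ->
  (forall t, t \in `[0, T] -> w t = primitive (fun s => f s - k * w s) t) ->
  let h s := k * (primitive w s * f s) + 2 * (w s * f s) - k * w s ^+ 2 in
  mu.-integrable (I_T T) (EFin \o h) /\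
  forall t, t \in `[0, T] -> 2^-1 * ((k * primitive w t + w t) ^+ 2 + w t ^+ 2) = primitive h t.
Proof.
move=> T0 hf cw hw h; have iw := continuous_on_Ig cw.
have cZ := primitive_continuous T0 iw; have ikw := IgZ (mI T) k iw.
have i1 := IgM_continuous cZ hf; have i2 := IgM_continuous cw hf.
have i3 := IgM_continuous cw iw.
have hh : mu.-integrable (I_T T) (EFin \o h).
  rewrite (_ : h = fun s => k * (primitive w s * f s) + 2 * (w s * f s) - k * (w s * w s)) //.
  exact: (IgB (mI T) (IgD (mI T) (IgZ (mI T) k i1) (IgZ (mI T) 2 i2)) (IgZ (mI T) k i3)).
split=> // t ht.
have sub s : s \in `[0, T] -> mu.-integrable (I_T s) (EFin \o f) /\ mu.-integrable (I_T s) (EFin \o (fun s => k * w s)) /\ mu.-integrable (I_T s) (EFin \o w).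
  rewrite in_itv => /andP[s0 sT]; split; [exact: (IgS sT hf)|split; [exact: (IgS sT ikw)|exact: (IgS sT iw)]].
have X s : s \in `[0, T] -> k * primitive w s + w s = primitive f s.
  move=> hs; have [a [b c]] := sub s hs; rewrite (hw s hs) /primitive (RintegralB (mI s) a b).
  by rewrite (Rint_Zl (mI s) k c) addrC subrK.
have e1 : primitive f t ^+ 2 = primitive (fun s => 2 * ((k * primitive w s + w s) * f s)) t.
  rewrite (sqr_primitive T0 hf ht); apply: (eq_primitive ht) => s hs; by rewrite X.
have hfk := IgB (mI T) hf ikw.
have e2 : w t ^+ 2 = primitive (fun s => 2 * (w s * (f s - k * w s))) t.
  rewrite (hw t ht) (sqr_primitive T0 hfk ht); apply: (eq_primitive ht) => s hs; by rewrite -(hw s hs).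
have /andP[t0 tT] : 0 <= t <= T by move: ht; rewrite in_itv.
have cX : continuous_on T (fun s => k * primitive w s + w s).
  by move=> s hs; apply: cvgD; [apply: cvgM; [exact: cvg_cst|exact: cZ]|exact: cw].
have j1 := IgS tT (IgZ (mI T) 2 (IgM_continuous cX hf)).
have j2 := IgS tT (IgZ (mI T) 2 (IgM_continuous cw hfk)).
rewrite (X t ht) e1 e2 /primitive -(RintegralD (mI t) j1 j2) -(Rint_Zl (mI t) _ (IgD (mI t) j1 j2)).
apply: eq_Rintegral => s _; rewrite /h /primitive; move: (\int[mu]_(s in I_T s) w s) => Z.
by field.
Qed.

Variables (T : R) (N : nat) (Z w : 'I_2 -> mode N -> R -> R) (g : 'I_2 -> 'I_2 -> mode N -> R -> R).
Hypotheses (T0 : 0 < T) (cw : forall i m, continuous_on T (w i m))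
  (ig : forall i a m, mu.-integrable (I_T T) (EFin \o g i a m))
  (hw : forall i m t, t \in `[0, T] -> w i m t =
    primitive (fun s => forcing (fun a k => g i a k s) m - ksq m * w i m s) t)
  (hZ : forall i m t, Z i m t = primitive (w i m) t).

Let Zt t i m := Z i m t.
Let wt' t i m := w i m t.
Let gt t i a m := g i a m t.

Let iforc i m : mu.-integrable (I_T T) (EFin \o (fun s => forcing (fun a k => g i a k s) m)).
Proof. by apply: (Ig_sum (mI T)) => a; apply: (IgZ (mI T)); exact: ig. Qed.

Lemma total_energy_continuous : continuous_on T (fun t => total_energy (Zt t) (wt' t)).
Proof.
have cZ i m : continuous_on T (Z i m).
  have e : Z i m = primitive (w i m) by apply/funext => t; exact: hZ.
  by rewrite e => t ht; exact: (primitive_continuous T0 (continuous_on_Ig (@cw i m)) ht).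
move=> t ht; apply: cvgM; first exact: cvg_cst.
apply: cvg_sum => i; apply: cvgM; first exact: cvg_cst.
apply: cvg_sum => m; apply: cvgM; first exact: cvg_cst.
have c1 : (ksq m * Z i m s + w i m s) @[s --> within `[0, T]%classic (nbhs t)] --> ksq m * Z i m t + w i m t.
  by apply: cvgD; [apply: cvgM; [exact: cvg_cst|exact: cZ]|exact: cw].
have c2 := @cw i m t ht.
by apply: cvgD; [exact: (cvgM c1 c1)|exact: (cvgM c2 c2)].
Qed.

Lemma total_energy_evolution :
  mu.-integrable (I_T T) (EFin \o (fun s => total_power (Zt s) (wt' s) (gt s))) /\
  forall t, t \in `[0, T] -> total_energy (Zt t) (wt' t) =
    primitive (fun s => total_power (Zt s) (wt' s) (gt s)) t.
Proof.
have H i m := mode_energy_evolution T0 (iforc i m) (@cw i m) (@hw i m).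
pose h i m s := ksq m * (Z i m s * forcing (fun a k => g i a k s) m) +
  2 * (w i m s * forcing (fun a k => g i a k s) m) - ksq m * w i m s ^+ 2.
have hE i m : h i m = (fun s => ksq m * (primitive (w i m) s * forcing (fun a k => g i a k s) m) +
  2 * (w i m s * forcing (fun a k => g i a k s) m) - ksq m * w i m s ^+ 2).
  by apply/funext => s; rewrite /h hZ.
have ih i m : mu.-integrable (I_T T) (EFin \o h i m) by rewrite hE; exact: (H i m).1.
have ihk S i m (hS : S <= T) : mu.-integrable (I_T S) (EFin \o (fun s => (ksq m)^-1 * h i m s)).
  exact: (IgS hS (IgZ (mI T) (ksq m)^-1 (ih i m))).
have is1 S i (hS : S <= T) : mu.-integrable (I_T S) (EFin \o (fun s => \sum_m (ksq m)^-1 * h i m s)).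
  by apply: (Ig_sum (mI S)) => m; exact: ihk.
have is2 S (hS : S <= T) : mu.-integrable (I_T S) (EFin \o (fun s => \sum_i \sum_m (ksq m)^-1 * h i m s)).
  by apply: (Ig_sum (mI S)) => i; exact: is1.
split; first exact: (IgZ (mI T) (wt N) (is2 T (lexx T))).
move=> t ht; have tT : t <= T by move: ht; rewrite in_itv => /andP[].
rewrite /primitive (Rint_Zl (mI t) (wt N) (is2 t tT)) /total_energy; congr (_ * _).
rewrite (Rint_sum (mI t) _ (fun i => is1 t i tT)); apply: eq_bigr => i _.
rewrite (Rint_sum (mI t) _ (fun m => ihk t i m tT)) /mode_energy mulr_sumr; apply: eq_bigr => m _.
rewrite (Rint_Zl (mI t) _ (IgS tT (ih i m))) mulrCA; congr (_ * _).
by rewrite /Zt /wt' hZ ((H i m).2 t ht) hE.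
Qed.

End EnergyEvolution.

(** * Stability in L^2 for solutions described by their modes *)

Lemma absorb_power (R : realType) (e s E d B C : R) : e <= s + C * E + d / 2 * B -> s <= `|s| -> 0 <= E ->
  e <= `|s| + (C + 1) * E + d / 2 * B.
Proof. by move=> h1 h2 E0; rewrite mulrDl mul1r; lra. Qed.

Lemma regroup_rates (V : zmodType) (S1 S2 S3 a b : V) : S1 - S2 = S3 -> S1 - a - (S2 - b) = S3 - (a - b).
Proof. by move=> <-; rewrite !opprD !opprK addrACA. Qed.

Lemma regroup_stress (R : comPzRingType) (q A B A' C : R) : q * (A + B) - q * (A' + 0 * C) = q * (A - A' + B).
Proof. by ring. Qed.

Lemma stability_constant (R : realType) (e d B T : R) : 8 * e * (d / 2 * B * T) = 4 * e * T * d * B.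
Proof. by field. Qed.

Section Stability.
Context {R : realType} (W : 'M[R]_2 -> R) (p K T : R).
Hypotheses (p2 : 2 <= p) (W3 : H1_regular W) (W2 : H2_growth p W) (K0 : 0 < K)
  (cW : H3_convex K W) (hW : hess_growth p W) (T0 : 0 < T).
Local Notation mu := (@lebesgue_measure R).
Local Notation mu2 := (@lebesgue_measure R \x @lebesgue_measure R)%E.
Local Notation cell := (@cell R).
Local Notation Ig f := (mu2.-integrable cell (EFin \o f)).
Local Notation "'I_T' T" := (`]0%R, T%R[%classic : set (measurableTypeR R)) (at level 0, T at level 0).
Let mC : measurable cell := @measurable_cell R.
Let fC : (mu2 cell < +oo)%E := @fin_cell R.
Let mI s : measurable (I_T s). Proof. exact: measurable_itv. Qed.
Implicit Types (uin : R * R -> 'cV[R]_2) (Fin : R * R -> 'M[R]_2)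
  (u ub : R -> R * R -> 'cV[R]_2) (F Fb : R -> R * R -> 'M[R]_2).

(** What the stability argument uses of a weak solution: continuity in time, the L^p bound, and the
    integrated equations of the coefficients. The limit system is the case [delta = 0]. *)
Definition mode_solution A delta uin Fin u F : Prop :=
  [/\ C_L T 2 u, C_L T 2 F, C_L T p F, ae_time T (fun t => p_slice p A (F t)) &
   (forall i a N (m : mode N) t, t \in `[0, T] -> coef2 m (fun x => F t x i a) =
     coef2 m (fun x => Fin x i a) + primitive (fun s => dcoef a (fun k => coef2 k (fun x => u s x i 0)) m) t) /\
   (forall i N (m : mode N) t, t \in `[0, T] -> coef2 m (fun x => u t x i 0) =
     coef2 m (fun x => uin x i 0) + primitive (momentum_rate W delta u F i m) t)].

Lemma ae_timeI (P Q : R -> Prop) : ae_time T P -> ae_time T Q -> ae_time T (fun t => P t /\ Q t).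
Proof.
move=> [N1 [mN1 N10 s1]] [N2 [mN2 N20 s2]].
exists (N1 `|` N2); split; [exact: measurableU|by rewrite measureU0|].
move=> t /= nt; apply: contrapT => /not_orP[n1 n2]; apply: nt => tT.
by split; [apply: contrapT => h; apply: n1; apply: s1 => k; exact/h/k|
           apply: contrapT => h; apply: n2; apply: s2 => k; exact/h/k].
Qed.

Lemma coef2B N (m : mode N) f g : Ig f -> Ig g ->
  coef2 m (fun x => f x - g x) = coef2 m f - coef2 m g.
Proof.
have he h : Ig h -> Ig (fun x => h x * e2 m x).
  by move=> hh; apply: (IgM_bounded mC hh (measurable_e2 m) (M := 1)) => x _; exact: abs_e2_le1.
move=> hf hg; rewrite /coef2 /coef -(RintegralB mC (he _ hf) (he _ hg)).
by apply: eq_Rintegral => x _; rewrite mulrBl.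
Qed.

Lemma p_slice_stress A G i a : p_slice p A G -> Ig (fun x => stress W (G x) i a).
Proof.
move=> hG; have hz : p_slice p A G := hG.
have [mG iG aG] := hG; have [C C0 HC] := stress_growth p2 W3 hW.
apply: (Ig_le mC _ _ (IgZ mC C (IgD mC (Ig_cst mC (1 + 1 : R) fC) iG))).
  by apply: (measurable_continuous_mx (h := fun G => stress W G i a)) => //; exact: continuous_stress.
move=> x _; rewrite (le_trans (abs_entry_le _ _ _))// (le_trans (HC _))//.
apply: ler_wpM2l; first exact: ltW.
rewrite -addrA lerD2l; have y0 := fnorm_ge0 (G x).
have [x1|x1] := leP (fnorm (G x)) 1.
  by rewrite (@le_trans _ _ 1) ?lerDl ?powR_ge0// powR_le1//; move: p2 => h; lra.
apply: (@le_trans _ _ (fnorm (G x) `^ p)); last by rewrite lerDr.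
by apply: ler_powR; [exact: ltW|rewrite gerBl].
Qed.

(** The weighted sum is the integral of [f] times its Fejer mean, which converges by
    [cvg_pairing_sm2] with both exponents equal to 2. *)
Lemma parseval_cvg f : Ig f -> Ig (fun x => f x ^+ 2) ->
  wt N * \sum_(m : mode N) coef2 m f ^+ 2 @[N --> \oo] --> \int[mu2]_(x in cell) f x ^+ 2.
Proof.
move=> hf hf2; have hp : Ig (fun x => `|f x| `^ 2).
  by rewrite (_ : (fun x => _) = (fun x => f x ^+ 2))//; apply/funext => x; rewrite powR_sqr// real_normK ?num_real.
have h22 : (2 : R)^-1 + 2^-1 = 1 by lra.
have := cvg_pairing_sm2 (ltr0Sn R 1) (ltr0Sn R 1) h22 hf hf hp hp.
rewrite (_ : (fun N => _) = (fun N => \int[mu2]_(x in cell) f x ^+ 2 - wt N * \sum_(m : mode N) coef2 m f ^+ 2)).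
  move=> h; rewrite -[X in _ --> X]subr0.
  apply: cvg_trans (cvgB (cvg_cst (\int[mu2]_(x in cell) f x ^+ 2)) h).
  by apply: near_eq_cvg; apply: nearW => N /=; rewrite opprB addrC subrK.
apply/funext => N; rewrite -[X in _ - wt N * X](eq_bigr _ (fun m _ => esym (expr2 (coef2 m f)))).
rewrite -(Rint_mul_sm2 N hf hf) -(RintegralB mC hf2 (Ig_mul_sm2 N hf hf)).
by apply: eq_Rintegral => x _; rewrite mulrBr expr2.
Qed.

Section Difference.
Variables (A delta B : R) (uin : R * R -> 'cV[R]_2) (Fin : R * R -> 'M[R]_2).
Variables (u ub : R -> R * R -> 'cV[R]_2) (F Fb : R -> R * R -> 'M[R]_2)
  (DFb : R -> R * R -> 'I_2 -> 'M[R]_2).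
Hypotheses (A0 : 0 <= A) (d0 : 0 <= delta) (d1 : delta <= 4^-1).
Hypotheses (sol : mode_solution A delta uin Fin u F) (solb : mode_solution A 0 uin Fin ub Fb).
Hypothesis (hDFb : forall t, t \in `[0, T] -> inH1 (Fb t) (DFb t)).
Hypothesis (hB : forall t, t \in `[0, T] ->
  \sum_i \sum_a \sum_b \int[mu2]_(x in cell) DFb t x b i a ^+ 2 <= B).

Section FixedLevel.
Variable N : nat.
Let w i (m : mode N) t := coef2 m (fun x => u t x i 0) - coef2 m (fun x => ub t x i 0).
Let Z i (m : mode N) t := primitive (w i m) t.
Let g i a (m : mode N) t := coef2 m (fun x => stress W (F t x) i a) -
  coef2 m (fun x => stress W (Fb t x) i a) + delta * (ksq m * coef2 m (fun x => F t x i a)).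

Let cuw i m : continuous_on T (w i m).
Proof.
case: sol => cu _ _ _ _; case: solb => cub _ _ _ _ t ht.
by apply: cvgB; [exact: (coef2_continuous cu ht)|exact: (coef2_continuous cub ht)].
Qed.

Let ig i a m : mu.-integrable (I_T T) (EFin \o g i a m).
Proof.
case: sol => _ cF cpF aF _; case: solb => _ _ cpFb aFb _.
have i1 := coef2_time_Ig m (stress_tx_Ig p2 W3 hW i a A0 cpF aF).
have i2 := coef2_time_Ig m (stress_tx_Ig p2 W3 hW i a A0 cpFb aFb).
have cf : continuous_on T (fun t => coef2 m (fun x => F t x i a)) by exact: coef2_continuous.
exact: (IgD (mI T) (IgB (mI T) i1 i2) (IgZ (mI T) delta (IgZ (mI T) (ksq m) (continuous_on_Ig cf)))).
Qed.

Let momentum_Ig d u' F' i m : 0 <= d -> mode_solution A d uin Fin u' F' ->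
  mu.-integrable (I_T T) (EFin \o @momentum_rate R W d u' F' i N m).
Proof.
move=> _ [cu cF cpF aF _].
have cf a (k : mode N) : continuous_on T (fun t => coef2 k (fun x => F' t x i a)) by exact: coef2_continuous.
have cu' : continuous_on T (fun t => coef2 m (fun x => u' t x i 0)) by exact: coef2_continuous.
apply: (IgB (mI T)); last exact: (IgZ (mI T) _ (continuous_on_Ig cu')).
apply: (Ig_sum (mI T)) => a; apply: (IgZ (mI T)); apply: (IgD (mI T)).
  exact: (coef2_time_Ig _ (stress_tx_Ig p2 W3 hW i a A0 cpF aF)).
exact: (IgZ (mI T) d (IgZ (mI T) _ (continuous_on_Ig (cf a (flip a m))))).
Qed.

(** The initial coefficients cancel because the two solutions share their data. *)
Let hw i m t : t \in `[0, T] -> w i m t =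
  primitive (fun s => forcing (fun a k => g i a k s) m - ksq m * w i m s) t.
Proof.
move=> ht; have tT : t <= T by move: ht; rewrite in_itv => /andP[].
have [_ _ _ _ [_ /(_ i N m t ht) e1]] := sol; have [_ _ _ _ [_ /(_ i N m t ht) e2']] := solb.
have i1 := IgS tT (momentum_Ig i m d0 sol); have i2 := IgS tT (momentum_Ig i m (lexx 0) solb).
rewrite /w e1 e2' opprD addrACA subrr add0r /primitive -(RintegralB (mI t) i1 i2).
apply: eq_Rintegral => s _; rewrite /momentum_rate /forcing /g.
rewrite mulrBr; apply: regroup_rates; rewrite -sumrB.
by apply: eq_bigr => a _; exact: regroup_stress.
Qed.

Let hG i a m t : t \in `[0, T] -> coef2 m (fun x => (F t x - Fb t x) i a) =
  dcoef a (fun k => Z i k t) m.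
Proof.
move=> ht; have tT : t <= T by move: ht; rewrite in_itv => /andP[].
have [cu cF _ _ [/(_ i a N m t ht) e1 _]] := sol.
have [cub cFb _ _ [/(_ i a N m t ht) e2' _]] := solb.
have -> : (fun x => (F t x - Fb t x) i a) = (fun x => F t x i a - Fb t x i a).
  by apply/funext => x; rewrite !mxE.
rewrite coef2B; [|exact: inL2_Ig (cF.2 t ht).1|exact: inL2_Ig (cFb.2 t ht).1].
rewrite e1 e2' opprD addrACA subrr add0r /dcoef /Z /primitive.
have j1 : mu.-integrable (I_T t) (EFin \o (fun s => coef2 (flip a m) (fun x => u s x i 0))).
  by apply: (IgS tT); apply: continuous_on_Ig => s hs; exact: (coef2_continuous cu hs).
have j2 : mu.-integrable (I_T t) (EFin \o (fun s => coef2 (flip a m) (fun x => ub s x i 0))).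
  by apply: (IgS tT); apply: continuous_on_Ig => s hs; exact: (coef2_continuous cub hs).
by rewrite (Rint_Zl (mI t) _ j1) (Rint_Zl (mI t) _ j2) -mulrBr -(RintegralB (mI t) j1 j2).
Qed.

Let y t i a (m : mode N) := coef2 m (fun x => Fb t x i a).

(** Bessel's inequality for the gradient of [Fb]. *)
Let hy t : t \in `[0, T] -> wt N * \sum_i \sum_a \sum_m ksq m * y t i a m ^+ 2 <= B.
Proof.
move=> ht; apply: le_trans (hB ht); have hH := hDFb ht.
rewrite mulr_sumr; apply: ler_sum => i _; rewrite mulr_sumr; apply: ler_sum => a _.
rewrite -sum_dcoef_sqr mulr_sumr; apply: ler_sum => b _.
have [_ /(_ b)[hD _]] := hH.
apply: le_trans (coef2_sqr_le N (inL2_Ig i a hD) (inL2_sqr i a hD)).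
rewrite le_eqVlt; apply/orP; left; apply/eqP; congr (_ * _); apply: eq_bigr => m _.
by rewrite (coef2_weak_derivative m b i a hH).
Qed.

(** [slice_error] written through coefficients. The two agree whenever both slices satisfy the L^p
    bound, hence at almost every time ([time_errorE]), and integrability in time can be read off
    this form. *)
Definition time_error t : R :=
  \sum_i \sum_a \int[mu2]_(x in cell) (defect W K (F t x) (Fb t x) i a * (F t x - Fb t x) i a) -
  wt N * \sum_i \sum_a \sum_(m : mode N) coef2 m (fun x => (F t x - Fb t x) i a) *
    (coef2 m (fun x => stress W (F t x) i a) - coef2 m (fun x => stress W (Fb t x) i a) +
     K * coef2 m (fun x => (F t x - Fb t x) i a)).

Lemma coef2_defect t i a (m : mode N) : t \in `[0, T] -> p_slice p A (F t) -> p_slice p A (Fb t) ->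
  coef2 m (fun x => defect W K (F t x) (Fb t x) i a) =
  coef2 m (fun x => stress W (F t x) i a) - coef2 m (fun x => stress W (Fb t x) i a) +
     K * coef2 m (fun x => (F t x - Fb t x) i a).
Proof.
move=> ht hF hFb; have s1 := p_slice_stress i a hF; have s2 := p_slice_stress i a hFb.
have [_ _ _ s3] := slice_integrable p2 K0 W3 hW hF hFb i a.
have he h : Ig h -> Ig (fun x => h x * e2 m x).
  by move=> hh; apply: (IgM_bounded mC hh (measurable_e2 m) (M := 1)) => x _; exact: abs_e2_le1.
have s4 := IgZ mC K (he _ s3).
rewrite -(coef2B m s1 s2) /coef2 /coef -(Rint_Zl mC K (he _ s3)).
rewrite -(RintegralD mC (he _ (IgB mC s1 s2)) s4); apply: eq_Rintegral => x _.
by rewrite /defect !mxE; ring.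
Qed.

Lemma time_errorE t : t \in `[0, T] -> p_slice p A (F t) -> p_slice p A (Fb t) ->
  time_error t = slice_error W K N (F t) (Fb t).
Proof.
move=> ht hF hFb; have h := Rint_defect_sm2 p2 K0 W3 hW N hF hFb.
rewrite /time_error; apply/eqP; rewrite subr_eq addrC -subr_eq; apply/eqP.
rewrite -[RHS]opprK; apply/eqP; rewrite -eqr_oppLR opprB; apply/eqP; rewrite -[LHS]h; congr (- (_ * _)).
apply: eq_bigr => i _; apply: eq_bigr => a _; apply: eq_bigr => m _.
by rewrite coef2_defect.
Qed.

Lemma time_error_Ig : mu.-integrable (I_T T) (EFin \o time_error).
Proof.
case: sol => cu cF cpF aF _; case: solb => cub cFb cpFb aFb _.
have cG i a (m : mode N) : continuous_on T (fun t => coef2 m (fun x => (F t x - Fb t x) i a)).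
  move=> t ht; have [cu' cF' _ _ _] := sol.
  have E s : s \in `[0, T] -> coef2 m (fun x => (F s x - Fb s x) i a) =
     coef2 m (fun x => F s x i a) - coef2 m (fun x => Fb s x i a).
    move=> hs; rewrite -coef2B; [|exact: inL2_Ig (cF.2 s hs).1|exact: inL2_Ig (cFb.2 s hs).1].
    by congr (coef2 m _); apply/funext => x; rewrite !mxE.
  rewrite (E t ht).
  apply: cvg_trans (cvgB (coef2_continuous (i := i) (j := a) (k := m) cF ht) (coef2_continuous (i := i) (j := a) (k := m) cFb ht)).
  apply: near_eq_cvg; rewrite near_withinE; apply: nearW => s hs.
  by rewrite E.
have i1 i a m := coef2_time_Ig (N := N) m (stress_tx_Ig p2 W3 hW i a A0 cpF aF).
have i2 i a m := coef2_time_Ig (N := N) m (stress_tx_Ig p2 W3 hW i a A0 cpFb aFb).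
apply: (IgB (mI T)).
  apply: (Ig_sum (mI T)) => i; apply: (Ig_sum (mI T)) => a.
  exact: (Fubini_Ig1 (mI T) mC (defect_tx_Ig p2 W3 K0 hW i a A0 cpF cpFb aF aFb)).
apply: (IgZ (mI T)); apply: (Ig_sum (mI T)) => i; apply: (Ig_sum (mI T)) => a.
apply: (Ig_sum (mI T)) => m; apply: (IgM_continuous (cG i a m)).
exact: (IgD (mI T) (IgB (mI T) (i1 i a m) (i2 i a m)) (IgZ (mI T) K (continuous_on_Ig (cG i a m)))).
Qed.

(** Gronwall's lemma for the energy of the modes of level [N], which starts from 0; the sources are
    the truncation error and delta B / 2. *)
Lemma energy_level_le Cp : 0 <= Cp ->
  (forall N (delta B : R) (F Fb : R * R -> 'M[R]_2) (Z w : 'I_2 -> mode N -> R)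
    (y g : 'I_2 -> 'I_2 -> mode N -> R),
  0 <= delta -> delta <= 4^-1 -> p_slice p A F -> p_slice p A Fb ->
  (forall i a m, coef2 m (fun x => (F x - Fb x) i a) = dcoef a (Z i) m) ->
  (forall i a m, g i a m = coef2 m (fun x => defect W K (F x) (Fb x) i a) -
     K * dcoef a (Z i) m + delta * (ksq m * (dcoef a (Z i) m + y i a m))) ->
  wt N * \sum_i \sum_a \sum_m ksq m * y i a m ^+ 2 <= B ->
  total_power Z w g <= slice_error W K N F Fb + Cp * total_energy Z w + delta / 2 * B) ->
  forall t, t \in `[0, T] ->
  wt N * \sum_i \sum_a \sum_(m : mode N) coef2 m (fun x => (F t x - Fb t x) i a) ^+ 2 <=
  8 * expR (2 * (Cp + 1) * T) * (\int[mu]_(s in I_T T) `|time_error s| + delta / 2 * B * T).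
Proof.
move=> Cp0 HP t ht.
pose E s := total_energy (fun i m => Z i m s) (fun i m => w i m s).
have cE : continuous_on T E := total_energy_continuous T0 cuw (fun _ _ _ => erefl).
have [ipow HE] := total_energy_evolution T0 cuw ig hw (fun _ _ _ => erefl).
have B0 : 0 <= B.
  apply: le_trans (hB ht); do 3 (apply: sumr_ge0 => ? _).
  by apply: Rintegral_ge0 => x _; exact: sqr_ge0.
have dB : 0 <= delta / 2 * B by rewrite mulr_ge0// divr_ge0.
pose H := \int[mu]_(s in I_T T) `|time_error s| + delta / 2 * B * T.
have ierr := Ig_abs time_error_Ig.
have H0 : 0 <= H.
  by rewrite addr_ge0//; [apply: Rintegral_ge0|rewrite mulr_ge0// ltW].
have E0 s : 0 <= E s.
  by rewrite mulr_ge0 ?wt_ge0// sumr_ge0// => i _; exact: mode_energy_ge0.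
have gron s : s \in `[0, T] -> E s <= H + (Cp + 1) * primitive E s.
  move=> hs; have /andP[s0 sT] : 0 <= s <= T by move: hs; rewrite in_itv.
  rewrite {1}/E (HE s hs).
  have iEs := IgS sT (continuous_on_Ig cE); have ies := IgS sT ierr.
  have ic := Ig_cst (mI s) (delta / 2 * B) (fin_time s).
  have ib := IgD (mI s) (IgD (mI s) ies (IgZ (mI s) (Cp + 1) iEs)) ic.
  apply: (@le_trans _ _ (\int[mu]_(r in I_T s) (`|time_error r| + (Cp + 1) * E r + delta / 2 * B))).
    apply: (ae_le_Rint (mI s) (IgS sT ipow) ib).
    case: sol => _ _ _ aF _; case: solb => _ _ _ aFb _.
    have [N0 [mN0 N00 sub]] := ae_timeI aF aFb; exists N0; split=> // r /= nr; apply: sub => /= hr.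
    apply: nr => rs; have rT : r \in `]0, T[.
      by move: rs; rewrite /= !in_itv /= => /andP[-> r2]; exact: lt_le_trans sT.
    have rin : r \in `[0, T] by apply: open_sub_closed; exact: rT.
    have [hFr hFbr] := hr rT.
    apply: absorb_power (ler_norm _) (E0 r); rewrite (time_errorE rin hFr hFbr).
    apply: (HP N delta B (F r) (Fb r) _ _ (y r)) => //.
    - by move=> i a m; exact: hG.
    - move=> i a m; rewrite -(hG i a m rin) (coef2_defect i a m rin hFr hFbr) /g /y.
      have -> : coef2 m (fun x => F r x i a) = coef2 m (fun x => (F r x - Fb r x) i a) + coef2 m (fun x => Fb r x i a).
        have [_ cF _ _ _] := sol; have [_ cFb _ _ _] := solb.
        have -> : (fun x => (F r x - Fb r x) i a) = (fun x => F r x i a - Fb r x i a).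
          by apply/funext => x; rewrite !mxE.
        by rewrite coef2B ?subrK//; [exact: inL2_Ig (cF.2 r rin).1|exact: inL2_Ig (cFb.2 r rin).1].
      by rewrite addrK.
    - exact: hy.
  rewrite (RintegralD (mI s) (IgD (mI s) ies (IgZ (mI s) (Cp + 1) iEs)) ic).
  rewrite (RintegralD (mI s) ies (IgZ (mI s) (Cp + 1) iEs)) (Rint_Zl (mI s) (Cp + 1) iEs).
  rewrite addrAC lerD2r /H lerD//.
    rewrite -(Rint_indicator (fun r => `|time_error r|) sT); apply: le_Rintegral => //.
      exact: Ig_before.
    by move=> r _; rewrite ler_piMr//; case: (r < s).
  rewrite Rintegral_cst//; apply: ler_wpM2l => //.
  rewrite [X in fine X](_ : _ = s%:E) //=.
  rewrite [LHS]lebesgue_measure_itv /= lte_fin; case: ltP => s0'; first by rewrite oppr0 adde0.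
  by congr EFin; apply/eqP; rewrite eq_le s0 s0'.
(* [Cp] may be 0, whereas [gronwall] asks for a positive rate. *)
have C1 : 0 < Cp + 1 by rewrite ltr_wpDl.
have := gronwall T0 C1 H0 cE gron ht; rewrite -/H => hEt.
(* The final factor 8 is the 4 of [displacement_le_energy] times the 2 of [gronwall]. *)
apply: (@le_trans _ _ (4 * E t)).
  rewrite /E /total_energy mulrCA ler_wpM2l ?wt_ge0// mulr_sumr; apply: ler_sum => i _.
  apply: le_trans (displacement_le_energy _ _); rewrite -sum_dcoef_sqr.
  by apply: ler_sum => a _; apply: ler_sum => m _; rewrite hG.
apply: (le_trans (ler_wpM2l _ hEt)) => //.
by rewrite le_eqVlt; apply/orP; left; apply/eqP; ring.
Qed.

End FixedLevel.
Lemma time_error_cvg : \int[mu]_(s in I_T T) `|time_error N s| @[N --> \oo] --> (0 : R).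
Proof.
have [C C0 HC] := slice_error_le p2 K0 W3 hW A0.
case: sol => _ _ _ aF _; case: solb => _ _ _ aFb _.
have ae2 := ae_timeI aF aFb.
have z0 : \int[mu]_(s in I_T T) (cst 0 s : R) = 0 by rewrite Rintegral_cst// mul0r.
rewrite -[X in _ --> X]z0; apply: (cvg_Rint_dominated (mI T) (g := cst C)).
- by move=> N; exact: (Ig_measurable (Ig_abs (time_error_Ig N))).
- exact: measurable_cst.
- apply: (ae_timeS ae2) => s sT [h1 h2]; have sin := open_sub_closed sT.
  rewrite (_ : (fun N => _) = (fun N => `|slice_error W K N (F s) (Fb s)|)); last first.
    by apply/funext => N; rewrite (time_errorE N sin h1 h2).
  rewrite /= -(normr0 R); apply: cvg_norm; exact: (slice_error_cvg p2 K0 W3 hW h1 h2).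
- exact: (Ig_cst (mI T) C (fin_time T)).
- have [N0 [mN0 N00 sub]] := ae2; exists N0; split=> // s /= ns; apply: sub => hs.
  apply: ns => N sT; have [h1 h2] := hs sT; have sin := open_sub_closed sT.
  by rewrite normr_id (time_errorE N sin h1 h2) HC.
Qed.

(** The limit of [energy_level_le] in [N]: the left-hand side converges by [parseval_cvg], and the
    truncation error vanishes by [time_error_cvg]. *)
Lemma sqdist_le Cp : 0 <= Cp ->
  (forall N (delta B : R) (F Fb : R * R -> 'M[R]_2) (Z w : 'I_2 -> mode N -> R)
    (y g : 'I_2 -> 'I_2 -> mode N -> R),
  0 <= delta -> delta <= 4^-1 -> p_slice p A F -> p_slice p A Fb ->
  (forall i a m, coef2 m (fun x => (F x - Fb x) i a) = dcoef a (Z i) m) ->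
  (forall i a m, g i a m = coef2 m (fun x => defect W K (F x) (Fb x) i a) -
     K * dcoef a (Z i) m + delta * (ksq m * (dcoef a (Z i) m + y i a m))) ->
  wt N * \sum_i \sum_a \sum_m ksq m * y i a m ^+ 2 <= B ->
  total_power Z w g <= slice_error W K N F Fb + Cp * total_energy Z w + delta / 2 * B) ->
  forall t, t \in `[0, T] ->
  \sum_i \sum_a \int[mu2]_(x in cell) ((F t x - Fb t x) i a) ^+ 2 <=
  4 * expR (2 * (Cp + 1) * T) * T * delta * B.
Proof.
move=> Cp0 HP t ht; have [_ cF _ _ _] := sol; have [_ cFb _ _ _] := solb.
have hG i a : Ig (fun x => (F t x - Fb t x) i a) /\ Ig (fun x => (F t x - Fb t x) i a ^+ 2).
  have -> : (fun x => (F t x - Fb t x) i a) = (fun x => F t x i a - Fb t x i a).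
    by apply/funext => x; rewrite !mxE.
  have -> : (fun x => (F t x - Fb t x) i a ^+ 2) = (fun x => (F t x i a - Fb t x i a) ^+ 2).
    by apply/funext => x; rewrite !mxE.
  split; last exact: (inL2B i a (cF.2 t ht).1 (cFb.2 t ht).1).
  exact: (IgB mC (inL2_Ig i a (cF.2 t ht).1) (inL2_Ig i a (cFb.2 t ht).1)).
have lhs : \sum_i \sum_a wt N * \sum_(m : mode N) coef2 m (fun x => (F t x - Fb t x) i a) ^+ 2
    @[N --> \oo] --> \sum_i \sum_a \int[mu2]_(x in cell) ((F t x - Fb t x) i a) ^+ 2.
  apply: cvg_sum => i; apply: cvg_sum => a; exact: (parseval_cvg (hG i a).1 (hG i a).2).
have rhs : 8 * expR (2 * (Cp + 1) * T) * (\int[mu]_(s in I_T T) `|time_error N s| + delta / 2 * B * T)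
    @[N --> \oo] --> 8 * expR (2 * (Cp + 1) * T) * (0 + delta / 2 * B * T).
  apply: cvgM; first exact: cvg_cst.
  by apply: cvgD; [exact: time_error_cvg|exact: cvg_cst].
have := ler_cvg_to lhs rhs; rewrite add0r.
have -> : 8 * expR (2 * (Cp + 1) * T) * (delta / 2 * B * T) = 4 * expR (2 * (Cp + 1) * T) * T * delta * B.
  exact: stability_constant.
apply; apply: nearW => N; apply: le_trans (energy_level_le N Cp0 HP ht).
rewrite le_eqVlt; apply/orP; left; apply/eqP; rewrite mulr_sumr; apply: eq_bigr => i _.
by rewrite mulr_sumr.
Qed.

End Difference.

(** The constant is fixed before delta, the data and the solutions, which enter it only through the
    L^p bound [A]. *)
Lemma mode_stability A : 0 <= A -> exists2 C : R, 0 <= C &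
  forall delta B uin Fin u ub F Fb DFb, 0 <= delta -> delta <= 4^-1 ->
  mode_solution A delta uin Fin u F -> mode_solution A 0 uin Fin ub Fb ->
  (forall t, t \in `[0, T] -> inH1 (Fb t) (DFb t)) ->
  (forall t, t \in `[0, T] -> \sum_i \sum_a \sum_b \int[mu2]_(x in cell) DFb t x b i a ^+ 2 <= B) ->
  forall t, t \in `[0, T] ->
  \sum_i \sum_a \int[mu2]_(x in cell) ((F t x - Fb t x) i a) ^+ 2 <= C * delta * B.
Proof.
move=> A0; have [Cp Cp0 HP] := slice_power_le p2 K0 W3 cW hW A0.
exists (4 * expR (2 * (Cp + 1) * T) * T).
  by rewrite mulr_ge0 ?(ltW T0)// mulr_ge0// expR_ge0.
move=> delta B uin Fin u ub F Fb DFb d0 d1 sol solb hDFb hB t ht.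
exact: (sqdist_le A0 d0 d1 sol solb hDFb hB Cp0 HP ht).
Qed.

End Stability.

(** * From weak solutions to mode equations *)

Section WeakSolutionModes.
Context {R : realType} (W : 'M[R]_2 -> R) (p K T : R).
Hypotheses (p2 : 2 <= p) (W3 : H1_regular W) (W2 : H2_growth p W) (K0 : 0 < K)
  (cW : H3_convex K W) (hW : hess_growth p W) (T0 : 0 < T).
Local Notation mu := (@lebesgue_measure R).
Local Notation mu2 := (@lebesgue_measure R \x @lebesgue_measure R)%E.
Local Notation cell := (@cell R).
Local Notation Ig f := (mu2.-integrable cell (EFin \o f)).
Local Notation "'I_T' T" := (`]0%R, T%R[%classic : set (measurableTypeR R)) (at level 0, T at level 0).
Let mC : measurable cell := @measurable_cell R.
Let mI s : measurable (I_T s). Proof. exact: measurable_itv. Qed.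

Lemma coef2_sum N (k : mode N) (I : Type) (r : seq I) (f : I -> R * R -> R) :
  (forall b, Ig (f b)) -> coef2 k (fun x => \sum_(b <- r) f b x) = \sum_(b <- r) coef2 k (f b).
Proof.
move=> hf; have he b : Ig (fun x => f b x * e2 k x).
  by apply: (IgM_bounded mC (hf b) (measurable_e2 k) (M := 1)) => x _; exact: abs_e2_le1.
rewrite /coef2 /coef -(Rint_sum mC r he).
by apply: eq_Rintegral => x _; rewrite mulr_suml.
Qed.

Lemma coef2_laplacian (f : R * R -> 'M[R]_2) Df D2f N (k : mode N) i a : inH1 f Df ->
  (forall b, inH1 (fun x => Df x b) (fun x => D2f x b)) ->
  coef2 k (fun x => lapl (D2f x) i a) = - (ksq k * coef2 k (fun x => f x i a)).
Proof.
move=> hf hD.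
have -> : (fun x => lapl (D2f x) i a) = (fun x => \sum_b D2f x b b i a).
  by apply/funext => x; rewrite /lapl summxE.
rewrite coef2_sum; last by move=> b; case: (hD b) => _ /(_ b)[h _]; exact: (inL2_Ig i a h).
rewrite /ksq mulr_suml -sumrN; apply: eq_bigr => b _.
rewrite (coef2_weak_derivative k b i a (hD b)) (coef2_weak_derivative (flip b k) b i a hf).
by rewrite flipK sg_flip mulNr mulrN mulrA expr2.
Qed.

Lemma ae_time_forall (P : 'I_2 -> R -> Prop) : (forall b, ae_time T (P b)) ->
  ae_time T (fun t => forall b, P b t).
Proof.
move=> hP; have := ae_timeI (hP 0) (hP 1).
move=> [N0 [mN0 N00 sub]]; exists N0; split=> // t /= nt; apply: sub => h; apply: nt => tT b.
have [h0 h1] := h tT.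
by have [->|->] : b = 0 \/ b = 1 by case: b => -[|[|//]] hb; [left|right]; exact: val_inj.
Qed.

Lemma initial_L2 uin Fin DFin : initial_data p uin Fin DFin -> inL 2 uin /\ inL 2 Fin.
Proof. by case=> hu _ [hF _] _. Qed.

Lemma weak_solution_modes A delta uin Fin DFin u F : 0 <= A -> 0 < delta ->
  (forall Du DF, C_L T 2 u -> C_L T p F -> C_H1 T F DF ->
    energy_ineq T delta W uin Fin DFin u Du F DF -> ae_time T (fun t => p_slice p A (F t))) ->
  initial_data p uin Fin DFin -> weak_solution T delta p K W uin Fin DFin u F ->
  mode_solution W p T A delta uin Fin u F.
Proof.
move=> A0 d0 hA /initial_L2[huin hFin] [Du [DF [D2F [y [hF hD [[cu hDu] [cpF hH] _ [hm hk] [he _]]]]]]].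
have [cF _ hHt] := hH; have aF := hA Du DF cu cpF hH he.
split=> //; split.
  by move=> i a N m; exact: (kinematic_modes i a m T0 hFin cu hDu cF hk).
move=> i N m; apply: (momentum_modes i m T0 huin cu hDu cF _ _ _ hm).
- by move=> j a; exact: (stress_tx_Ig p2 W3 hW j a A0 cpF aF).
- move=> j a; have -> : (fun t x => lapl (D2F t x) j a) = (fun t x => \sum_b D2F t x b b j a).
    by apply/funext => t; apply/funext => x; rewrite /lapl summxE.
  exact: (Ig_sum (measurableX (mI T) mC) _ (fun b => L2_H1_gradient b j a (hD b))).
- have haD b : ae_time T (fun t => inH1 (fun x => DF t x b) (fun x => D2F t x b)) by case: (hD b).
  have [N0 [mN0 N00 sub]] := ae_time_forall haD; exists N0; split=> // t /= nt; apply: sub => h; apply: nt => tT j a M k.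
  by rewrite (coef2_laplacian k j a (hHt t (open_sub_closed tT)) (h tT)) mulrN.
Qed.

Lemma weak_solution_lim_modes A uin Fin DFin u F : 0 <= A ->
  (forall Du DF, C_L T 2 u -> C_L T p F -> C_H1 T F DF ->
    energy_ineq T 0 W uin Fin DFin u Du F DF -> ae_time T (fun t => p_slice p A (F t))) ->
  initial_data p uin Fin DFin -> weak_solution_lim T p K W uin Fin DFin u F ->
  mode_solution W p T A 0 uin Fin u F /\ exists DF, C_H1 T F DF.
Proof.
move=> A0 hA /initial_L2[huin hFin] [Du [DF [y [[cu hDu] [cpF hH] _ [hm hk] [he _]]]]].
have [cF _ hHt] := hH; have aF := hA Du DF cu cpF hH he.
split; last by exists DF.
split=> //; split.
  by move=> i a N m; exact: (kinematic_modes i a m T0 hFin cu hDu cF hk).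
move=> i N m; apply: (momentum_modes i m T0 huin cu hDu cF _ _ _ hm).
- by move=> j a; exact: (stress_tx_Ig p2 W3 hW j a A0 cpF aF).
- move=> j a; have -> : (fun _ _ => (0 : 'M[R]_2) j a) = (fun (_ : R) (_ : R * R) => 0 : R).
    by apply/funext => t; apply/funext => x; rewrite mxE.
  exact: Ig0.
- by apply: aeW => t _ j a M k; rewrite !mul0r oppr0.
Qed.

End WeakSolutionModes.

(** * Scalar inequalities for the final form of the estimate *)

Section Scalar.
Context {R : realType}.

(** After scaling by [s], a power at most 2 is below 1 or below the square. It is applied with [s]
    the square root of delta. *)
Lemma powR_le_sqr (a s r : R) : 0 <= a -> 0 < s -> 0 < r -> r <= 2 ->
  a `^ r <= s `^ r * (1 + s ^- 2 * a ^+ 2).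
Proof.
move=> a0 s0 r0 r2; have as0 : 0 <= a / s by rewrite divr_ge0// ltW.
have -> : a `^ r = s `^ r * (a / s) `^ r.
  by rewrite -powRM ?(ltW s0)// mulrC divfK// gt_eqF.
apply: ler_wpM2l; first exact: powR_ge0.
have -> : s ^- 2 * a ^+ 2 = (a / s) ^+ 2 by rewrite expr_div_n mulrC.
have [h|h] := leP (a / s) 1.
  apply: (@le_trans _ _ 1); last by rewrite lerDl sqr_ge0.
  by rewrite powR_le1 ?(ltW r0)// as0 h.
apply: (@le_trans _ _ ((a / s) `^ 2)); first by apply: ler_powR => //; exact: ltW.
by rewrite powR_sqr// lerDr.
Qed.

Lemma sqrt_powR (d r : R) : 0 <= d -> (d `^ (2^-1)) `^ r = d `^ (r / 2).
Proof. by move=> d0; rewrite -powRrM mulrC. Qed.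

Lemma threshold_le (C r d t : R) : 1 <= C -> 0 < r -> 0 < d -> 0 <= t ->
  d <= expR (4 / r * (1 - expR (1 * t))) / C `^ (2 / r) -> d <= (C `^ (2 / r))^-1.
Proof.
move=> C1 r0 d0 t0 h; apply: (le_trans h); rewrite ler_piMl ?invr_ge0 ?powR_ge0//.
rewrite -expR0 ler_expR mulr_ge0_le0 ?divr_ge0 ?(ltW r0)//.
by rewrite subr_le0 ler_expR mulr_ge0 ?expR_ge0.
Qed.

(** As 2 / r >= 1 and C >= 1, the power C^(2/r) is at least C. *)
Lemma threshold_small (C r d : R) : 4 <= C -> 0 < r -> r <= 2 ->
  d <= (C `^ (2 / r))^-1 -> d <= 4^-1.
Proof.
move=> C4 r0 r2 h; have C1 : 1 <= C by lra.
have C0 : 0 < C by lra.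
apply: (le_trans h); rewrite lef_pV2 ?posrE ?powR_gt0//.
apply: (le_trans C4); rewrite -{1}(powRr1 (ltW C0)); apply: ler_powR => //.
by rewrite ler_pdivlMr// mul1r.
Qed.

(** The threshold on [d] says precisely that x = C d^(r/2) is at most 1. Lowering its exponent from
    1 to exp(- t) increases x, and the remaining exponential factor is at least 1. *)
Lemma holder_power_le (C r d t : R) : 1 <= C -> 0 < r -> 0 < d -> 0 <= t ->
  d <= (C `^ (2 / r))^-1 ->
  C * d `^ (r / 2) <= (C * d `^ (r / 2)) `^ expR (- 1 * t) * expR (2 - 2 * expR (- 1 * t)).
Proof.
move=> C1 r0 d0 t0 h; have C0 : 0 < C by exact: lt_le_trans C1.
set x := C * _; have x0 : 0 < x by rewrite mulr_gt0// powR_gt0.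
have x1 : x <= 1.
  rewrite /x -ler_pdivlMl// mulr1; apply: (@le_trans _ _ (((C `^ (2 / r))^-1) `^ (r / 2))).
    by apply: ge0_ler_powR; rewrite ?nnegrE ?invr_ge0 ?powR_ge0 ?divr_ge0 ?(ltW r0) ?(ltW d0).
  rewrite -powRN -powRrM (_ : - (2 / r) * (r / 2) = -1) ?powRN ?powRr1 ?(ltW C0)//.
  by field; rewrite gt_eqF.
set th := expR (- 1 * t); have th1 : th <= 1 by rewrite /th mulN1r -[leRHS]expR0 ler_expR oppr_le0.
apply: (@le_trans _ _ (x `^ th)).
  rewrite -{1}(powRr1 (ltW x0)); apply: ger_powR => //; exact/andP.
by rewrite ler_peMr ?powR_ge0// -[leLHS]expR0 ler_expR subr_ge0; lra.
Qed.

Lemma sqr_add_le (a b : R) : (a + b) ^+ 2 <= 2 * a ^+ 2 + 2 * b ^+ 2.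
Proof. by have := sqr_ge0 (a - b); rewrite sqrrB sqrrD; lra. Qed.

End Scalar.

(** * The L^2 and L^r estimates for weak solutions *)

Section FinalEstimate.
Context {R : realType} (W : 'M[R]_2 -> R) (p K T : R).
Hypotheses (p2 : 2 <= p) (hyp : hypW p K W) (T0 : 0 < T).
Local Notation mu := (@lebesgue_measure R).
Local Notation mu2 := (@lebesgue_measure R \x @lebesgue_measure R)%E.
Local Notation cell := (@cell R).
Local Notation Ig f := (mu2.-integrable cell (EFin \o f)).
Let mC : measurable cell := @measurable_cell R.
Let fC : (mu2 cell < +oo)%E := @fin_cell R.
Implicit Types (uin : R * R -> 'cV[R]_2) (Fin : R * R -> 'M[R]_2) (DFin : R * R -> 'I_2 -> 'M[R]_2)
  (u ub : R -> R * R -> 'cV[R]_2) (F Fb : R -> R * R -> 'M[R]_2).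

Lemma gradient_bound F DF : C_H1 T F DF -> exists2 B : R, 0 <= B &
  forall t, t \in `[0, T] -> \sum_i \sum_a \sum_b \int[mu2]_(x in cell) DF t x b i a ^+ 2 <= B.
Proof.
move=> [_ hD _].
have c : continuous_on T (fun t => \sum_i \sum_a \sum_b \int[mu2]_(x in cell) DF t x b i a ^+ 2).
  move=> t ht; apply: cvg_sum => i; apply: cvg_sum => a; apply: cvg_sum => b.
  exact: (sqnorm_continuous (i := i) (j := a) (hD b) ht).
have [B B0 HB] := continuous_on_bounded c; exists B => // t ht.
exact: le_trans (ler_norm _) (HB t ht).
Qed.

Lemma sqdist_triangle f g h : inL 2 f -> inL 2 g -> inL 2 h ->
  \sum_i \sum_a \int[mu2]_(x in cell) ((f x - h x) i a : R) ^+ 2 <=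
  2 * \sum_(i < 2) \sum_(a < 2) \int[mu2]_(x in cell) ((f x - g x) i a) ^+ 2 +
  2 * \sum_(i < 2) \sum_(a < 2) \int[mu2]_(x in cell) ((h x - g x) i a) ^+ 2.
Proof.
move=> hf hg hh; rewrite !mulr_sumr -big_split; apply: ler_sum => i _.
rewrite !mulr_sumr -big_split; apply: ler_sum => a _ /=.
have hD v w : inL 2 v -> inL 2 w -> Ig (fun x => (v x - w x) i a ^+ 2).
  move=> hv hw; rewrite (_ : (fun x => _) = (fun x => (v x i a - w x i a) ^+ 2)); first exact: inL2B.
  by apply/funext => x; rewrite !mxE.
have i1 := IgZ mC 2 (hD _ _ hf hg); have i2 := IgZ mC 2 (hD _ _ hh hg).
rewrite -(Rint_Zl mC 2 (hD _ _ hf hg)) -(Rint_Zl mC 2 (hD _ _ hh hg)) -(RintegralD mC i1 i2).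
apply: le_Rintegral => //; [exact: hD|exact: (IgD mC i1 i2)|].
move=> x _; have -> : (f x - h x) i a = (f x - g x) i a + - (h x - g x) i a.
  by rewrite !mxE; ring.
by apply: (le_trans (sqr_add_le _ _)); rewrite sqrrN.
Qed.

(* One limit solution, chosen once, carries the constant; since the bound for
   [delta = 0] gives uniqueness of [Fb], it serves for all of them. *)
Lemma weak_stability uin Fin DFin : initial_data p uin Fin DFin -> exists2 B : R, 0 <= B &
  forall delta u F ub Fb, 0 < delta -> delta <= 4^-1 ->
  weak_solution T delta p K W uin Fin DFin u F -> weak_solution_lim T p K W uin Fin DFin ub Fb ->
  forall t, t \in `[0, T] -> [/\ inL 2 (F t), inL 2 (Fb t) &
  \sum_i \sum_a \int[mu2]_(x in cell) ((F t x - Fb t x) i a) ^+ 2 <= B * delta].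
Proof.
move=> hin; have [W3 W2 K0 cW hW] := hyp.
have [A A0 HA] := energy_bound W3 W2 hin.
have [C C0 HC] := mode_stability p2 W3 K0 cW hW T0 A0.
(* The constant must be fixed before the limit solution is given; if there is none, the claim is
   vacuous. *)
have [[us [Fs hs]]|no] := EM (exists us Fs, weak_solution_lim T p K W uin Fin DFin us Fs); last first.
  by exists 0 => // delta u F ub Fb _ _ _ h; exfalso; apply: no; exists ub, Fb.
have v4 : (0 : R) <= 4^-1 by rewrite invr_ge0.
have hlim u F : weak_solution_lim T p K W uin Fin DFin u F -> mode_solution W p T A 0 uin Fin u F /\ exists DF, C_H1 T F DF.
  apply: (weak_solution_lim_modes p2 W3 hW T0 A0) => // Du DF.
  by apply: HA.
have [ss [DFs hDFs]] := hlim _ _ hs; have [B B0 HB] := gradient_bound hDFs.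
exists (2 * (C * B)); first by rewrite mulr_ge0// mulr_ge0.
move=> delta u F ub Fb d0 d1 sF sFb t ht; have [sb _] := hlim _ _ sFb.
have sf : mode_solution W p T A delta uin Fin u F.
  apply: (weak_solution_modes p2 W3 hW T0 A0 d0 _ hin sF) => Du DF.
  by apply: HA => //; exact: ltW.
have [_ _ hH] := hDFs.
have e1 := HC _ _ _ _ _ _ _ _ _ (ltW d0) d1 sf ss hH HB t ht.
have e2 := HC _ _ _ _ _ _ _ _ _ (lexx 0) v4 sb ss hH HB t ht.
have [_ cF _ _ _] := sf; have [_ cFb _ _ _] := sb; have [_ cFs _ _ _] := ss.
have l1 := (cF.2 t ht).1; have l2 := (cFb.2 t ht).1; have l3 := (cFs.2 t ht).1.
split=> //; apply: (le_trans (sqdist_triangle l1 l3 l2)).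
(* The second term compares [Fb] with the chosen limit solution and is 0: this is uniqueness for the
   limit system. *)
have -> : 2 * (C * B) * delta = 2 * (C * delta * B) + 2 * (C * 0 * B).
  by rewrite mulr0 mul0r mulr0 addr0 -mulrA -mulrA (mulrC B) -!mulrA.
by rewrite lerD// ler_wpM2l.
Qed.

Lemma Lpow_le (r delta B : R) (G : R * R -> 'M[R]_2) : 0 < r -> r <= 2 -> 0 < delta ->
  (forall i a, measurable_fun cell (fun x => G x i a)) ->
  (forall i a, Ig (fun x => G x i a ^+ 2)) ->
  \sum_i \sum_a \int[mu2]_(x in cell) (G x i a) ^+ 2 <= B * delta ->
  (Lpow r G <= (delta `^ (r / 2) * (1 + B))%:E)%E.
Proof.
move=> r0 r2 d0 mG hG hB; have s0 : 0 < delta `^ 2^-1 by rewrite powR_gt0.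
have ssq : (delta `^ 2^-1) ^+ 2 = delta by rewrite -powR_sqr ?powR_ge0// sqrt_powR ?(ltW d0)// divff ?powRr1 ?(ltW d0).
have hsum : Ig (fun x => \sum_i \sum_a G x i a ^+ 2).
  by apply: (Ig_sum mC) => i; apply: (Ig_sum mC) => a; exact: hG.
have hb := IgZ mC (delta `^ (r / 2)) (IgD mC (Ig_cst mC 1 fC) (IgZ mC delta^-1 hsum)).
have ptw x : fnorm (G x) `^ r <= delta `^ (r / 2) * (1 + delta^-1 * \sum_i \sum_a G x i a ^+ 2).
  by rewrite -sqr_fnorm -(sqrt_powR r (ltW d0)) -{2}ssq; apply: powR_le_sqr => //; exact: fnorm_ge0.
have hi : Ig (fun x => fnorm (G x) `^ r).
  apply: (Ig_le mC _ _ hb).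
    by apply: (measurableT_comp (measurable_powR r)); exact: measurable_fnorm.
  by move=> x _; rewrite ger0_norm ?powR_ge0.
rewrite /Lpow /xint (Ig_fin mC hi) lee_fin.
apply: (@le_trans _ _ (\int[mu2]_(x in cell) (delta `^ (r / 2) * (1 + delta^-1 * \sum_i \sum_a G x i a ^+ 2)))).
  by apply: le_Rintegral.
rewrite (Rint_Zl mC _ (IgD mC (Ig_cst mC 1 fC) (IgZ mC delta^-1 hsum))).
apply: ler_wpM2l; first exact: powR_ge0.
rewrite (RintegralD mC (Ig_cst mC 1 fC) (IgZ mC delta^-1 hsum)) Rintegral_cst//= mu_cell /= mulr1 lerD2l.
rewrite (Rint_Zl mC _ hsum) ler_pdivrMl// mulrC.
rewrite (Rint_sum mC _ (fun i => Ig_sum mC _ (hG i))).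
rewrite (eq_bigr (fun i => \sum_a \int[mu2]_(x in cell) (G x i a) ^+ 2))// => i _.
exact: (Rint_sum mC _ (hG i)).
Qed.

Lemma stability_estimate_holds r uin Fin DFin : 1 < r -> r < 2 -> initial_data p uin Fin DFin ->
  exists2 C1 : R, 0 < C1 & stability_estimate T p K W r C1 1 uin Fin DFin.
Proof.
move=> r1 r2 hin; have [B B0 HB] := weak_stability hin.
have r0 : 0 < r by exact: lt_trans r1.
have C4 : 4 <= 4 + B by rewrite lerDl.
have C1 : 1 <= 4 + B by apply: le_trans C4; rewrite ler1n.
(* The estimate itself needs 1 + B; the larger constant makes the threshold imply delta <= 1/4. *)
exists (4 + B); first exact: lt_le_trans C1.
move=> delta u F ub Fb d0 sF sFb t /andP[t0 tT] hd.
have hd' := threshold_le C1 r0 d0 t0 hd.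
have tin : t \in `[0, T] by rewrite in_itv /= t0 tT.
have [l1 l2 h] := HB _ _ _ _ _ d0 (threshold_small C4 r0 (ltW r2) hd') sF sFb t tin.
have e i a : (fun x => (F t x - Fb t x) i a) = (fun x => F t x i a - Fb t x i a).
  by apply/funext => x; rewrite !mxE.
apply: (@le_trans _ _ (delta `^ (r / 2) * (1 + B))%:E).
  apply: (Lpow_le r0 (ltW r2) d0 _ _ h) => i a.
    by rewrite e; apply: measurable_funB; [exact: l1.1|exact: l2.1].
  rewrite (_ : (fun x => _) = (fun x => (F t x i a - Fb t x i a) ^+ 2)); first exact: (inL2B i a l1 l2).
  by apply/funext => x; rewrite !mxE.
rewrite lee_fin; apply: le_trans (holder_power_le C1 r0 d0 t0 hd').
by rewrite mulrC ler_wpM2r ?powR_ge0// lerD2r ler1n.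
Qed.

End FinalEstimate.

Theorem theorem4p1 (R : realType) :
  (forall p r : R,
     2 <= p -> p < 4 ->
     1 < r -> r < 2 -> (2 < p -> r < 2 / (p - 2)) ->
     exists2 C2 : R, 0 < C2 &
     forall (T K : R) (W : 'M[R]_2 -> R),
       0 < T -> hypW p K W ->
     forall (u0 : R * R -> 'cV[R]_2) (F0 : R * R -> 'M[R]_2)
       (DF0 : R * R -> 'I_2 -> 'M[R]_2),
       initial_data p u0 F0 DF0 ->
     exists2 C1 : R, 0 < C1 &
       stability_estimate T p K W r C1 C2 u0 F0 DF0) /\
  (forall p r : R,
     2 <= p ->
     1 < r -> r < 2 -> (2 < p -> r < p / (p - 2)) ->
     exists2 C2 : R, 0 < C2 &
     forall (T K : R) (W : 'M[R]_2 -> R),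
       0 < T -> hypW p K W -> strong_monotone p W ->
     forall (u0 : R * R -> 'cV[R]_2) (F0 : R * R -> 'M[R]_2)
       (DF0 : R * R -> 'I_2 -> 'M[R]_2),
       initial_data p u0 F0 DF0 ->
     exists2 C1 : R, 0 < C1 &
       stability_estimate T p K W r C1 C2 u0 F0 DF0).
Proof.
(* [C2 = 1]: the rate only has to make exp(- C2 t) <= 1, since [C1] already covers the whole
   interval [0, T]. *)
split=> [p r p2 _ r1 r2 _|p r p2 r1 r2 _]; exists 1 => //.
  by move=> T K W T0 hyp u0 F0 DF0; exact: stability_estimate_holds.
by move=> T K W T0 hyp _ u0 F0 DF0; exact: stability_estimate_holds.
Qed.
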